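(* Let $f\in S_k(N,\Psi)$ be a newform with nebentypus $\Psi$ of exact order $m$. For a prime $p\mid N$, suppose that the local component $\pi_{f,p}$ is a principal series $\pi(\chi_1,\chi_2)$. Let $d$ be the order of $\chi_1|_{\mathbb{Z}_p^\times}$. Then the Hecke field $E_f$ contains the field $\mathbb{Q}(\xi_d+\zeta\xi_d^{-1})$ for some $m$-th root of unity $\zeta\in\mu_m$.
   Context: $E_f=\mathbb{Q}(\{a_n\})$ is the field generated by all Fourier coefficients of $f=\sum a_nq^n$. $\pi_{f,p}$ is the local component at $p$ of the automorphic representation of $\mathrm{GL}_2(\mathbb{A}_{\mathbb{Q}})$ attached to $f$; $\pi(\chi_1,\chi_2)$ is the irreducible (normalized) principal series representation of $\mathrm{GL}_2(\mathbb{Q}_p)$ attached to quasi-characters $\chi_1,\chi_2$ of $\mathbb{Q}_p^\times$. $\xi_d$ is a primitive $d$-th root of unity and $\mu_m$ is the group of $m$-th roots of unity. *)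

(* Defs.v *)
(* The real numbers are an R : realType and the complex numbers are R[i]. *)
From HB Require Import structures.
From mathcomp Require Import all_boot all_order all_algebra.
From mathcomp Require Import fraction complex.
From mathcomp Require Import all_classical all_reals all_analysis.
Set Implicit Arguments.
Unset Strict Implicit.
Unset Printing Implicit Defensive.
Import Order.TTheory GRing.Theory Num.Theory.
Import numFieldNormedType.Exports.
Local Open Scope classical_set_scope.
Local Open Scope complex_scope.
Local Open Scope ring_scope.

(** * p-adic numbers *)

Definition primeT := {p : nat | prime p}.
Definition prime_val (p : primeT) : nat := val p.
Coercion prime_val : primeT >-> nat.

Section PadicIntegers.
Variable p : primeT.

(* Z_p is the inverse limit of the Z/p^n: the n-th term of the sequence is the
   residue mod p^n, represented by an integer in [0, p^n[. *)
Definition coherent (x : nat -> int) :=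
  forall n, x n = (x n.+1 %% (p ^ n)%:Z)%Z.

Record Zp := MkZp { zp_seq : nat -> int; _ : `[< coherent zp_seq >] }.
HB.instance Definition _ := [isSub for zp_seq].
HB.instance Definition _ := [Choice of Zp by <:].

Lemma zp_coh (x : Zp) n : (zp_seq x n.+1 %% (p ^ n)%:Z)%Z = zp_seq x n.
Proof. by case: x => x /= /asboolP xc; rewrite -xc. Qed.

Lemma zp_mod (x : Zp) n : (zp_seq x n %% (p ^ n)%:Z)%Z = zp_seq x n.
Proof. by rewrite -[in LHS]zp_coh modz_mod zp_coh. Qed.

Lemma zp_eqP (x y : Zp) :
  (forall n, zp_seq x n = zp_seq y n %[mod (p ^ n)%:Z])%Z -> x = y.
Proof.
by move=> xy; apply/val_inj/funext => n /=; rewrite -zp_mod xy zp_mod.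
Qed.

Lemma modz_pow (u : int) n :
  ((u %% (p ^ n.+1)%:Z)%Z = u %[mod (p ^ n)%:Z])%Z.
Proof.
have e : (p ^ n.+1)%:Z = p%:Z * (p ^ n)%:Z by rewrite expnS PoszM.
by rewrite [in RHS](divz_eq u (p ^ n.+1)%:Z) [X in _ * X + _]e mulrA modzMDl.
Qed.

Lemma zp_reduce_subproof (y : nat -> int) :
  (forall n, y n.+1 = y n %[mod (p ^ n)%:Z])%Z ->
  `[< coherent (fun n => (y n %% (p ^ n)%:Z)%Z) >].
Proof. by move=> yc; apply/asboolP => n; rewrite modz_pow yc. Qed.

Definition zp_reduce y yc := MkZp (@zp_reduce_subproof y yc).

Lemma zp_step (x : Zp) n : (zp_seq x n.+1 = zp_seq x n %[mod (p ^ n)%:Z])%Z.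
Proof. by rewrite zp_coh zp_mod. Qed.

Lemma zp_const_step (u : int) n : (u = u %[mod (p ^ n)%:Z])%Z.
Proof. by []. Qed.

Lemma zp_add_step (x y : Zp) n :
  (zp_seq x n.+1 + zp_seq y n.+1 = zp_seq x n + zp_seq y n
     %[mod (p ^ n)%:Z])%Z.
Proof. by rewrite -modzDm !zp_step modzDm. Qed.

Lemma zp_opp_step (x : Zp) n :
  (- zp_seq x n.+1 = - zp_seq x n %[mod (p ^ n)%:Z])%Z.
Proof. by rewrite -modzNm zp_step modzNm. Qed.

Lemma zp_mul_step (x y : Zp) n :
  (zp_seq x n.+1 * zp_seq y n.+1 = zp_seq x n * zp_seq y n
     %[mod (p ^ n)%:Z])%Z.
Proof. by rewrite -modzMm !zp_step modzMm. Qed.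

Definition zp0 := zp_reduce (zp_const_step 0).
Definition zp1 := zp_reduce (zp_const_step 1).
Definition zp_add x y := zp_reduce (zp_add_step x y).
Definition zp_opp x := zp_reduce (zp_opp_step x).
Definition zp_mul x y := zp_reduce (zp_mul_step x y).

Lemma zp_addA : associative zp_add.
Proof.
by move=> x y z; apply: zp_eqP => n /=; rewrite !modz_mod modzDml modzDmr addrA.
Qed.
Lemma zp_addC : commutative zp_add.
Proof. by move=> x y; apply: zp_eqP => n /=; rewrite addrC. Qed.
Lemma zp_add0 : left_id zp0 zp_add.
Proof.
by move=> x; apply: zp_eqP => n /=; rewrite modz_mod modzDml add0r.
Qed.
Lemma zp_addN : left_inverse zp0 zp_opp zp_add.
Proof.
by move=> x; apply: zp_eqP => n /=; rewrite !modz_mod modzDml addNr.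
Qed.
HB.instance Definition _ :=
  GRing.isZmodule.Build Zp zp_addA zp_addC zp_add0 zp_addN.

Lemma zp_mulA : associative zp_mul.
Proof.
by move=> x y z; apply: zp_eqP => n /=; rewrite !modz_mod modzMml modzMmr mulrA.
Qed.
Lemma zp_mulC : commutative zp_mul.
Proof. by move=> x y; apply: zp_eqP => n /=; rewrite mulrC. Qed.
Lemma zp_mul1 : left_id zp1 zp_mul.
Proof.
by move=> x; apply: zp_eqP => n /=; rewrite modz_mod modzMml mul1r.
Qed.
Lemma zp_mulD : left_distributive zp_mul zp_add.
Proof.
move=> x y z; apply: zp_eqP => n /=.
by rewrite !modz_mod modzMml modzDm mulrDl.
Qed.
Lemma zp_1neq0 : zp1 != zp0.
Proof.
apply/eqP => /(congr1 (fun x => zp_seq x 1)) /=; rewrite expn1 mod0z.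
by rewrite modz_small ?ltz_nat ?(prime_gt1 (valP p)).
Qed.
HB.instance Definition _ := GRing.Zmodule_isComNzRing.Build Zp
  zp_mulA zp_mulC zp_mul1 zp_mulD zp_1neq0.

Definition zp_unit : pred Zp := fun x => `[< exists y, y * x = 1 >].
Definition zp_inv (x : Zp) : Zp :=
  if zp_unit x then xget 0 [set y | y * x = 1] else x.

Lemma zp_mulV : {in zp_unit, left_inverse 1 zp_inv *%R}.
Proof.
move=> x ux; have {}ux : zp_unit x by [].
by rewrite /zp_inv ux; have /asboolP[y yx] := ux; case: xgetP => [z _ //|/(_ y)].
Qed.
Lemma zp_unitPl : forall x y, y * x = 1 -> x \in zp_unit.
Proof. by move=> x y yx; apply/asboolP; exists y. Qed.
Lemma zp_inv0id : {in [predC zp_unit], zp_inv =1 id}.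
Proof. by move=> x nx; have /negbTE nx' : ~~ zp_unit x by []; rewrite /zp_inv nx'. Qed.
HB.instance Definition _ :=
  GRing.ComNzRing_hasMulInverse.Build Zp zp_mulV zp_unitPl zp_inv0id.

Lemma zp_stable (x : Zp) n k :
  (zp_seq x (k + n)%N = zp_seq x n %[mod (p ^ n)%:Z])%Z.
Proof.
elim: k => [//|k IH]; rewrite -IH addSn -[in RHS]zp_coh.
have dv : ((p ^ n)%:Z %| (p ^ (k + n))%:Z)%Z.
  by rewrite dvdzE /= dvdn_exp2l// leq_addl.
have /dvdzP[q e] := dv.
rewrite [in LHS](divz_eq (zp_seq x (k + n).+1) (p ^ (k + n))%:Z).
by rewrite [X in _ * X + _]e mulrA modzMDl.
Qed.

Lemma zp_neq0P (x : Zp) : x != 0 ->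
  exists n, forall k, ~~ ((p ^ n)%:Z %| zp_seq x (k + n)%N)%Z.
Proof.
move=> x0; apply: contrapT => /forallNP xn; case/eqP: x0.
apply: zp_eqP => n /=; rewrite modz_mod mod0z.
have /existsNP[k /negP/negbNE] := xn n.
by move=> /dvdz_mod0P; rewrite zp_stable.
Qed.

Lemma zp_idom : GRing.integral_domain_axiom Zp.
Proof.
move=> x y xy0; apply: contraT; rewrite negb_or => /andP[].
move=> /zp_neq0P[a xa] /zp_neq0P[b yb].
have := congr1 (fun z => zp_seq z (a + b)%N) xy0 => /=; rewrite mod0z.
move=> /dvdz_mod0P.
have := xa b; have := yb a; rewrite [(b + a)%N]addnC !dvdzE /= abszM.
have pp := valP p; move: `|zp_seq x _|%N `|zp_seq y _|%N => u v yv xu uv.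
have u0 : (0 < u)%N by case: u xu {uv} => //; rewrite dvdn0.
have v0 : (0 < v)%N by case: v yv {uv} => //; rewrite dvdn0.
move: uv xu yv; rewrite !pfactor_dvdn ?muln_gt0 ?u0// lognM// -!ltnNge.
by move=> uv ua vb; move: uv; rewrite leqNgt (leq_trans _ (leq_add (ltnW ua) vb))// ?addnS.
Qed.
HB.instance Definition _ := GRing.ComUnitRing_isIntegral.Build Zp zp_idom.

Lemma zp_natr (k : nat) n : zp_seq (k%:R : Zp) n = (k%:Z %% (p ^ n)%:Z)%Z.
Proof.
elim: k => [|k IH]; first by rewrite mod0z /= mod0z.
by rewrite -addn1 natrD /= IH modzDm PoszD.
Qed.

Lemma dvdz_powM (u v : int) m n : ~~ ((p ^ n)%:Z %| v)%Z ->
  ((p ^ (m + n))%:Z %| u * v)%Z -> ((p ^ m)%:Z %| u)%Z.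
Proof.
rewrite !dvdzE /= abszM; move: `|u|%N `|v|%N => {}u {}v nv uv.
have pp := valP p; case: (posnP u) => [->|u0]; first by rewrite dvdn0.
have v0 : (0 < v)%N by case: v nv {uv} => //; rewrite dvdn0.
move: uv nv; rewrite !pfactor_dvdn ?muln_gt0 ?u0// lognM// -ltnNge => uv nv.
by rewrite -(leq_add2r n) (leq_trans uv)// leq_add2l ltnW.
Qed.

Lemma bezout_pow (v : int) m n : ~~ ((p ^ n)%:Z %| v)%Z ->
  exists c : int, (c * v = (p ^ n)%:Z %[mod (p ^ (m + n))%:Z])%Z.
Proof.
move=> nv; have [u [w uw]] := Bezoutz v (p ^ (m + n))%:Z.
suff /dvdzP[q qe] : (gcdz v (p ^ (m + n))%:Z %| (p ^ n)%:Z)%Z.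
  exists (q * u); by rewrite qe -uw mulrDr addrC !mulrA modzMDl.
rewrite dvdzE /=; have : (gcdn `|v| (p ^ (m + n)) %| p ^ (m + n))%N.
  exact: dvdn_gcdr.
move=> /(dvdn_pfactor _ _ (valP p))[j _ gj].
rewrite /prime_val gj dvdn_exp2l// ltnW// ltnNge; apply: contra nv => nj.
by rewrite dvdzE /= (dvdn_trans (dvdn_exp2l p nj))// -gj dvdn_gcdl.
Qed.

Lemma zp_dvd_pow (b : Zp) : b != 0 -> exists n c, c * b = p%:R ^+ n.
Proof.
move=> /zp_neq0P[n bn]; exists n.
have [c cb] := choice (fun m => bezout_pow m (bn m)).
have cstep m : (c m.+1 = c m %[mod (p ^ m)%:Z])%Z.
  apply/eqP; rewrite eqz_mod_dvd; apply: (dvdz_powM (bn m)).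
  rewrite mulrBl -eqz_mod_dvd cb -modzMmr -(zp_stable b _ 1) add1n modzMmr.
  by rewrite -modz_pow -addSn cb modz_pow.
exists (zp_reduce cstep); apply: zp_eqP => m.
rewrite -natrX zp_natr /= !modz_mod modzMml -modzMmr -(zp_stable b m n) modzMmr.
have dv : ((p ^ m)%:Z %| (p ^ (m + n))%:Z)%Z.
  by rewrite dvdzE /= dvdn_exp2l// leq_addr.
have := cb m; move=> /eqP; rewrite eqz_mod_dvd => /(dvdz_trans dv).
by rewrite -eqz_mod_dvd addnC => /eqP.
Qed.

Definition Qp := {fraction Zp}.
HB.instance Definition _ := GRing.Field.on Qp.

Definition Zp_to_Qp : Zp -> Qp := @tofrac Zp.
HB.instance Definition _ := GRing.RMorphism.copy Zp_to_Qp (@tofrac Zp).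

Lemma Zp_to_Qp_inj : injective Zp_to_Qp.
Proof. by move=> a b /eqP; rewrite /Zp_to_Qp tofrac_eq => /eqP. Qed.

Lemma Qp_bounded (x : Qp) : exists n z, p%:R ^+ n * x = Zp_to_Qp z.
Proof.
have [a [b b0 xE]] : exists a, exists2 b, b != 0 & x * Zp_to_Qp b = Zp_to_Qp a.
  move: x; elim/quotW => x; exists (frac x).1, (frac x).2; first exact: denom_ratioP.
  rewrite /Zp_to_Qp; unlock FracField.tofrac; rewrite -[LHS]FracField.pi_mul.
  apply/eqmodP; rewrite /= FracField.equivfE /FracField.mulf.
  by rewrite !numden_Ratio ?mulf_neq0 ?oner_neq0 ?denom_ratioP// !mulr1 mulrC.
have [n [c cb]] := zp_dvd_pow b0; exists n, (c * a).
rewrite [RHS]rmorphM/= -xE mulrCA -rmorphM cb mulrC; congr (_ * _).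
by rewrite rmorphXn rmorph_nat.
Qed.

Lemma Qp_mx_bounded m n (A : 'M[Qp]_(m, n)) :
  exists k (B : 'M[Zp]_(m, n)), p%:R ^+ k *: A = map_mx Zp_to_Qp B.
Proof.
have [k kP] := choice (fun ij : 'I_m * 'I_n => Qp_bounded (A ij.1 ij.2)).
have [B BP] := choice kP.
pose K := \sum_ij k ij.
exists K, (\matrix_(i, j) (p%:R ^+ (K - k (i, j)) * B (i, j))).
apply/matrixP => i j; rewrite !mxE [RHS]rmorphM/= -BP rmorphXn rmorph_nat mulrA.
by rewrite -exprD subnK// /K (bigD1 (i, j))//= leq_addr.
Qed.

Definition Zp_units : set Qp := [set Zp_to_Qp u | u in [set u | u \is a GRing.unit]].

Definition padic_val (x : Qp) : int :=
  xget 0 [set n : int | exists2 u, Zp_units u & x = u * p%:R ^ n].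

End PadicIntegers.

(** * The groups GL_2(K) and GL_2(A_Q) *)

Section GL2.
Variable K : fieldType.

Record GL2 := MkGL2 { GL2_mx :> 'M[K]_2; GL2_unit : GL2_mx \in unitmx }.
HB.instance Definition _ := [isSub for GL2_mx].
HB.instance Definition _ := [Choice of GL2 by <:].

Lemma GL2_mul_subproof (g h : GL2) : g *m h \in unitmx.
Proof. by rewrite unitmx_mul !GL2_unit. Qed.
Lemma GL2_inv_subproof (g : GL2) : invmx g \in unitmx.
Proof. by rewrite unitmx_inv GL2_unit. Qed.

Definition GL2_one := MkGL2 (unitmx1 K 2).
Definition GL2_mul g h := MkGL2 (GL2_mul_subproof g h).
Definition GL2_inv g := MkGL2 (GL2_inv_subproof g).

Lemma GL2_mulA : associative GL2_mul.
Proof. by move=> x y z; apply: val_inj; rewrite /= mulmxA. Qed.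
Lemma GL2_mul1g : left_id GL2_one GL2_mul.
Proof. by move=> x; apply: val_inj; rewrite /= mul1mx. Qed.
Lemma GL2_mulg1 : right_id GL2_one GL2_mul.
Proof. by move=> x; apply: val_inj; rewrite /= mulmx1. Qed.
Lemma GL2_mulVg : left_inverse GL2_one GL2_inv GL2_mul.
Proof. by move=> x; apply: val_inj; rewrite /= mulVmx ?GL2_unit. Qed.
Lemma GL2_mulgV : right_inverse GL2_one GL2_inv GL2_mul.
Proof. by move=> x; apply: val_inj; rewrite /= mulmxV ?GL2_unit. Qed.
HB.instance Definition _ :=
  isGroup.Build GL2 GL2_mulA GL2_mul1g GL2_mulg1 GL2_mulVg GL2_mulgV.
End GL2.

Definition GL2_Zp (p : primeT) : set (GL2 (Qp p)) :=
  [set g | exists2 h : 'M[Zp p]_2, h \in unitmx & GL2_mx g = map_mx (@Zp_to_Qp p) h].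

Section AdelicGL2.
Variable R : realType.

Record GL2A := MkGL2A {
  comp_inf : GL2 R;
  comp_fin : forall l : primeT, GL2 (Qp l);
  GL2A_fin : finite_set [set l | ~ GL2_Zp (comp_fin l)] }.
HB.instance Definition _ := gen_eqMixin GL2A.
HB.instance Definition _ := gen_choiceMixin GL2A.

Lemma GL2A_eqP (g h : GL2A) : comp_inf g = comp_inf h ->
  (forall l, comp_fin g l = comp_fin h l) -> g = h.
Proof.
case: g h => [a b P] [c d Q] /= ac bd; subst c.
have bd' : b = d by apply: functional_extensionality_dep.
by subst d; congr MkGL2A; apply: Prop_irrelevance.
Qed.

Lemma GL2_Zp1 l : @GL2_Zp l 1%g.
Proof. by exists 1%:M; rewrite ?unitmx1//= map_mx1. Qed.
Lemma GL2_ZpM l (g h : GL2 (Qp l)) : GL2_Zp g -> GL2_Zp h -> GL2_Zp (g * h)%g.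
Proof.
move=> [a ua ga] [b ub hb]; exists (a *m b); first by rewrite unitmx_mul ua.
by rewrite /= ga hb map_mxM.
Qed.
Lemma GL2_ZpV l (g : GL2 (Qp l)) : GL2_Zp g -> GL2_Zp (g^-1)%g.
Proof.
move=> [a ua ga]; exists (invmx a); first by rewrite unitmx_inv.
have ug : map_mx (@Zp_to_Qp l) a \in unitmx by rewrite -ga GL2_unit.
by rewrite /= ga -[RHS](mulKmx ug) -map_mxM mulmxV// map_mx1 mulmx1.
Qed.

Lemma GL2A_one_subproof : finite_set [set l | ~ @GL2_Zp l 1%g].
Proof.
by rewrite (_ : mkset _ = set0) // -subset0 => l /=; apply; apply: GL2_Zp1.
Qed.
Lemma GL2A_mul_subproof (g h : GL2A) :
  finite_set [set l | ~ GL2_Zp (comp_fin g l * comp_fin h l)%g].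
Proof.
have /sub_finite_set : [set l | ~ GL2_Zp (comp_fin g l * comp_fin h l)%g] `<=`
    [set l | ~ GL2_Zp (comp_fin g l)] `|` [set l | ~ GL2_Zp (comp_fin h l)].
  move=> l /= gh; apply: contrapT => /not_orP[/contrapT ? /contrapT ?].
  exact/gh/GL2_ZpM.
by apply; rewrite finite_setU; split; apply: GL2A_fin.
Qed.
Lemma GL2A_inv_subproof (g : GL2A) :
  finite_set [set l | ~ GL2_Zp (comp_fin g l)^-1%g].
Proof.
by apply: sub_finite_set (GL2A_fin g) => l /= gV /GL2_ZpV.
Qed.

Definition GL2A_one := MkGL2A 1%g GL2A_one_subproof.
Definition GL2A_mul g h :=
  MkGL2A (comp_inf g * comp_inf h)%g (GL2A_mul_subproof g h).
Definition GL2A_inv g := MkGL2A (comp_inf g)^-1%g (GL2A_inv_subproof g).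

Lemma GL2A_mulA : associative GL2A_mul.
Proof. by move=> x y z; apply: GL2A_eqP => [|l] /=; rewrite mulgA. Qed.
Lemma GL2A_mul1g : left_id GL2A_one GL2A_mul.
Proof. by move=> x; apply: GL2A_eqP => [|l] /=; rewrite mul1g. Qed.
Lemma GL2A_mulg1 : right_id GL2A_one GL2A_mul.
Proof. by move=> x; apply: GL2A_eqP => [|l] /=; rewrite mulg1. Qed.
Lemma GL2A_mulVg : left_inverse GL2A_one GL2A_inv GL2A_mul.
Proof. by move=> x; apply: GL2A_eqP => [|l] /=; rewrite mulVg. Qed.
Lemma GL2A_mulgV : right_inverse GL2A_one GL2A_inv GL2A_mul.
Proof. by move=> x; apply: GL2A_eqP => [|l] /=; rewrite mulgV. Qed.
HB.instance Definition _ :=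
  isGroup.Build GL2A GL2A_mulA GL2A_mul1g GL2A_mulg1 GL2A_mulVg GL2A_mulgV.
End AdelicGL2.

(** * Representations *)

Section Representations.
Variable R : realType.
Local Notation C := R[i].

Record rep (G : groupType) := MkRep {
  rep_space :> lmodType C;
  rep_act : G -> {linear rep_space -> rep_space};
  rep_act1 : forall v, rep_act 1%g v = v;
  rep_actM : forall g h v, rep_act (g * h)%g v = rep_act g (rep_act h v) }.
Arguments rep_act {G} r g.

Definition irreducible_rep (G : groupType) (V : rep G) :=
  (exists v : V, v != 0) /\
  forall S : {pred V}, GRing.submod_closed S ->
    (forall g, {in S, forall v, rep_act V g v \in S}) ->
    (forall v, v \in S -> v = 0) \/ (forall v, v \in S).

Definition tensor_product (V W P : lmodType C) (t : V -> W -> P) :=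
  bilinear_for *:%R *:%R t /\
  forall (U : lmodType C) (b : V -> W -> U), bilinear_for *:%R *:%R b ->
    exists2 h : {linear P -> U}, (forall v w, h (t v w) = b v w) &
      forall h' : {linear P -> U}, (forall v w, h' (t v w) = b v w) -> h' =1 h.

Section RightTranslation.
Variable G : groupType.

Definition rtrans (g : G) (f : G -> C^o) : G -> C^o := fun x => f (x * g)%g.

Section SubRep.
Variable S : submodClosed (G -> C^o).

Record subfun := MkSubfun { subfun_val : G -> C^o; subfunP : subfun_val \in S }.
HB.instance Definition _ := [isSub for subfun_val].
HB.instance Definition _ := [Choice of subfun by <:].
HB.instance Definition _ := [SubChoice_isSubLmodule of subfun by <:].

Hypothesis Sstab : forall g, {in S, forall f, rtrans g f \in S}.

Definition subfun_act (g : G) (u : subfun) := MkSubfun (Sstab g (subfunP u)).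
Lemma subfun_act_linear g : linear (subfun_act g).
Proof. by move=> a u v; apply: val_inj. Qed.
HB.instance Definition _ g :=
  GRing.isLinear.Build C subfun subfun _ (subfun_act g) (subfun_act_linear g).
Lemma subfun_act1 v : subfun_act 1%g v = v.
Proof. by apply/val_inj/funext => x /=; rewrite /rtrans mulg1. Qed.
Lemma subfun_actM g h v :
  subfun_act (g * h)%g v = subfun_act g (subfun_act h v).
Proof. by apply/val_inj/funext => x /=; rewrite /rtrans mulgA. Qed.

Definition subrep : rep G :=
  @MkRep G subfun (fun g => subfun_act g) subfun_act1 subfun_actM.
End SubRep.

Section Translates.
Variable phi : G -> C.

Definition translates : {pred G -> C^o} := fun f =>
  `[< exists s : seq (C * G), f = \sum_(x <- s) x.1 *: rtrans x.2 phi >].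

Lemma translates_submod : GRing.submod_closed translates.
Proof.
split; first by apply/asboolP; exists [::]; rewrite big_nil.
move=> a u v /asboolP[s ->] /asboolP[t ->]; apply/asboolP.
exists ([seq (a * x.1, x.2) | x <- s] ++ t).
rewrite big_cat big_map scaler_sumr; congr (_ + _).
by apply: eq_bigr => x _; rewrite scalerA.
Qed.
HB.instance Definition _ :=
  GRing.isSubmodClosed.Build C (G -> C^o) translates translates_submod.

Lemma translates_stable g : {in translates, forall f, rtrans g f \in translates}.
Proof.
move=> f /asboolP[s ->]; apply/asboolP; exists [seq (x.1, g * x.2)%g | x <- s].
rewrite big_map; elim: s => [|x s IH]; first by rewrite !big_nil.
rewrite !big_cons -IH; apply/funext => y.
by rewrite /rtrans /= !fctE /rtrans mulgA.
Qed.

Definition translates_rep : rep G := subrep translates_stable.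
End Translates.
End RightTranslation.

(* [pi] is a representation of GL_2(A_Q).  Its local component at p is the
   V in a factorization pi = V (x) W where V is a representation of GL_2(Q_p)
   and W one of the away-from-p part GL_2(A_Q^p), i.e. a representation of
   GL_2(A_Q) on which the factor GL_2(Q_p) acts trivially. *)
Definition local_component (pi : rep (GL2A R)) (p : primeT)
    (V : rep (GL2 (Qp p))) :=
  exists (W : rep (GL2A R)) (t : V -> W -> pi),
    [/\ forall g : GL2A R, comp_inf g = 1%g ->
          (forall l, l != p -> comp_fin g l = 1%g) ->
          forall w, rep_act W g w = w,
        tensor_product t &
        forall (g : GL2A R) v w,
          rep_act pi g (t v w) = t (rep_act V (comp_fin g p) v) (rep_act W g w)].

Section PrincipalSeries.
Variable p : primeT.

Definition quasi_character (chi : Qp p -> C) :=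
  [/\ forall x, x != 0 -> chi x != 0,
      forall x y, x != 0 -> y != 0 -> chi (x * y) = chi x * chi y &
      forall x, x != 0 -> forall e : R, 0 < e -> exists n, forall y, y != 0 ->
        (exists z : Zp p, y - x = p%:R ^+ n * Zp_to_Qp z) ->
        `|chi y - chi x| < e%:C].

(* |x|_p^(1/2) for x != 0 *)
Definition sqrt_padic_abs (x : Qp p) : R := Num.sqrt p%:R ^ (- padic_val x).

Definition congruence_subgroup (n : nat) : set (GL2 (Qp p)) :=
  [set g | exists h : 'M[Zp p]_2,
     GL2_mx g = 1%:M + p%:R ^+ n *: map_mx (@Zp_to_Qp p) h].

Definition principal_series_space (chi1 chi2 : Qp p -> C) :
    {pred GL2 (Qp p) -> C^o} := fun f => `[<
  (forall b g : GL2 (Qp p), b 1 0 = 0 ->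
     f (b * g)%g = chi1 (b 0 0) * chi2 (b 1 1)
                   * (sqrt_padic_abs (b 0 0 / b 1 1))%:C * f g) /\
  (exists n : nat, forall g k, congruence_subgroup n.+1 k ->
     f (g * k)%g = f g) >].

Variables chi1 chi2 : Qp p -> C.
Local Notation PS := (principal_series_space chi1 chi2).

Lemma congruence_subgroup_le m n : (n <= m)%N ->
  congruence_subgroup m `<=` congruence_subgroup n.
Proof.
move=> nm g [h gh]; exists (p%:R ^+ (m - n) *: h); rewrite gh.
by rewrite map_mxZ rmorphXn rmorph_nat scalerA -exprD subnKC.
Qed.

Lemma congruence_subgroup_conj (g : GL2 (Qp p)) n :
  exists m, forall k, congruence_subgroup m.+1 k ->
    congruence_subgroup n.+1 (g^-1 * k * g)%g.
Proof.
have [a [A aA]] := Qp_mx_bounded (GL2_mx (g^-1)%g).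
have [b [B bB]] := Qp_mx_bounded (GL2_mx g).
exists (a + b + n)%N => k [h kh]; exists (A *m h *m B).
rewrite /= kh mulmxDr mulmxDl mulmx1 mulVmx ?GL2_unit//; congr (_ + _).
rewrite !map_mxM -aA -bB /= -!(scalemxAl, scalemxAr) !scalerA -!exprD.
by congr (_ ^+ _ *: _); rewrite -addnS addnC -addnA.
Qed.

Lemma principal_series_submod : GRing.submod_closed PS.
Proof.
split.
  apply/asboolP; split=> [b g _|]; first exact: esym (mulr0 _).
  by exists 0%N.
move=> a u v /asboolP[u1 [m um]] /asboolP[v1 [n vn]]; apply/asboolP; split.
  by move=> b g b0; rewrite !fctE u1// v1// mulrDr -mulrCA.
exists (maxn m n) => g k kmn; rewrite !fctE um ?vn//.
  by apply: congruence_subgroup_le kmn; rewrite ltnS leq_maxr.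
by apply: congruence_subgroup_le kmn; rewrite ltnS leq_maxl.
Qed.
HB.instance Definition _ :=
  GRing.isSubmodClosed.Build C (GL2 (Qp p) -> C^o) PS principal_series_submod.

Lemma principal_series_stable g : {in PS, forall f, rtrans g f \in PS}.
Proof.
move=> f /asboolP[f1 [n fn]]; apply/asboolP; split.
  by move=> b h b0; rewrite /rtrans -mulgA f1.
have [m mP] := congruence_subgroup_conj g n.
exists m => h k /mP km; rewrite /rtrans -[in RHS](fn _ _ km).
by rewrite !mulgA mulgK.
Qed.

(* normalized induction of chi1 (x) chi2 from the upper triangular Borel *)
Definition principal_series : rep (GL2 (Qp p)) := subrep principal_series_stable.
End PrincipalSeries.
End Representations.

(** * Modular forms *)

(* the (multiplicative) order of the function chi restricted to S *)
Definition has_order (R : realType) (T : Type) (S : set T) (chi : T -> R[i])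
    (m : nat) :=
  (0 < m)%N /\
  forall j, (forall x, S x -> chi x ^+ j = 1) <-> (m %| j)%N.

Section ModularForms.
Variable R : realType.
Local Notation C := R[i].

Definition upper_half_plane : set C := [set z | 0 < complex.Im z].
Local Notation H := upper_half_plane.

(* a Dirichlet character mod N, extended by 0 to the integers not coprime to N *)
Definition dirichlet_character (N : nat) (Psi : int -> C) :=
  [/\ forall a b, Psi (a * b) = Psi a * Psi b,
      forall a, Psi (a + N%:Z) = Psi a &
      forall a, (Psi a != 0) = coprimez a N%:Z].

Definition automorphy_factor (g : 'M[R]_2) (z : C) : C :=
  (g 1 0)%:C * z + (g 1 1)%:C.

Definition mobius (g : 'M[R]_2) (z : C) : C :=
  ((g 0 0)%:C * z + (g 0 1)%:C) / automorphy_factor g z.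

(* for \det g > 0, with the factor (\det g)^(k/2) *)
Definition slash (k : nat) (g : 'M[R]_2) (f : C -> C) (z : C) : C :=
  (Num.sqrt (\det g))%:C ^+ k / automorphy_factor g z ^+ k * f (mobius g z).

Definition slashZ (k : nat) (g : 'M[int]_2) : (C -> C) -> C -> C :=
  slash k (map_mx intr g).

Definition SL2Z : set 'M[int]_2 := [set g | \det g = 1].
Definition Gamma0 (N : nat) : set 'M[int]_2 :=
  [set g | SL2Z g /\ (N%:Z %| (g 1 0)%R)%Z].

(* Functions on H are represented by functions on C whose values outside H
   are irrelevant. *)
Definition cusp_form (k N : nat) (Psi : int -> C) (f : C -> C) :=
  [/\ forall z, H z -> derivable (f : C^o -> C^o) z 1,
      forall g, Gamma0 N g -> forall z, H z -> slashZ k g f z = Psi (g 1 1) * f z &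
      forall g, SL2Z g -> forall e : R, 0 < e ->
        exists y : R, forall z, H z -> y < complex.Im z ->
          `|slashZ k g f z| < e%:C].

(* q = exp(2 pi i z) *)
Definition nome (z : C) : C :=
  (expR (- (2 * pi * complex.Im z)))%:C
  * (cos (2 * pi * complex.Re z) +i* sin (2 * pi * complex.Re z)).

Definition q_expansion (f : C -> C) (a : nat -> C) :=
  forall z, H z ->
    series ((fun n => a n * nome z ^+ n) : nat -> C^o) @ \oo --> (f z : C^o).

(* T_n f (z) = n^(k-1) \sum_(ad = n) \sum_(0 <= b < d) Psi(a) d^(-k) f((az+b)/d),
   where n^(k-1) d^(-k) = n^(-1) a^k. *)
Definition hecke_operator (k : nat) (Psi : int -> C) (n : nat) (f : C -> C) (z : C) : C :=
  n%:R^-1 * \sum_(a <- divisors n) Psi a%:Z * a%:R ^+ k *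
    \sum_(b < (n %/ a)%N) f ((a%:R * z + b%:R) / (n %/ a)%:R).

(* Petersson product on S_k(N, Psi), not normalized by the volume: a fundamental
   domain of Gamma_0(N) is the union of the g D, for D the standard fundamental
   domain of SL_2(Z) and g in a set of representatives of Gamma_0(N)\SL_2(Z). *)
Definition is_coset_reps (N : nat) (s : seq 'M[int]_2) :=
  [/\ uniq s, forall g, g \in s -> SL2Z g &
      forall h, SL2Z h -> exists! g, g \in s /\ Gamma0 N (h *m invmx g)].

Definition coset_reps (N : nat) : seq 'M[int]_2 := xget [::] (is_coset_reps N).

Definition SL2Z_domain : set (R * R) :=
  [set w | [/\ 0 < w.2, `|w.1| <= 2^-1 & 1 <= w.1 ^+ 2 + w.2 ^+ 2]].

Definition integral_SL2Z_domain (h : C -> C) : C :=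
  let mu := (lebesgue_measure \x lebesgue_measure)%E in
  (\int[mu]_(w in SL2Z_domain) complex.Re (h (w.1 +i* w.2)))
  +i* (\int[mu]_(w in SL2Z_domain) complex.Im (h (w.1 +i* w.2))).

Definition petersson (k N : nat) (f g : C -> C) : C :=
  \sum_(s <- coset_reps N) integral_SL2Z_domain (fun z =>
    slashZ k s f z * (slashZ k s g z)^*
    * (complex.Im z ^+ k / complex.Im z ^+ 2)%:C).

(* the forms z |-> g(tz) spanning the old subspace of S_k(N, Psi) *)
Definition old_form (k N : nat) (Psi : int -> C) (h : C -> C) :=
  exists (M t : nat) (Psi' : int -> C) (g : C -> C),
    [/\ (0 < M < N)%N && (0 < t)%N && (t * M %| N)%N,
        dirichlet_character M Psi',
        forall x, coprimez x N%:Z -> Psi x = Psi' x,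
        cusp_form k M Psi' g &
        h = fun z => g (t%:R * z)].

(* f = \sum_n a_n q^n is a normalized Hecke eigenform in the new subspace *)
Record newform (k N : nat) (Psi : int -> C) (f : C -> C) (a : nat -> C) : Prop :=
  Newform {
    newform_cusp : cusp_form k N Psi f;
    newform_qexp : q_expansion f a;
    newform_new : forall h, old_form k N Psi h -> petersson k N f h = 0;
    newform_eigen : forall n, (0 < n)%N ->
      exists lam : C, forall z, H z -> hecke_operator k Psi n f z = lam * f z;
    newform_normalized : a 1%N = 1 }.

(* The open compact subgroup K_0(N) of GL_2(A_{Q,f}); [n] is an integer whose
   class mod N is that of the lower right entry of [u]. *)
Definition in_K0 (N : nat) (u : forall l : primeT, 'M[Zp l]_2) (n : int) :=
  forall l, [/\ u l \in unitmx,
    exists z, u l 1 0 = N%:R * z &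
    exists z, u l 1 1 = n%:~R + N%:R * z].

(* The automorphic form on GL_2(A_Q) attached to f: by strong approximation
   GL_2(A_Q) = GL_2(Q) GL_2(R)^+ K_0(N), and
     phi (gamma h u) = (f |_k h)(i) * Psi(d_u)^-1. *)
Definition adelic_lift (k N : nat) (Psi : int -> C) (f : C -> C) (g : GL2A R) : C :=
  xget 0 [set w | exists (gamma : GL2 rat) (h : GL2 R)
                         (u : forall l : primeT, 'M[Zp l]_2) (n : int),
    [/\ 0 < \det h, in_K0 N u n,
        GL2_mx (comp_inf g) = map_mx ratr gamma *m h,
        forall l, GL2_mx (comp_fin g l)
                  = map_mx ratr gamma *m map_mx (@Zp_to_Qp l) (u l) &
        w = slash k h f (0 +i* 1) * (Psi n)^-1]].

(* Right translates, not their Hilbert space closure or its K-finite vectors: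
   the lift is a pure tensor in (x)' pi_v, so its translates span the tensor
   product of the spans of the local translates, and at a finite place p this
   span is the whole irreducible smooth representation pi_p. *)
Definition automorphic_rep (k N : nat) (Psi : int -> C) (f : C -> C) :
    rep R (GL2A R) :=
  translates_rep (adelic_lift k N Psi f).

(* the field Q(S) *)
Definition Q_adjoin (S : set C) : set C :=
  [set x | forall F : {pred C}, GRing.divring_closed F ->
     (forall y, S y -> y \in F) -> x \in F].

Definition hecke_field (a : nat -> C) : set C := Q_adjoin (range a).

End ModularForms.

(* Main.v *)
(* By continuity of [chi1] there is a natural number [u] prime to [p] with [chi1 u = xi]; put
   [om = chi1 u * chi2 u] and [c = chi1 u + chi2 u = xi + om / xi]. The central character of the lift
   of [f] makes [om] a value of [Psi^-1], hence an m-th root of unity, and it remains to show that [c]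
   lies in every field [F] containing the coefficients of [f].

   If A denotes diag(u, 1), the operator A^2 - c A + om kills the Jacquet module of pi(chi1, chi2): the
   sum of its translates by the matrices n(t/p^r) = [[1, t/p^r], [0, 1]] vanishes on every vector, as
   one checks on the two Bruhat cells. Evaluated on a lower unipotent translate of the adelic lift, at
   the points diag(s, 1) at p, this is a relation S(u^2, s) - c S(u, s) + om S(1, s) = 0 for all s prime
   to p, where S(v, s)(z) is the sum over j of G_{sv}(z - sj/p^r) and G_s is the transform of [f] by a
   lower unipotent integral matrix depending on s modulo a power of p. Some S(u, s) is not identically
   zero, because vectors of the principal series are detected by their values at lower unipotent
   matrices, and because strong approximation leaves only the points diag(s, 1).

   The functions G_s are Galois conjugate, in the following sense: after multiplication by a common
   factor their Fourier coefficients are A_n(zeta^s) with A_n in F[X] and zeta a root of unity. To see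
   this, a dimension count and the Sturm bound write f as a quotient B / A of polynomials over F in
   Eisenstein series, whose expansions at all cusps are given explicitly by the Lipschitz formula.
   Clearing denominators and summing over the residues s prime to p, which turns powers of zeta into
   rational numbers, the relation becomes one with coefficients in F, so that c is a quotient of two
   elements of F. *)
Require Import Defs.
From HB Require Import structures.
From mathcomp Require Import all_boot all_order all_algebra.
From mathcomp Require Import fraction complex.
From mathcomp Require Import all_classical all_reals all_analysis.
From mathcomp Require Import ring lra zify.
Set Implicit Arguments.
Unset Strict Implicit.
Unset Printing Implicit Defensive.
Import Order.TTheory GRing.Theory Num.Theory.
Import numFieldNormedType.Exports.
Local Open Scope classical_set_scope.
Local Open Scope complex_scope.
Local Open Scope ring_scope.

(** The field [F] is arbitrary, so the degree over [F] of a root of unity zeta is unknown and the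
    conjugation taking zeta to zeta^s need not exist over [F]. It is therefore carried by
    polynomials: all s prime to p are kept at once, with the same c in the relation for each of
    them, and averaging over s replaces the trace. The lower unipotent translate is forced: when
    both characters are ramified, the image of the newform in the Jacquet module is zero and the
    relation would read 0 = 0. The quotient B / A has to make sense at every cusp. This is why it is
    built from Eisenstein series, whose transforms under SL_2(Z) are again explicit. The product of
    A, f and one auxiliary Eisenstein series is compared with B in a weight divisible by 12; as A
    and B together offer twice as many unknowns as one of them, a Sturm bound with a crude constant
    suffices. Complex analysis enters through second order Taylor expansions: they are stable under
    the operations used and already give the maximum principle, hence the identity theorem and the
    Sturm bound. *)

(** * The complex modulus as a real number *)

Section ComplexModulus.
Variable R : realType.
Local Notation C := R[i].

(** [|z|] has values in [R[i]]; this is the same number in [R], where the order is total. *)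
Definition cn (z : C) : R := Normc.normc z.

Lemma cnE z : `|z| = (cn z)%:C.
Proof. by case: z. Qed.
Lemma cn_sqrE z : cn z ^+ 2 = complex.Re z ^+ 2 + complex.Im z ^+ 2.
Proof. by case: z => a b; rewrite /cn/= sqr_sqrtr// addr_ge0// sqr_ge0. Qed.
Lemma cn_ge0 z : 0 <= cn z.
Proof. by case: z => a b; rewrite /cn/= sqrtr_ge0. Qed.
Lemma cn0 : cn 0 = 0. Proof. exact: Normc.normc0. Qed.
Lemma cn1 : cn 1 = 1. Proof. exact: Normc.normc1. Qed.
Lemma cnM z w : cn (z * w) = cn z * cn w. Proof. exact: Normc.normcM. Qed.
Lemma cnV z : cn z^-1 = (cn z)^-1. Proof. exact: Normc.normcV. Qed.
Lemma cnN z : cn (- z) = cn z. Proof. exact: normcN. Qed.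
Lemma cnD z w : cn (z + w) <= cn z + cn w. Proof. exact: le_normcD. Qed.
Lemma cnB z w : cn (z - w) <= cn z + cn w. Proof. by rewrite -(cnN w) cnD. Qed.
Lemma cn_distC z w : cn (z - w) = cn (w - z). Proof. by rewrite -cnN opprB. Qed.
Lemma cnX z n : cn (z ^+ n) = cn z ^+ n.
Proof. by elim: n => [|n IH]; rewrite ?expr0 ?cn1// !exprS cnM IH. Qed.
Lemma cn_real (x : R) : cn x%:C = `|x|.
Proof. by rewrite /cn/= expr0n addr0 sqrtr_sqr. Qed.
Lemma cn_nat n : cn n%:R = n%:R.
Proof. by rewrite -(rmorph_nat (real_complex R)) cn_real normr_nat. Qed.
Lemma cn_eq0 z : (cn z == 0) = (z == 0).
Proof. by apply/eqP/eqP => [/Normc.eq0_normc//|->]; exact: cn0. Qed.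
Lemma cn_gt0 z : (0 < cn z) = (z != 0).
Proof. by rewrite lt_neqAle cn_ge0 andbT eq_sym cn_eq0. Qed.
Lemma cn_tri z w : cn z <= cn w + cn (z - w).
Proof. by rewrite -{1}(subrK w z) addrC cnD. Qed.
Lemma cn_sum (I : Type) (r : seq I) (P : pred I) (f : I -> C) :
  cn (\sum_(i <- r | P i) f i) <= \sum_(i <- r | P i) cn (f i).
Proof.
elim/big_rec2: _ => [|i y x _ le]; first by rewrite cn0.
by rewrite (le_trans (cnD _ _))// lerD2l.
Qed.
Lemma cn_prod (I : Type) (r : seq I) (P : pred I) (f : I -> C) :
  cn (\prod_(i <- r | P i) f i) = \prod_(i <- r | P i) cn (f i).
Proof. by elim/big_rec2: _ => [|i y x _ <-]; rewrite ?cn1 ?cnM. Qed.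
Lemma Re_le_cn z : `|complex.Re z| <= cn z.
Proof.
rewrite -(@ler_pXn2r _ 2)// ?nnegrE ?cn_ge0// cn_sqrE real_normK ?num_real//.
by rewrite lerDl sqr_ge0.
Qed.
Lemma Im_le_cn z : `|complex.Im z| <= cn z.
Proof.
rewrite -(@ler_pXn2r _ 2)// ?nnegrE ?cn_ge0// cn_sqrE real_normK ?num_real//.
by rewrite lerDr sqr_ge0.
Qed.
Lemma cn_le_ReIm z : cn z <= `|complex.Re z| + `|complex.Im z|.
Proof.
rewrite -(@ler_pXn2r _ 2)// ?nnegrE ?cn_ge0 ?addr_ge0// cn_sqrE sqrrD.
rewrite !real_normK ?num_real//.
have : 0 <= `|complex.Re z| * `|complex.Im z| by rewrite mulr_ge0.
by rewrite mulr2n; lra.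
Qed.
Lemma cn_i : cn 'i%C = 1.
Proof. by rewrite /cn/= expr0n/= add0r expr1n sqrtr1. Qed.
Lemma cReD (z w : C) : complex.Re (z + w) = complex.Re z + complex.Re w.
Proof. by case: z w => a b []. Qed.
Lemma cImD (z w : C) : complex.Im (z + w) = complex.Im z + complex.Im w.
Proof. by case: z w => a b []. Qed.
Lemma cReN (z : C) : complex.Re (- z) = - complex.Re z. Proof. by case: z. Qed.
Lemma cImN (z : C) : complex.Im (- z) = - complex.Im z. Proof. by case: z. Qed.
Lemma cReM (z w : C) : complex.Re (z * w) =
  complex.Re z * complex.Re w - complex.Im z * complex.Im w.
Proof. by case: z w => a b []. Qed.
Lemma cImM (z w : C) : complex.Im (z * w) =
  complex.Re z * complex.Im w + complex.Im z * complex.Re w.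
Proof. by case: z w => a b []. Qed.
(** In [taylor2_local_max] this takes the place of the mean value property on a circle. *)
Lemma parallelogram (z w : C) :
  cn (z + w) ^+ 2 + cn (z - w) ^+ 2 = 2 * cn z ^+ 2 + 2 * cn w ^+ 2.
Proof. rewrite !cn_sqrE !(cReD, cImD, cReN, cImN); ring. Qed.
Lemma cplxP (z w : C) : complex.Re z = complex.Re w ->
  complex.Im z = complex.Im w -> z = w.
Proof. by case: z w => a b [c d] /= -> ->. Qed.
End ComplexModulus.
Arguments cn : simpl never.

(** * Second order Taylor expansions and the maximum principle *)

Section Taylor.
Variable R : realType.
Local Notation C := R[i].
Implicit Types (f g : C -> C) (n m : nat) (z : C).

Definition isO n g := exists K d : R,
  [/\ 0 <= K, 0 < d & forall h, cn h < d -> cn (g h) <= K * cn h ^+ n].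

Lemma isO_ext n f g : f =1 g -> isO n f -> isO n g.
Proof. by move=> fg [K [d [? ? H]]]; exists K, d; split=> // h /H; rewrite fg. Qed.

Lemma isO_le m n g : (m <= n)%N -> isO n g -> isO m g.
Proof.
move=> mn [K [d [K0 d0 H]]]; exists K, (Num.min d 1); split=> //.
  by rewrite lt_min d0 ltr01.
move=> h; rewrite lt_min => /andP[/H gh h1]; apply: (le_trans gh).
by rewrite ler_wpM2l// ler_wiXn2l// ?cn_ge0// ltW.
Qed.

Lemma isOD n f g : isO n f -> isO n g -> isO n (fun h => f h + g h).
Proof.
move=> [K [d [K0 d0 H]]] [K' [d' [K0' d0' H']]].
exists (K + K'), (Num.min d d'); split; rewrite ?addr_ge0 ?lt_min ?d0//.
move=> h; rewrite lt_min => /andP[/H fh /H' gh].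
by rewrite (le_trans (cnD _ _))// mulrDl lerD.
Qed.

Lemma isOM m n f g : isO m f -> isO n g -> isO (m + n) (fun h => f h * g h).
Proof.
move=> [K [d [K0 d0 H]]] [K' [d' [K0' d0' H']]].
exists (K * K'), (Num.min d d'); split; rewrite ?mulr_ge0 ?lt_min ?d0//.
move=> h; rewrite lt_min => /andP[/H fh /H' gh].
by rewrite cnM exprD mulrACA ler_pM ?cn_ge0.
Qed.

Lemma isO_cst (c : C) : isO 0 (fun=> c).
Proof. by exists (cn c), 1; split=> [||h _]; rewrite ?cn_ge0// expr0 mulr1. Qed.
Lemma isO_id : isO 1 id.
Proof. by exists 1, 1; split=> // h _; rewrite mul1r. Qed.
Lemma isO0 n : isO n (fun=> 0).
Proof. by exists 0, 1; split=> // h _; rewrite cn0 mul0r. Qed.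
Lemma isO_exp n : isO n (fun h => h ^+ n).
Proof. by exists 1, 1; split=> // h _; rewrite cnX mul1r. Qed.
Lemma isOcM n c g : isO n g -> isO n (fun h => c * g h).
Proof. exact: isOM (isO_cst c). Qed.
Lemma isOMc n c g : isO n g -> isO n (fun h => g h * c).
Proof. by move=> /(isOcM c); apply: isO_ext => h; rewrite mulrC. Qed.

Lemma isO_comp n f g : isO n f -> isO 1 g -> isO n (f \o g).
Proof.
move=> [K [d [K0 d0 H]]] [K' [d' [K0' d0' H']]].
exists (K * (K' ^+ n)), (Num.min d' (d / (K' + 1))).
have K1 : 0 < K' + 1 by rewrite ltr_wpDl.
split; rewrite ?mulr_ge0 ?exprn_ge0 ?lt_min ?d0' ?divr_gt0//.
move=> h; rewrite lt_min => /andP[/H']; rewrite expr1 => gh.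
rewrite ltr_pdivlMr// => hd /=.
have gd : cn (g h) < d.
  rewrite (le_lt_trans gh)// (le_lt_trans _ hd)// mulrC ler_wpM2l ?cn_ge0//.
  by rewrite lerDl.
rewrite (le_trans (H _ gd))// -mulrA ler_wpM2l// -exprMn lerXn2r// ?nnegrE ?cn_ge0//.
by rewrite mulr_ge0 ?cn_ge0.
Qed.

(** The substitute for holomorphy. The error must be cubic: in [taylor2_local_max] it competes with
    a gain of order t^2. *)
Definition taylor2 f z := exists a b c : C,
  isO 3 (fun h => f (z + h) - (a + b * h + c * h ^+ 2)).

Lemma isO_at0 n g : isO n.+1 g -> g 0 = 0.
Proof.
move=> [K [d [K0 d0 /(_ 0)]]]; rewrite cn0 => /(_ d0).
by rewrite expr0n mulr0 => g0; apply/eqP; rewrite -cn_eq0 eq_le g0 cn_ge0.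
Qed.

Lemma taylor2_at0 f z a b c :
  isO 3 (fun h => f (z + h) - (a + b * h + c * h ^+ 2)) -> a = f z.
Proof.
move=> /isO_at0/eqP; rewrite expr0n/= !mulr0 !addr0.
by rewrite subr_eq0 => /eqP.
Qed.

Lemma isO_poly a b c : isO 0 (fun h : C => a + b * h + c * h ^+ 2).
Proof.
apply: isOD; first apply: isOD; first exact: isO_cst.
  exact/isOcM/(isO_le _ isO_id).
exact/isOcM/(isO_le _ (isO_exp 2)).
Qed.

Lemma taylor2_isO0 f z : taylor2 f z -> isO 0 (fun h => f (z + h)).
Proof.
move=> [a [b [c H]]]; apply: isO_ext (isOD (isO_le (leq0n _) H) (isO_poly a b c)).
by move=> h; rewrite subrK.
Qed.

Lemma taylor2_isO1 f z : taylor2 f z -> isO 1 (fun h => f (z + h) - f z).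
Proof.
move=> [a [b [c H]]]; have az := taylor2_at0 H; rewrite -az.
apply: isO_ext (isOD (isO_le (isT : 1 <= 3)%N H)
  (isOD (isOcM b isO_id) (isOcM c (isO_le (isT : 1 <= 2)%N (isO_exp 2))))).
move=> h /=; ring.
Qed.

Lemma taylor2_ext f g z (d : R) : 0 < d ->
  (forall h, cn h < d -> f (z + h) = g (z + h)) -> taylor2 f z -> taylor2 g z.
Proof.
move=> d0 fg [a [b [c [K [d' [K0 d0' H]]]]]]; exists a, b, c, K, (Num.min d d').
split; rewrite ?lt_min ?d0// => h; rewrite lt_min => /andP[hd hd'].
by rewrite -fg// H.
Qed.

Lemma taylor2_cst c z : taylor2 (fun=> c) z.
Proof.
exists c, 0, 0; apply: isO_ext (isO0 3) => h; ring.
Qed.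

Lemma taylor2_id z : taylor2 id z.
Proof. exists z, 1, 0; apply: isO_ext (isO0 3) => h; ring. Qed.

Lemma taylor2D f g z : taylor2 f z -> taylor2 g z -> taylor2 (fun w => f w + g w) z.
Proof.
move=> [a [b [c H]]] [a' [b' [c' H']]]; exists (a + a'), (b + b'), (c + c').
apply: isO_ext (isOD H H') => h; ring.
Qed.

Lemma taylor2M f g z : taylor2 f z -> taylor2 g z -> taylor2 (fun w => f w * g w) z.
Proof.
move=> T T'; have [a [b [c H]]] := T; have [a' [b' [c' H']]] := T'.
exists (a * a'), (a * b' + b * a'), (a * c' + b * b' + c * a').
apply: isO_ext (isOD (isOM (taylor2_isO0 T) H') (isOD (isOM H (isO_poly a' b' c'))
  (isOD (isOcM (b * c' + c * b') (isO_exp 3))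
        (isOcM (c * c') (isO_le (isT : 3 <= 4)%N (isO_exp 4)))))).
move=> h /=; ring.
Qed.

Lemma taylor2N f z : taylor2 f z -> taylor2 (fun w => - f w) z.
Proof.
move=> /(taylor2M (taylor2_cst (-1) z)); apply: (taylor2_ext ltr01) => h _.
by rewrite mulN1r.
Qed.

Lemma taylor2X f n z : taylor2 f z -> taylor2 (fun w => f w ^+ n) z.
Proof.
move=> T; elim: n => [|n IH]; first exact: taylor2_cst.
by apply: (taylor2_ext ltr01 _ (taylor2M T IH)) => h _; rewrite exprS.
Qed.

Lemma taylor2_sum (I : Type) (r : seq I) (P : pred I) (f : I -> C -> C) z :
  (forall i, taylor2 (f i) z) -> taylor2 (fun w => \sum_(i <- r | P i) f i w) z.
Proof.
move=> T; elim: r => [|i r IH].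
  by apply: (taylor2_ext ltr01 _ (taylor2_cst 0 z)) => h _; rewrite big_nil.
case: (boolP (P i)) => Pi; last first.
  by apply: (taylor2_ext ltr01 _ IH) => h _; rewrite big_cons (negbTE Pi).
by apply: (taylor2_ext ltr01 _ (taylor2D (T i) IH)) => h _; rewrite big_cons Pi.
Qed.

Lemma taylor2_prod (I : Type) (r : seq I) (P : pred I) (f : I -> C -> C) z :
  (forall i, taylor2 (f i) z) -> taylor2 (fun w => \prod_(i <- r | P i) f i w) z.
Proof.
move=> T; elim: r => [|i r IH].
  by apply: (taylor2_ext ltr01 _ (taylor2_cst 1 z)) => h _; rewrite big_nil.
case: (boolP (P i)) => Pi; last first.
  by apply: (taylor2_ext ltr01 _ IH) => h _; rewrite big_cons (negbTE Pi).
by apply: (taylor2_ext ltr01 _ (taylor2M (T i) IH)) => h _; rewrite big_cons Pi.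
Qed.

Lemma isO1_small f e : isO 1 f -> 0 < e ->
  exists2 d : R, 0 < d & forall h, cn h < d -> cn (f h) < e.
Proof.
move=> [K [d [K0 d0 H]]] e0; have K1 : 0 < K + 1 by rewrite ltr_wpDl.
exists (Num.min d (e / (K + 1))); first by rewrite lt_min d0 divr_gt0.
move=> h; rewrite lt_min => /andP[/H fh]; rewrite ltr_pdivlMr// => he.
by rewrite (le_lt_trans fh)// expr1 (le_lt_trans _ he)// mulrC ler_wpM2l ?cn_ge0 ?lerDl.
Qed.

Lemma taylor2_cont f z e : taylor2 f z -> 0 < e ->
  exists2 d : R, 0 < d & forall h, cn h < d -> cn (f (z + h) - f z) < e.
Proof. by move=> /taylor2_isO1; apply: isO1_small. Qed.

Lemma taylor2_comp f g z : taylor2 f (g z) -> taylor2 g z ->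
  taylor2 (fun w => f (g w)) z.
Proof.
move=> [a [b [c H]]] T; have k1 := taylor2_isO1 T.
have k2 := isOM k1 k1; have [a' [b' [c' H']]] := T.
have ga := taylor2_at0 H'.
exists a, (b * b'), (b * c' + c * b' ^+ 2).
have E : isO 3 (fun h => (g (z + h) - g z) ^+ 2 - b' ^+ 2 * h ^+ 2).
  apply: isO_ext (isOD (isOM H' (isO_le (leq0n _) k1))
    (isOD (isOM (isOD (isOMc b' isO_id) (isOcM c' (isO_le (isT : 1 <= 2)%N
             (isO_exp 2)))) (isO_le (isT : 2 <= 3)%N H'))
    (isOD (isOcM (b' * c' + c' * b') (isO_exp 3))
          (isOcM (c' * c') (isO_le (isT : 3 <= 4)%N (isO_exp 4)))))).
  move=> h /=; rewrite -ga; ring.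
apply: isO_ext (isOD (isO_comp H k1) (isOD (isOcM b H') (isOcM c E))) => h /=.
have -> : g z + (g (z + h) - g z) = g (z + h) by rewrite addrC subrK.
rewrite -ga; ring.
Qed.

Lemma taylor2V f z : f z != 0 -> taylor2 f z -> taylor2 (fun w => (f w)^-1) z.
Proof.
move=> fz0; suff Vz (w : C) : w != 0 -> taylor2 (fun w => w^-1) w.
  by move=> T; apply: (taylor2_comp _ T); exact: Vz.
move=> w0; exists w^-1, (- w ^- 2), (w ^- 3).
have c0 : 0 < cn w / 2 by rewrite divr_gt0 ?cn_gt0.
have nz h : cn h < cn w / 2 -> w + h != 0.
  move=> hd; apply/negP => /eqP/(congr1 (@cn R)); rewrite cn0 => wh.
  have := cn_tri w (- h); rewrite opprK wh addr0 cnN => wh'.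
  by have := cn_ge0 h; lra.
have V0 : isO 0 (fun h => (w + h)^-1).
  exists (2 / cn w), (cn w / 2); split; rewrite ?divr_ge0 ?cn_ge0// => h hd.
  rewrite expr0 mulr1 cnV -[leRHS]invrK invf_div lef_pV2 ?posrE ?cn_gt0 ?nz//.
  have := cn_tri w (- h); rewrite opprK cnN [w + h]addrC => wh.
  move: hd wh; rewrite [h + w]addrC; lra.
(* The exact remainder of (w + h)^-1 after order 2 is -w^-3 h^3 (w + h)^-1. *)
have [K [d [K0 d0 H]]] := isOM V0 (isOcM (- w ^- 3) (isO_exp 3)).
exists K, (Num.min d (cn w / 2)); split; rewrite ?lt_min ?d0// => h.
rewrite lt_min => /andP[/H hd /nz wh0]; apply: le_trans hd; rewrite le_eqVlt.
by apply/orP/or_introl/eqP; congr cn; field; rewrite w0 wh0.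
Qed.

(** Over the four points h = t, -t, it, -it, the average of |a + b h + c h^2|^2 is |a|^2 + |b|^2 t^2
    + |c|^2 t^4, at least its value at h = 0. The term in [e] gains a positive multiple of e t^2 on
    average, which for small t outweighs the cubic remainder. *)
Lemma taylor2_local_max f z (e r : R) : taylor2 f z -> 0 < e -> 0 < r ->
  exists2 w, cn (w - z) < r & cn (f z) ^+ 2 + e * complex.Im z ^+ 2 <
                         cn (f w) ^+ 2 + e * complex.Im w ^+ 2.
Proof.
move=> [a [b [c H]]] e0 r0; have fa := taylor2_at0 H.
have [K [d [K0 d0 Hd]]] := H; have [M [d' [M0 d0' Hd']]] := isO_poly a b c.
(* The four remainders cost 8 M K t^3 in total and the four imaginary parts bring 2 e t^2, hence the
   last bound on t. *)
pose t := Num.min (Num.min r 1) (Num.min (Num.min d d') (e / (4 * M * K + 1))) / 2.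
have KM0 : 0 <= M * K by rewrite mulr_ge0.
have t0 : 0 < t.
  rewrite /t divr_gt0// !lt_min r0 d0 d0' ltr01/= divr_gt0//; lra.
have [tr t1 td td' te] : [/\ t < r, t < 1, t < d, t < d' & t * (4 * M * K + 1) < e].
  rewrite -[_ * _ < e]ltr_pdivlMr; last lra.
  have tt : t < t * 2 by lra.
  have : t * 2 = Num.min (Num.min r 1) (Num.min (Num.min d d') (e / (4 * M * K + 1))).
    by rewrite /t divfK.
  move=> t2; move: tt; rewrite t2 !lt_min.
  by case/andP=> /andP[h1 h2] /andP[/andP[h3 h4] h5]; split.
clearbody t.
pose P h := a + b * h + c * h ^+ 2.
have N2 h : cn h = t -> cn (P h) ^+ 2 - 2 * M * K * t ^+ 3 <= cn (f (z + h)) ^+ 2.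
  move=> ht; have := Hd h; rewrite ht => /(_ td) e1.
  have := Hd' h; rewrite ht => /(_ td'); rewrite expr0 mulr1 => e2.
  have := cn_tri (P h) (f (z + h)); rewrite (cn_distC (P h)) => e3.
  have f0 := cn_ge0 (f (z + h)); have P0 := cn_ge0 (P h).
  have t3 : 0 <= K * t ^+ 3 by rewrite mulr_ge0 // exprn_ge0 // ltW.
  have e4 : cn (P h) <= cn (f (z + h)) + K * t ^+ 3 by apply: (le_trans e3); rewrite lerD2l.
  case: (leP (cn (P h)) (K * t ^+ 3)) => Pk.
    have : cn (P h) ^+ 2 <= M * (K * t ^+ 3) by rewrite expr2 ler_pM.
    move=> ?; have : 0 <= cn (f (z + h)) ^+ 2 by rewrite sqr_ge0.
    have : 0 <= M * (K * t ^+ 3) by rewrite mulr_ge0.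
    nra.
  have : (cn (P h) - K * t ^+ 3) ^+ 2 <= cn (f (z + h)) ^+ 2.
    by rewrite lerXn2r// ?nnegrE ?subr_ge0 ?(ltW Pk)//; lra.
  have : cn (P h) * (K * t ^+ 3) <= M * (K * t ^+ 3) by rewrite ler_wpM2r.
  have := sqr_ge0 (K * t ^+ 3); nra.
have it : cn (t%:C : C) = t by rewrite cn_real gtr0_norm.
have nt : cn (- t%:C : C) = t by rewrite cnN it.
have i1 : cn ('i%C * t%:C : C) = t by rewrite cnM cn_i mul1r it.
have ni1 : cn (- ('i%C * t%:C) : C) = t by rewrite cnN i1.
have S : cn (P t%:C) ^+ 2 + cn (P (- t%:C)) ^+ 2 + cn (P ('i%C * t%:C)) ^+ 2
   + cn (P (- ('i%C * t%:C))) ^+ 2 =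
   4 * cn a ^+ 2 + 4 * cn b ^+ 2 * t ^+ 2 + 4 * cn c ^+ 2 * t ^+ 4.
  have PE h : P h = (a + c * h ^+ 2) + b * h /\ P (- h) = (a + c * h ^+ 2) - b * h.
    by split; rewrite /P; ring.
  have [-> ->] := PE t%:C; have [-> ->] := PE ('i%C * t%:C).
  rewrite parallelogram -addrA parallelogram !exprMn sqr_i mulN1r mulrN.
  have := parallelogram a (c * t%:C ^+ 2).
  rewrite !cnM it cn_i => h; lra.
apply: contrapT => nex.
have le4 h : cn h = t -> cn (f (z + h)) ^+ 2 + e * complex.Im (z + h) ^+ 2 <=
    cn (f z) ^+ 2 + e * complex.Im z ^+ 2.
  move=> ht; rewrite leNgt; apply/negP => lt; apply: nex; exists (z + h) => //.
  by rewrite addrC addKr ht.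
have := le4 _ it; have := le4 _ nt; have := le4 _ i1; have := le4 _ ni1.
have := N2 _ it; have := N2 _ nt; have := N2 _ i1; have := N2 _ ni1.
rewrite !(cReD, cImD, cReM, cImM, cReN, cImN)/= -fa.
move: S; set u1 := cn (P _); set u2 := cn (P _); set u3 := cn (P _); set u4 := cn (P _).
move: (cn (f _)) (cn (f _)) (cn (f _)) (cn (f _)) => v1 v2 v3 v4.
have b0 : 0 <= cn b ^+ 2 * t ^+ 2 by rewrite mulr_ge0 ?sqr_ge0.
have c0 : 0 <= cn c ^+ 2 * t ^+ 4 by rewrite mulr_ge0 ?sqr_ge0// exprn_even_ge0.
have : t ^+ 2 * (t * (4 * M * K + 1)) < t ^+ 2 * e by rewrite ltr_pM2l// exprn_gt0.
have : 0 < t ^+ 3 by rewrite exprn_gt0.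
rewrite !exprS expr0; nra.
Qed.

End Taylor.

(** * The function q = exp(2 pi i z) and its Taylor expansion *)

Section Exponential.
Variable R : realType.
Local Notation C := R[i].

(** By the mean value theorem. The factor 1 / (n + 1) of an integration is given away, so that the
    bounds for sin, cos and exp below chain with the same constant. *)
Lemma derive_bound (f df : R -> R) (K : R) (n : nat) :
  (forall x : R, is_derive x 1 f (df x)) -> f 0 = 0 -> 0 <= K ->
  (forall x : R, `|x| <= 1 -> `|df x| <= K * `|x| ^+ n) ->
  forall x : R, `|x| <= 1 -> `|f x| <= K * `|x| ^+ n.+1.
Proof.
move=> fd f0 K0 dfb x x1.
have cf : continuous f by move=> y; exact/differentiable_continuous/derivable1_diffP.
have key c : `|c| <= `|x| -> f x = df c * x -> `|f x| <= K * `|x| ^+ n.+1.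
  move=> cx ->; rewrite normrM exprSr mulrA ler_wpM2r// (le_trans (dfb _ _))//.
    exact: le_trans x1.
  by rewrite ler_wpM2l// lerXn2r// nnegrE.
have [x0|x0] := leP 0 x.
  have [c] := @MVT_segment _ f df 0 x x0 (fun y _ => fd y) (continuous_subspaceT cf).
  rewrite in_itv/= f0 !subr0 => /andP[c0 cx]; apply: key.
  by rewrite !ger0_norm.
have [c] := @MVT_segment _ f df x 0 (ltW x0) (fun y _ => fd y) (continuous_subspaceT cf).
rewrite in_itv/= f0 !sub0r => /andP[c0 cx]; rewrite mulrN => /oppr_inj; apply: key.
by rewrite !ler0_norm ?lerN2// ltW.
Qed.

Lemma sin_le_id (x : R) : `|x| <= 1 -> `|sin x| <= `|x|.
Proof.
move=> x1; rewrite -[leRHS]mul1r -[X in _ <= _ * X]expr1.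
apply: (@derive_bound (@sin R) cos 1 0) => //; first exact: sin0.
by move=> y _; rewrite expr0 mulr1 ler_norml cos_geN1 cos_le1.
Qed.

Lemma cos_sub1 (x : R) : `|x| <= 1 -> `|cos x - 1| <= `|x| ^+ 2.
Proof.
move=> x1; rewrite -[leRHS]mul1r.
apply: (@derive_bound (fun x => cos x - 1) (fun x => - sin x) 1 1) => // {x x1}.
- by move=> y; apply: is_derive_eq; rewrite subr0.
- by rewrite cos0 subrr.
- by move=> y y1; rewrite normrN mul1r expr1 sin_le_id.
Qed.

Lemma sin_sub_id (x : R) : `|x| <= 1 -> `|sin x - x| <= `|x| ^+ 3.
Proof.
move=> x1; rewrite -[leRHS]mul1r.
apply: (@derive_bound (fun x => sin x - x) (fun x => cos x - 1) 1 2) => // {x x1}.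
  by rewrite sin0 subrr.
by move=> y y1; rewrite mul1r cos_sub1.
Qed.

Lemma cos_taylor (x : R) : `|x| <= 1 -> `|cos x - 1 + x ^+ 2 / 2| <= `|x| ^+ 4.
Proof.
move=> x1; rewrite -[leRHS]mul1r.
apply: (@derive_bound (fun x => cos x - 1 + x ^+ 2 / 2) (fun x => - sin x + x) 1 3) => // {x x1}.
- move=> y; apply: is_derive_eq; rewrite /GRing.scale/= !subr0; by field.
- by rewrite cos0 subrr expr0n mul0r add0r.
- by move=> y y1; rewrite mul1r -normrN opprD opprK sin_sub_id.
Qed.

Lemma expR_taylor (x : R) : `|x| <= 1 ->
  `|expR x - 1 - x - x ^+ 2 / 2| <= expR 1 * `|x| ^+ 3.
Proof.
move: x; apply: (@derive_bound (fun x => expR x - 1 - x - x ^+ 2 / 2) (fun x => expR x - 1 - x) _ 2).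
- move=> y; apply: is_derive_eq; rewrite /GRing.scale/= !subr0; by field.
- by rewrite expR0 expr0n mul0r !subr0 subrr.
- exact: expR_ge0.
apply: (@derive_bound (fun x => expR x - 1 - x) (fun x => expR x - 1) _ 1).
- move=> y; apply: is_derive_eq; rewrite !subr0//.
- by rewrite expR0 !subr0 subrr.
- exact: expR_ge0.
apply: (@derive_bound (fun x => expR x - 1) (fun x => expR x) _ 0).
- move=> y; apply: is_derive_eq; rewrite !subr0//.
- by rewrite expR0 subrr.
- exact: expR_ge0.
move=> y y1; rewrite expr0 mulr1 ger0_norm ?expR_ge0// ler_expR.
by rewrite (le_trans _ y1)// ler_norm.
Qed.

Lemma nomeD (z w : C) : nome (z + w) = nome z * nome w.
Proof.
rewrite /nome cReD cImD !mulrDr opprD expRD cosD sinD; apply: cplxP; rewrite /=; ring.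
Qed.
Lemma nome0 : nome (0 : C) = 1.
Proof.
by apply: cplxP; rewrite /= !mulr0 oppr0 expR0 cos0 sin0 ?(mul0r, mul1r, mulr0, subr0, addr0, mulr1)//; lra.
Qed.
Lemma cn_nome (z : C) : cn (nome z) = expR (- (2 * pi * complex.Im z)).
Proof.
rewrite /nome cnM cn_real ger0_norm ?expR_ge0// /cn/= cos2Dsin2 sqrtr1; lra.
Qed.
Lemma nome_neq0 (z : C) : nome z != 0.
Proof. by rewrite -cn_eq0 cn_nome gt_eqF ?expR_gt0. Qed.
Lemma nomeN (z : C) : nome (- z) = (nome z)^-1.
Proof.
by apply: (mulIf (nome_neq0 z)); rewrite -nomeD addNr nome0 mulVf ?nome_neq0.
Qed.
Lemma nomeMn (z : C) n : nome (n%:R * z) = nome z ^+ n.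
Proof.
elim: n => [|n IH]; first by rewrite mul0r nome0.
by rewrite -addn1 natrD mulrDl mul1r nomeD IH exprD.
Qed.
Lemma nomeMz (z : C) (n : int) : nome (n%:~R * z) = nome z ^ n.
Proof.
case: n => n; first exact: nomeMn.
by rewrite NegzE mulrNz mulNr nomeN nomeMn.
Qed.
Lemma nome1 : nome (1 : C) = 1.
Proof.
apply: cplxP; rewrite /= ?mulr0 ?oppr0 ?expR0 ?mulr1 ?mul1r ?mul0r ?subr0.
  by rewrite mulr_natl cos2pi.
by rewrite addr0 mulr_natl sin2pi.
Qed.
Lemma nome_int (n : int) : nome (n%:~R : C) = 1.
Proof. by rewrite -[n%:~R]mulr1 nomeMz nome1 exp1rz. Qed.
Lemma nome_nat (n : nat) : nome (n%:R : C) = 1.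
Proof. exact: (nome_int n). Qed.

Lemma isO_Re : isO 1 (fun h : C => (complex.Re h)%:C).
Proof.
by exists 1, 1; split=> // h _; rewrite cn_real mul1r expr1 Re_le_cn.
Qed.
Lemma isO_Im : isO 1 (fun h : C => (complex.Im h)%:C).
Proof.
by exists 1, 1; split=> // h _; rewrite cn_real mul1r expr1 Im_le_cn.
Qed.

Lemma isO_real n (f : R -> R) (u : C -> R) (K : R) : 0 <= K ->
  (forall x, `|x| <= 1 -> `|f x| <= K * `|x| ^+ n) ->
  isO 1 (fun h => (u h)%:C) -> isO n (fun h => (f (u h))%:C).
Proof.
move=> K0 fK [M [d [M0 d0 H]]]; have M1 : 0 < M + 1 by rewrite ltr_wpDl.
exists (K * M ^+ n), (Num.min d (M + 1)^-1); split.
- by rewrite mulr_ge0// exprn_ge0.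
- by rewrite lt_min d0 invr_gt0.
move=> h; rewrite lt_min => /andP[/H]; rewrite !cn_real expr1 => uh hM.
have u1 : `|u h| <= 1.
  rewrite (le_trans uh)//; move: hM; rewrite -[X in _ < X]mul1r ltr_pdivlMr// => hM.
  have := cn_ge0 h; nra.
rewrite (le_trans (fK _ u1))// -mulrA ler_wpM2l// -exprMn lerXn2r// nnegrE//.
by rewrite mulr_ge0 ?cn_ge0.
Qed.

(** The remainder of e(h), with t, x, y for the exponential, cosine and sine, and v + j u for the
    exponent. With j a free variable this is a polynomial identity, and j^2 = -1 is used only at the
    end. *)
Lemma nome_taylor_identity (j t v x y u : C) :
  (t - 1 - v - v ^+ 2 / 2) * (x + j * y) +
  ((1 + v + v * v / 2) * (x - 1 + u ^+ 2 / 2 + j * (y - u)) +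
   (u * (v * v) * (j / 2) +
    (v * (u * u) * - (1 / 2) + u * u * (v * v) * - (1 / 4)))) -
  (t * (x + j * y) - (1 + (v + j * u) + (v + j * u) ^+ 2 / 2)) =
  (j ^+ 2 + 1) * (u ^+ 2 / 2).
Proof. by field. Qed.

(** The derivative of [nome] at 0. *)
Definition tau : C := (2 * pi)%:C * 'i%C.

Lemma nome_taylor0 : isO 3 (fun h : C => nome h - (1 + tau * h + tau ^+ 2 / 2 * h ^+ 2)).
Proof.
pose A (h : C) := 2 * pi * complex.Re h; pose B (h : C) := - (2 * pi * complex.Im h).
have OA : isO 1 (fun h => (A h)%:C).
  by apply: isO_ext (isOcM (2 * pi)%:C isO_Re) => h; rewrite -rmorphM.
have OB : isO 1 (fun h => (B h)%:C).
  by apply: isO_ext (isOcM (- (2 * pi))%:C isO_Im) => h; rewrite -rmorphM /B mulNr.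
pose c4 x : R := cos x - 1 + x ^+ 2 / 2; pose s3 x : R := sin x - x.
pose e3 x : R := expR x - 1 - x - x ^+ 2 / 2.
have Oc : isO 3 (fun h => (c4 (A h))%:C).
  apply: isO_le (isT : 3 <= 4)%N _; apply: (isO_real ler01 _ OA) => x x1.
  by rewrite mul1r cos_taylor.
have Os : isO 3 (fun h => (s3 (A h))%:C).
  by apply: (isO_real ler01 _ OA) => x x1; rewrite mul1r sin_sub_id.
have Oe : isO 3 (fun h => (e3 (B h))%:C).
  by apply: (isO_real (expR_ge0 1) _ OB) => x x1; exact: expR_taylor.
pose w := tau.
change (isO 3 (fun h : C => nome h - (1 + w * h + w ^+ 2 / 2 * h ^+ 2))).
have Ot : isO 0 (fun h => (cos (A h))%:C + 'i%C * (sin (A h))%:C).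
  exists 2, 1; split=> // h _; rewrite expr0 mulr1 (le_trans (cnD _ _))// cnM cn_i mul1r.
  rewrite !cn_real (_ : 2 = 1 + 1)// lerD// ler_norml.
    by rewrite cos_geN1 cos_le1.
  by rewrite sin_geN1 sin_le1.
have O1 := isOM Oe Ot.
have Ob2 : isO 2 (fun h => (B h)%:C * (B h)%:C) := isOM OB OB.
have Oa2 : isO 2 (fun h => (A h)%:C * (A h)%:C) := isOM OA OA.
have Oab : isO 3 (fun h => (A h)%:C * ((B h)%:C * (B h)%:C)) := isOM OA Ob2.
have Oba : isO 3 (fun h => (B h)%:C * ((A h)%:C * (A h)%:C)) := isOM OB Oa2.
have Oaabb : isO 3 (fun h => ((A h)%:C * (A h)%:C) * ((B h)%:C * (B h)%:C)).
  exact: isO_le (isT : 3 <= 4)%N (isOM Oa2 Ob2).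
have Op : isO 0 (fun h => 1 + (B h)%:C + (B h)%:C * (B h)%:C / 2).
  apply: isOD; first exact: isOD (isO_cst _) (isO_le (leq0n _) OB).
  by apply: isOMc; exact: isO_le (leq0n _) Ob2.
apply: isO_ext (isOD O1 (isOD (isOM Op (isOD Oc (isOcM 'i%C Os)))
   (isOD (isOMc ('i%C / 2) Oab) (isOD (isOMc (- (1 / 2)) Oba) (isOMc (- (1 / 4)) Oaabb))))).
move=> h /=; rewrite /nome -/(A h) -/(B h).
have -> : w * h = (B h)%:C + 'i%C * (A h)%:C.
  by rewrite /w /tau /A /B; case: (h) => a b; apply: cplxP; rewrite /=; ring.
have -> : w ^+ 2 / 2 * h ^+ 2 = ((B h)%:C + 'i%C * (A h)%:C) ^+ 2 / 2.
  have -> : (B h)%:C + 'i%C * (A h)%:C = w * h.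
    by rewrite /w /tau /A /B; case: (h) => a b; apply: cplxP; rewrite /=; ring.
  by rewrite [(w * h) ^+ 2]exprMn [w ^+ 2 / 2 * _]mulrAC.
have -> : cos (A h) +i* sin (A h) = (cos (A h))%:C + 'i%C * (sin (A h))%:C.
  by apply: cplxP; rewrite /=; ring.
have -> : (c4 (A h))%:C = (cos (A h))%:C - 1 + (A h)%:C ^+ 2 / 2.
  by rewrite rmorphD rmorphM rmorphXn rmorphB fmorphV rmorph_nat rmorph1.
have -> : (s3 (A h))%:C = (sin (A h))%:C - (A h)%:C by rewrite rmorphB.
have -> : (e3 (B h))%:C = (expR (B h))%:C - 1 - (B h)%:C - (B h)%:C ^+ 2 / 2.
  by rewrite !rmorphB rmorphM rmorphXn fmorphV rmorph_nat rmorph1.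
have i2 : 'i%C ^+ 2 = -1 :> C by rewrite sqr_i.
move: (cos _)%:C (sin _)%:C (expR _)%:C (A h)%:C (B h)%:C => x y t u v.
move: 'i%C i2 => j j2; apply/eqP; rewrite -subr_eq0.
rewrite nome_taylor_identity ?j2 ?addNr ?mul0r//.
Qed.

Lemma taylor2_nome (z : C) : taylor2 (@nome R) z.
Proof.
apply: (taylor2_ext ltr01 (f := fun w => nome z * nome (w - z))).
  by move=> h _; rewrite -nomeD addrC subrK.
apply: taylor2M (taylor2_cst _ _) _; exists 1, tau, (tau ^+ 2 / 2).
by apply: isO_ext nome_taylor0 => h; rewrite [z + h]addrC addrK.
Qed.

End Exponential.

(** * Maximum principle and identity theorem on the upper half plane *)

Section MaximumPrinciple.
Variable R : realType.
Local Notation C := R[i].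
Implicit Types (F : C -> C) (z : C).

Definition hol F := forall z, 0 < complex.Im z -> taylor2 F z.

Let pt (p : R * R) : C := p.1 +i* p.2.

Lemma continuous_cn F (p : R * R) : taylor2 F (pt p) ->
  {for p, continuous (fun q => cn (F (pt q)))}.
Proof.
move=> T; apply/cvgrPdist_lt => e e0; have [d d0 H] := taylor2_cont T e0.
have d2 : 0 < d / 2 by rewrite divr_gt0.
apply: filterS (nbhsx_ballx p _ d2) => q [/= q1 q2]; set h := pt q - pt p.
have hd : cn h < d.
  rewrite (le_lt_trans (cn_le_ReIm _))//= [d]splitr ltrD// distrC; [exact: q1|exact: q2].
have := H _ hd; rewrite /h [pt p + _]addrC subrK => H'.
rewrite (le_lt_trans _ H')// ler_norml.
have := cn_tri (F (pt q)) (F (pt p)); have := cn_tri (F (pt p)) (F (pt q)).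
rewrite (cn_distC (F (pt p)) (F (pt q))); lra.
Qed.

(** The term in [e] makes the maximum strict: [taylor2_local_max] finds larger values arbitrarily
    near, and these must lie outside [K]. In the applications this puts the maximum on a part of the
    boundary where F is controlled; [sqr_bound] then lets e tend to 0. *)
Lemma compact_max F (K : set (R * R)) (e : R) : compact K -> K !=set0 -> 0 < e ->
  (forall p, K p -> taylor2 F (pt p)) ->
  exists p, [/\ K p, forall q, K q ->
      cn (F (pt q)) ^+ 2 + e * q.2 ^+ 2 <= cn (F (pt p)) ^+ 2 + e * p.2 ^+ 2 &
    forall r, 0 < r -> exists2 q, ~ K q & cn (pt q - pt p) < r /\
      cn (F (pt p)) ^+ 2 + e * p.2 ^+ 2 < cn (F (pt q)) ^+ 2 + e * q.2 ^+ 2].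
Proof.
move=> cK K0 e0 T.
have cv : {within K, continuous (fun q : R * R => cn (F (pt q)) ^+ 2 + e * q.2 ^+ 2)}.
  apply: continuous_in_subspaceT => q; rewrite inE => Kq.
  have c1 := continuous_cn (T _ Kq).
  have c2 : {for q, continuous (fun q : R * R => q.2)} by exact: cvg_snd.
  by apply: cvgD; [exact: cvgM|apply: cvgM; [exact: cvg_cst|exact: cvgM]].
have [p pK pmax] := compact_EVT_max K0 cK cv.
exists p; split; [by rewrite inE in pK|by move=> q Kq; apply: pmax; rewrite inE|].
rewrite inE in pK; move=> r r0; have [w wr wlt] := taylor2_local_max (T _ pK) e0 r0.
exists (complex.Re w, complex.Im w).
  move=> Kw; have := pmax (complex.Re w, complex.Im w); rewrite inE => /(_ Kw).
  rewrite leNgt => /negP; apply; move: wlt; rewrite /pt/=.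
  by case: (w).
by case: (w) wr wlt.
Qed.

Lemma segment_boxcompact (a b c d : R) : compact (`[a, b] `*` `[c, d] : set (R * R)).
Proof. by apply: compact_setX; exact: segment_compact. Qed.

Lemma box_bound F (a b c d : R) : 0 < c ->
  hol F -> exists2 B, 0 <= B & forall p : R * R,
    a <= p.1 <= b -> c <= p.2 <= d -> cn (F (pt p)) <= B.
Proof.
move=> c0 hF; pose K := `[a, b] `*` `[c, d] : set (R * R).
have [[p0 Kp0]|K0] := pselect (K !=set0); last first.
  exists 0 => // p p1 p2; exfalso; apply: K0; exists p.
  by split; rewrite /= in_itv.
have [|p [Kp pmax _]] := @compact_max F K 1 (@segment_boxcompact a b c d)
  (ex_intro _ _ Kp0) ltr01.
  by move=> p [/= _]; rewrite in_itv/= => /andP[cp _]; apply: hF; exact: lt_le_trans cp.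
exists (cn (F (pt p)) + `|p.2|); first by rewrite addr_ge0 ?cn_ge0.
move=> q q1 q2; have := pmax q; rewrite !mul1r => /(_ _)/wrap[].
  by split; rewrite /= in_itv.
move=> H; rewrite -(@ler_pXn2r _ 2)// ?nnegrE ?addr_ge0 ?cn_ge0//.
rewrite sqrrD real_normK ?num_real//; have := sqr_ge0 q.2.
have : 0 <= cn (F (pt p)) * `|p.2| by rewrite mulr_ge0 ?cn_ge0.
rewrite mulr2n; lra.
Qed.

Lemma sqr_bound (a B K : R) : 0 <= B -> 0 <= a -> 0 <= K ->
  (forall e, 0 < e -> a ^+ 2 <= B ^+ 2 + e * K) -> a <= B.
Proof.
move=> B0 a0 K0 H; rewrite -(@ler_pXn2r _ 2)// ?nnegrE//.
apply/ler_addgt0Pr => e e0; have := H (e / (K + 1)).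
have K1 : 0 < K + 1 by rewrite ltr_wpDl.
rewrite divr_gt0// => /(_ isT) /le_trans; apply; rewrite lerD2l.
by rewrite mulrAC ler_pdivrMr// ler_wpM2l ?lerDl// ltW.
Qed.

Lemma periodic_shift F (P : R) (n : int) z : (forall z, 0 < complex.Im z -> cn (F (z + P%:C)) = cn (F z)) ->
  0 < complex.Im z -> cn (F (z + (n%:~R * P)%:C)) = cn (F z).
Proof.
move=> per z0; have nat_shift (m : nat) w : 0 < complex.Im w ->
    cn (F (w + (m%:R * P)%:C)) = cn (F w).
  move=> w0; elim: m => [|m IH]; first by rewrite mul0r addr0.
  by rewrite -addn1 natrD mulrDl mul1r rmorphD addrA per ?cImD/= ?addr0.
case: n => m; first exact: nat_shift.
rewrite NegzE mulrNz -(nat_shift m.+1) ?cImD/= ?addr0// -addrA -rmorphD mulNr addNr.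
by rewrite addr0.
Qed.

(** Periodicity lets a box stand for the strip, and its vertical sides are then no boundary, since a
    point just beyond them has a translate inside. Periodicity of the modulus is enough, which makes
    room for the factor used in [strip_decay]. *)
Lemma strip_bound F (P y1 Y B : R) : 0 < P -> 0 < y1 -> y1 <= Y -> hol F -> 0 <= B ->
  (forall z, 0 < complex.Im z -> cn (F (z + P%:C)) = cn (F z)) ->
  (forall z, complex.Im z = y1 \/ complex.Im z = Y -> cn (F z) <= B) ->
  forall z, y1 <= complex.Im z <= Y -> cn (F z) <= B.
Proof.
move=> P0 y0 yY hF B0 per bd z zY; apply: (@sqr_bound _ _ (Y ^+ 2)) => //.
- exact: cn_ge0.
- exact: sqr_ge0.
move=> e e0; pose K := `[0, P] `*` `[y1, Y] : set (R * R).
have [||p [[/= p1 p2] pmax pout]] :=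
  @compact_max F K e (@segment_boxcompact _ _ _ _) _ e0.
- by exists (0, y1); split; rewrite /= in_itv/= lexx ?yY ?(ltW P0).
- by move=> p [/= _]; rewrite in_itv/= => /andP[cp _]; apply: hF; exact: lt_le_trans cp.
have smax w : y1 <= complex.Im w <= Y ->
    cn (F w) ^+ 2 + e * complex.Im w ^+ 2 <= cn (F (pt p)) ^+ 2 + e * p.2 ^+ 2.
  move=> wY; pose n := Num.floor (complex.Re w / P).
  pose q := (complex.Re w - n%:~R * P, complex.Im w).
  have qw : cn (F w) = cn (F (pt q)).
    rewrite -(periodic_shift (- n) per); last by case/andP: wY => /(lt_le_trans y0).
    congr (cn (F _)).
    by rewrite /q /pt; case: (w) => a b; apply: cplxP; rewrite /= ?mulrNz; ring.
  rewrite qw; apply: (pmax q); split; rewrite /= in_itv/= ?wY//.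
  have /andP[n1 n2] := mem_rg1_floor (complex.Re w / P).
  rewrite subr_ge0 -ler_pdivlMr// n1/= lerBlDl -[X in _ + X]mul1r -mulrDl.
  by rewrite -ler_pdivrMr// ltW//; move: n2; rewrite intrD.
rewrite (le_trans _ (le_trans (smax _ zY) _))//.
  by rewrite lerDl mulr_ge0 ?sqr_ge0// ltW.
rewrite !in_itv/= in p1 p2; have /andP[p2a p2b] := p2.
suff pY : p.2 = y1 \/ p.2 = Y.
  rewrite lerD// ?ler_pM2l// lerXn2r// ?nnegrE ?cn_ge0//; last 2 first.
  - by rewrite (le_trans (ltW y0)).
  - by rewrite (le_trans (ltW y0)).
  exact: bd.
apply: contrapT => /not_orP[/eqP ny1 /eqP nY].
have {}p2a : y1 < p.2 by rewrite lt_neqAle eq_sym ny1.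
have {}p2b : p.2 < Y by rewrite lt_neqAle nY.
have [|q _ [qr]] := pout (Num.min (p.2 - y1) (Y - p.2)).
  by rewrite lt_min !subr_gt0 p2a.
rewrite ltNge => /negP; apply; apply: (smax (pt q)).
have := le_lt_trans (Im_le_cn _) qr; rewrite cImD cImN /= lt_min !ltr_norml.
by move=> /andP[/andP[? ?] /andP[? ?]]; apply/andP; split; lra.
Qed.

(** The maximum principle for F(z) e(-rho z), of modulus |F| exp(2 pi rho y); the decay bounds it on
    a high horizontal line. *)
Lemma strip_decay F (P y1 rho B : R) : 0 < P -> 0 < y1 -> hol F -> 0 <= B ->
  (forall z, 0 < complex.Im z -> cn (F (z + P%:C)) = cn (F z)) ->
  (forall e, 0 < e -> exists Y, forall z, Y <= complex.Im z ->
     cn (F z) * expR (2 * pi * rho * complex.Im z) <= e) ->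
  (forall z, complex.Im z = y1 -> cn (F z) * expR (2 * pi * rho * y1) <= B) ->
  forall z, y1 <= complex.Im z -> cn (F z) * expR (2 * pi * rho * complex.Im z) <= B.
Proof.
move=> P0 y0 hF B0 per dec bd z yz; apply/ler_addgt0Pr => e e0.
pose G w := F w * nome ((- rho)%:C * w).
have GE w : cn (G w) = cn (F w) * expR (2 * pi * rho * complex.Im w).
  rewrite /G cnM cn_nome; congr (_ * expR _).
  by rewrite cImM /= mul0r addr0; ring.
have [Y HY] := dec (B + e) (ltr_wpDl B0 e0).
rewrite -GE; apply: (@strip_bound G P y1 (Num.max Y (complex.Im z))) => //.
- by rewrite le_max yz orbT.
- move=> w w0; apply: taylor2M; first exact: hF.
  apply: taylor2_comp; first exact: taylor2_nome.
  by apply: taylor2M; [exact: taylor2_cst|exact: taylor2_id].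
- by rewrite addr_ge0// ltW.
- by move=> w w0; rewrite !GE per// cImD /= addr0.
- move=> w [wE|wE]; rewrite GE.
    by rewrite wE (le_trans (bd _ wE))// lerDl ltW.
  by apply: HY; rewrite wE le_max lexx.
- by rewrite yz le_max lexx orbT.
Qed.

Lemma archi_zero (a B t : R) : 0 < t -> 0 <= a ->
  (forall n : nat, a * (1 + n%:R * t) <= B) -> a = 0.
Proof.
move=> t0 a0 H; apply/eqP; rewrite eq_le a0 andbT leNgt; apply/negP => {}a0.
have [n nB] : exists n : nat, B / (a * t) < n%:R.
  exists (Num.bound `|B / (a * t)|).
  by rewrite (le_lt_trans (ler_norm _))// archi_boundP.
have := H n; rewrite leNgt => /negP; apply.
by move: nB; rewrite ltr_pdivrMr ?mulr_gt0//; nra.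
Qed.

Lemma hol_cst c : hol (fun=> c).
Proof. by move=> z _; exact: taylor2_cst. Qed.

(** Let M bound F on the disc of radius s. The function F(w) (s / (w - z0))^n vanishes near z0 and
    is at most M on the circle of radius s, hence at most M in between, for every n. As s / |z - z0|
    > 1, letting n grow forces F(z) = 0. *)
Lemma disc_zero F z0 (r s : R) : hol F -> 0 < r -> s < complex.Im z0 ->
  (forall z, cn (z - z0) < r -> F z = 0) -> forall z, cn (z - z0) < s -> F z = 0.
Proof.
move=> hF r0 s0 Fr z zs.
have [zr|rz] := ltP (cn (z - z0)) r; first exact: Fr.
have sP : 0 < s := le_lt_trans (cn_ge0 _) zs.
have y0 : 0 < complex.Im z0 := lt_trans sP s0.
pose D p := cn (pt p - z0).
pose B := `[complex.Re z0 - s, complex.Re z0 + s] `*` `[complex.Im z0 - s, complex.Im z0 + s]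
  : set (R * R).
have cD : continuous D.
  by move=> p; apply: (@continuous_cn (fun w => w - z0));
     apply: taylor2D; [exact: taylor2_id|exact: taylor2_cst].
(* An annulus: the inner radius r / 2 avoids the pole at [z0], while F vanishes up to radius r. *)
pose K := B `&` (D @^-1` `[r / 2, s]).
have cK : compact K.
  rewrite /K; apply: compact_closedI; first exact: segment_boxcompact.
  apply: closed_comp; first by move=> p _; exact: cD.
  exact: interval_closed.
have inK p : r / 2 <= D p <= s -> K p.
  move=> /[dup] Dp /andP[_ ps]; split; last by rewrite /= in_itv.
  have := le_trans (Re_le_cn _) ps; have := le_trans (Im_le_cn _) ps.
  rewrite cReD cImD cReN cImN !ler_norml /= => /andP[? ?] /andP[? ?].
  by split; rewrite /= in_itv/=; apply/andP; split; lra.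
have KH p : K p -> 0 < p.2.
  move=> [[_ /=]]; rewrite in_itv/= => /andP[p2 _] _; lra.
pose zp := (complex.Re z, complex.Im z).
have zpE : pt zp = z by rewrite /pt/=; case: (z).
have Kz : K zp by apply: inK; rewrite /D zpE (ltW zs) andbT (le_trans _ rz)//; lra.
have [M M0 HM] := @box_bound F (complex.Re z0 - s) (complex.Re z0 + s)
  (complex.Im z0 - s) (complex.Im z0 + s) (ltac:(lra)) hF.
have KM p : K p -> cn (F (pt p)) <= M.
  by move=> [[/= p1 p2] _]; apply: HM; rewrite in_itv/= in p1 p2.
have D0 : 0 < cn (z - z0) := lt_le_trans r0 rz.
have main n : cn (F z) * (s / cn (z - z0)) ^+ n <= M.
  pose G w := F w * (s%:C / (w - z0)) ^+ n.
  have GE w : cn (G w) = cn (F w) * (s / cn (w - z0)) ^+ n.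
    by rewrite /G cnM cnX cnM cnV cn_real gtr0_norm.
  rewrite -GE; apply: (@sqr_bound _ _ ((2 * complex.Im z0) ^+ 2)); rewrite ?cn_ge0 ?sqr_ge0//.
  move=> e e0; have [||p [Kp pmax pout]] := @compact_max G K e cK _ e0.
  - by exists zp.
  - move=> p Kp; apply: taylor2M; first exact/hF/KH.
    apply: taylor2X; apply: taylor2M; first exact: taylor2_cst.
    apply: taylor2V; last by apply: taylor2D; [exact: taylor2_id|exact: taylor2_cst].
    rewrite -cn_gt0; case: Kp => _ /=; rewrite in_itv/= => /andP[Dp _].
    by apply: lt_le_trans Dp; rewrite divr_gt0.
  have := pmax _ Kz; rewrite zpE => zmax.
  rewrite (le_trans (le_trans _ zmax))//; first by rewrite lerDl mulr_ge0 ?sqr_ge0// ltW.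
  have p20 := KH _ Kp; have [[_ /=]] := Kp; rewrite !in_itv/= => /andP[p2a p2b] /andP[Da Db].
  have [Dr|Dr] := ltP (D p) r.
    rewrite {1}/G Fr// mul0r cn0 expr0n add0r ler_wpDl ?sqr_ge0// ler_pM2l//.
    by rewrite lerXn2r// ?nnegrE ?mulr_ge0//; [exact: ltW|exact: ltW|lra].
  have [Ds|Ds] := ltP (D p) s; last first.
    rewrite lerD//; last first.
      rewrite ler_pM2l// lerXn2r// ?nnegrE ?mulr_ge0//; [exact: ltW|exact: ltW|lra].
    rewrite lerXn2r// ?nnegrE ?cn_ge0// GE.
    have -> : cn (pt p - z0) = s by apply/eqP; rewrite eq_le; apply/andP; split.
    by rewrite divff ?gt_eqF// expr1n mulr1 KM.
  have [|q Kq [qr _]] := pout (Num.min (r / 2) (s - D p)).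
    by rewrite lt_min subr_gt0 Ds divr_gt0.
  exfalso; apply/Kq/inK.
  move: qr; rewrite lt_min => /andP[q1 q2].
  have := cn_tri (pt q - z0) (pt p - z0); have := cn_tri (pt p - z0) (pt q - z0).
  have -> : pt p - z0 - (pt q - z0) = pt p - pt q by ring.
  have -> : pt q - z0 - (pt p - z0) = pt q - pt p by ring.
  move: Dr q1 q2; rewrite (cn_distC (pt p) (pt q)) /D => *; apply/andP; split; lra.
apply/eqP; rewrite -cn_eq0; apply/eqP.
apply: (@archi_zero _ M (s / cn (z - z0) - 1)).
- by rewrite subr_gt0 ltr_pdivlMr// mul1r.
- exact: cn_ge0.
move=> n; apply: le_trans (main n); rewrite ler_wpM2l ?cn_ge0//.
have t1 : 0 <= s / cn (z - z0) - 1 by rewrite subr_ge0 ler_pdivlMr// mul1r ltW.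
move: (s / cn (z - z0)) t1 => t t1; have t0 : 0 <= t by lra.
elim: n => [|n IH]; first by rewrite mul0r addr0 expr0.
rewrite exprSr -[n.+1]addn1 natrD.
have : 0 <= (n%:R : R) * (t - 1) ^+ 2 by rewrite mulr_ge0// sqr_ge0.
have := ler_wpM2r t0 IH; lra.
Qed.

Lemma hol_identity F z0 (r : R) : hol F -> 0 < complex.Im z0 -> 0 < r ->
  (forall z, cn (z - z0) < r -> F z = 0) -> forall z, 0 < complex.Im z -> F z = 0.
Proof.
move=> hF y0 r0 Fr.
(* Consecutive centres are Im (c n) / 2 apart, so the disc of radius Im (c n) / 4 about [c n.+1]
   lies in the one of radius 3/4 Im (c n) about [c n]. The discs of radius Im (c n) about [c n]
   exhaust the half plane. *)
pose c n : C := complex.Re z0 +i* (complex.Im z0 * (3 / 2) ^+ n).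
have cy n : 0 < complex.Im (c n) by rewrite /= mulr_gt0 ?exprn_gt0.
have grow n : exists2 e, 0 < e & forall z, cn (z - c n) < e -> F z = 0.
  elim: n => [|n [e e0 He]].
    by exists r => // z; rewrite /c expr0 mulr1; move: Fr; case: (z0) => a b Fr /Fr.
  exists (complex.Im (c n) / 4); first by rewrite divr_gt0.
  move=> z zn; apply: (@disc_zero F (c n) e (3 / 4 * complex.Im (c n)) hF e0 _ He).
    by have := cy n; lra.
  have := cn_tri (z - c n) (z - c n.+1).
  have -> : z - c n - (z - c n.+1) = 'i%C * (complex.Im (c n) / 2)%:C.
    apply: cplxP; rewrite ?(cReM, cImM, cReD, cImD, cReN, cImN)/= ?exprSr; lra.
  rewrite cnM cn_i cn_real gtr0_norm; last by rewrite divr_gt0.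
  move: zn; lra.
move=> z zy; have [n Hn] : exists n, cn (z - c n) < complex.Im (c n).
  pose A := (complex.Re z - complex.Re z0) ^+ 2 + complex.Im z ^+ 2.
  pose n := Num.bound (A / (complex.Im z * complex.Im z0)); exists n.
  rewrite -(@ltr_pXn2r _ 2)// ?nnegrE ?cn_ge0//; last exact: ltW.
  have A0 : 0 <= A / (complex.Im z * complex.Im z0).
    by rewrite divr_ge0 ?addr_ge0 ?sqr_ge0// mulr_ge0// ltW.
  have := archi_boundP A0; rewrite -/n ltr_pdivrMr ?mulr_gt0// => An.
  have gr : 1 + n%:R / 2 <= (3 / 2 : R) ^+ n.
    elim: (n) => [|m IH]; first by rewrite mul0r addr0.
    rewrite exprSr -[m.+1]addn1 natrD; have : 0 <= (m%:R : R) by []. nra.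
  have : complex.Im z * complex.Im z0 * (1 + n%:R / 2) <=
         complex.Im z * complex.Im z0 * (3 / 2) ^+ n by rewrite ler_pM2l// mulr_gt0.
  move: An; rewrite cn_sqrE !(cReD, cImD, cReN, cImN)/= /A.
  have := mulr_gt0 zy y0; set p := (3 / 2) ^+ n; nra.
have [e e0 He] := grow n.
have d0 : 0 < complex.Im (c n) - cn (z - c n) by rewrite subr_gt0.
apply: (@disc_zero F (c n) e (complex.Im (c n) - (complex.Im (c n) - cn (z - c n)) / 2) hF e0 _ He);
  lra.
Qed.

Lemma holM F G : hol F -> hol G -> hol (fun z => F z * G z).
Proof. by move=> hF hG z z0; apply: taylor2M; [exact: hF|exact: hG]. Qed.
Lemma holD F G : hol F -> hol G -> hol (fun z => F z + G z).
Proof. by move=> hF hG z z0; apply: taylor2D; [exact: hF|exact: hG]. Qed.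
Lemma holN F : hol F -> hol (fun z => - F z).
Proof. by move=> hF z z0; apply: taylor2N; exact: hF. Qed.
Lemma holX F n : hol F -> hol (fun z => F z ^+ n).
Proof. by move=> hF z z0; apply: taylor2X; exact: hF. Qed.
Lemma hol_sum (I : Type) (r : seq I) (P : pred I) (f : I -> C -> C) :
  (forall i, hol (f i)) -> hol (fun w => \sum_(i <- r | P i) f i w).
Proof. by move=> H z z0; apply: taylor2_sum => i; exact: H. Qed.
Lemma hol_prod (I : Type) (r : seq I) (P : pred I) (f : I -> C -> C) :
  (forall i, hol (f i)) -> hol (fun w => \prod_(i <- r | P i) f i w).
Proof. by move=> H z z0; apply: taylor2_prod => i; exact: H. Qed.

Definition null F := forall z, 0 < complex.Im z -> F z = 0.

(** Near a point where F is nonzero it stays so by continuity; G vanishes there, and the identity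
    theorem applies to G. *)
Lemma hol_domain F G : hol F -> hol G -> null (fun z => F z * G z) -> null F \/ null G.
Proof.
move=> hF hG FG; have [|/existsNP[z /not_implyP[z0 /eqP Fz]]] := pselect (null F).
  by left.
right; have Fz0 : 0 < cn (F z) by rewrite cn_gt0.
have [d d0 Hd] := taylor2_cont (hF _ z0) Fz0.
apply: (@hol_identity G z (Num.min d (complex.Im z)) hG z0).
  by rewrite lt_min d0.
move=> w; rewrite lt_min => /andP[wd wy].
have wz : z + (w - z) = w by rewrite addrC subrK.
have := Hd _ wd; rewrite wz => Fw.
have Fw0 : F w != 0.
  apply/eqP => Fw0; move: Fw; rewrite Fw0 sub0r cnN ltxx//.
have w0 : 0 < complex.Im w.
  have := le_lt_trans (Im_le_cn _) wy; rewrite cImD cImN ltr_norml => /andP[]; lra.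
by have /eqP := FG _ w0; rewrite mulf_eq0 (negbTE Fw0) => /eqP.
Qed.

Lemma hol_domain_prod (I : Type) (r : seq I) (f : I -> C -> C) :
  (forall i, hol (f i)) -> null (fun w => \prod_(i <- r) f i w) -> exists i, null (f i).
Proof.
move=> H; elim: r => [|i r IH] N.
  have /eqP := N 'i%C ltr01.
  by rewrite big_nil oner_eq0.
have [||Ni|Nr] := @hol_domain (f i) (fun w => \prod_(i <- r) f i w) (H i).
- exact: hol_prod.
- by move=> z z0; have := N z z0; rewrite big_cons.
- by exists i.
- exact: IH.
Qed.

End MaximumPrinciple.

(** * A Sturm bound *)

Section Sturm.
Variable R : realType.
Local Notation C := R[i].

Lemma Im_invN (z : C) : complex.Im (- z^-1) = complex.Im z / cn z ^+ 2.
Proof. by rewrite cn_sqrE; case: z => a b /=; rewrite opprK. Qed.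

Lemma bounded_prod (I : Type) (r : seq I) (g : I -> C -> C) :
  (forall i, exists K Y : R, forall z, Y <= complex.Im z -> cn (g i z) <= K) ->
  exists K Y : R, forall z, Y <= complex.Im z -> cn (\prod_(i <- r) g i z) <= K.
Proof.
move=> H; elim: r => [|i r [K [Y HY]]].
  by exists 1, 0 => z _; rewrite big_nil cn1.
have [K' [Y' HY']] := H i; exists (K' * K), (Num.max Y Y') => z.
rewrite ge_max => /andP[/HY ? /HY' ?]; rewrite big_cons cnM.
by rewrite ler_pM ?cn_ge0.
Qed.

(** The product G of the family has |G|^2 y^W invariant under S and T, for W = w |I|, and this
    function tends to 0 at the cusp. Were G nonzero, it would have a maximum at some z0 = x0 + i y0
    with y0 > 4/5, and [strip_decay] above the line y = 4/5 would give exp(4 pi r (y0 - 4/5)) <= (y0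
    / (4/5))^W, which the last hypothesis excludes. *)
Lemma sturm (I : finType) (i0 : I) (g : I -> C -> C) (sigma tau : I -> I) (w r : nat) :
  injective sigma -> injective tau -> (forall i, hol (g i)) ->
  (forall i z, 0 < complex.Im z -> cn (g i (z + 1)) = cn (g (tau i) z)) ->
  (forall i z, 0 < complex.Im z -> cn (g i (- z^-1)) = cn z ^+ w * cn (g (sigma i) z)) ->
  (forall i, exists K Y : R, forall z, Y <= complex.Im z -> cn (g i z) <= K) ->
  (exists K Y : R, forall z, Y <= complex.Im z ->
     cn (g i0 z) * expR (2 * pi * r.+1%:R * complex.Im z) <= K) ->
  (5 * (w * #|I|) < 32 * r)%N -> exists i, null (g i).
Proof.
move=> injs injt hg gT gS gB g0 wr.
pose G z := \prod_(i <- index_enum I) g i z; pose W := (w * #|I|)%N.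
have hG : hol G by apply: hol_prod => i; exact: hg.
apply: (@hol_domain_prod R I (index_enum I)) => //; rewrite -/G.
apply: contrapT => nG.
have GT z : 0 < complex.Im z -> cn (G (z + 1)) = cn (G z).
  move=> z0; rewrite /G !cn_prod [RHS](reindex_inj injt); apply: eq_bigr => i _.
  exact: gT.
have GS z : 0 < complex.Im z -> cn (G (- z^-1)) = cn z ^+ W * cn (G z).
  move=> z0; rewrite /G !cn_prod [in RHS](reindex_inj injs) /=.
  rewrite (eq_bigr (fun i => cn z ^+ w * cn (g (sigma i) z))); last first.
    by move=> i _; exact: gS.
  by rewrite big_split/= prodr_const -exprM.
have [K0 [Y0 HG]] : exists K Y : R, forall z, Y <= complex.Im z ->
     cn (G z) * expR (2 * pi * r.+1%:R * complex.Im z) <= K.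
  have [K [Y HK]] := g0.
  have [K' [Y' HK']] := bounded_prod [seq i <- index_enum I | i != i0] gB.
  exists (K * K'), (Num.max Y Y') => z; rewrite ge_max => /andP[/HK k1 /HK' k2].
  rewrite /G (bigD1 i0)//= cnM mulrAC ler_pM ?cn_ge0 ?mulr_ge0 ?cn_ge0 ?expR_ge0//.
  by rewrite -big_filter.
have pi2 := pi_ge2 R; have pi0 := pi_gt0 R.
pose Phi z := cn (G z) ^+ 2 * complex.Im z ^+ W.
have PhiT z : 0 < complex.Im z -> Phi (z + 1) = Phi z.
  by move=> z0; rewrite /Phi GT// cImD/= addr0.
have PhiS z : 0 < complex.Im z -> Phi (- z^-1) = Phi z.
  move=> z0; rewrite /Phi GS// Im_invN expr_div_n -exprM exprMn -exprM.
  have : cn z ^+ (W * 2) != 0.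
    by rewrite expf_neq0// cn_eq0; apply: contraTneq z0 => ->; rewrite ltxx.
  rewrite [(2 * W)%N]mulnC; move: (cn z ^+ _) => u u0.
  by rewrite mulrACA mulrC mulrA mulfVK// mulrC.
have [zs zs1 zs2] : exists2 z, 4 / 5 < complex.Im z & G z != 0.
  apply: contrapT => nz; apply: nG; apply: (@hol_identity _ G (0 +i* 2) 1) => // z z1.
  apply: contrapT => /eqP Gz; apply: nz; exists z => //.
  have := le_lt_trans (Im_le_cn _) z1; rewrite cImD cImN/= ltr_norml => /andP[]; lra.
have Ps0 : 0 < Phi zs by rewrite /Phi mulr_gt0 ?exprn_gt0 ?cn_gt0//; lra.
have [Y1 HY1] : exists Y, forall z, Y <= complex.Im z -> Phi z <= Phi zs.
  (* The exponential decay of G beats y^W; the factorial comes from y^n / n! <= exp y. *)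
  pose A := `|K0| ^+ 2 * (W.+1)`!%:R.
  have A0 : 0 <= A by rewrite mulr_ge0// sqr_ge0.
  exists (Num.max Y0 (Num.max 1 (A / Phi zs))) => z; rewrite !ge_max => /andP[zY /andP[z1 zA]].
  have y0 : 0 <= complex.Im z by lra.
  have := HG _ zY; set E := expR _ => GE.
  have E1 : expR (complex.Im z) <= E.
    rewrite ler_expR; have : 1 <= (r.+1%:R : R) by rewrite ler1n. 
    move=> r1; have : 1 * 1 <= 2 * pi * r.+1%:R :> R by rewrite ler_pM//; lra.
    nra.
  have P1 : cn (G z) * E <= `|K0| by rewrite (le_trans GE)// ler_norm.
  have E0 : 0 < E by exact: expR_gt0.
  have P2 : complex.Im z ^+ W <= (W.+1)`!%:R * expR (complex.Im z).
    have := expR_ge1Dxn W y0 => H.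
    have : complex.Im z ^+ W.+1 / (W.+1)`!%:R <= expR (complex.Im z) by lra.
    rewrite ler_pdivrMr ?ltr0n ?fact_gt0// mulrC; apply: le_trans.
    by rewrite exprS ler_peMl// exprn_ge0.
  have P3 : (cn (G z) * E) ^+ 2 <= `|K0| ^+ 2.
    by rewrite lerXn2r// nnegrE ?mulr_ge0 ?cn_ge0 ?expR_ge0.
  have P4 : Phi z * E ^+ 2 <= A * expR (complex.Im z).
    rewrite /Phi mulrAC -exprMn /A -mulrA ler_pM ?sqr_ge0 ?exprn_ge0//.
  have P5 : Phi z * E <= A.
    rewrite -(ler_pM2r (expR_gt0 (complex.Im z))) (le_trans _ P4)//.
    have Phi0 : 0 <= Phi z by rewrite mulr_ge0 ?sqr_ge0 ?exprn_ge0.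
    rewrite -[X in X <= _]mulrA; apply: ler_wpM2l => //.
    by rewrite [leRHS]expr2 ler_pM2l.
  have P6 : A <= Phi zs * E.
    move: zA; rewrite ler_pdivrMr// mulrC => /le_trans; apply; rewrite ler_pM2l//.
    apply: le_trans E1; have := expR_ge1Dx (complex.Im z); lra.
  by rewrite -(ler_pM2r E0) (le_trans P5).
pose Yt := Num.max Y1 (complex.Im zs).
pose K := `[0, 1] `*` `[4 / 5, Yt] : set (R * R).
have HK p : K p -> 0 < p.2 by case=> _ /=; rewrite in_itv/= => /andP[? _]; lra.
have cPhi : {within K, continuous (fun q : R * R => Phi (q.1 +i* q.2))}.
  apply: continuous_in_subspaceT => q; rewrite inE => /HK q0.
  have c1 : {for q, continuous (fun q : R * R => cn (G (q.1 +i* q.2)))}.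
    exact: (@continuous_cn R G q (hG (q.1 +i* q.2) q0)).
  have c2 : {for q, continuous (fun q : R * R => q.2)} by exact: cvg_snd.
  have c3 : {for q, continuous (fun q : R * R => q.2 ^+ W)}.
    by apply: (@continuous_comp _ _ _ snd (fun x : R => x ^+ W)) => //; exact: exprn_continuous.
  by apply: cvgM => //; exact: cvgM.
have shift z : 0 < complex.Im z -> exists2 x, 0 <= x <= 1 & Phi z = Phi (x +i* complex.Im z).
  move=> z0; have PT (n : nat) u : 0 < complex.Im u -> Phi (u + n%:R) = Phi u.
    move=> u0; elim: n => [|n IH]; first by rewrite addr0.
    rewrite -addn1 natrD addrA PhiT// cImD -(rmorph_nat (real_complex R)) /= addr0//.
  pose n := Num.floor (complex.Re z); exists (complex.Re z - n%:~R).
    have /andP[n1 n2] := floor_itv (complex.Re z).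
    by move: n1 n2; rewrite intrD -/n => ? ?; apply/andP; split; lra.
  case: n => n /=.
    rewrite -[RHS](PT n); last by [].
    by congr Phi; rewrite -(rmorph_nat (real_complex R)); case: (z) => a b;
       apply: cplxP; rewrite /= ?subrK ?addr0.
  rewrite -(PT n.+1 z)//; congr Phi; rewrite -(rmorph_nat (real_complex R)).
  by case: (z) => a b; apply: cplxP; rewrite /= ?NegzE ?mulrNz ?opprK ?addr0.
have K0' : K !=set0.
  exists (0, Yt); split; rewrite /= in_itv/= ?lexx ?ler01 ?andbT//.
  by rewrite le_max (ltW zs1) orbT.
have [p0 p0K pmax] := compact_EVT_max K0' (@segment_boxcompact R 0 1 (4 / 5) Yt) cPhi.
rewrite inE in p0K; have p00 := HK _ p0K.
have gmax z : 4 / 5 <= complex.Im z -> Phi z <= Phi (p0.1 +i* p0.2).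
  have inbox u : 4 / 5 <= complex.Im u <= Yt -> Phi u <= Phi (p0.1 +i* p0.2).
    move=> /andP[u1 u2]; have [|x x1 ->] := shift u; first by lra.
    apply: (pmax (x, complex.Im u)); rewrite inE; split; rewrite /= in_itv//=.
    by rewrite u1.
  move=> z1; have [zY|zY] := leP (complex.Im z) Yt; first by apply: inbox; rewrite z1.
  rewrite (le_trans (HY1 _ _))//; first by move: zY; rewrite gt_max => /andP[/ltW].
  by apply: inbox; rewrite (ltW zs1) le_max lexx orbT.
(* A maximum on the line y = 4/5 is brought to |x| <= 1/2 by T and then moved strictly upwards by S,
   since 1/4 + (4/5)^2 < 1. *)
have [z0 y0 zmax] : exists2 z0, 4 / 5 < complex.Im z0 &
    forall z, 4 / 5 <= complex.Im z -> Phi z <= Phi z0.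
  have [|p0n] := ltP (4 / 5) p0.2; first by exists (p0.1 +i* p0.2).
  have p0E : p0.2 = 4 / 5.
    by case: p0K => _ /=; rewrite in_itv/= => /andP[? _]; lra.
  have [x x1 xE] : exists2 x, x ^+ 2 <= 1 / 4 & Phi (x +i* p0.2) = Phi (p0.1 +i* p0.2).
    case: p0K => /=; rewrite in_itv/= => /andP[x0 x1] _.
    have [x2|x2] := leP p0.1 (1 / 2); first by exists p0.1 => //; nra.
    exists (p0.1 - 1); first by nra.
    rewrite -PhiT//; congr Phi; apply: cplxP; rewrite /= ?subrK ?addr0//.
  exists (- (x +i* p0.2)^-1); last by move=> z /gmax; rewrite PhiS// xE.
  rewrite Im_invN cn_sqrE /= p0E ltr_pdivlMr; last by have := sqr_ge0 x; lra.
  by have := sqr_ge0 x; nra.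
have Gz0 : 0 < cn (G z0).
  have P0 := lt_le_trans Ps0 (zmax _ (ltW zs1)).
  rewrite lt_neqAle cn_ge0 andbT eq_sym; apply: contraTneq P0.
  by rewrite /Phi => ->; rewrite expr0n mul0r ltxx.
pose y1 : R := 4 / 5.
have y1P : 0 < y1 ^+ W by rewrite exprn_gt0// divr_gt0.
pose B := Num.sqrt (Phi z0 / y1 ^+ W) * expR (2 * pi * r%:R * y1).
have sq0 : 0 <= Phi z0 / y1 ^+ W.
  by rewrite divr_ge0 ?(ltW y1P)// mulr_ge0 ?sqr_ge0 ?exprn_ge0//; lra.
(* One of the [r.+1] powers of q is spent on the decay to 0 at the top of the strip. *)
have := @strip_decay R G 1 y1 r%:R B ltr01 ltac:(rewrite divr_gt0//) hG.
rewrite mulr_ge0 ?sqrtr_ge0 ?expR_ge0// => /(_ isT GT)/(_ _)/wrap[|].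
  move=> e e0; exists (Num.max Y0 (Num.max 1 (K0 / e))) => z; rewrite !ge_max.
  move=> /andP[/HG HGz /andP[z1 ze]].
  move: HGz; rewrite (_ : 2 * pi * r.+1%:R * complex.Im z =
    2 * pi * r%:R * complex.Im z + 2 * pi * complex.Im z); last first.
    by rewrite -[r.+1]addn1 natrD; ring.
  rewrite expRD mulrA => HGz.
  rewrite -(ler_pM2r (expR_gt0 (2 * pi * complex.Im z))) (le_trans HGz)//.
  move: ze; rewrite ler_pdivrMr// => ze.
  have yE : complex.Im z <= expR (2 * pi * complex.Im z).
    apply: le_trans (expR_ge1Dx _); nra.
  by rewrite (le_trans ze)// mulrC ler_pM2l.
move=> /(_ _)/wrap[|].
  move=> z zy; rewrite ler_pM2r ?expR_gt0// -(@ler_pXn2r _ 2)// ?nnegrE ?cn_ge0 ?sqrtr_ge0//.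
  rewrite sqr_sqrtr// ler_pdivlMr// -zy; apply: zmax; rewrite zy//.
move=> /(_ z0 (ltW y0)); rewrite /B -(@ler_pXn2r _ 2)// ?nnegrE; last 2 first.
- by rewrite mulr_ge0 ?cn_ge0 ?expR_ge0.
- by rewrite mulr_ge0 ?sqrtr_ge0 ?expR_ge0.
rewrite [leLHS]exprMn [leRHS]exprMn sqr_sqrtr// /Phi -[X in _ <= X * _]mulrA -[leRHS]mulrA.
rewrite ler_pM2l ?exprn_gt0// -expr_div_n -!expRM_natl.
pose s := complex.Im z0 / y1 - 1.
have s0 : 0 < s by rewrite subr_gt0 ltr_pdivlMr ?mul1r// divr_gt0.
have -> : complex.Im z0 = y1 * (1 + s) by rewrite /s addrC subrK mulrC divfK// gt_eqF// divr_gt0.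
have -> : y1 * (1 + s) / y1 = 1 + s by rewrite mulrAC divff ?mul1r// gt_eqF// divr_gt0.
rewrite -ler_pdivrMr ?expR_gt0// -expRN -expRD.
(* (1 + s)^W <= exp(W s) is compared with exp(4 pi r y1 s); with y1 = 4/5 and pi >= 2 it suffices
   that 5 W < 32 r. *)
apply/negP; rewrite -ltNge.
apply: (@le_lt_trans _ _ (expR (W%:R * s))).
  by rewrite expRM_natl lerXn2r// ?nnegrE ?expR_ge0 ?expR_ge1Dx//; lra.
rewrite ltr_expR /y1.
have rW : 5 * W%:R < 32 * r%:R :> R by rewrite -!natrM ltr_nat.
have : 16 * (2 * r%:R) <= 16 * (pi * r%:R) :> R by rewrite ler_pM2l// ler_wpM2r.
rewrite -!natrM mulr_natl; nra.
Qed.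

End Sturm.

(** * Unconditional sums *)

Section UnconditionalSum.
Variable R : realType.
Local Notation C := R[i].

(** A limit over finite subsets ordered by inclusion: it depends on no enumeration, so sums over
    lattices, pairs and divisors can be reindexed freely. *)
Definition hasSum (I : eqType) (f : I -> C) (S : C) := forall e : R, 0 < e ->
  exists s0 : seq I, forall s, uniq s -> {subset s0 <= s} ->
    cn (\sum_(i <- s) f i - S) < e.

Definition absum (I : eqType) (f : I -> C) := exists B : R, forall s : seq I,
  uniq s -> \sum_(i <- s) cn (f i) <= B.

Lemma hasSum_ext (I : eqType) (f g : I -> C) S : f =1 g -> hasSum f S -> hasSum g S.
Proof.
move=> fg H e /H[s0 Hs]; exists s0 => s us ss; have := Hs _ us ss.
by under eq_bigr do rewrite fg.
Qed.

Lemma absum_ext (I : eqType) (f g : I -> C) : (forall i, cn (f i) = cn (g i)) ->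
  absum f -> absum g.
Proof.
by move=> fg [B HB]; exists B => s us; under eq_bigr do rewrite -fg; exact: HB.
Qed.

Lemma uniq_extend (I : eqType) (s t : seq I) :
  exists u, [/\ uniq u, {subset s <= u} & {subset t <= u}].
Proof.
exists (undup (s ++ t)); split; first exact: undup_uniq.
  by move=> x xs; rewrite mem_undup mem_cat xs.
by move=> x xs; rewrite mem_undup mem_cat xs orbT.
Qed.

Lemma hasSum_unique (I : eqType) (f : I -> C) S T : hasSum f S -> hasSum f T -> S = T.
Proof.
move=> HS HT; apply/eqP; rewrite -subr_eq0 -cn_eq0 eq_le cn_ge0 andbT leNgt.
apply/negP => d0; have d2 : 0 < cn (S - T) / 2 by rewrite divr_gt0.
have [s Hs] := HS _ d2; have [t Ht] := HT _ d2.
have [u [uu su tu]] := uniq_extend s t.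
have := Hs _ uu su; have := Ht _ uu tu; set X := \sum_(i <- u) _.
have := cn_tri (S - T) (X - T); rewrite (_ : S - T - (X - T) = S - X); last by ring.
rewrite (cn_distC S X); lra.
Qed.

Lemma hasSumD (I : eqType) (f g : I -> C) S T : hasSum f S -> hasSum g T ->
  hasSum (fun i => f i + g i) (S + T).
Proof.
move=> HS HT e e0; have d2 : 0 < e / 2 by rewrite divr_gt0.
have [s Hs] := HS _ d2; have [t Ht] := HT _ d2.
have [u [_ su tu]] := uniq_extend s t.
exists u => v uv sv; have := Hs v uv (fun x xs => sv _ (su _ xs)).
have := Ht v uv (fun x xs => sv _ (tu _ xs)); rewrite big_split/=.
set X := \sum_(i <- v) _; set Y := \sum_(i <- v) _ => h1 h2.
have -> : Y + X - (S + T) = (Y - S) + (X - T) by ring.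
have := cnD (Y - S) (X - T); lra.
Qed.

Lemma hasSumcM (I : eqType) (f : I -> C) S c : hasSum f S ->
  hasSum (fun i => c * f i) (c * S).
Proof.
move=> HS e e0; have c1 : 0 < cn c + 1 by rewrite ltr_wpDl ?cn_ge0.
have [|s Hs] := HS (e / (cn c + 1)); first by rewrite divr_gt0.
exists s => v uv sv; rewrite -mulr_sumr -mulrBr cnM.
have := Hs _ uv sv; rewrite ltr_pdivlMr//; have := cn_ge0 (\sum_(i <- v) f i - S).
have := cn_ge0 c; nra.
Qed.

Lemma hasSum0 (I : eqType) : hasSum (fun _ : I => 0) 0.
Proof. by move=> e e0; exists [::] => s _ _; rewrite big1// subr0 cn0. Qed.

Lemma hasSum_sum (I J : eqType) (r : seq J) (P : pred J) (f : J -> I -> C) (S : J -> C) :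
  (forall j, hasSum (f j) (S j)) ->
  hasSum (fun i => \sum_(j <- r | P j) f j i) (\sum_(j <- r | P j) S j).
Proof.
move=> H; elim: r => [|j r IH].
  by rewrite big_nil; apply: hasSum_ext (hasSum0 I) => i; rewrite big_nil.
rewrite big_cons; case: ifP => Pj; last first.
  by apply: hasSum_ext IH => i; rewrite big_cons Pj.
by apply: hasSum_ext (hasSumD (H j) IH) => i; rewrite big_cons Pj.
Qed.

Section Injection.
Variables (I J : eqType) (h : I -> J).
Hypothesis hinj : injective h.

Let inv j : option I :=
  if pselect (exists i, h i = j) is left p then Some (projT1 (cid p)) else None.
Let invh i : inv (h i) = Some i.
Proof.
rewrite /inv; case: pselect => [p|[]]; last by exists i.
by case: cid => /= k /hinj ->.
Qed.
Let inv_some j i : inv j = Some i -> h i = j.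
Proof. by rewrite /inv; case: pselect => // p [] <-; case: cid. Qed.
Let inv_none j : inv j = None -> forall i, h i <> j.
Proof. by rewrite /inv; case: pselect => // n _ i hi; apply: n; exists i. Qed.

Lemma pmap_inj_sum (V : zmodType) (f : J -> V) : (forall j, (forall i, h i <> j) -> f j = 0) ->
  forall s, uniq s -> exists t, [/\ uniq t, (forall i, (i \in t) = (h i \in s)) &
   \sum_(j <- s) f j = \sum_(i <- t) f (h i)].
Proof.
move=> f0 s us; exists (pmap inv s); split.
- elim: s us => //= j s IH /andP[js us].
  case E : (inv j) => [i|] /=; last exact: IH.
  rewrite IH// andbT mem_pmap; apply/negP => /mapP[j' j's].
  by move=> /esym/inv_some hj'; move: js; rewrite -(inv_some E) hj' j's.
- move=> i; rewrite mem_pmap; apply/mapP/idP => [[j js /esym/inv_some ->]//|his].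
  by exists (h i).
rewrite big_pmap; apply: eq_bigr => j _; case E : (inv j) => [i|] /=.
  by rewrite (inv_some E).
by apply: f0; exact: inv_none.
Qed.

Lemma hasSum_inj (f : J -> C) S : (forall j, (forall i, h i <> j) -> f j = 0) ->
  hasSum (f \o h) S -> hasSum f S.
Proof.
move=> f0 H e /H[s0 Hs]; exists (map h s0) => s us ss.
have [t [ut tE ->]] := pmap_inj_sum f0 us.
apply: Hs => // i is0; rewrite tE; apply: ss; exact: map_f.
Qed.

Lemma absum_inj (f : J -> C) : (forall j, (forall i, h i <> j) -> f j = 0) ->
  absum (f \o h) -> absum f.
Proof.
move=> f0 [B HB]; exists B => s us.
have [|t [ut tE ->]] := @pmap_inj_sum _ (fun j => cn (f j)) _ s us; last exact: HB.
by move=> j /f0 ->; rewrite cn0.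
Qed.

Lemma absum_sub (f : J -> C) : absum f -> absum (f \o h).
Proof.
move=> [B HB]; exists B => s us /=; rewrite -(big_map h predT (fun j => cn (f j))).
by apply: HB; rewrite map_inj_uniq.
Qed.

End Injection.

Lemma hasSum_bij (I J : eqType) (h : I -> J) (f : J -> C) S : bijective h ->
  hasSum (f \o h) S -> hasSum f S.
Proof.
move=> [g hK gK]; apply: hasSum_inj; first exact: can_inj hK.
by move=> j /(_ (g j)); rewrite gK.
Qed.

Lemma ler_sum_subset (I : eqType) (f : I -> R) (s t : seq I) : (forall i, 0 <= f i) ->
  uniq s -> uniq t -> {subset s <= t} -> \sum_(i <- s) f i <= \sum_(i <- t) f i.
Proof.
move=> f0 us ut st; rewrite [leRHS](bigID (mem s))/= -[leLHS]addr0 lerD ?sumr_ge0//.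
rewrite le_eqVlt; apply/orP/or_introl/eqP; rewrite -[in RHS]big_filter.
apply: perm_big; apply: uniq_perm => //; first exact: filter_uniq.
by move=> x; rewrite mem_filter; have [/st ->|] := boolP (x \in s).
Qed.

Lemma nonneg_hasSum (I : eqType) (f : I -> R) (B : R) : (forall i, 0 <= f i) ->
  (forall s, uniq s -> \sum_(i <- s) f i <= B) -> exists S, hasSum (fun i => (f i)%:C) S.
Proof.
move=> f0 HB; pose A := [set \sum_(i <- s) f i | s in [set s : seq I | uniq s]].
have supA : has_sup A.
  split; first by exists 0, [::]; rewrite ?big_nil.
  by exists B => _ [s us <-]; exact: HB.
exists (sup A)%:C => e e0; have [_ [s0 us0 <-] lt] := sup_adherent e0 supA.
exists s0 => s us ss; rewrite -rmorph_sum -rmorphB cn_real ler0_norm.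
  have := @ler_sum_subset I f s0 s f0 us0 us ss; lra.
rewrite subr_le0; apply: sup_upper_bound => //; by exists s.
Qed.

(** f = (Re f + |f|) + i (Im f + |f|) - (1 + i) |f| is a combination of nonnegative families. *)
Lemma absum_hasSum (I : eqType) (f : I -> C) : absum f -> exists S, hasSum f S.
Proof.
move=> [B HB].
have [||S0 HS0] := @nonneg_hasSum I (fun i => cn (f i)) B; [by move=> i; exact: cn_ge0|exact: HB|].
have sum2 (u : I -> R) : (forall i, u i <= cn (f i)) -> forall s, uniq s ->
    \sum_(i <- s) (u i + cn (f i)) <= B + B.
  move=> H s us; rewrite big_split lerD ?HB//.
  by apply: le_trans (HB _ us); apply: ler_sum => i _.
have [||S1 HS1] := @nonneg_hasSum I (fun i => complex.Re (f i) + cn (f i)) (B + B).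
- by move=> i; have := Re_le_cn (f i); rewrite ler_norml => /andP[]; lra.
- by apply: sum2 => i; rewrite (le_trans (ler_norm _))// Re_le_cn.
have [||S2 HS2] := @nonneg_hasSum I (fun i => complex.Im (f i) + cn (f i)) (B + B).
- by move=> i; have := Im_le_cn (f i); rewrite ler_norml => /andP[]; lra.
- by apply: sum2 => i; rewrite (le_trans (ler_norm _))// Im_le_cn.
have HS := hasSumD HS1 (hasSumD (hasSumcM 'i%C HS2) (hasSumcM (- 1 - 'i%C) HS0)).
eexists; apply: hasSum_ext HS => i; apply: cplxP; rewrite /=; ring.
Qed.

Lemma absum_le (I : eqType) (f g : I -> C) : (forall i, cn (f i) <= cn (g i)) ->
  absum g -> absum f.
Proof.
move=> fg [B HB]; exists B => s us; apply: le_trans (HB _ us); exact: ler_sum.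
Qed.

Lemma absumcM (I : eqType) (f : I -> C) c : absum f -> absum (fun i => c * f i).
Proof.
move=> [B HB]; exists (cn c * B) => s us; under eq_bigr do rewrite cnM.
by rewrite -mulr_sumr ler_wpM2l ?cn_ge0 ?HB.
Qed.

Lemma absumD (I : eqType) (f g : I -> C) : absum f -> absum g -> absum (fun i => f i + g i).
Proof.
move=> [B HB] [B' HB']; exists (B + B') => s us.
apply: (@le_trans _ _ (\sum_(i <- s) (cn (f i) + cn (g i)))).
  by apply: ler_sum => i _; exact: cnD.
by rewrite big_split lerD ?HB ?HB'.
Qed.

Lemma absum_prod (I J : eqType) (a : I -> C) (b : J -> C) : absum a -> absum b ->
  absum (fun p : I * J => a p.1 * b p.2).
Proof.
move=> [A HA] [B HB]; exists (A * B) => s us.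
pose s1 := undup (map fst s); pose s2 := undup (map snd s).
apply: (@le_trans _ _ (\sum_(p <- [seq (i, j) | i <- s1, j <- s2]) cn (a p.1 * b p.2))).
  apply: ler_sum_subset => //.
  - by move=> p; exact: cn_ge0.
  - by apply: allpairs_uniq; rewrite ?undup_uniq// => -[? ?] [? ?] _ _ [-> ->].
  - move=> [i j] ij; apply/allpairsP; exists (i, j); split=> //; rewrite mem_undup.
      by apply/mapP; exists (i, j).
    by apply/mapP; exists (i, j).
rewrite big_allpairs /=.
under eq_bigr do (under eq_bigr do rewrite cnM; rewrite -mulr_sumr).
rewrite -mulr_suml ler_pM ?HA ?HB ?undup_uniq//; apply: sumr_ge0 => i _; exact: cn_ge0.
Qed.

(** For a finite set of rows, one finite set of columns approximates all the row sums at once; the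
    rectangle is then compared with S. *)
Lemma hasSum_fubini (I J : eqType) (f : I * J -> C) (g : I -> C) S : hasSum f S ->
  (forall i, hasSum (fun j => f (i, j)) (g i)) -> hasSum g S.
Proof.
move=> H row e e0; have e2 : 0 < e / 2 by rewrite divr_gt0.
have [s0 Hs] := H _ e2; exists (map fst s0) => K uK sK.
pose d := e / 2 / (size K).+1%:R; have d0 : 0 < d by rewrite divr_gt0.
have [L0 HL0] : exists L0 : seq J, forall i, i \in K -> forall L, uniq L ->
    {subset L0 <= L} -> cn (\sum_(j <- L) f (i, j) - g i) < d.
  elim: (K) => [|i K' [L0 IH]]; first by exists [::].
  have [L1 H1] := row i _ d0; exists (L0 ++ L1) => i'; rewrite inE.
  move=> /orP[/eqP ->|iK] L uL sL.
    by apply: H1 => // x xL; apply: sL; rewrite mem_cat xL orbT.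
  by apply: IH => // x xL; apply: sL; rewrite mem_cat xL.
have [L [uL sL1 sL2]] := uniq_extend L0 (map snd s0).
have uKL : uniq [seq (i, j) | i <- K, j <- L].
  by apply: allpairs_uniq => // -[? ?] [? ?] _ _ [-> ->].
have := Hs _ uKL; rewrite big_allpairs => /(_ _)/wrap[|h].
  move=> [i j] ij; apply/allpairsP; exists (i, j); split=> //=.
    by apply: sK; apply/mapP; exists (i, j).
  by apply: sL2; apply/mapP; exists (i, j).
have h2 : cn (\sum_(i <- K) g i - \sum_(i <- K) \sum_(j <- L) f (i, j)) <= e / 2.
  rewrite -sumrB; apply: (le_trans (cn_sum _ _ _)).
  apply: (@le_trans _ _ (\sum_(i <- K) d)).
    rewrite big_seq [leRHS]big_seq; apply: ler_sum => i iK.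
    by rewrite cn_distC ltW// HL0.
  rewrite big_const_seq count_predT iter_addr_0 -[leLHS]mulr_natr.
  apply: (@le_trans _ _ (d * (size K).+1%:R)); first by rewrite ler_pM2l// ler_nat leqnSn.
  by rewrite /d divfK.
have := cnD (\sum_(i <- K) g i - \sum_(i <- K) \sum_(j <- L) f (i, j))
   (\sum_(i <- K) \sum_(j <- L) f (i, j) - S).
rewrite subrKA; lra.
Qed.

Lemma hasSum_prod (I J : eqType) (a : I -> C) (b : J -> C) A B : absum a -> absum b ->
  hasSum a A -> hasSum b B -> hasSum (fun p : I * J => a p.1 * b p.2) (A * B).
Proof.
move=> aa ab HA HB; have [S HS] := absum_hasSum (absum_prod aa ab).
suff -> : A * B = S by [].
have := hasSum_fubini HS (fun i => hasSumcM (a i) HB) => HS'.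
have HS2 : hasSum (fun i => B * a i) S by apply: hasSum_ext HS' => i; rewrite mulrC.
by rewrite mulrC; apply: hasSum_unique (hasSumcM B HA) HS2.
Qed.

Lemma hasSum_finite (I : eqType) (f : I -> C) (s : seq I) : uniq s ->
  (forall i, i \notin s -> f i = 0) -> hasSum f (\sum_(i <- s) f i).
Proof.
move=> us f0 e e0; exists s => t ut st.
suff -> : \sum_(i <- t) f i = \sum_(i <- s) f i by rewrite subrr cn0.
rewrite (bigID (mem s))/= [X in _ + X]big1 ?addr0; last by move=> i /f0.
rewrite -[LHS]big_filter; apply: perm_big; apply: uniq_perm => //; first exact: filter_uniq.
by move=> x; rewrite mem_filter; have [/st ->|] := boolP (x \in s).
Qed.

(** Fubini on the graph of [e]. *)
Lemma hasSum_fibers (I N : eqType) (f : I -> C) (e : I -> N) (fib : N -> seq I) S :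
  (forall n, uniq (fib n)) -> (forall n i, (i \in fib n) = (e i == n)) ->
  hasSum f S -> hasSum (fun n => \sum_(i <- fib n) f i) S.
Proof.
move=> ufib mfib H; pose f' (p : N * I) := if e p.2 == p.1 then f p.2 else 0.
have H' : hasSum f' S.
  apply: (@hasSum_inj _ _ (fun i => (e i, i))); first by move=> i j [].
    move=> [n i] H'; rewrite /f' /=; case: eqP => // en; case: (H' i).
    by rewrite en.
  by apply: hasSum_ext H => i; rewrite /f' /= eqxx.
apply: hasSum_fubini H' _ => n.
have -> : \sum_(i <- fib n) f i = \sum_(i <- fib n) f' (n, i).
  by apply: eq_big_seq => i; rewrite mfib /f' /= => ->.
apply: (@hasSum_finite _ (fun i => f' (n, i))) => // i.
by rewrite mfib /f' /= => /negbTE ->.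
Qed.

Lemma hasSum_tail (I : eqType) (b : I -> C) : absum b -> forall e, 0 < e ->
  exists s0 : seq I, uniq s0 /\ forall s, uniq s -> (forall i, i \in s -> i \notin s0) ->
    \sum_(i <- s) cn (b i) < e.
Proof.
move=> [B HB] e e0; have e2 : 0 < e / 2 by rewrite divr_gt0.
have [S HS] := @nonneg_hasSum I (fun i => cn (b i)) B (fun i => cn_ge0 _) HB.
have [s0 Hs] := HS _ e2; exists (undup s0); split; first exact: undup_uniq.
move=> s us sd; have sub0 : {subset s0 <= undup s0} by move=> x; rewrite mem_undup.
have h1 := Hs _ (undup_uniq _) sub0.
have ucat : uniq (undup s0 ++ s).
  rewrite cat_uniq undup_uniq us andbT /=; apply/hasPn => x /sd //.
have := Hs _ ucat; rewrite big_cat/=.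
move=> /(_ _)/wrap[|h2]; first by move=> x xs; rewrite mem_cat mem_undup xs.
have E : \sum_(i <- s) cn (b i) = cn (\sum_(i <- s) (cn (b i))%:C : C).
  by rewrite -rmorph_sum cn_real ger0_norm// sumr_ge0// => i _; exact: cn_ge0.
rewrite E; move: h1 h2; set X := \sum_(i <- undup s0) _; set Y := \sum_(i <- s) _.
move=> h1 h2; have := cnD (X + Y - S) (- (X - S)).
rewrite cnN (_ : X + Y - S + - (X - S) = Y); [lra|ring].
Qed.

Lemma hasSum_close (I : eqType) (f b : I -> C) S (s0 : seq I) (e : R) : uniq s0 ->
  (forall i, cn (f i) <= cn (b i)) ->
  (forall s, uniq s -> (forall i, i \in s -> i \notin s0) -> \sum_(i <- s) cn (b i) < e) ->
  hasSum f S -> cn (S - \sum_(i <- s0) f i) <= e.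
Proof.
move=> us0 fb tail H; apply/ler_addgt0Pr => d /H[s1 Hs].
pose s := s0 ++ [seq i <- undup s1 | i \notin s0].
have us : uniq s.
  rewrite cat_uniq us0 filter_uniq ?undup_uniq// andbT /=; apply/hasPn => x.
  by rewrite mem_filter => /andP[].
have := Hs _ us; rewrite big_cat/= => /(_ _)/wrap[|h].
  by move=> x xs; rewrite mem_cat mem_filter mem_undup xs andbT; case: (x \in s0).
have ht : \sum_(i <- [seq i <- undup s1 | i \notin s0]) cn (f i) < e.
  apply: (@le_lt_trans _ _ (\sum_(i <- [seq i <- undup s1 | i \notin s0]) cn (b i))).
    exact: ler_sum.
  apply: tail; first by rewrite filter_uniq ?undup_uniq.
  by move=> i; rewrite mem_filter => /andP[].
have := cn_sum [seq i <- undup s1 | i \notin s0] predT f.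
move: h ht; set X := \sum_(i <- s0) _; set Y := \sum_(i <- [seq _ <- _ | _]) f _.
have := cnD (S - (X + Y)) Y; rewrite (_ : S - (X + Y) + Y = S - X); last by ring.
rewrite (cn_distC S (X + Y)); lra.
Qed.

(* Tannery's theorem *)
Lemma hasSum_dominated (I : eqType) (f : nat -> I -> C) (g b : I -> C) (S : nat -> C) T :
  absum b -> (exists L0, forall L i, (L0 <= L)%N -> cn (f L i) <= cn (b i)) ->
  (forall i, cn (g i) <= cn (b i)) ->
  (forall i e, 0 < e -> exists L0, forall L, (L0 <= L)%N -> cn (f L i - g i) < e) ->
  (forall L, hasSum (f L) (S L)) -> hasSum g T ->
  forall e, 0 < e -> exists L0, forall L, (L0 <= L)%N -> cn (S L - T) < e.
Proof.
move=> ab [M fb] gb lim HS HT e e0; have e4 : 0 < e / 4 by rewrite divr_gt0.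
have [s0 [us0 tail]] := hasSum_tail ab e4.
have cT := hasSum_close us0 gb tail HT.
have [L0 HL0] : exists L0, forall L, (L0 <= L)%N ->
    cn (\sum_(i <- s0) f L i - \sum_(i <- s0) g i) < e / 4.
  suff [L0 H] : exists L0, forall L, (L0 <= L)%N ->
      \sum_(i <- s0) cn (f L i - g i) < e / 4.
    by exists L0 => L /H; apply: le_lt_trans; rewrite -sumrB cn_sum.
  elim: (s0) (e / 4) e4 => [|i s IH] d d0.
    by exists 0%N => L _; rewrite big_nil.
  have d2 : 0 < d / 2 by rewrite divr_gt0.
  have [L1 H1] := IH _ d2; have [L2 H2] := lim i _ d2.
  exists (maxn L1 L2) => L; rewrite geq_max => /andP[/H1 h1 /H2 h2].
  by rewrite big_cons; lra.
exists (maxn L0 M) => L; rewrite geq_max => /andP[/HL0 h /fb fbL].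
have cS := hasSum_close us0 fbL tail (HS L).
move: h cS cT; set X := \sum_(i <- s0) _; set Y := \sum_(i <- s0) _ => h cS cT.
have := cnD (S L - X) (X - Y); have := cnD (S L - Y) (Y - T).
rewrite !subrKA (cn_distC Y T); lra.
Qed.

Lemma absum_nat (f : nat -> C) (B : R) : (forall n, \sum_(i < n) cn (f i) <= B) -> absum f.
Proof.
move=> H; exists B => s us; pose n := (\max_(i <- s) i).+1.
rewrite (le_trans _ (H n))// -(big_mkord predT (fun i => cn (f i))) /index_iota subn0.
apply: ler_sum_subset => //; [by move=> i; exact: cn_ge0|exact: iota_uniq|].
by move=> x xs; rewrite mem_iota /= add0n ltnS; apply: leq_bigmax_seq.
Qed.

Lemma absum_geometric (r : R) : 0 <= r < 1 -> absum (fun n => r%:C ^+ n : C).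
Proof.
move=> /andP[r0 r1]; apply: (@absum_nat _ (1 - r)^-1) => n.
under eq_bigr do rewrite cnX cn_real ger0_norm//.
rewrite -[leRHS]mul1r ler_pdivlMr ?subr_gt0//.
have := subrX1 r n; have : 0 <= r ^+ n by rewrite exprn_ge0.
move=> h1 h2; have : (1 - r) * \sum_(i < n) r ^+ i = 1 - r ^+ n.
  by rewrite -[1 - r]opprB mulNr -h2 opprB.
move: (\sum_(i < n) _) => X; lra.
Qed.

Lemma absum_int (f : int -> C) : absum (fun n : nat => f n%:Z) ->
  absum (fun n : nat => f (- n.+1%:Z)) -> absum f.
Proof.
move=> h1 h2; pose f1 (n : int) := if n is Posz _ then f n else 0.
pose f2 (n : int) := if n is Posz _ then 0 else f n.
apply: (absum_ext (f := fun n => f1 n + f2 n)); first by case=> n /=; rewrite ?addr0 ?add0r.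
apply: absumD.
  apply: (@absum_inj _ _ Posz) => //; first by move=> ? ? [].
  by case=> // n /(_ n).
apply: (@absum_inj _ _ Negz); first by move=> ? ? [].
  by case=> // n /(_ n).
by apply: absum_ext h2 => n /=; rewrite NegzE.
Qed.

Lemma absum_inv_sqr_nat : absum (fun n : nat => (1 + n%:R ^+ 2 : C)^-1).
Proof.
apply: (@absum_nat _ 3) => n /=.
(* Telescoping, as 1 / (1 + m^2) <= 2 / m - 2 / (m + 1) for m >= 1. *)
suff : \sum_(i < n.+1) cn (1 + i%:R ^+ 2 : C)^-1 <= 3 - 2 * (n.+1%:R)^-1 :> R.
  rewrite big_ord_recr; set X := \sum_(i < n) _; set Y := cn _.
  have Y0 : 0 <= Y by exact: cn_ge0.
  have : 0 < (n.+1%:R : R)^-1 by rewrite invr_gt0.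
  move: (n.+1%:R^-1) => u u0 /= H; lra.
have cE m : cn (1 + m%:R ^+ 2 : C)^-1 = (1 + m%:R ^+ 2 : R)^-1.
  rewrite cnV (_ : 1 + m%:R ^+ 2 = (1 + m%:R ^+ 2)%:C); last first.
    by rewrite rmorphD rmorph1 rmorphXn rmorph_nat.
  by rewrite cn_real ger0_norm// addr_ge0// sqr_ge0.
elim: n => [|n IH]; first by rewrite big_ord1 cE expr0n addr0 invr1; lra.
rewrite big_ord_recr/= cE.
have n0 : 0 < (n.+1%:R : R) by []. 
have E : n.+2%:R = n.+1%:R + 1 :> R by rewrite -[n.+2]addn1 natrD.
move: (n.+1%:R : R) n0 E IH => m m0 ->.
have : (1 + m ^+ 2)^-1 <= 2 * m^-1 - 2 * (m + 1)^-1.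
  have m1 : 0 < m + 1 by lra.
  have -> : 2 * m^-1 - 2 * (m + 1)^-1 = 2 / (m * (m + 1)).
    by field; rewrite !gt_eqF.
  have m2 : 0 < 1 + m ^+ 2 by rewrite ltr_wpDr ?sqr_ge0.
  rewrite ler_pdivlMr ?mulr_gt0// mulrC ler_pdivrMr//; nra.
lra.
Qed.

End UnconditionalSum.

(** * Expansions in powers of q *)

Section PowerSeries.
Variable R : realType.
Local Notation C := R[i].

(** Radius of convergence at least 1, in the form that convergence at single points provides. *)
Definition radius1 (b : nat -> C) := forall r : R, 0 < r < 1 ->
  exists2 K, 0 <= K & forall n, cn (b n) * r ^+ n <= K.

Lemma exprn_unbounded (r : R) n : 0 < r < 1 -> n%:R * (1 - r) * r ^+ n <= 1.
Proof.
move=> /andP[r0 r1]; elim: n => [|n IH]; first by rewrite !mul0r.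
have rn : r ^+ n.+1 <= 1 by rewrite exprn_ile1 // ltW.
have : n%:R * (1 - r) * r ^+ n * r <= r by rewrite ler_piMl // ltW.
have : (1 - r) * r ^+ n.+1 <= (1 - r) by rewrite ler_piMr// subr_ge0 ltW.
rewrite -[n.+1]addn1 natrD addn1 exprSr; nra.
Qed.

Lemma radius1_absum3 (b : nat -> C) (r : R) : radius1 b -> 0 < r < 1 ->
  absum (fun n => b n * (n%:R ^+ 3 * r ^+ n)%:C).
Proof.
(* r = x^8 is spent as x^4 on the coefficients, x on each of the three factors n, and x on a
   geometric series. *)
move=> rb /andP[r0 r1]; pose x := Num.sqrt (Num.sqrt (Num.sqrt r)).
have xE : x ^+ 8 = r.
  by rewrite (_ : 8 = 2 * 2 * 2)%N// !exprM /x !sqr_sqrtr ?sqrtr_ge0// ltW.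
have x0 : 0 < x by rewrite !sqrtr_gt0.
have x1 : x < 1.
  by rewrite ltNge; apply/negP => x1; have := exprn_ege1 8 x1; rewrite xE leNgt r1.
have [K K0 HK] : exists2 K, 0 <= K & forall n, cn (b n) * (x ^+ 4) ^+ n <= K.
  by apply: rb; rewrite exprn_gt0//= exprn_ilt1 // ltW.
pose M := K * ((1 - x)^-1) ^+ 3.
apply: (absum_le (g := fun n => M%:C * x%:C ^+ n)); last first.
  by apply: absumcM; apply: absum_geometric; rewrite ltW.
have x1' : 0 < 1 - x by rewrite subr_gt0.
have ix : 0 <= (1 - x)^-1 by rewrite invr_ge0 ltW.
have M0 : 0 <= M by rewrite mulr_ge0// exprn_ge0.
move=> n; rewrite !cnM cnX !cn_real !ger0_norm ?mulr_ge0 ?exprn_ge0 ?(ltW x0) ?(ltW r0)//.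
have nx : n%:R * x ^+ n <= (1 - x)^-1.
  rewrite -[leRHS]mul1r ler_pdivlMr// mulrAC; apply: exprn_unbounded; exact/andP.
have -> : r ^+ n = (x ^+ 4) ^+ n * (x ^+ n) ^+ 3 * x ^+ n.
  by rewrite -xE -!exprM -!exprD; congr (_ ^+ _); lia.
rewrite (_ : _ * _ = (cn (b n) * (x ^+ 4) ^+ n) * (n%:R * x ^+ n) ^+ 3 * x ^+ n); last by ring.
rewrite ler_wpM2r ?exprn_ge0 ?(ltW x0)// ler_pM ?exprn_ge0 ?mulr_ge0 ?cn_ge0 ?exprn_ge0 ?(ltW x0)//.
by rewrite lerXn2r// nnegrE mulr_ge0// exprn_ge0// ltW.
Qed.

Lemma radius1_absum (b : nat -> C) (q : C) : radius1 b -> cn q < 1 ->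
  absum (fun n => b n * q ^+ n).
Proof.
move=> rb q1; pose r := (cn q + 1) / 2.
have rr : 0 < r < 1 by have := cn_ge0 q; rewrite /r => ?; apply/andP; split; lra.
have qr : cn q <= r by rewrite /r; lra.
have [B HB] := radius1_absum3 rb rr; have [K K0 HK] := rb _ rr.
exists (B + cn (b 0%N)) => s us; apply: (@le_trans _ _
   (\sum_(n <- s) (cn (b n * (n%:R ^+ 3 * r ^+ n)%:C) + (if n == 0%N then cn (b 0%N) else 0)))).
  apply: ler_sum => n _; rewrite !cnM cnX cn_real ger0_norm; last first.
    by rewrite mulr_ge0 ?exprn_ge0//; case/andP: rr => /ltW.
  case: n => [|n]; first by rewrite eqxx !expr0 expr0n mul0r mulr0 mulr1 add0r.
  rewrite addr0 ler_wpM2l ?cn_ge0// -[leLHS]mul1r ler_pM ?exprn_ge0 ?cn_ge0//.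
    by rewrite exprn_ege1// ler1n.
  by rewrite lerXn2r// nnegrE ?cn_ge0//; case/andP: rr => /ltW.
rewrite big_split lerD ?HB//= -big_mkcond /=.
case: (boolP (0%N \in s)) => s0.
  by rewrite -big_filter filter_pred1_uniq// big_seq1.
by rewrite big_seq_cond big1 ?cn_ge0// => n /andP[ns /eqP n0]; rewrite -n0 ns in s0.
Qed.

(* coefficients of the second order Taylor polynomial of q^n, and the remainder *)
Fixpoint pow_taylor (q : C) n : C * C * C :=
  if n is n'.+1 then let: (a, b, c) := pow_taylor q n' in (q * a, q * b + a, q * c + b)
  else (1, 0, 0).

(** Crude bounds of the shape n^i r^(n - i), which pass through the recursion; the powers of r are
    put on the left to avoid negative exponents. *)
Lemma pow_taylorP (q h : C) (r : R) n : 0 < r -> cn q + cn h <= r ->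
  let: (a, b, c) := pow_taylor q n in
  [/\ cn a <= r ^+ n, cn b * r <= n%:R * r ^+ n, cn c * r ^+ 2 <= n%:R ^+ 2 * r ^+ n &
   cn ((q + h) ^+ n - (a + b * h + c * h ^+ 2)) * r ^+ 3 <= n%:R ^+ 3 * r ^+ n * cn h ^+ 3].
Proof.
move=> r0 qh; have q0 := cn_ge0 q; have h0 := cn_ge0 h; have qr : cn q <= r by lra.
elim: n => [|n] /=.
  rewrite !mul0r !addr0 expr0 subrr cn0 cn1 !expr0n /= !mul0r; split=> //.
case: pow_taylor => -[a b] c [Ha Hb Hc He].
have rn : 0 <= r ^+ n by rewrite exprn_ge0// ltW.
have n0 : 0 <= (n%:R : R) by [].
have nr : 0 <= n%:R * r ^+ n by exact: mulr_ge0.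
have nrr : 0 <= n%:R ^+ 2 * r ^+ n by apply: mulr_ge0 => //; exact: sqr_ge0.
have b0 := cn_ge0 b; have c0 := cn_ge0 c; have a0 := cn_ge0 a.
rewrite -[n.+1]addn1 natrD addn1 exprSr; split.
- by rewrite cnM mulrC ler_pM.
- have := cnD (q * b) a; rewrite cnM => H.
  have : cn q * (cn b * r) <= r * (n%:R * r ^+ n) by rewrite ler_pM// mulr_ge0// ltW.
  have : cn a * r <= r ^+ n * r by rewrite ler_wpM2r// ltW.
  have := ler_wpM2r (ltW r0) H; nra.
- have := cnD (q * c) b; rewrite cnM => H.
  have : cn q * (cn c * r ^+ 2) <= r * (n%:R ^+ 2 * r ^+ n).
    by rewrite ler_pM// mulr_ge0 ?sqr_ge0.
  have : cn b * r * r <= n%:R * r ^+ n * r by rewrite ler_wpM2r// ltW.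
  have := ler_wpM2r (sqr_ge0 r) H.
  have : 0 <= n%:R * r ^+ n * r by rewrite mulr_ge0// ltW.
  have : 0 <= r ^+ n * r by rewrite mulr_ge0// ltW.
  rewrite !expr2; nra.
set e := (q + h) ^+ n - _ in He; rewrite exprSr.
have -> : (q + h) ^+ n * (q + h) - (q * a + (q * b + a) * h + (q * c + b) * h ^+ 2) =
   (q + h) * e + c * h ^+ 3 by rewrite /e; ring.
have := cnD ((q + h) * e) (c * h ^+ 3); rewrite !cnM => H.
have qhr : cn (q + h) <= r by rewrite (le_trans (cnD _ _)).
have r3 : 0 <= r ^+ 3 by rewrite exprn_ge0// ltW.
have h3 : 0 <= cn h ^+ 3 by rewrite exprn_ge0.
have h1 : cn (q + h) * (cn e * r ^+ 3) <= r * (n%:R ^+ 3 * r ^+ n * cn h ^+ 3).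
  by rewrite ler_pM ?cn_ge0// mulr_ge0 ?cn_ge0.
have h2 : cn c * r ^+ 2 * (r * cn h ^+ 3) <= n%:R ^+ 2 * r ^+ n * (r * cn h ^+ 3).
  by rewrite ler_wpM2r// mulr_ge0// ltW.
apply: (le_trans (ler_wpM2r r3 H)).
have -> : (cn (q + h) * cn e + cn c * (cn h * (cn h * cn h))) * r ^+ 3 =
   cn (q + h) * (cn e * r ^+ 3) + cn c * r ^+ 2 * (r * cn h ^+ 3) by ring.
apply: (le_trans (lerD h1 h2)).
rewrite -subr_ge0 (_ : _ - _ = (2 * n%:R ^+ 2 + 3 * n%:R + 1) * (r ^+ n * r * cn h ^+ 3)).
  by rewrite !mulr_ge0 ?addr_ge0 ?mulr_ge0 ?sqr_ge0//; exact: ltW.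
ring.
Qed.

Lemma hasSum_bound (I : eqType) (f : I -> C) S (B : R) :
  (forall s, uniq s -> \sum_(i <- s) cn (f i) <= B) -> hasSum f S -> cn S <= B.
Proof.
move=> HB H; apply/ler_addgt0Pr => e /H[s0 /(_ (undup s0) (undup_uniq _))].
move=> /(_ _)/wrap[|h]; first by move=> x; rewrite mem_undup.
have := cn_tri S (\sum_(i <- undup s0) f i); rewrite (cn_distC S).
have := HB _ (undup_uniq s0); have := cn_sum (undup s0) predT f; lra.
Qed.

(** Termwise: by [pow_taylorP] the remainders are dominated by a multiple of |b_n| n^3 r^n, summable
    by [radius1_absum3]. *)
Lemma taylor2_series (b : nat -> C) (P : C -> C) (q : C) : radius1 b ->
  (forall q, cn q < 1 -> hasSum (fun n => b n * q ^+ n) (P q)) -> cn q < 1 -> taylor2 P q.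
Proof.
move=> rb HP q1.
have [r [d [rr d0 qd]]] : exists r d, [/\ 0 < r < 1, 0 < d & cn q + d = r].
  exists ((cn q + 1) / 2), ((1 - cn q) / 2).
  by have := cn_ge0 q; split; [apply/andP; split; lra|lra|lra].
have [r0 r1] := andP rr; have [B HB] := radius1_absum3 rb rr.
pose t n := pow_taylor q n.
have at3 : absum (fun n => b n * (n%:R ^+ 3 * r ^+ n)%:C) := radius1_absum3 rb rr.
have at0 : absum (fun n => b n * r%:C ^+ n).
  by apply: radius1_absum => //; rewrite cn_real ger0_norm// ltW.
have tP n := @pow_taylorP q 0 r n r0.
have q0r : cn q + cn (0 : C) <= r by rewrite cn0 addr0; lra.
have n3 (n : nat) i : (i <= 3)%N -> (0 < i)%N -> n%:R ^+ i <= n%:R ^+ 3 :> R.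
  case: n => [|n] i3 i0; first by rewrite !expr0n; case: (i) i0.
  by rewrite ler_weXn2l// ler1n.
have [[Sb HSb] [Sc HSc]] : (exists S, hasSum (fun n => b n * (t n).1.2) S) /\
    (exists S, hasSum (fun n => b n * (t n).2) S).
  split; apply: absum_hasSum.
    apply: (absum_le _ (absumcM (r^-1)%:C at3)) => n; have := tP n q0r.
    rewrite /t; case: pow_taylor => -[a' b'] c' [_ h _ _] /=.
    rewrite !cnM !cn_real !ger0_norm ?invr_ge0 ?mulr_ge0 ?exprn_ge0 ?(ltW r0)//.
    rewrite mulrCA ler_wpM2l ?cn_ge0// mulrC ler_pdivlMr// (le_trans h)//.
    by rewrite ler_wpM2r ?exprn_ge0 ?(ltW r0)// -[leLHS]expr1 n3.
  apply: (absum_le _ (absumcM (r ^- 2)%:C at3)) => n; have := tP n q0r.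
  rewrite /t; case: pow_taylor => -[a' b'] c' [_ _ h _] /=.
  rewrite !cnM !cn_real !ger0_norm ?invr_ge0 ?mulr_ge0 ?exprn_ge0 ?(ltW r0)//.
  rewrite mulrCA ler_wpM2l ?cn_ge0// mulrC ler_pdivlMr ?exprn_gt0// (le_trans h)//.
  by rewrite ler_wpM2r ?exprn_ge0 ?(ltW r0)// n3.
exists (P q), Sb, Sc; exists (B / r ^+ 3), d; split=> //.
  rewrite divr_ge0 ?exprn_ge0 ?(ltW r0)//.
  by have := HB [::] isT; rewrite big_nil.
move=> h hd; have qh : cn q + cn h <= r by rewrite -qd lerD2l ltW.
have qh1 : cn (q + h) < 1 by rewrite (le_lt_trans (cnD _ _))// (le_lt_trans qh).
have HS := hasSumD (HP _ qh1) (hasSumcM (-1) (hasSumD (HP _ q1)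
   (hasSumD (hasSumcM h HSb) (hasSumcM (h ^+ 2) HSc)))).
have -> : P (q + h) - (P q + Sb * h + Sc * h ^+ 2) =
  P (q + h) + -1 * (P q + (h * Sb + h ^+ 2 * Sc)) by ring.
apply: (hasSum_bound _ HS) => s us.
apply: (@le_trans _ _ (\sum_(n <- s) cn (b n * (n%:R ^+ 3 * r ^+ n)%:C) * (cn h ^+ 3 / r ^+ 3))).
  apply: ler_sum => n _; have := @pow_taylorP q h r n r0 qh.
  have aE : (t n).1.1 = q ^+ n.
    by rewrite /t; elim: n => //= n; case: pow_taylor => -[a' b'] c' /= ->; rewrite exprS.
  move: aE; rewrite /t; case: pow_taylor => -[a' b'] c' /= -> [_ _ _ he].
  have -> : b n * (q + h) ^+ n + -1 * (b n * q ^+ n + (h * (b n * b') + h ^+ 2 * (b n * c')))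
    = b n * ((q + h) ^+ n - (q ^+ n + b' * h + c' * h ^+ 2)) by ring.
  rewrite !cnM cn_real ger0_norm ?mulr_ge0 ?exprn_ge0 ?(ltW r0)//.
  rewrite -mulrA ler_wpM2l ?cn_ge0// mulrA ler_pdivlMr ?exprn_gt0//.
rewrite -mulr_suml mulrA [leRHS]mulrAC ler_wpM2r ?invr_ge0 ?exprn_ge0 ?(ltW r0)//.
by rewrite ler_wpM2r ?exprn_ge0 ?cn_ge0 ?HB.
Qed.

(** The parameter q^(1/M) of a cusp of width M. *)
Definition qpar (M : nat) (z : C) : C := nome (z / M%:R).

Definition qseries (M : nat) (b : nat -> C) (F : C -> C) := forall z,
  0 < complex.Im z -> hasSum (fun n => b n * qpar M z ^+ n) (F z).

Definition asymp (M : nat) (b : nat -> C) (F : C -> C) := forall n,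
  exists K Y : R, forall z, Y <= complex.Im z ->
    cn (F z - \sum_(j < n) b j * qpar M z ^+ j) <= K * cn (qpar M z) ^+ n.

Lemma cn_qpar M z : cn (qpar M z) = expR (- (2 * pi * (complex.Im z / M%:R))).
Proof.
rewrite /qpar cn_nome (_ : z / M%:R = z * (M%:R^-1)%:C); last first.
  by rewrite fmorphV rmorph_nat.
by rewrite cImM/= mulr0 add0r.
Qed.

Lemma cn_qpar_lt1 M z : (0 < M)%N -> 0 < complex.Im z -> cn (qpar M z) < 1.
Proof.
move=> M0 z0; rewrite cn_qpar expR_lt1 oppr_lt0.
by apply: mulr_gt0; [apply: mulr_gt0 => //; exact: pi_gt0|rewrite divr_gt0// ltr0n].
Qed.

Lemma qpar_surj M (r : R) : (0 < M)%N -> 0 < r < 1 ->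
  exists2 z : C, 0 < complex.Im z & cn (qpar M z) = r.
Proof.
move=> M0 /andP[r0 r1]; exists (0 +i* (- ln r * M%:R / (2 * pi))) => /=.
  by rewrite divr_gt0 ?mulr_gt0 ?pi_gt0 ?ltr0n// oppr_gt0 ln_lt0// r0.
rewrite cn_qpar /= (_ : - _ = ln r) ?lnK ?posrE//.
have : M%:R != 0 :> R by rewrite pnatr_eq0 -lt0n.
have : pi != 0 :> R by rewrite gt_eqF ?pi_gt0.
by move: (@pi R) => P p0 m0; field; rewrite m0 p0.
Qed.

Lemma hasSum_terms_bounded (f : nat -> C) S : hasSum f S ->
  exists2 K, 0 <= K & forall n, cn (f n) <= K.
Proof.
move=> /(_ 1 ltr01)[s0 Hs].
exists (2 + \sum_(i <- undup s0) cn (f i)).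
  by rewrite addr_ge0// sumr_ge0// => i _; exact: cn_ge0.
move=> n; have [ns|ns] := boolP (n \in undup s0).
  rewrite (bigD1_seq n)//= ?undup_uniq//; have : 0 <= \sum_(i <- undup s0 | i != n) cn (f i).
    by apply: sumr_ge0 => i _; exact: cn_ge0.
  lra.
have sub0 : {subset s0 <= undup s0} by move=> x; rewrite mem_undup.
have h1 := Hs _ (undup_uniq _) sub0.
have un : uniq (n :: undup s0) by rewrite /= ns undup_uniq.
have := Hs _ un; rewrite big_cons => /(_ _)/wrap[|h2].
  by move=> x xs; rewrite inE mem_undup xs orbT.
have := cnD (f n + \sum_(i <- undup s0) f i - S) (- (\sum_(i <- undup s0) f i - S)).
rewrite cnN (_ : _ + _ - S + - (_ - S) = f n); last by ring.
have : 0 <= \sum_(i <- undup s0) cn (f i) by apply: sumr_ge0 => i _; exact: cn_ge0.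
lra.
Qed.

Lemma qseries_radius M b F : (0 < M)%N -> qseries M b F -> radius1 b.
Proof.
move=> M0 H r rr; have [z z0 zr] := qpar_surj M0 rr.
have [K K0 HK] := hasSum_terms_bounded (H z z0); exists K => // n.
by have := HK n; rewrite cnM cnX zr.
Qed.

Lemma qseries_hol M b F : (0 < M)%N -> qseries M b F -> hol F.
Proof.
move=> M0 H; have rb := qseries_radius M0 H.
have ex q : exists S, cn q < 1 -> hasSum (fun n => b n * q ^+ n) S.
  have [q1|q1] := ltP (cn q) 1; last by exists 0.
  by have [S HS] := absum_hasSum (radius1_absum rb q1); exists S.
have [P HP] := choice ex; move=> z z0.
apply: (@taylor2_ext _ (P \o qpar M) F z (complex.Im z) z0).
  move=> h hz; have zh : 0 < complex.Im (z + h).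
    by have := le_lt_trans (Im_le_cn h) hz; rewrite cImD ltr_norml => /andP[]; lra.
  exact: hasSum_unique (HP _ (cn_qpar_lt1 M0 zh)) (H _ zh).
apply: taylor2_comp; first by apply: taylor2_series rb HP _; exact: cn_qpar_lt1.
apply: taylor2_comp; first exact: taylor2_nome.
by apply: taylor2M; [exact: taylor2_id|exact: taylor2_cst].
Qed.

Lemma qseries_asymp M b F : (0 < M)%N -> qseries M b F -> asymp M b F.
Proof.
move=> M0 H n; have rb := qseries_radius M0 H.
have [r [rE r0]] : exists r : R, r = 1 / 2 /\ 0 < r by exists (1 / 2); split=> //; lra.
have hc : cn (r%:C : C) < 1 by rewrite cn_real ger0_norm; lra.
have [B HB] := radius1_absum rb hc.
exists ((B + 1) / r ^+ n), M%:R => z zM.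
have z0 : 0 < complex.Im z by rewrite (lt_le_trans _ zM)// ltr0n.
have qr : cn (qpar M z) <= r.
  rewrite cn_qpar expRN -[r]invrK lef_pV2 ?posrE ?expR_gt0 ?invr_gt0//.
  apply: le_trans (expR_ge1Dx _).
  have : 1 <= complex.Im z / M%:R by rewrite ler_pdivlMr ?ltr0n// mul1r.
  have := pi_ge2 R; rewrite rE; move: (complex.Im z / M%:R) => u; nra.
set q := qpar M z in qr *; have q0 : 0 < cn q by rewrite cn_gt0 nome_neq0.
have -> : \sum_(j < n) b j * q ^+ j = \sum_(j <- iota 0 n) b j * q ^+ j.
  by rewrite -(big_mkord predT (fun j => b j * q ^+ j)) /index_iota subn0.
apply: (hasSum_close (iota_uniq 0 n) (fun i => lexx _) _ (H z z0)) => s us sn.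
apply: (@le_lt_trans _ _ (\sum_(i <- s) cn (b i * r%:C ^+ i) * (cn q ^+ n / r ^+ n))).
  rewrite big_seq [leRHS]big_seq; apply: ler_sum => i /sn.
  rewrite mem_iota /= add0n -leqNgt => ni; rewrite (cnM (b i)) (cnM (b i)) !cnX cn_real (ger0_norm (ltW r0)).
  rewrite -[leRHS]mulrA ler_wpM2l ?cn_ge0// -(subnKC ni) !exprD.
  rewrite (_ : r ^+ n * r ^+ (i - n) * (cn q ^+ n / r ^+ n) = cn q ^+ n * r ^+ (i - n)).
    by rewrite ler_wpM2l ?exprn_ge0 ?cn_ge0// lerXn2r// nnegrE ?cn_ge0 ?ltW.
  have rn : r ^+ n != 0 by rewrite expf_neq0// gt_eqF.
  by move: (r ^+ n) rn => u u0; field.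
rewrite -mulr_suml mulrA [ltRHS]mulrAC ltr_pM2r ?invr_gt0 ?exprn_gt0//.
by rewrite ltr_pM2r ?exprn_gt0//; have := HB _ us; lra.
Qed.

(** The series converges as an ordered one only, but at all points of the half plane; its terms are
    bounded there, so the radius is 1 and the convergence absolute. *)
Lemma q_expansion_qseries (f : C -> C) (a : nat -> C) : q_expansion f a -> qseries 1 a f.
Proof.
move=> H; have cvg z e : 0 < complex.Im z -> 0 < e -> exists n0, forall n, (n0 <= n)%N ->
    cn (\sum_(i < n) a i * nome z ^+ i - f z) < e.
  move=> z0 e0; have e0' : 0 < e%:C :> C by rewrite ltcE /= eqxx.
  have /cvgrPdist_lt/(_ _ e0')[n0 _ Hn] := H z z0; exists n0 => n /Hn.
  rewrite distrC cnE ltcE /= eqxx /= seriesEnat /= big_mkord => /le_lt_trans; apply.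
  exact: lexx.
have rb : radius1 a.
  move=> r rr; have [z z0 zr] := qpar_surj (isT : 0 < 1)%N rr.
  rewrite /qpar divr1 in zr; have [n0 Hn] := cvg z 1 z0 ltr01.
  exists (2 + \sum_(i < n0) cn (a i) * r ^+ i).
    rewrite addr_ge0// sumr_ge0// => i _; rewrite mulr_ge0 ?cn_ge0// exprn_ge0//.
    by case/andP: rr => /ltW.
  have sn0 : 0 <= \sum_(i < n0) cn (a i) * r ^+ i.
    rewrite sumr_ge0// => i _; rewrite mulr_ge0 ?cn_ge0// exprn_ge0//.
    by case/andP: rr => /ltW.
  move=> n; have [nn|nn] := ltnP n n0.
    rewrite (bigD1 (Ordinal nn))//=; set X := \sum_(i < n0 | _) _.
    suff : 0 <= X by lra.
    rewrite sumr_ge0// => i _; rewrite mulr_ge0 ?cn_ge0// exprn_ge0//.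
    by case/andP: rr => /ltW.
  have := Hn _ nn; have := Hn _ (leqW nn); rewrite big_ord_recr/=.
  set X := \sum_(i < n) _ => h1 h2.
  have := cnD (X + a n * nome z ^+ n - f z) (- (X - f z)).
  rewrite cnN (_ : _ + _ - _ + - (_ - _) = a n * nome z ^+ n); last by ring.
  by rewrite cnM cnX zr; lra.
move=> z z0; have [S HS] := absum_hasSum (radius1_absum rb (cn_qpar_lt1 (isT : 0 < 1)%N z0)).
suff -> : f z = S by [].
apply/eqP; rewrite -subr_eq0 -cn_eq0 eq_le cn_ge0 andbT; apply/ler_addgt0Pr => e e0.
rewrite add0r; have e2 : 0 < e / 2 by rewrite divr_gt0.
have [n0 Hn] := cvg z _ z0 e2; have [s0 Hs] := HS _ e2.
pose n := maxn n0 (\max_(i <- s0) i).+1.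
have := Hn n (leq_maxl _ _); have := Hs (iota 0 n) (iota_uniq _ _).
move=> /(_ _)/wrap[|].
  move=> x xs; rewrite mem_iota /= add0n leq_max ltnS.
  by apply/orP; right; apply: leq_bigmax_seq.
have -> : \sum_(i <- iota 0 n) a i * qpar 1 z ^+ i = \sum_(i < n) a i * nome z ^+ i.
  by rewrite -(big_mkord predT (fun j => a j * nome z ^+ j)) /index_iota subn0 /qpar divr1.
set X := \sum_(i < n) _ => h1 h2; have := cnD (f z - X) (X - S).
rewrite subrKA (cn_distC (f z) X); lra.
Qed.

End PowerSeries.

(** * The Lipschitz formula *)

Section Lipschitz.
Variable R : realType.
Local Notation C := R[i].

Lemma radius1_pow k : radius1 (fun j => (j%:R : C) ^+ k).
Proof.
elim: k => [|k IH] r /andP[r0 r1].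
  exists 1 => // n; rewrite expr0 cn1 mul1r; apply: exprn_ile1; exact: ltW.
pose s := Num.sqrt r; have sE : s ^+ 2 = r by rewrite sqr_sqrtr// ltW.
have s0 : 0 < s by rewrite sqrtr_gt0.
have s1 : s < 1.
  by rewrite ltNge; apply/negP => s1; have := exprn_ege1 2 s1; rewrite sE leNgt r1.
have ss : 0 < s < 1 by rewrite s0.
have [K K0 HK] := IH s ss; exists (K / (1 - s)).
  by rewrite divr_ge0// subr_ge0 ltW.
move=> n; have := exprn_unbounded n ss; rewrite mulrAC -ler_pdivlMr ?subr_gt0// => h.
rewrite -sE -exprM mulnC exprM expr2 exprS cnM cn_nat.
rewrite (_ : _ * _ = (cn (n%:R ^+ k : C) * s ^+ n) * (n%:R * s ^+ n)); last by ring.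
have sn : 0 <= s ^+ n by rewrite exprn_ge0// ltW.
by rewrite ler_pM ?mulr_ge0 ?cn_ge0// (le_trans h)// mul1r.
Qed.

Lemma absum_pow k (q : C) : cn q < 1 -> absum (fun j : nat => j%:R ^+ k * q ^+ j).
Proof. exact/radius1_absum/radius1_pow. Qed.

Lemma hasSum_geometric (q : C) : cn q < 1 -> hasSum (fun j => q ^+ j) (1 - q)^-1.
Proof.
move=> q1; have [S HS] := absum_hasSum (absum_pow 0 q1).
have {}HS : hasSum (fun j => q ^+ j) S by apply: hasSum_ext HS => j; rewrite expr0 mul1r.
have H : hasSum (fun j : nat => q ^+ j) (1 + q * S).
  have h0 : hasSum (fun j : nat => if j == 0%N then 1 else 0 : C) 1.
    have := @hasSum_finite R _ (fun j : nat => if j == 0%N then 1 else 0) [:: 0%N] isT.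
    rewrite big_seq1 eqxx; apply=> i.
    by rewrite inE => /negbTE ->.
  have h1 : hasSum (fun j : nat => if j is j'.+1 then q ^+ j else 0) (q * S).
    apply: (@hasSum_inj R _ _ succn); first exact: succn_inj.
      by case=> // j /(_ j).
    by apply: hasSum_ext (hasSumcM q HS) => j /=; rewrite exprS.
  by apply: hasSum_ext (hasSumD h0 h1) => -[|j] /=; rewrite ?addr0 ?add0r ?expr0.
have SE := hasSum_unique HS H.
have q0 : 1 - q != 0.
  by rewrite subr_eq0; apply/eqP => q1'; move: q1; rewrite -q1' cn1 ltxx.
suff -> : (1 - q)^-1 = S by [].
by apply: (mulfI q0); rewrite divff// mulrBl mul1r {1}SE addrK.
Qed.

Definition int_poly (P : {poly C}) := forall i, exists z : int, P`_i = z%:~R.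

(** Expanding (j + 1)^(k+1) by the binomial formula gives S = q (Q + S) for the sum S of exponent
    k+1, where Q combines those of lower exponents. As q / (1 - q) = X - 1 at X = (1 - q)^-1, the
    new polynomial is (X - 1) Q. Such a polynomial also has values at the roots of unity other than
    1. *)
Lemma Li_poly k : exists P : {poly C}, [/\ int_poly P, (size P <= k.+2)%N,
  P`_k.+1 = k`!%:R &
  forall q, cn q < 1 -> hasSum (fun j : nat => j%:R ^+ k * q ^+ j) P.[(1 - q)^-1]].
Proof.
elim/ltn_ind: k => -[|k] IH.
  exists 'X; split; rewrite ?size_polyX ?coefX//.
    by move=> i; rewrite coefX; case: eqP => _; [exists 1|exists 0].
  move=> q q1; rewrite hornerX; apply: hasSum_ext (hasSum_geometric q1) => j.
  by rewrite mul1r.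
have ex i : exists P : {poly C}, (i < k.+1)%N ->
  [/\ int_poly P, (size P <= i.+2)%N, P`_i.+1 = i`!%:R &
  forall q, cn q < 1 -> hasSum (fun j : nat => j%:R ^+ i * q ^+ j) P.[(1 - q)^-1]].
  by case: (ltnP i k.+1) => [/IH[P HP]|_]; [exists P|exists 0].
have [T HT] := choice ex.
pose Q := \sum_(i < k.+1) 'C(k.+1, i)%:R *: T i.
have sQ : (size Q <= k.+2)%N.
  apply: leq_trans (size_sum _ _ _) _; apply/bigmax_leqP => i _.
  apply: leq_trans (size_scale_leq _ _) _; have [_ /leq_trans + _ _] := HT i (ltn_ord i).
  by apply; rewrite !ltnS -ltnS.
have Qk : Q`_k.+1 = k.+1`!%:R.
  rewrite coef_sum big_ord_recr big1 => [|i _]; last first.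
    rewrite coefZ; have [_ sT _ _] := HT i (leqW (ltn_ord i)).
    by rewrite (leq_sizeP _ _ sT)// ?mulr0//= ltnS.
  rewrite /= add0r coefZ; have [_ _ -> _] := HT k (ltnSn k).
  by rewrite binSn -natrM factS.
exists (('X - 1) * Q); split.
- have iQ : int_poly Q.
    move=> i; rewrite coef_sum.
    elim/big_ind: _ => [|x y [a ->] [b ->]|j _]; first by exists 0.
      by exists (a + b); rewrite intrD.
    have [/(_ i)[z zE] _ _ _] := HT j (ltn_ord j); exists ('C(k.+1, j)%:Z * z).
    by rewrite coefZ zE intrM.
  move=> i; rewrite mulrBl mul1r coefB coefXM; have [b ->] := iQ i.
  case: i => [|i] /=; first by exists (- b); rewrite sub0r mulrNz.
  by have [a ->] := iQ i; exists (a - b); rewrite intrB.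
- have [->|Q0] := eqVneq Q 0; first by rewrite mulr0 size_poly0.
  by rewrite size_proper_mul ?size_XsubC ?lead_coefXsubC ?mul1r ?lead_coef_eq0.
- rewrite mulrBl mul1r coefB coefXM /= Qk.
  by rewrite (leq_sizeP _ _ sQ)// subr0.
move=> q q1; have [S HS] := absum_hasSum (absum_pow k.+1 q1).
have q0 : 1 - q != 0.
  by rewrite subr_eq0; apply/eqP => q1'; move: q1; rewrite -q1' cn1 ltxx.
suff SE : S = q * (Q.[(1 - q)^-1] + S).
  suff -> : (('X - 1) * Q).[(1 - q)^-1] = S by [].
  rewrite hornerM !hornerE; apply: (mulfI q0).
  rewrite mulrA (_ : (1 - q) * _ = q); last by rewrite mulrBr divff// mulr1; ring.
  by rewrite mulrBl mul1r {1}SE mulrDr addrK.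
apply: (hasSum_unique HS).
have H i : (i < k.+2)%N -> exists2 A, hasSum (fun j : nat => j%:R ^+ i * q ^+ j) A &
    A = if (i < k.+1)%N then (T i).[(1 - q)^-1] else S.
  rewrite ltnS leq_eqVlt => /orP[/eqP ->|ik]; first by exists S => //; rewrite ltnn.
  by exists (T i).[(1 - q)^-1]; rewrite ?ik//; have [_ _ _ /(_ q q1)] := HT i ik.
pose A i := if (i < k.+1)%N then (T i).[(1 - q)^-1] else S.
have HA (i : 'I_k.+2) : hasSum (fun j : nat => j%:R ^+ i * q ^+ j) (A i).
  by have [A' + AE] := H i (ltn_ord i); rewrite AE.
have := hasSumcM q (hasSum_sum (index_enum _) predT (fun i : 'I_k.+2 => hasSumcM 'C(k.+1, i)%:R (HA i))).
rewrite big_ord_recr /= /A ltnn binn mul1r.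
have -> : \sum_(i < k.+1) 'C(k.+1, i)%:R * (if (i < k.+1)%N then (T i).[(1 - q)^-1] else S) =
    Q.[(1 - q)^-1].
  by rewrite horner_sum; apply: eq_bigr => i _; rewrite ltn_ord hornerZ.
move=> H'; apply: (@hasSum_inj R _ _ succn); first exact: succn_inj.
  by case=> [_|j /(_ j)]//; rewrite expr0n mul0r.
apply: hasSum_ext H' => j /=; rewrite [q ^+ j.+1]exprS [RHS]mulrCA; congr (_ * _).
rewrite -[in RHS]addn1 natrD addrC exprDn mulr_suml; apply: eq_bigr => i _.
by rewrite expr1n mul1r mulrA mulr_natl.
Qed.

Definition LiP k : {poly C} := projT1 (cid (Li_poly k)).
(** The polylogarithm of order -k as a rational function. Its value at the pole q = 1 is an
    artefact; [Li_lim] and [frac_sum] treat that point apart. *)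
Definition Li k (q : C) : C := (LiP k).[(1 - q)^-1].

Lemma LiP_int k : int_poly (LiP k).
Proof. by rewrite /LiP; case: cid => P []. Qed.
Lemma LiP_size k : (size (LiP k) <= k.+2)%N.
Proof. by rewrite /LiP; case: cid => P []. Qed.
Lemma LiP_lead k : (LiP k)`_k.+1 = k`!%:R.
Proof. by rewrite /LiP; case: cid => P []. Qed.
Lemma LiE k q : cn q < 1 -> hasSum (fun j : nat => j%:R ^+ k * q ^+ j) (Li k q).
Proof. by rewrite /Li /LiP; case: cid => P [? ? ? H] /=; exact: H. Qed.

Lemma LiP_expand k (y : C) : (LiP k).[y] = \sum_(i < k.+2) (LiP k)`_i * y ^+ i.
Proof.
by rewrite (horner_coef_wide _ (LiP_size k)).
Qed.

Lemma cn_nome_real (x : R) : cn (nome (x%:C)) = 1.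
Proof. by rewrite cn_nome /= mulr0 oppr0 expR0. Qed.

Lemma cos_eq1 (t : R) : `|t| <= pi -> cos t = 1 -> t = 0.
Proof.
move=> tp c1; have c2 : cos `|t| = cos 0.
  by rewrite cos0 -c1; case: (ler0P t) => _ //; rewrite cosN.
apply/eqP; rewrite -normr_eq0; apply/eqP; apply: (cos_inj _ _ c2).
  by rewrite in_itv /= normr_ge0.
by rewrite in_itv /= lexx pi_ge0.
Qed.

Lemma nome_small_eq1 (x : R) : `|x| <= 1 / 2 -> nome (x%:C : C) = 1 -> x = 0.
Proof.
move=> x2 /(congr1 (@complex.Re R)); rewrite /= mulr0 oppr0 expR0 !mul1r mul0r subr0.
move=> /cos_eq1; have pi0 := pi_gt0 R.
rewrite normrM gtr0_norm ?mulr_gt0// => /(_ _)/wrap[|/eqP].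
  have : 2 * pi * `|x| <= 2 * pi * (1 / 2) by rewrite ler_pM2l// mulr_gt0.
  by move/le_trans; apply; lra.
by rewrite mulf_eq0 gt_eqF ?mulr_gt0//= => /eqP.
Qed.

(** In this rectangle 1 - e(w) has a single zero, simple, at 0. Near 0 the Taylor expansion decides;
    elsewhere either Im w is bounded below and |e(w)| stays under 1, or |Re w| is and the argument
    stays away from 0. *)
Lemma nome_lower_bound : exists2 c : R, 0 < c & forall w : C,
  `|complex.Re w| <= 1 / 2 -> 0 <= complex.Im w <= 1 -> c * cn w <= cn (1 - nome w).
Proof.
have pi0 := pi_gt0 R; have pi2 := pi_ge2 R.
have [K [d [K0 d0 Hd]]] := nome_taylor0 R.
have ct : cn (tau R) = 2 * pi.
  by rewrite /tau cnM cn_i mulr1 cn_real gtr0_norm// mulr_gt0.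
pose M := K + cn (tau R ^+ 2 / 2).
have M0 : 0 <= M by rewrite addr_ge0 ?cn_ge0.
have [e [e0 e1 He]] : exists e, [/\ 0 < e, e <= 1 / 2 & forall w : C, cn w < e -> cn w <= cn (1 - nome w)].
  exists (Num.min (Num.min d (1 / 2)) (1 / (M + 1))); split.
  - by rewrite !lt_min d0 /= divr_gt0//= divr_gt0// ltr_wpDl.
  - by rewrite !ge_min lexx orbT.
  move=> w; rewrite !lt_min => /andP[/andP[/Hd wd w1]].
  rewrite ltr_pdivlMr ?ltr_wpDl// => wM.
  have w0 := cn_ge0 w.
  have h1 : cn (nome w - 1 - tau R * w) <= M * cn w ^+ 2.
    have -> : nome w - 1 - tau R * w = (nome w - (1 + tau R * w + tau R ^+ 2 / 2 * w ^+ 2)) +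
       tau R ^+ 2 / 2 * w ^+ 2 by ring.
    apply: (le_trans (cnD _ _)); rewrite /M mulrDl (cnM _ (w ^+ 2)) cnX lerD2r.
    apply: (le_trans wd); rewrite ler_wpM2l// exprS ler_piMl ?sqr_ge0//; lra.
  have := cn_tri (tau R * w) (- (nome w - 1 - tau R * w)).
  rewrite opprK (_ : tau R * w + _ = nome w - 1); last by ring.
  rewrite cnN cnM ct (cn_distC 1) => h2.
  have h3 : M * cn w ^+ 2 <= cn w by rewrite expr2; nra.
  nra.
pose m1 := 1 - expR (- (pi * e)); pose m2 := 1 - cos (pi * e).
have m10 : 0 < m1 by rewrite subr_gt0 expR_lt1 oppr_lt0 mulr_gt0.
have pe : 0 < pi * e < pi by rewrite mulr_gt0//=; nra.
have m20 : 0 < m2.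
  rewrite subr_gt0 -cos0 ltr_cos ?in_itv/= ?lexx ?pi_ge0//; first by case/andP: pe.
  by case/andP: pe => ? ?; apply/andP; split; exact: ltW.
pose s := Num.min (Num.sqrt m2) (1 / 2).
have s0 : 0 < s by rewrite lt_min sqrtr_gt0 m20 divr_gt0.
exists (Num.min 1 (Num.min (m1 / 2) (s / 2))).
  by rewrite !lt_min ltr01 !divr_gt0.
move=> w wx /andP[wy0 wy1]; have w0 := cn_ge0 w.
have wle : cn w <= 2 by rewrite (le_trans (cn_le_ReIm w))// (ger0_norm wy0); lra.
have [we|we] := ltP (cn w) e.
  by apply: le_trans (He _ we); rewrite -[leRHS]mul1r ler_wpM2r// ge_min lexx.
have rho1 := expR_gt0 (- (2 * pi * complex.Im w)).
have [wye|wye] := ltP (e / 2) (complex.Im w).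
  apply: (@le_trans _ _ m1).
    apply: (@le_trans _ _ (m1 / 2 * cn w)); first by rewrite ler_wpM2r// !ge_min lexx orbT.
    by rewrite mulrAC ler_pdivrMr// ler_pM2l.
  have := cn_tri 1 (nome w); rewrite cn1 cn_nome /m1.
  suff : expR (- (2 * pi * complex.Im w)) <= expR (- (pi * e)) by lra.
  rewrite ler_expR lerN2; nra.
have wxe : e / 2 <= `|complex.Re w|.
  by have := cn_le_ReIm w; rewrite (ger0_norm wy0); lra.
apply: (@le_trans _ _ s).
  apply: (@le_trans _ _ (s / 2 * cn w)); first by rewrite ler_wpM2r// !ge_min lexx !orbT.
  by rewrite mulrAC ler_pdivrMr// ler_pM2l.
have E : cn (1 - nome w) ^+ 2 = (1 - cn (nome w)) ^+ 2 +
    2 * cn (nome w) * (1 - cos (2 * pi * complex.Re w)).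
  rewrite cn_nome cn_sqrE /nome !(cReD, cReN, cImD, cImN, cReM, cImM)/=.
  have := cos2Dsin2 (2 * pi * complex.Re w).
  move: (cos _) (sin _) (expR _) => c t r ct1.
  have : r ^+ 2 * (c ^+ 2 + t ^+ 2) = r ^+ 2 by rewrite ct1 mulr1.
  lra.
have cw : cos (2 * pi * complex.Re w) <= cos (pi * e).
  have -> : cos (2 * pi * complex.Re w) = cos (2 * pi * `|complex.Re w|).
    by case: (ler0P (complex.Re w)) => // _; rewrite mulrN cosN.
  have i1 : 0 <= pi * e <= pi by case/andP: pe => ? ?; apply/andP; split; exact: ltW.
  have i2 : 0 <= 2 * pi * `|complex.Re w| <= pi.
    apply/andP; split; first by rewrite mulr_ge0// mulr_ge0// ltW.
    have : 2 * pi * `|complex.Re w| <= 2 * pi * (1 / 2) by rewrite ler_pM2l// mulr_gt0.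
    by move/le_trans; apply; lra.
  rewrite leNgt ltr_cos ?in_itv//= -leNgt.
  have : 2 * pi * (e / 2) <= 2 * pi * `|complex.Re w| by rewrite ler_pM2l// mulr_gt0.
  by apply: le_trans; lra.
have rw0 := cn_ge0 (nome w).
rewrite -(@ler_pXn2r _ 2)// ?nnegrE ?cn_ge0 ?(ltW s0)// E.
have [rh|rh] := leP (1 / 2) (cn (nome w)).
  apply: (@le_trans _ _ m2).
    have -> : m2 = Num.sqrt m2 ^+ 2 by rewrite sqr_sqrtr// ltW.
    by rewrite lerXn2r// ?nnegrE ?sqrtr_ge0 ?(ltW s0)// ge_min lexx.
  have := sqr_ge0 (1 - cn (nome w)); have : 0 < 1 - cos (2 * pi * complex.Re w).
    by rewrite /m2 in m20; lra.
  rewrite /m2 in m20 *; nra.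
apply: (@le_trans _ _ ((1 / 2) ^+ 2)).
  by rewrite lerXn2r// ?nnegrE ?(ltW s0)// ge_min lexx orbT.
have : 0 < 1 - cos (2 * pi * complex.Re w) by rewrite /m2 in m20; lra.
have : (1 / 2) ^+ 2 <= (1 - cn (nome w)) ^+ 2.
  by rewrite lerXn2r// ?nnegrE; lra.
nra.
Qed.

End Lipschitz.

Section LipschitzFormula.
Variable R : realType.
Local Notation C := R[i].

Definition zeta (M : nat) : C := nome (M%:R^-1).

Lemma zetaX M n : zeta M ^+ n = nome (n%:R / M%:R).
Proof. by rewrite /zeta -nomeMn. Qed.

Lemma zeta_prim M : (0 < M)%N -> M.-primitive_root (zeta M).
Proof.
move=> M0; have MC : M%:R != 0 :> C by rewrite pnatr_eq0 -lt0n.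
have MR : 0 < M%:R :> R by rewrite ltr0n.
have z1 : zeta M ^+ M = 1 by rewrite zetaX divff// nome1.
have small i : (0 < i < M)%N -> zeta M ^+ i != 1.
  move=> /andP[i0 iM]; apply/eqP; rewrite zetaX => ni.
  have iE (j : R) : nome (i%:R / M%:R : C) = nome ((i%:R / M%:R : R)%:C).
    by rewrite rmorphM fmorphV !rmorph_nat.
  have x0 : 0 < i%:R / M%:R :> R by rewrite divr_gt0// ltr0n.
  have x1 : i%:R / M%:R < 1 :> R by rewrite ltr_pdivrMr// mul1r ltr_nat.
  rewrite (iE 0) in ni; move: (i%:R / M%:R : R) x0 x1 ni => x x0 x1 ni.
  have [x2|x2] := leP x (1 / 2).
    by have := @nome_small_eq1 _ x; rewrite (ger0_norm (ltW x0)) => /(_ x2 ni); lra.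
  have := @nome_small_eq1 _ (x - 1); rewrite ler0_norm; last lra.
  move=> /(_ _)/wrap[|]; first by lra.
  rewrite rmorphB rmorph1 nomeD nomeN nome1 invr1 mulr1 => /(_ ni); lra.
apply/andP; split=> //; apply/forallP => i; rewrite unity_rootE.
have := ltn_ord i; rewrite -ltnS ltnS; case: (ltngtP i.+1 M) => // iM _.
  by rewrite (negbTE (small _ _)).
by rewrite iM z1 eqxx.
Qed.

Lemma zeta_sum M j : (0 < M)%N ->
  \sum_(i < M) (zeta M ^+ j) ^+ i = if (M %| j)%N then M%:R else 0.
Proof.
move=> M0; have zp := zeta_prim M0; rewrite (prim_order_dvd zp).
case: eqP => [->|/eqP zj].
  by rewrite (eq_bigr (fun=> 1)) ?sumr_const ?card_ord// => i _; rewrite expr1n.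
apply: (mulfI (x := zeta M ^+ j - 1)); first by rewrite subr_eq0.
by rewrite -subrX1 -exprM mulnC exprM (prim_expr_order zp) expr1n subrr mulr0.
Qed.

(** Orthogonality of the L-th roots of unity keeps the exponents divisible by L. *)
Lemma Li_distribution k (z : C) L : (0 < L)%N -> 0 < complex.Im z ->
  \sum_(i < L) Li k (nome ((z + i%:R) / L%:R)) = L%:R ^+ k.+1 * Li k (nome z).
Proof.
move=> L0 z0; have LC : L%:R != 0 :> C by rewrite pnatr_eq0 -lt0n.
have n1 (i : nat) : cn (nome ((z + i%:R) / L%:R)) < 1.
  have := @cn_qpar_lt1 R L (z + i%:R) L0; rewrite /qpar; apply.
  by rewrite cImD -(rmorph_nat (real_complex R)) /= addr0.
have n2 : cn (nome z) < 1.
  by have := @cn_qpar_lt1 R 1 z isT z0; rewrite /qpar divr1.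
have H := hasSum_sum (index_enum _) predT (fun i : 'I_L => LiE k (n1 i)).
have E j : \sum_(i < L) j%:R ^+ k * nome ((z + i%:R) / L%:R) ^+ j =
   j%:R ^+ k * nome (z / L%:R) ^+ j * \sum_(i < L) (zeta L ^+ j) ^+ i.
  rewrite mulr_sumr; apply: eq_bigr => i _; rewrite mulrDl nomeD exprMn -mulrA.
  by congr (_ * (_ * _)); rewrite -exprM mulnC exprM zetaX.
apply: (hasSum_unique H); apply: (@hasSum_inj R _ _ (muln L)).
- by move=> i j /eqP; rewrite eqn_pmul2l// => /eqP.
- move=> j nj; rewrite E zeta_sum//; case: dvdnP => [[m jm]|]; last by rewrite mulr0.
  by case: (nj m); rewrite jm mulnC.
apply: hasSum_ext (hasSumcM (L%:R ^+ k.+1) (LiE k n2)) => m /=.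
rewrite E.
rewrite zeta_sum// dvdn_mulr// exprM -[nome (z / _) ^+ L]nomeMn [L%:R * (z / _)]mulrC divfK//.
rewrite /= natrM exprS [(L%:R * m%:R) ^+ k]exprMn; ring.
Qed.

Lemma isO_pow_sub (g : C -> C) (a : C) n : isO 1 (fun h => g h - a) ->
  isO 1 (fun h => g h ^+ n - a ^+ n).
Proof.
move=> H; have g0 : isO 0 g.
  by apply: isO_ext (isOD (isO_le (leq0n 1) H) (isO_cst a)) => h; rewrite subrK.
elim: n => [|n IH].
  by apply: isO_ext (isO0 R 1) => h; rewrite !expr0 subrr.
have gn : isO 0 (fun h => g h ^+ n).
  by apply: isO_ext (isOD (isO_le (leq0n 1) IH) (isO_cst (a ^+ n))) => h; rewrite subrK.
apply: isO_ext (isOD (isOM gn H) (isOMc a IH)) => h /=; rewrite !exprSr; ring.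
Qed.

Lemma tau_neq0 : tau R != 0.
Proof.
rewrite /tau mulf_eq0 negb_or -!cn_eq0 cn_i oner_eq0 andbT cn_real normr_eq0.
by rewrite gt_eqF// mulr_gt0 ?pi_gt0.
Qed.

(** The removable singularity at 0 is filled in by the limit. *)
Definition gfun (w : C) : C := if w == 0 then - (tau R)^-1 else w / (1 - nome w).

Lemma gfun_lim : isO 1 (fun w => gfun w - (- (tau R)^-1)).
Proof.
have t0 := tau_neq0; have pi2 := pi_ge2 R; have pi0 := pi_gt0 R.
have [K [d [K0 d0 Hd]]] : isO 2 (fun h : C => nome h - 1 - tau R * h).
  apply: isO_ext (isOD (isO_le (isT : 2 <= 3)%N (nome_taylor0 R))
     (isOcM (tau R ^+ 2 / 2) (isO_exp R 2))) => h /=; ring.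
have ct : cn (tau R) = 2 * pi.
  by rewrite /tau cnM cn_i mulr1 cn_real gtr0_norm// mulr_gt0.
exists (K / cn (tau R)), (Num.min d (K + 1)^-1); split.
- by rewrite divr_ge0// cn_ge0.
- by rewrite lt_min d0 invr_gt0 ltr_wpDl.
move=> w; rewrite lt_min => /andP[/Hd h1 h2]; rewrite expr1 /gfun.
have [->|w0] := eqVneq w 0; first by rewrite subrr !cn0 mulr0.
have cw0 : 0 < cn w by rewrite cn_gt0.
have Kw : K * cn w <= 1.
  move: h2; rewrite -[ltRHS]mul1r ltr_pdivlMr ?ltr_wpDl// => h2; nra.
have lb : cn w <= cn (1 - nome w).
  have := cn_tri (tau R * w) (- (nome w - 1 - tau R * w)).
  rewrite opprK (_ : tau R * w + _ = nome w - 1); last by ring.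
  rewrite cnN cnM ct (cn_distC 1) => h3.
  have : K * cn w ^+ 2 <= cn w by rewrite expr2; nra.
  nra.
have n0 : 1 - nome w != 0 by rewrite -cn_gt0 (lt_le_trans cw0).
have -> : w / (1 - nome w) - - (tau R)^-1 =
    - (nome w - 1 - tau R * w) / (tau R * (1 - nome w)).
  by move: (tau R) t0 => t t0; field; rewrite t0 n0.
have p2 : 0 < 2 * pi :> R by rewrite mulr_gt0.
have n1 : 0 < cn (1 - nome w) := lt_le_trans cw0 lb.
rewrite cnM cnV cnM cnN ct ler_pdivrMr; last by rewrite mulr_gt0.
rewrite (le_trans h1)// (_ : _ * _ * (_ * _) = K * (cn w * cn (1 - nome w))); last first.
  by move: (2 * pi) p2 => t tp; field; rewrite gt_eqF.
by rewrite ler_wpM2l// expr2 ler_pM2l.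
Qed.

Lemma inv_int_bound (z : C) (d : R) : 0 < d -> (forall n : int, d <= cn (z + n%:~R)) ->
  forall K, absum (fun n : int => (z + n%:~R) ^- K.+2).
Proof.
move=> d0 Hd K; pose A := (d ^-1) ^+ K * ((d^-1) ^+ 2 + (1 + cn z / d) ^+ 2).
have dV : 0 <= d^-1 by rewrite invr_ge0 ltW.
have zd : 0 <= cn z / d by rewrite divr_ge0 ?cn_ge0 ?ltW.
have A0 : 0 <= A by rewrite mulr_ge0 ?exprn_ge0// addr_ge0 ?sqr_ge0.
apply: (absum_le (g := fun n : int => A%:C * (1 + n%:~R ^+ 2)^-1)).
  move=> n; have rE : 1 + n%:~R ^+ 2 = (1 + n%:~R ^+ 2)%:C :> C.
    by rewrite rmorphD rmorph1 rmorphXn rmorph_int.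
  have p0 : 0 < 1 + n%:~R ^+ 2 :> R by rewrite ltr_wpDr ?sqr_ge0.
  rewrite cnV cnX cnM cnV rE !cn_real (ger0_norm A0) (ger0_norm (ltW p0)).
  have u0 : 0 < cn (z + n%:~R) := lt_le_trans d0 (Hd n).
  have nu : `|n%:~R| <= cn (z + n%:~R) * (1 + cn z / d).
    have := cnB (z + n%:~R) z; rewrite [z + _]addrC addrK addrC.
    rewrite -[X in cn X <= _](rmorph_int (real_complex R)) cn_real => /le_trans; apply.
    rewrite mulrDr mulr1 addrC [n%:~R + z]addrC lerD2l mulrA ler_pdivlMr//.
    by rewrite mulrC ler_wpM2r ?cn_ge0.
  have u1 : 1 <= cn (z + n%:~R) * d^-1 by rewrite ler_pdivlMr// mul1r.
  rewrite ler_pdivlMr// mulrC ler_pdivrMr ?exprn_gt0//.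
  have e1 : 1 + n%:~R ^+ 2 <= cn (z + n%:~R) ^+ 2 * ((d^-1) ^+ 2 + (1 + cn z / d) ^+ 2).
    rewrite mulrDr -!exprMn lerD//; first by rewrite exprn_ege1.
    rewrite -real_normK ?num_real// lerXn2r// nnegrE mulr_ge0//; first exact: ltW.
    by rewrite addr_ge0.
  apply: (le_trans e1); rewrite /A.
  have uK : 1 <= (cn (z + n%:~R) * d^-1) ^+ K by rewrite exprn_ege1.
  move: (cn (z + n%:~R)) (d^-1 ^+ 2 + _) e1 uK => u v e1 uK.
  have -> : d^-1 ^+ K * v * u ^+ K.+2 = (u * d^-1) ^+ K * (u ^+ 2 * v).
    by rewrite exprMn -[K.+2]addn2 exprD; ring.
  rewrite ler_peMl//; apply: le_trans e1; rewrite addr_ge0 ?sqr_ge0//.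
apply: absumcM; apply: absum_int.
  exact: absum_inv_sqr_nat.
apply: (absum_le _ (absum_inv_sqr_nat R)) => n /=.
have E (m : nat) : cn (1 + m%:R ^+ 2 : C)^-1 = (1 + m%:R ^+ 2 : R)^-1.
  rewrite cnV (_ : 1 + m%:R ^+ 2 = (1 + m%:R ^+ 2)%:C); last first.
    by rewrite rmorphD rmorph1 rmorphXn rmorph_nat.
  by rewrite cn_real ger0_norm// addr_ge0// sqr_ge0.
rewrite mulrNz sqrrN !E lef_pV2 ?posrE ?ltr_wpDr ?sqr_ge0// lerD2l.
by rewrite lerXn2r// ?nnegrE// ler_nat.
Qed.

(** Multiplied by w^(k+1), every term of [LiP] at (1 - e(w))^-1 keeps a positive power of w, except
    the leading one, k! (w / (1 - e(w)))^(k+1). *)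
Lemma Li_lim k : isO 1 (fun w => (if w == 0 then (k`!)%:R * (- (tau R)^-1) ^+ k.+1 else
   w ^+ k.+1 * Li k (nome w)) - (k`!)%:R * (- (tau R)^-1) ^+ k.+1).
Proof.
pose g := gfun; pose a := - (tau R)^-1.
pose E w := \sum_(i < k.+2) (LiP R k)`_i * w ^+ (k.+1 - i) * g w ^+ i.
have EO : isO 1 (fun w => E w - (k`!)%:R * a ^+ k.+1).
  have g0 : isO 0 g.
    by apply: isO_ext (isOD (isO_le (leq0n 1) gfun_lim) (isO_cst a)) => h; rewrite subrK.
  have gn n : isO 0 (fun w => g w ^+ n).
    apply: isO_ext (isOD (isO_le (leq0n 1) (isO_pow_sub n gfun_lim)) (isO_cst (a ^+ n))) => h.
    by rewrite subrK.
  have H1 : isO 1 (fun w => \sum_(i < k.+1) (LiP R k)`_i * w ^+ (k.+1 - i) * g w ^+ i).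
    elim: (index_enum _) => [|i r IH].
      by apply: isO_ext (isO0 R 1) => w; rewrite big_nil.
    have hi : isO 1 (fun w => (LiP R k)`_i * w ^+ (k.+1 - i) * g w ^+ i).
      have ki : (1 <= k.+1 - i)%N by rewrite subn_gt0.
      exact: isO_le (leq_trans ki (leq_addr 0 _)) (isOM (isOcM _ (isO_exp R _)) (gn i)).
    by apply: isO_ext (isOD hi IH) => w; rewrite big_cons.
  apply: isO_ext (isOD H1 (isOcM (k`!)%:R (isO_pow_sub k.+1 gfun_lim))) => w.
  by rewrite /E [in RHS]big_ord_recr /= subnn expr0 mulr1 LiP_lead mulrBr addrA.
apply: isO_ext EO => w; case: eqVneq => [w0|w0].
  congr (_ - _); rewrite /E big_ord_recr big1 => [|i _].
    by rewrite /= add0r subnn expr0 mulr1 LiP_lead /g /gfun w0 eqxx.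
  by rewrite w0 expr0n /= subn_eq0 leqNgt ltn_ord /= mulr0 mul0r.
congr (_ - _); rewrite /Li LiP_expand mulr_sumr; apply: eq_bigr => i _.
rewrite /g /gfun (negbTE w0) exprMn; have -> : w ^+ k.+1 = w ^+ (k.+1 - i) * w ^+ i.
  by rewrite -exprD subnK// -ltnS ltn_ord.
ring.
Qed.

End LipschitzFormula.

Section LipschitzFormula2.
Variable R : realType.
Local Notation C := R[i].

(** The constant (-2 pi i)^(k+1) / k! of the Lipschitz formula. *)
Definition lip k : C := (- tau R) ^+ k.+1 / (k`!)%:R.

Lemma lip_neq0 k : lip k != 0.
Proof.
apply: mulf_neq0; first by rewrite expf_neq0// oppr_eq0 tau_neq0.
by rewrite invr_neq0// pnatr_eq0 -lt0n fact_gt0.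
Qed.

Lemma lipV k : (lip k)^-1 = (k`!)%:R * (- (tau R)^-1) ^+ k.+1.
Proof. by rewrite /lip invfM invrK mulrC -invrN exprVn. Qed.

Lemma Li_strip_bound k : exists2 B : R, 0 <= B & forall w : C,
  `|complex.Re w| <= 1 / 2 -> 0 < complex.Im w <= 1 -> cn (w ^+ k.+1 * Li k (nome w)) <= B.
Proof.
have [c c0 Hc] := nome_lower_bound R.
exists (\sum_(i < k.+2) cn (LiP R k)`_i * 2 ^+ (k.+1 - i) * c^-1 ^+ i).
  apply: sumr_ge0 => i _; rewrite mulr_ge0 ?exprn_ge0 ?invr_ge0 ?(ltW c0)//.
  by rewrite mulr_ge0 ?cn_ge0 ?exprn_ge0.
move=> w wx wy; have wy' : 0 <= complex.Im w <= 1 by case/andP: wy => /ltW -> ->.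
have lb := Hc w wx wy'; have [wy0 wy1] := andP wy.
have w0 : 0 < cn w.
  by rewrite cn_gt0; apply: contraTneq wy0 => ->; rewrite ltxx.
have w2 : cn w <= 2 by rewrite (le_trans (cn_le_ReIm w))// (ger0_norm (ltW wy0)); lra.
have n0 : 0 < cn (1 - nome w) by apply: lt_le_trans lb; rewrite mulr_gt0.
rewrite /Li LiP_expand mulr_sumr; apply: (le_trans (cn_sum _ _ _)); apply: ler_sum => i _.
have -> : w ^+ k.+1 * ((LiP R k)`_i * (1 - nome w)^-1 ^+ i) =
    (LiP R k)`_i * w ^+ (k.+1 - i) * (w * (1 - nome w)^-1) ^+ i.
  have -> : w ^+ k.+1 = w ^+ (k.+1 - i) * w ^+ i.
    by rewrite -exprD subnK// -ltnS ltn_ord.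
  by rewrite [(w * _) ^+ i]exprMn; ring.
rewrite !cnM !cnX cnM cnV ler_pM ?mulr_ge0 ?cn_ge0 ?exprn_ge0 ?mulr_ge0 ?invr_ge0 ?cn_ge0//.
  by rewrite ler_pM ?cn_ge0 ?exprn_ge0 ?cn_ge0// lerXn2r// nnegrE ?cn_ge0.
rewrite lerXn2r// ?nnegrE ?mulr_ge0 ?invr_ge0 ?cn_ge0 ?(ltW c0)//.
by rewrite ler_pdivrMr// mulrC ler_pdivlMr// mulrC.
Qed.

(** By [Li_distribution] with L = 2m + 1, Li_k(e(z)) is the sum over |n| <= m of (z + n)^(-k-1)
    w^(k+1) Li_k(e(w)) with w = (z + n) / L. As m grows, w tends to 0 and [Li_lim] gives the limit
    of each term; [Li_strip_bound] dominates them, and Tannery's theorem concludes. *)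
Lemma lipschitz_centered k (z : C) : (0 < k)%N -> 0 < complex.Im z ->
  `|complex.Re z| <= 1 / 2 ->
  hasSum (fun n : int => (z + n%:~R) ^- k.+1) (lip k * Li k (nome z)).
Proof.
case: k => // k0; set k := k0.+1 => _ z0 zx.
have zn (n : int) : complex.Im z <= cn (z + n%:~R).
  rewrite (le_trans _ (Im_le_cn _))// cImD -(rmorph_int (real_complex R)) /= addr0.
  exact: ler_norm.
have zn0 (n : int) : z + n%:~R != 0 by rewrite -cn_gt0 (lt_le_trans z0).
have asg := inv_int_bound z0 zn k0.
have [S HS] := absum_hasSum asg; suff -> : lip k * Li k (nome z) = S by [].
have [B B0 HB] := Li_strip_bound k.
(* An odd L allows the residues -m, ..., m: as |Re z| <= 1/2, all points (z + n) / L stay in |Re| <=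
   1/2. *)
pose L m : C := m.*2.+1%:R.
have L0 m : L m != 0 by rewrite pnatr_eq0.
have LE m : cn (L m) = m.*2.+1%:R by rewrite cn_nat.
pose f m (n : int) := if (`|n| <= m)%N then (L m) ^- k.+1 * Li k (nome ((z + n%:~R) / L m)) else 0.
have fE m (n : int) : L m ^- k.+1 * Li k (nome ((z + n%:~R) / L m)) =
    (z + n%:~R) ^- k.+1 * (((z + n%:~R) / L m) ^+ k.+1 * Li k (nome ((z + n%:~R) / L m))).
  rewrite mulrA expr_div_n mulrA mulVf ?expf_neq0// mul1r//.
have Hf m : hasSum (f m) (Li k (nome z)).
  pose s := [seq i%:Z - m%:Z | i <- iota 0 m.*2.+1].
  have us : uniq s.
    by rewrite map_inj_uniq ?iota_uniq// => i j /addIr [].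
  have fs n : n \notin s -> f m n = 0.
    move=> ns; rewrite /f; case: ifP => // nm; case/negP: ns.
    apply/mapP; exists (absz (n + m%:Z)); first by rewrite mem_iota /=; lia.
    lia.
  have D : \sum_(i < m.*2.+1) Li k (nome ((z - m%:R + i%:R) / m.*2.+1%:R)) =
      m.*2.+1%:R ^+ k.+1 * Li k (nome z).
    rewrite Li_distribution//; first by rewrite nomeD nomeN nome_nat invr1 mulr1.
    by rewrite cImD cImN -(rmorph_nat (real_complex R)) /= oppr0 addr0.
  have := hasSum_finite us fs; rewrite big_map.
  suff -> : \sum_(i <- iota 0 m.*2.+1) f m (i%:Z - m%:Z) = Li k (nome z) by [].
  have -> : Li k (nome z) = L m ^- k.+1 * (L m ^+ k.+1 * Li k (nome z)).
    by rewrite mulKf ?expf_neq0.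
  rewrite -D mulr_sumr -[iota 0 m.*2.+1]/(index_iota 0 m.*2.+1) big_mkord.
  apply: eq_bigr => i _; have im := ltn_ord i.
  rewrite /f ifT; last by lia.
  have -> : z + (i%:Z - m%:Z)%:~R = z - m%:R + i%:R :> C by rewrite intrB addrA addrAC.
  by rewrite /L.
apply/eqP; rewrite -subr_eq0 -cn_eq0 eq_le cn_ge0 andbT; apply/ler_addgt0Pr => e e0.
have lk0 : 0 < cn (lip k) by rewrite cn_gt0 lip_neq0.
have lkV : cn (lip k)^-1 <= B + cn (lip k)^-1 by rewrite lerDr.
pose B' := B + cn (lip k)^-1; have B'0 : 0 <= B' by rewrite addr_ge0// cn_ge0.
have [M HM] : exists M, forall m, (M <= m)%N -> complex.Im z <= m.*2.+1%:R.
  exists (Num.bound (complex.Im z)) => m Mm.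
  rewrite (le_trans (ltW (archi_boundP (ltW z0))))// ler_nat; lia.
have cvg := @hasSum_dominated R _ f (fun n => (lip k)^-1 * (z + n%:~R) ^- k.+1)
  (fun n => B'%:C * (z + n%:~R) ^- k.+1) (fun=> Li k (nome z)) _
  (absumcM B'%:C asg) _ _ _ Hf (hasSumcM (lip k)^-1 HS) _ (divr_gt0 e0 lk0).
have [|||m0 /(_ _ (leqnn m0))] := cvg.
- exists M => m n /HM zm; rewrite /f; case: ifP => nm; last by rewrite cn0 cn_ge0.
  rewrite fE (cnM ((z + n%:~R) ^- k.+1)) (cnM B'%:C) [leLHS]mulrC ler_wpM2r ?cn_ge0// cn_real (ger0_norm B'0).
  apply: (@le_trans _ _ B); last by rewrite lerDl cn_ge0.
  have mR : 0 < (m.*2.+1)%:R :> R by rewrite ltr0n.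
  have ReE : complex.Re ((z + n%:~R) / L m) = (complex.Re z + n%:~R) / m.*2.+1%:R.
    rewrite (_ : _ / L m = ((m.*2.+1%:R)^-1)%:C * (z + (n%:~R)%:C)); last first.
      by rewrite fmorphV rmorph_nat rmorph_int mulrC.
    by rewrite cReM cReD /= mul0r subr0 mulrC.
  have ImE : complex.Im ((z + n%:~R) / L m) = complex.Im z / m.*2.+1%:R.
    rewrite (_ : _ / L m = ((m.*2.+1%:R)^-1)%:C * (z + (n%:~R)%:C)); last first.
      by rewrite fmorphV rmorph_nat rmorph_int mulrC.
    by rewrite cImM cImD /= mul0r addr0 addr0 mulrC.
  apply: HB.
    rewrite ReE normrM (ger0_norm (x := (_)^-1)) ?invr_ge0 ?(ltW mR)// ler_pdivrMr//.
    apply: (le_trans (ler_normD _ _)).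
    have : `|n%:~R| <= m%:R :> R by rewrite -intr_norm -abszE -pmulrn ler_nat.
    rewrite -[m.*2.+1]addn1 -muln2 natrD natrM; lra.
  by rewrite ImE divr_gt0//= ler_pdivrMr// mul1r.
- move=> n; rewrite !cnM ler_wpM2r ?cn_ge0// cn_real (ger0_norm B'0)//.
- move=> n d d0; set u := z + n%:~R.
  have u0 : u != 0 by exact: zn0.
  have uk0 : 0 < cn (u ^- k.+1) by rewrite cn_gt0 invr_neq0// expf_neq0.
  have [r r0 Hr] := isO1_small (Li_lim R k) (divr_gt0 d0 uk0).
  exists (maxn `|n| (Num.bound (cn u / r))) => m; rewrite geq_max => /andP[nm rm].
  rewrite /f nm fE -/u lipV [X in _ - X]mulrC -mulrBr cnM mulrC -ltr_pdivlMr//.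
  have uL : u / L m != 0 by rewrite mulf_neq0// invr_neq0.
  have := Hr (u / L m); rewrite (negbTE uL); apply.
  rewrite cnM cnV LE ltr_pdivrMr ?ltr0n// mulrC -ltr_pdivrMr//.
  apply: (lt_le_trans (archi_boundP _)); first by rewrite divr_ge0 ?cn_ge0 ?ltW.
  by rewrite ler_nat (leq_trans rm)// -addnn -addnS leq_addr.
rewrite ltr_pdivlMr// -cnM.
have -> : (Li k (nome z) - (lip k)^-1 * S) * lip k = lip k * Li k (nome z) - S.
  by rewrite mulrBl mulrAC mulVf ?lip_neq0// mul1r mulrC.
by move=> /ltW; rewrite add0r.
Qed.

Lemma lipschitz_sum k (z : C) : (0 < k)%N -> 0 < complex.Im z ->
  hasSum (fun n : int => (z + n%:~R) ^- k.+1) (lip k * Li k (nome z)).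
Proof.
move=> k0 z0; pose j := Num.floor (complex.Re z + 1 / 2).
have jE : complex.Re (z - j%:~R) = complex.Re z - j%:~R.
  by rewrite cReD cReN -(rmorph_int (real_complex R)).
have := @lipschitz_centered k (z - j%:~R) k0; rewrite jE => /(_ _)/wrap[|].
  by rewrite cImD cImN -(rmorph_int (real_complex R)) /= oppr0 addr0.
move=> /(_ _)/wrap[|].
  have /andP[] := floor_itv (complex.Re z + 1 / 2); rewrite intrD -/j ler_norml => *.
  by apply/andP; split; lra.
rewrite nomeD nomeN nome_int invr1 mulr1 => H.
apply: (@hasSum_bij R _ _ (fun n => n - j)).
  by exists (fun n => n + j) => n; rewrite ?addrK ?subrK.
by apply: hasSum_ext H => n /=; rewrite intrB addrA addrAC.
Qed.

(** The limit of [lipschitz_sum] on a vertical line down to x, where every term is dominated by its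
    value at x. It serves the constant terms of Eisenstein series, which are sums over real lattice
    points. *)
Lemma lipschitz_real k (x d : R) : (0 < k)%N -> 0 < d ->
  (forall n : int, d <= `|x + n%:~R|) ->
  hasSum (fun n : int => (x%:C + n%:~R) ^- k.+1) (lip k * Li k (nome x%:C)).
Proof.
case: k => // k0; set k := k0.+1 => _ d0 Hd.
have Hd' (n : int) : d <= cn (x%:C + n%:~R).
  by rewrite -(rmorph_int (real_complex R)) -rmorphD cn_real.
have asg := inv_int_bound d0 Hd' k0; have [S HS] := absum_hasSum asg.
suff -> : lip k * Li k (nome x%:C) = S by [].
pose z m : C := x +i* (m.+1%:R)^-1.
have zI m : 0 < complex.Im (z m) by rewrite /= invr_gt0.
have zE m : z m = x%:C + 'i%C * ((m.+1%:R)^-1)%:C.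
  by apply: cplxP; rewrite /= ?mul0r ?mulr0 ?mul1r ?subr0 ?addr0 ?add0r//; lra.
have Hz m := @lipschitz_sum k (z m) isT (zI m).
have xn0 (n : int) : x%:C + n%:~R != 0 by rewrite -cn_gt0 (lt_le_trans d0).
have xz m : cn (z m - x%:C) = (m.+1%:R)^-1.
  by rewrite zE addrC addKr cnM cn_i mul1r cn_real ger0_norm// invr_ge0.
have lim (F : C -> C) e : taylor2 F x%:C -> 0 < e -> exists m0, forall m, (m0 <= m)%N ->
    cn (F (z m) - F x%:C) < e.
  move=> T e0; have [r r0 Hr] := taylor2_cont T e0.
  exists (Num.bound r^-1) => m m0; have := Hr (z m - x%:C).
  rewrite (_ : x%:C + (z m - x%:C) = z m); last by rewrite addrC subrK.
  apply; rewrite xz -[r]invrK ltf_pV2 ?posrE ?invr_gt0//.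
  apply: (lt_le_trans (archi_boundP _)); first by rewrite invr_ge0 ltW.
  by rewrite ler_nat leqW.
have nx : 1 - nome x%:C != 0 :> C.
  rewrite subr_eq0; apply/eqP => /esym nx1.
  pose j := Num.floor (x + 1 / 2).
  have xj : `|x - j%:~R| <= 1 / 2.
    have /andP[] := floor_itv (x + 1 / 2); rewrite intrD -/j ler_norml => *.
    by apply/andP; split; lra.
  have := Hd (- j); rewrite mulrNz (nome_small_eq1 xj) ?normr0; first lra.
  by rewrite rmorphB rmorph_int nomeD nomeN nome_int invr1 mulr1.
have TL : taylor2 (fun w => lip k * Li k (nome w)) x%:C.
  apply: taylor2M; first exact: taylor2_cst.
  apply: (taylor2_ext ltr01 (f := fun w => \sum_(i < k.+2) (LiP R k)`_i * (1 - nome w)^-1 ^+ i)).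
    by move=> h _; rewrite /Li LiP_expand.
  apply: taylor2_sum => i; apply: taylor2M; first exact: taylor2_cst.
  apply: taylor2X; apply: taylor2V => //.
  by apply: taylor2D; [exact: taylor2_cst|apply: taylor2N; exact: taylor2_nome].
have dom m (n : int) : cn ((z m + n%:~R) ^- k.+1) <= cn ((x%:C + n%:~R) ^- k.+1).
  have x1 : 0 < cn (x%:C + n%:~R) by apply: lt_le_trans (Hd' n).
  have z1 : 0 < cn (z m + n%:~R).
    rewrite (lt_le_trans (zI m))// (le_trans _ (Im_le_cn _))// cImD.
    by rewrite -(rmorph_int (real_complex R)) addr0 ler_norm.
  rewrite !cnV !cnX lef_pV2 ?posrE ?exprn_gt0//.
  rewrite lerXn2r// ?nnegrE ?cn_ge0// (le_trans _ (Re_le_cn _))//.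
  by rewrite cReD -(rmorph_int (real_complex R)) -rmorphD cn_real.
apply/eqP; rewrite -subr_eq0 -cn_eq0 eq_le cn_ge0 andbT; apply/ler_addgt0Pr => e e0.
have e2 : 0 < e / 2 by rewrite divr_gt0.
have [|||m1 H1] := @hasSum_dominated R _ (fun m n => (z m + n%:~R) ^- k.+1)
   (fun n => (x%:C + n%:~R) ^- k.+1) (fun n => (x%:C + n%:~R) ^- k.+1) _ _ asg _ _ _ Hz HS _ e2.
- by exists 0%N => m n _; exact: dom.
- by [].
- move=> n d' d'0; apply: (lim (fun w => (w + n%:~R) ^- k.+1)) => //.
  apply: taylor2V; first by rewrite expf_neq0.
  by apply: taylor2X; apply: taylor2D; [exact: taylor2_id|exact: taylor2_cst].
have [m2 H2] := lim _ _ TL e2.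
have := H1 _ (leq_maxl m1 m2); have := H2 _ (leq_maxr m1 m2).
set X := lip k * _; set Y := lip k * _ => h1 h2; rewrite add0r.
have := cnD (Y - X) (X - S); rewrite (cn_distC Y X) addrA subrK; lra.
Qed.

End LipschitzFormula2.

(** * The weight k action *)

Section Slash.
Variable R : realType.
Local Notation C := R[i].
Implicit Types (g h : 'M[R]_2) (f : C -> C) (z : C).

Lemma lift0_ord2 : lift ord0 ord0 = 1 :> 'I_2.
Proof. exact: val_inj. Qed.

Lemma mulmx2 (K : comRingType) (g h : 'M[K]_2) i j :
  (g *m h) i j = g i 0 * h 0 j + g i 1 * h 1 j.
Proof. by rewrite mxE big_ord_recl big_ord1 lift0_ord2. Qed.

Lemma det2 (K : comRingType) (g : 'M[K]_2) : \det g = g 0 0 * g 1 1 - g 0 1 * g 1 0.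
Proof.
rewrite (expand_det_row _ ord0) big_ord_recl big_ord1 /cofactor !det_mx11 !mxE.
rewrite !lift0_ord2 /= !expr0 expr1 mul1r mulN1r mulrN.
by congr (_ * g _ _ - _ * g _ _); exact: val_inj.
Qed.

Lemma Im_div (u v : C) : complex.Im (u / v) =
  (complex.Im u * complex.Re v - complex.Re u * complex.Im v) / cn v ^+ 2.
Proof. by rewrite cn_sqrE; case: u v => a b [c d] /=; rewrite mulrN mulrBl !mulrA addrC. Qed.

Lemma Re_automorphy g z :
  complex.Re (automorphy_factor g z) = g 1 0 * complex.Re z + g 1 1.
Proof. by rewrite /automorphy_factor cReD cReM /= mul0r subr0. Qed.
Lemma Im_automorphy g z : complex.Im (automorphy_factor g z) = g 1 0 * complex.Im z.
Proof. by rewrite /automorphy_factor cImD cImM /= mul0r !addr0. Qed.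

Lemma automorphy_neq0 g z : \det g != 0 -> 0 < complex.Im z -> automorphy_factor g z != 0.
Proof.
move=> dg z0; apply/eqP => az; have := congr1 (@complex.Im R) az.
rewrite Im_automorphy /= => /eqP; rewrite mulf_eq0 (gt_eqF z0) orbF => /eqP c0.
have := congr1 (@complex.Re R) az; rewrite Re_automorphy c0 mul0r add0r /= => d0.
by move: dg; rewrite det2 c0 d0 !mulr0 subrr eqxx.
Qed.

Lemma Im_mobius g z : complex.Im (mobius g z) =
  \det g * complex.Im z / cn (automorphy_factor g z) ^+ 2.
Proof.
rewrite /mobius Im_div; congr (_ / _); rewrite Re_automorphy Im_automorphy det2.
rewrite cReD cImD cReM cImM /=; ring.
Qed.

Lemma mobius_upper g z : 0 < \det g -> 0 < complex.Im z -> 0 < complex.Im (mobius g z).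
Proof.
move=> dg z0; rewrite Im_mobius; apply: divr_gt0; first exact: mulr_gt0.
by rewrite exprn_gt0// cn_gt0 automorphy_neq0 ?gt_eqF.
Qed.

Lemma automorphyM g h z : 0 < \det h -> 0 < complex.Im z ->
  automorphy_factor (g *m h) z = automorphy_factor g (mobius h z) * automorphy_factor h z.
Proof.
move=> dh z0; have a0 : automorphy_factor h z != 0 by rewrite automorphy_neq0 ?gt_eqF.
rewrite /mobius {1}/automorphy_factor [automorphy_factor g _]/automorphy_factor.
rewrite mulrDl -mulrA divfK// /automorphy_factor !mulmx2 !rmorphD !rmorphM /=; ring.
Qed.

Lemma mobiusM g h z : 0 < \det g -> 0 < \det h -> 0 < complex.Im z ->
  mobius (g *m h) z = mobius g (mobius h z).
Proof.
move=> dg dh z0; have a0 : automorphy_factor h z != 0 by rewrite automorphy_neq0 ?gt_eqF.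
have a1 : automorphy_factor g (mobius h z) != 0.
  by rewrite automorphy_neq0 ?gt_eqF// mobius_upper.
rewrite {1}/mobius automorphyM// {2}/mobius.
apply: (mulIf (mulf_neq0 a1 a0)); rewrite divfK ?mulf_neq0// mulrA divfK//.
rewrite /mobius mulrDl -mulrA divfK// /automorphy_factor !mulmx2 !rmorphD !rmorphM /=; ring.
Qed.

Lemma slashM k g h f z : 0 < \det g -> 0 < \det h -> 0 < complex.Im z ->
  slash k (g *m h) f z = slash k h (slash k g f) z.
Proof.
move=> dg dh z0; rewrite /slash mobiusM// automorphyM// det_mulmx sqrtrM ?ltW//.
rewrite rmorphM !exprMn invfM; ring.
Qed.

Lemma slash1 k f z : slash k 1%:M f z = f z.
Proof.
rewrite /slash /mobius /automorphy_factor det1 sqrtr1 !mxE /=.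
by rewrite rmorph0 rmorph1 mul0r add0r mul1r addr0 !divr1 expr1n divr1 mul1r.
Qed.

Lemma slash_mul k l g f1 f2 z : slash (k + l) g (fun w => f1 w * f2 w) z =
  slash k g f1 z * slash l g f2 z.
Proof. rewrite /slash !exprD invfM; ring. Qed.

Lemma slash_scale k g c f z : slash k g (fun w => c * f w) z = c * slash k g f z.
Proof. by rewrite /slash mulrCA. Qed.

Lemma slash_eq k g f1 f2 z : 0 < \det g -> 0 < complex.Im z ->
  (forall w, 0 < complex.Im w -> f1 w = f2 w) -> slash k g f1 z = slash k g f2 z.
Proof. by move=> dg z0 H; rewrite /slash H// mobius_upper. Qed.

Lemma slash_hol k g f : 0 < \det g -> hol f -> hol (slash k g f).
Proof.
move=> dg hf z z0; have a0 : automorphy_factor g z != 0 by rewrite automorphy_neq0 ?gt_eqF.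
have Ta c d : taylor2 (fun w => c * w + d) z.
  apply: taylor2D; last exact: taylor2_cst.
  by apply: taylor2M; [exact: taylor2_cst|exact: taylor2_id].
apply: taylor2M.
  apply: taylor2M; first exact: taylor2_cst.
  by apply: taylor2V; [rewrite expf_neq0|apply: taylor2X; exact: Ta].
apply: taylor2_comp; first exact/hf/mobius_upper.
by apply: taylor2M; [exact: Ta|apply: taylor2V => //; exact: Ta].
Qed.

Lemma det_intr (g : 'M[int]_2) : \det (map_mx intr g : 'M[R]_2) = (\det g)%:~R.
Proof. by rewrite det_map_mx. Qed.

Lemma SL2Z_det (g : 'M[int]_2) : SL2Z g -> \det (map_mx intr g : 'M[R]_2) = 1.
Proof. by rewrite det_intr => ->. Qed.
Lemma SL2Z_det_gt0 (g : 'M[int]_2) : SL2Z g -> 0 < \det (map_mx intr g : 'M[R]_2).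
Proof. by move/SL2Z_det ->. Qed.

Lemma SL2Z_mul (g h : 'M[int]_2) : SL2Z g -> SL2Z h -> SL2Z (g *m h).
Proof. by rewrite /SL2Z /= det_mulmx => -> ->. Qed.
Lemma SL2Z_one : SL2Z 1%:M. Proof. exact: det1. Qed.

Lemma slashZE k (g : 'M[int]_2) f z : SL2Z g -> slashZ k g f z =
  ((g 1 0)%:~R * z + (g 1 1)%:~R) ^- k *
  f (((g 0 0)%:~R * z + (g 0 1)%:~R) / ((g 1 0)%:~R * z + (g 1 1)%:~R)).
Proof.
move=> gS; rewrite /slashZ /slash SL2Z_det// sqrtr1 expr1n mul1r /mobius.
by rewrite /automorphy_factor !mxE !(rmorph_int (real_complex R)).
Qed.

Lemma slashZM k (g h : 'M[int]_2) f z : SL2Z g -> SL2Z h -> 0 < complex.Im z ->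
  slashZ k (g *m h) f z = slashZ k h (slashZ k g f) z.
Proof.
by move=> gS hS z0; rewrite /slashZ map_mxM slashM// SL2Z_det_gt0.
Qed.

Lemma slashZ_eq k (g : 'M[int]_2) f1 f2 z : SL2Z g -> 0 < complex.Im z ->
  (forall w, 0 < complex.Im w -> f1 w = f2 w) -> slashZ k g f1 z = slashZ k g f2 z.
Proof. by move=> gS z0; apply: slash_eq => //; exact: SL2Z_det_gt0. Qed.

Lemma slashZ_hol k (g : 'M[int]_2) f : SL2Z g -> hol f -> hol (slashZ k g f).
Proof. by move=> gS; apply: slash_hol; exact: SL2Z_det_gt0. Qed.

End Slash.

(** * Eisenstein series *)

Section Eisenstein.
Variable R : realType.
Local Notation C := R[i].
Implicit Types (phi : int -> int -> bool) (z : C).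

Definition csum (I : eqType) (f : I -> C) : C := xget 0 [set S | hasSum f S].

Lemma csumP (I : eqType) (f : I -> C) : absum f -> hasSum f (csum f).
Proof.
by move=> /absum_hasSum[S HS]; rewrite /csum; case: xgetP => [T _ //|/(_ S)].
Qed.

Lemma csumE (I : eqType) (f : I -> C) S : hasSum f S -> csum f = S.
Proof.
move=> H; rewrite /csum; case: xgetP => [T _ HT|/(_ S)//].
exact: hasSum_unique HT H.
Qed.

(* the term at (0, 0) is 0^-k.+1 = 0 *)
Definition eis_term k phi z (p : int * int) : C :=
  (phi p.1 p.2)%:R * (p.1%:~R * z + p.2%:~R) ^- k.+1.

(* of weight k.+1 *)
Definition eis k phi z : C := (lip R k)^-1 * csum (eis_term k phi z).

Lemma lattice_bound z : 0 < complex.Im z -> exists2 K : R, 0 < K & forall m n : int,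
  m%:~R ^+ 2 + n%:~R ^+ 2 <= K * cn (m%:~R * z + n%:~R) ^+ 2.
Proof.
move=> z0; pose y := complex.Im z; exists ((y^-1) ^+ 2 + (1 + cn z / y) ^+ 2).
  by rewrite ltr_pwDl ?exprn_gt0 ?invr_gt0// sqr_ge0.
move=> m n; set u := cn (m%:~R * z + _).
have my : `|m%:~R| * y <= u.
  have := Im_le_cn (m%:~R * z + n%:~R); rewrite -/u.
  rewrite -!(rmorph_int (real_complex R)) cImD cImM /= mul0r !addr0 normrM.
  by rewrite (ger0_norm (ltW z0)).
have my' : `|m%:~R| <= u * y^-1 by rewrite ler_pdivlMr.
have nu : `|n%:~R| <= u * (1 + cn z / y).
  have := cnB (m%:~R * z + n%:~R) (m%:~R * z); rewrite addrC addKr cnM -/u.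
  rewrite -!(rmorph_int (real_complex R)) !cn_real => /le_trans; apply.
  rewrite mulrDr mulr1 lerD2l mulrCA mulrC.
  by rewrite ler_wpM2l ?cn_ge0.
have sq (a b : R) : `|a| <= b -> a ^+ 2 <= b ^+ 2.
  move=> ab; rewrite -real_normK ?num_real// lerXn2r// nnegrE ?normr_ge0//.
  exact: le_trans ab.
rewrite mulrDl -!exprMn ![_ * u]mulrC; exact: lerD (sq _ _ my') (sq _ _ nu).
Qed.

(** For (m, n) nonzero, |mz + n|^4 is at least a constant times (1 + m^2) (1 + n^2), whose inverse
    is a product of summable families; hence the weights from 4 on. *)
Lemma absum_lattice k z : 0 < complex.Im z -> (3 <= k)%N ->
  absum (fun p : int * int => (p.1%:~R * z + p.2%:~R) ^- k.+1).
Proof.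
move=> z0 k3; have [K K0 HK] := lattice_bound z0.
have intS : absum (fun n : int => (1 + n%:~R ^+ 2 : C)^-1).
  have E (m : R) : cn (1 + (m%:C) ^+ 2 : C)^-1 = (1 + m ^+ 2)^-1.
    rewrite cnV (_ : 1 + (m%:C) ^+ 2 = (1 + m ^+ 2)%:C); last first.
      by rewrite rmorphD rmorph1 rmorphXn.
    by rewrite cn_real ger0_norm// addr_ge0// sqr_ge0.
  apply: absum_int; first exact: absum_inv_sqr_nat.
  apply: (absum_le _ (absum_inv_sqr_nat R)) => n /=.
  rewrite -(rmorph_int (real_complex R)) -(rmorph_nat (real_complex R)) !E.
  rewrite lef_pV2 ?posrE ?ltr_wpDr ?sqr_ge0// lerD2l mulrNz sqrrN.
  by rewrite lerXn2r// ?nnegrE// ler_nat.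
pose A := 3 * K ^+ 2 * (K + 1) ^+ (k - 3).
have A0 : 0 <= A.
  by rewrite mulr_ge0 ?exprn_ge0 ?mulr_ge0 ?sqr_ge0//; lra.
apply: (absum_le (g := fun p : int * int => A%:C * ((1 + p.1%:~R ^+ 2)^-1 * (1 + p.2%:~R ^+ 2)^-1))).
  move=> [m n] /=; set u := m%:~R * z + n%:~R.
  have E (j : int) : cn (1 + j%:~R ^+ 2 : C)^-1 = (1 + j%:~R ^+ 2)^-1.
    rewrite cnV (_ : 1 + j%:~R ^+ 2 = (1 + j%:~R ^+ 2)%:C); last first.
      by rewrite rmorphD rmorph1 rmorphXn rmorph_int.
    by rewrite cn_real ger0_norm// addr_ge0// sqr_ge0.
  rewrite cnV cnX 2!cnM !E cn_real (ger0_norm A0) -invfM.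
  have s0 (j : int) : 0 < 1 + (j%:~R : R) ^+ 2 by rewrite ltr_wpDr ?sqr_ge0.
  have [u0|u0] := eqVneq u 0.
    by rewrite u0 cn0 expr0n invr0 mulr_ge0// invr_ge0 mulr_ge0// ltW.
  have cu0 : 0 < cn u by rewrite cn_gt0.
  rewrite ler_pdivlMr ?mulr_gt0// mulrC ler_pdivrMr ?exprn_gt0//.
  have t1 : 1 <= (m%:~R : R) ^+ 2 + n%:~R ^+ 2.
    have [m0|m0] := eqVneq m 0; last first.
      have : 1 <= (m%:~R : R) ^+ 2.
        by rewrite -rmorphXn /= -[1]/(1%:~R) ler_int; nia.
      have := sqr_ge0 (n%:~R : R); lra.
    have n0 : n != 0.
      by apply: contraNneq u0 => n0; rewrite /u m0 n0 mul0r addr0.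
    have : 1 <= (n%:~R : R) ^+ 2 by rewrite -rmorphXn /= -[1]/(1%:~R) ler_int; nia.
    have := sqr_ge0 (m%:~R : R); lra.
  have Ku := HK m n; rewrite -/u in Ku.
  have m2 := sqr_ge0 (m%:~R : R); have n2 := sqr_ge0 (n%:~R : R).
  move: (m%:~R ^+ 2 : R) (n%:~R ^+ 2 : R) m2 n2 t1 Ku => a b a0 b0 ab Ku.
  have h1 : (1 + a) * (1 + b) <= 3 * (a + b) ^+ 2 by nra.
  have h2 : (a + b) ^+ 2 <= (K * cn u ^+ 2) ^+ 2.
    by rewrite lerXn2r// nnegrE ?addr_ge0// mulr_ge0 ?sqr_ge0// ltW.
  have h3 : 1 <= (K + 1) * cn u.
    have : 1 <= K * cn u ^+ 2 by lra.
    have [u1|u1] := leP 1 (cn u); first by nra.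
    rewrite expr2; nra.
  have h4 : 1 <= ((K + 1) * cn u) ^+ (k - 3) by rewrite exprn_ege1.
  apply: (le_trans h1).
  have -> : A * cn u ^+ k.+1 = 3 * (K * cn u ^+ 2) ^+ 2 * ((K + 1) * cn u) ^+ (k - 3).
    have -> : cn u ^+ k.+1 = cn u ^+ 4 * cn u ^+ (k - 3) by rewrite -exprD; congr (_ ^+ _); lia.
    rewrite /A [((K + 1) * _) ^+ _]exprMn; ring.
  by rewrite -[leLHS]mulr1 ler_pM ?mulr_ge0 ?sqr_ge0 ?addr_ge0// ler_wpM2l.
apply: absumcM; exact: (absum_prod intS intS).
Qed.

Lemma absum_eis k phi z : 0 < complex.Im z -> (3 <= k)%N -> absum (eis_term k phi z).
Proof.
move=> z0 k3; apply: (absum_le _ (absum_lattice z0 k3)) => p; rewrite /eis_term cnM.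
by case: (phi _ _); rewrite ?cn1 ?mul1r// cn0 mul0r cn_ge0.
Qed.

(** [phi] at the row vector (m, n) g^-1, for g of determinant 1. *)
Definition phi_act (g : 'M[int]_2) phi : int -> int -> bool := fun m n =>
  phi (m * g 1 1 - n * g 1 0) (n * g 0 0 - m * g 0 1).

(** Right multiplication by g permutes the pairs (m, n). Since [phi] is arbitrary, all transforms
    stay in the same class, and one expansion formula covers all cusps. *)
Lemma eis_modular k phi (g : 'M[int]_2) z : (3 <= k)%N -> SL2Z g -> 0 < complex.Im z ->
  slashZ k.+1 g (eis k phi) z = eis k (phi_act g phi) z.
Proof.
move=> k3 gS z0; have dg : g 0 0 * g 1 1 - g 0 1 * g 1 0 = 1 by rewrite -det2.
have w0 := mobius_upper (SL2Z_det_gt0 R gS) z0.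
have a0 := @automorphy_neq0 R (map_mx intr g) z (lt0r_neq0 (SL2Z_det_gt0 R gS)) z0.
rewrite slashZE// /eis mulrCA; congr (_ * _).
set w := _ / _; set a := (g 1 0)%:~R * z + _.
have wE : mobius (map_mx intr g) z = w.
  by rewrite /mobius /automorphy_factor !mxE !(rmorph_int (real_complex R)).
have aE : automorphy_factor (map_mx intr g : 'M[R]_2) z = a.
  by rewrite /automorphy_factor !mxE !(rmorph_int (real_complex R)).
rewrite wE in w0; rewrite aE in a0.
have H := csumP (absum_eis phi w0 k3).
apply/esym/csumE; pose h (p : int * int) := (p.1 * g 0 0 + p.2 * g 1 0, p.1 * g 0 1 + p.2 * g 1 1).
apply: (@hasSum_bij R _ _ h).
  exists (fun p => (p.1 * g 1 1 - p.2 * g 1 0, p.2 * g 0 0 - p.1 * g 0 1)) => -[m n] /=;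
    rewrite /h /=; congr pair; rewrite -[RHS]mulr1 -dg; ring.
apply: hasSum_ext (hasSumcM (a ^- k.+1) H) => -[m n].
rewrite /eis_term /h /phi_act /=.
have -> : (m * g 0 0 + n * g 1 0) * g 1 1 - (m * g 0 1 + n * g 1 1) * g 1 0 = m.
  by rewrite -[RHS]mulr1 -dg; ring.
have -> : (m * g 0 1 + n * g 1 1) * g 0 0 - (m * g 0 0 + n * g 1 0) * g 0 1 = n.
  by rewrite -[RHS]mulr1 -dg; ring.
rewrite mulrCA; congr (_ * _); rewrite -invfM -exprMn; congr (_ ^- _).
rewrite mulrC mulrDl -mulrA /w divfK// /a !intrD !intrM; ring.
Qed.

End Eisenstein.

(** * Fourier expansions of Eisenstein series *)

Section EisensteinExpansion.
Variable R : realType.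
Local Notation C := R[i].
Implicit Types (phi : int -> int -> bool) (z : C).

Lemma hasSum_residues (M : nat) (g : int -> C) (S : 'I_M -> C) : (0 < M)%N ->
  (forall i : 'I_M, hasSum (fun j : int => g (i%:Z + M%:Z * j)) (S i)) ->
  hasSum g (\sum_i S i).
Proof.
move=> M0 H; pose f (i : 'I_M) (n : int) := if (n %% M)%Z == i%:Z then g n else 0.
have Hf i : hasSum (f i) (S i).
  apply: (@hasSum_inj R _ _ (fun j : int => i%:Z + M%:Z * j)).
  - by move=> a b /addrI /mulfI; apply; lia.
  - move=> j nj; rewrite /f; case: eqP => // ji; case: (nj (j %/ M)%Z).
    by rewrite -ji addrC mulrC -divz_eq.
  - apply: hasSum_ext (H i) => j; rewrite /f /= mulrC addrC modzMDl modz_small ?eqxx//.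
    by rewrite ltz_nat ltn_ord.
apply: hasSum_ext (hasSum_sum (index_enum 'I_M) predT Hf) => n.
have n1 : (0 <= (n %% M)%Z) by apply: modz_ge0; lia.
have n2 : (`|(n %% M)%Z| < M)%N by have := @ltz_pmod n M; lia.
rewrite (bigD1 (Ordinal n2))//= big1 ?addr0.
  by rewrite /f /= ifT//; apply/eqP; lia.
move=> i /eqP ni; rewrite /f; case: eqP => // e; case: ni; apply: val_inj => /=.
by rewrite e.
Qed.

Lemma hasSum_inj_rev (I J : eqType) (h : I -> J) (f : J -> C) S : injective h ->
  absum f -> (forall j, (forall i, h i <> j) -> f j = 0) -> hasSum f S -> hasSum (f \o h) S.
Proof.
move=> hI af f0 HS; have [T HT] := absum_hasSum (absum_sub hI af).
by rewrite (hasSum_unique HS (hasSum_inj hI f0 HT)).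
Qed.

Lemma sum_residue_unit (V : zmodType) (M s : nat) (g : int -> V) : (0 < M)%N -> coprime s M ->
  (forall n, g (n + M%:Z) = g n) -> \sum_(i < M) g i%:Z = \sum_(i < M) g (s%:Z * i%:Z).
Proof.
move=> M0 sM gM.
have gMz n (j : nat) : g (n + j%:Z * M%:Z) = g n.
  by elim: j => [|j IH]; rewrite ?mul0r ?addr0// -addn1 PoszD mulrDl mul1r addrA gM.
have gmod (n : nat) : g n%:Z = g (n %% M)%N%:Z.
  by rewrite {1}(divn_eq n M) PoszD PoszM addrC gMz.
pose h (i : 'I_M) : 'I_M := Ordinal (ltn_pmod (s * i) M0).
rewrite (reindex_inj (h := h)) /=; last first.
  move=> i j /(congr1 val) /= /eqP ij; apply: val_inj => /=.
  wlog ltij : i j ij / (i <= j)%N.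
    by move=> W; case: (leqP i j) => [|/ltnW] ?; [exact: W|apply/esym/W; rewrite // eq_sym].
  move: ij; rewrite eq_sym eqn_mod_dvd ?leq_mul2l ?ltij ?orbT// -mulnBr Gauss_dvdr; last first.
    by rewrite coprime_sym.
  have := ltn_ord j; case: (posnP (j - i)) => [|d0 jM /dvdn_leq]; first lia.
  by move=> /(_ d0); lia.
by apply: eq_bigr => i _; rewrite -PoszM [RHS]gmod.
Qed.

(** Coefficients in powers of q^(1/M). The row m = 0 gives the constant term; the sign (-1)^(k+1)
    comes from the rows m < 0, folded onto m > 0 by (m, n) -> (-m, -n). *)
Definition eis_coef k M phi (N : nat) : C := if N == 0%N
  then (lip R k)^-1 * csum (fun n : int => (phi 0 n)%:R * n%:~R ^- k.+1)
  else M%:R ^- k.+1 * \sum_(d <- divisors N) (N %/ d)%:R ^+ k *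
    \sum_(i < M) ((phi d%:Z i%:Z)%:R + (-1) ^+ k.+1 * (phi (- d%:Z) (- i%:Z))%:R) *
      zeta R M ^+ (N %/ d * i).

Lemma per_int (M : nat) (P : int -> bool) : (forall n, P (n + M%:Z) = P n) ->
  forall n j, P (n + M%:Z * j) = P n.
Proof.
move=> PM n [j|j].
  by elim: j => [|j IH]; rewrite ?mulr0 ?addr0// -addn1 PoszD mulrDr mulr1 addrA PM.
rewrite NegzE; elim: j.+1 => [|{}j IH]; first by rewrite oppr0 mulr0 addr0.
by rewrite -IH -(PM (n + M%:Z * - j.+1%:Z)); congr P; rewrite -addn1 PoszD; ring.
Qed.

Lemma row_sum k (M m : nat) (P : int -> bool) z : (0 < k)%N -> (0 < M)%N -> (0 < m)%N ->
  0 < complex.Im z -> (forall n, P (n + M%:Z) = P n) ->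
  hasSum (fun n : int => (P n)%:R * (m%:R * z + n%:~R) ^- k.+1)
    (\sum_(i < M) (P i%:Z)%:R * (M%:R ^- k.+1 * (lip R k * Li k (qpar M z ^+ m * zeta R M ^+ i)))).
Proof.
move=> k0 M0 m0 z0 PM; have MC : M%:R != 0 :> C by rewrite pnatr_eq0 -lt0n.
apply: hasSum_residues => // i.
have w0 : 0 < complex.Im ((m%:R * z + i%:R) / M%:R).
  rewrite (_ : _ / M%:R = (m%:R * z + (i%:R)%:C) * (M%:R^-1)%:C); last first.
    by rewrite fmorphV !rmorph_nat.
  rewrite cImM cImD -(rmorph_nat (real_complex R)) cImM /= !mul0r mulr0 add0r !addr0.
  by rewrite divr_gt0 ?mulr_gt0 ?ltr0n.
have := lipschitz_sum k0 w0.
rewrite mulrDl nomeD -zetaX -mulrA nomeMn -/(qpar M z) => H.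
apply: hasSum_ext (hasSumcM (P i%:Z)%:R (hasSumcM (M%:R ^- k.+1) H)) => j /=.
rewrite per_int//; congr (_ * _); rewrite -invfM -exprMn; congr (_ ^- _).
rewrite mulrDr mulrDr mulrA mulrCA mulfV// mulr1 [M%:R * (i%:R / _)]mulrCA mulfV// mulr1.
by rewrite intrD intrM -!pmulrn addrA.
Qed.

Lemma Li_succ k (q : C) : (0 < k)%N -> cn q < 1 ->
  hasSum (fun j : nat => j.+1%:R ^+ k * q ^+ j.+1) (Li k q).
Proof.
move=> k0 q1; apply: (@hasSum_inj_rev _ _ succn _ _ succn_inj (absum_pow k q1) _ (LiE k q1)).
by move=> [|j] H; [rewrite expr0n eqn0Ngt k0 mul0r|case: (H j)].
Qed.

Let pairterm k M phi (n j : nat) : C := M%:R ^- k.+1 * (j%:R ^+ k *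
    \sum_(i < M) ((phi n%:Z i%:Z)%:R + (-1) ^+ k.+1 * (phi (- n%:Z) (- i%:Z))%:R) *
      zeta R M ^+ (j * i)).

Let cn_pairterm k M phi n j : (0 < M)%N -> cn (pairterm k M phi n j) <= 2 * j%:R ^+ k.
Proof.
move=> M0; have Mk : 0 < M%:R ^+ k.+1 :> R by rewrite exprn_gt0 ?ltr0n.
rewrite /pairterm cnM cnV cnX cn_nat ler_pdivrMl// cnM cnX cn_nat.
rewrite mulrA [leRHS]mulrC ler_wpM2l ?exprn_ge0//.
apply: (le_trans (cn_sum _ _ _)); apply: (@le_trans _ _ (\sum_(i < M) 2)).
  apply: ler_sum => i _; rewrite cnM cnX (_ : cn (zeta R M) = 1) ?expr1n ?mulr1; last first.
    by rewrite /zeta -(rmorph_nat (real_complex R)) -fmorphV cn_nome_real.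
  apply: (le_trans (cnD _ _)); rewrite cnM cnX cnN cn1 expr1n mul1r !cn_nat.
  by case: (phi _ _); case: (phi _ _) => /=; lra.
rewrite sumr_const card_ord -[leLHS]mulr_natr mulrC ler_wpM2r//.
by rewrite exprS ler_peMr// exprn_ege1// ler1n.
Qed.

(** Each row is summed by the Lipschitz formula on the classes of n modulo M. This gives a double
    series over the row d and the exponent j of [Li], regrouped by N = d j. *)
Lemma eis_qseries k M phi : (3 <= k)%N -> (0 < M)%N ->
  (forall m n, phi m (n + M%:Z) = phi m n) -> qseries M (eis_coef k M phi) (eis k phi).
Proof.
move=> k3 M0 phiM z z0; have k0 : (0 < k)%N by apply: leq_trans k3.
have lk := lip_neq0 R k.
set q := qpar M z; have q1 : cn q < 1 by exact: cn_qpar_lt1.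
have HT := csumP (absum_eis phi z0 k3); set T := csum _ in HT.
pose phi' m n := phi (- m) (- n).
have phi'M m n : phi' m (n + M%:Z) = phi' m n.
  rewrite /phi' (_ : - (n + M%:Z) = - n + M%:Z * (-1)) ?per_int//; ring.
pose R0 : C := csum (fun n : int => (phi 0 n)%:R * n%:~R ^- k.+1).
pose Rw (P : int -> int -> bool) (m : nat) := \sum_(i < M) (P m%:Z i%:Z)%:R *
  (M%:R ^- k.+1 * (lip R k * Li k (q ^+ m * zeta R M ^+ i))).
pose row (n : int) := match n with Posz 0 => R0 | Posz m => Rw phi m
  | Negz m => (-1) ^+ k.+1 * Rw phi' m.+1 end.
have Hrow n : hasSum (fun j => eis_term k phi z (n, j)) (row n).
  case: n => [[|m]|m].
  - have HR : hasSum (fun j => eis_term k phi z (0, j)) R0.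
      suff -> : R0 = csum (fun j => eis_term k phi z (0, j)).
        apply: csumP; apply: (@absum_sub _ _ _ (fun j : int => (0 : int, j)) _ _ (absum_eis phi z0 k3)).
        by move=> i j [].
      by congr csum; apply/funext => n; rewrite /eis_term /= mul0r add0r.
    exact: HR.
  - apply: hasSum_ext (row_sum k0 M0 (ltn0Sn m) z0 (phiM _)) => j.
    by rewrite /eis_term /= -pmulrn.
  - apply: (@hasSum_bij R _ _ (fun j : int => - j)); first by exists (fun j : int => - j) => j; rewrite opprK.
    apply: hasSum_ext (hasSumcM ((-1) ^+ k.+1) (row_sum k0 M0 (ltn0Sn m) z0 (phi'M _))) => j.
    rewrite /eis_term /= /phi' NegzE mulrCA; congr (_ * _).
    rewrite -[(-1) ^+ k.+1]invrK -exprVn invrN1 -invfM -exprMn; congr (_ ^- _).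
    by rewrite !mulrNz mulN1r opprD mulNr.
have H0 : hasSum row T by exact: hasSum_fubini HT Hrow.
have H1 : hasSum (fun n : int => if n == 0 then 0 else row n) (T - R0).
  have HF := @hasSum_finite R _ (fun n : int => if n == 0 then R0 else 0) [:: 0] isT.
  have := hasSumD H0 (hasSumcM (-1) (HF _)).
  rewrite big_seq1 eqxx mulN1r => H1; apply: hasSum_ext (H1 _) => [n|].
    by case: eqP => [->|_]; rewrite ?mulr0 ?addr0//= mulN1r subrr.
  by move=> n; rewrite inE => /negbTE ->.
have H2 : hasSum (fun n : nat => row n.+1 + row (Negz n)) (T - R0).
  pose fib (n : nat) : seq int := if n is 0 then [:: 0; 1; -1] else [:: n.+1%:Z; Negz n].
  have := @hasSum_fibers R _ _ _ (fun n : int => (absz n).-1) fib _ _ _ H1.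
  move=> /(_ _)/wrap[|]; first by case.
  move=> /(_ _)/wrap[|H2].
    by move=> [|n] i; rewrite !inE; lia.
  apply: hasSum_ext H2 => -[|n]; rewrite /fib !big_cons big_nil addr0 ?add0r//.
have H3 n : hasSum (fun j => pairterm k M phi n.+1 j.+1 * q ^+ (n.+1 * j.+1))
    ((lip R k)^-1 * (row n.+1 + row (Negz n))).
  have qz (i : nat) : cn (q ^+ n.+1 * zeta R M ^+ i) < 1.
    rewrite cnM !cnX (_ : cn (zeta R M) = 1) ?expr1n ?mulr1; last first.
      by rewrite /zeta -(rmorph_nat (real_complex R)) -fmorphV cn_nome_real.
    by rewrite exprn_ilt1 ?cn_ge0.
  pose a (i : nat) : C := (phi n.+1%:Z i%:Z)%:R + (-1) ^+ k.+1 * (phi (- n.+1%:Z) (- i%:Z))%:R.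
  have -> : (lip R k)^-1 * (row n.+1 + row (Negz n)) =
      \sum_(i < M) (M%:R ^- k.+1 * a i) * Li k (q ^+ n.+1 * zeta R M ^+ i).
    rewrite /row /Rw mulr_sumr -big_split mulr_sumr; apply: eq_bigr => i _.
    rewrite /a /phi' /=; apply: (mulfI lk); rewrite mulVKf//.
    move: (M%:R ^- k.+1) ((-1) ^+ k.+1) (Li _ _) => x y v; ring.
  have := hasSum_sum (index_enum 'I_M) predT (fun i : 'I_M => hasSumcM (M%:R ^- k.+1 * a i) (Li_succ k0 (qz i))).
  apply: hasSum_ext => j; rewrite /pairterm !mulr_sumr mulr_suml; apply: eq_bigr => i _.
  rewrite -/(a i) [(_ * zeta R M ^+ i) ^+ _]exprMn -exprM -[(zeta R M ^+ i) ^+ _]exprM [(i * _)%N]mulnC.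
  ring.
have H4 : absum (fun x : nat * nat => pairterm k M phi x.1.+1 x.2.+1 * q ^+ (x.1.+1 * x.2.+1)).
  apply: (@absum_le R _ _ (fun x : nat * nat => (x.1%:R ^+ 0 * q ^+ x.1) * (2%:R * (x.2.+1%:R ^+ k * q ^+ x.2.+1)))).
    move=> [n j] /=; have := cn_pairterm k phi n.+1 j.+1 M0.
    move: (pairterm _ _ _ _ _) => w Hw; rewrite expr0 mul1r !cnM !cnX !cn_nat.
    apply: (@le_trans _ _ (2 * j.+1%:R ^+ k * cn q ^+ (n.+1 * j.+1))).
      by rewrite ler_wpM2r ?exprn_ge0 ?cn_ge0.
    have -> : cn q ^+ n * (2 * (j.+1%:R ^+ k * cn q ^+ j.+1)) =
        2 * j.+1%:R ^+ k * (cn q ^+ n * cn q ^+ j.+1) by ring.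
    apply: ler_wpM2l; first by rewrite mulr_ge0 ?exprn_ge0.
    rewrite -exprD; apply: ler_wiXn2l; rewrite ?cn_ge0 ?(ltW q1)//.
    by nia.
  exact: (absum_prod (absum_pow 0 q1) (absumcM 2%:R (absum_sub succn_inj (absum_pow k q1)))).
have [S HS] := absum_hasSum H4.
have SE : S = (lip R k)^-1 * (T - R0).
  exact: hasSum_unique (hasSum_fubini HS H3) (hasSumcM _ H2).
pose fib N := if N == 0%N then [::] else [seq (d.-1, (N %/ d).-1) | d <- divisors N].
have H5 := @hasSum_fibers R _ _ _ (fun x : nat * nat => x.1.+1 * x.2.+1)%N fib _ _ _ HS.
move: H5 => /(_ _)/wrap[|].
  move=> N; rewrite /fib; case: posnP => // N0.
  rewrite map_inj_in_uniq ?divisors_uniq// => i j; rewrite -!dvdn_divisors// => iN jN [].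
  have := dvdn_gt0 N0 iN; have := dvdn_gt0 N0 jN; lia.
move=> /(_ _)/wrap[|].
  move=> N [i j] /=; rewrite /fib; case: posnP => [->|N0]; first by rewrite in_nil muln_eq0.
  apply/mapP/eqP => [[d + [-> ->]]|<-].
    rewrite -dvdn_divisors// => dN.
    have d0 := dvdn_gt0 N0 dN.
    have q0 : (0 < N %/ d)%N by rewrite (divn_gt0 _ d0); exact: dvdn_leq.
    by rewrite (prednK d0) (prednK q0) mulnC divnK.
  by exists i.+1; rewrite -?dvdn_divisors ?dvdn_mulr ?muln_gt0// mulKn.
move=> H5.
have H6 := @hasSum_finite R _ (fun n : nat => if n == 0%N then (lip R k)^-1 * R0 else 0) [:: 0%N] isT.
move: H6 => /(_ _)/wrap[|]; first by move=> n; rewrite inE => /negbTE ->.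
rewrite big_seq1 eqxx => H6; have := hasSumD H6 H5.
have -> : eis k phi z = (lip R k)^-1 * R0 + S.
  by rewrite SE mulrBr addrC subrK.
apply: hasSum_ext => -[|N].
  by rewrite big_nil addr0 expr0 mulr1.
rewrite add0r /eis_coef /fib /= big_map mulr_sumr mulr_suml /= big_seq [RHS]big_seq.
apply: eq_bigr => d; rewrite -dvdn_divisors// => dN.
have d0 := dvdn_gt0 (ltn0Sn N) dN.
have dV : (0 < N.+1 %/ d)%N by rewrite (divn_gt0 _ d0); exact: dvdn_leq.
by rewrite (prednK d0) (prednK dV) [(d * _)%N]mulnC (divnK dN).
Qed.

End EisensteinExpansion.

(** * Rational families of Fourier series *)

Section RationalFamilies.
Variable R : realType.
Local Notation C := R[i].
Variables (F : divringClosed C) (p : nat).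
Implicit Types (phi : int -> int -> bool) (z : C) (g h : nat -> C -> C).

Lemma qseriesM M a b (f h : C -> C) : (0 < M)%N -> qseries M a f -> qseries M b h ->
  qseries M (fun n => \sum_(i < n.+1) a i * b (n - i)%N) (fun z => f z * h z).
Proof.
move=> M0 Hf Hh z z0; have q1 := cn_qpar_lt1 M0 z0.
have aa := radius1_absum (qseries_radius M0 Hf) q1.
have ab := radius1_absum (qseries_radius M0 Hh) q1.
have H := hasSum_prod aa ab (Hf z z0) (Hh z z0).
pose fib (n : nat) := [seq (i, (n - i)%N) | i <- iota 0 n.+1].
have := @hasSum_fibers R _ _ _ (fun x : nat * nat => x.1 + x.2)%N fib _ _ _ H.
move=> /(_ _)/wrap[|].
  by move=> n; rewrite map_inj_uniq ?iota_uniq// => i j [].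
move=> /(_ _)/wrap[|].
  move=> n [i j] /=; apply/mapP/eqP => [[l]|<-].
    by rewrite mem_iota => ln [-> ->]; rewrite subnKC//; lia.
  by exists i; rewrite ?mem_iota ?addKn//; lia.
apply: hasSum_ext => n; rewrite /fib big_map -[iota 0 n.+1]/(index_iota 0 n.+1) big_mkord.
rewrite mulr_suml; apply: eq_bigr => i _ /=.
have -> : qpar M z ^+ n = qpar M z ^+ i * qpar M z ^+ (n - i).
  by rewrite -exprD subnKC// -ltnS.
ring.
Qed.

Lemma qseries_eq0 M b (f : C -> C) : qseries M b f -> (forall n, b n = 0) -> null f.
Proof.
move=> H b0 z z0; apply: hasSum_unique (H z z0) _.
by apply: hasSum_ext (@hasSum0 R _) => n; rewrite b0 mul0r.
Qed.

Lemma null_qseries M b (f : C -> C) : (0 < M)%N -> qseries M b f -> null f ->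
  forall n, b n = 0.
Proof.
move=> M0 H f0; have As := qseries_asymp M0 H; elim/ltn_ind => n IH.
have [K [Y HK]] := As n.+1.
apply/eqP; rewrite -cn_eq0 eq_le cn_ge0 andbT; apply/ler_addgt0Pr => e e0; rewrite add0r.
pose y := Num.max 1 (Num.max Y (`|K| * M%:R / e)).
have [y1 [yY yK]] : 1 <= y /\ (Y <= y /\ `|K| * M%:R / e <= y) by rewrite !le_max !lexx ?orbT.
have y0 : 0 < y by apply: lt_le_trans y1.
have := HK (0 +i* y) yY; rewrite f0//= sub0r cnN big_ord_recr /= big1 ?add0r; last first.
  by move=> i _; rewrite IH// mul0r.
set q := qpar M _; have MR : 0 < M%:R :> R by rewrite ltr0n.
have pi2 := pi_ge2 R.
have qE : cn q = expR (- (2 * pi * (y / M%:R))) by rewrite cn_qpar.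
have q0 : 0 < cn q by rewrite qE expR_gt0.
rewrite cnM cnX exprS mulrA ler_pM2r ?exprn_gt0// => /le_trans; apply.
apply: (@le_trans _ _ (`|K| * (M%:R / y))).
  apply: (@le_trans _ _ (`|K| * cn q)); first by rewrite ler_wpM2r ?ler_norm ?cn_ge0.
  rewrite ler_wpM2l// qE expRN -[leRHS]invf_div lef_pV2 ?posrE ?expR_gt0 ?divr_gt0//.
  apply: le_trans (expR_ge1Dx _).
  have yM : 0 < y / M%:R by rewrite divr_gt0.
  have : y / M%:R * 1 <= y / M%:R * (2 * pi) by rewrite ler_pM2l//; lra.
  by rewrite mulr1 [_ * (2 * pi)]mulrC; lra.
by rewrite mulrA ler_pdivrMr// [e * y]mulrC -ler_pdivrMr.
Qed.

(** The index s plays the part of the conjugation taking zeta to zeta^s, which the polynomials [A n]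
    make explicit. [M] is the denominator of the exponents of q, [M'] the order of zeta. *)
Definition ratfam M M' g := exists A : nat -> {poly C}, (forall n, A n \is a polyOver F) /\
  forall s, coprime s p -> qseries M (fun n => (A n).[zeta R M' ^+ s]) (g s).

Lemma ratfam_eq M M' g h : (forall s z, coprime s p -> 0 < complex.Im z -> g s z = h s z) ->
  ratfam M M' g -> ratfam M M' h.
Proof. by move=> gh [A [AF H]]; exists A; split=> // s sp z z0; rewrite -gh//; exact: H. Qed.

Lemma ratfamD M M' g h : ratfam M M' g -> ratfam M M' h ->
  ratfam M M' (fun s z => g s z + h s z).
Proof.
move=> [A [AF Hg]] [B [BF Hh]]; exists (fun n => A n + B n); split=> [n|s sp z z0].
  by rewrite rpredD.
by apply: hasSum_ext (hasSumD (Hg s sp z z0) (Hh s sp z z0)) => n; rewrite hornerD mulrDl.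
Qed.

Lemma ratfamM M M' g h : (0 < M)%N -> ratfam M M' g -> ratfam M M' h ->
  ratfam M M' (fun s z => g s z * h s z).
Proof.
move=> M0 [A [AF Hg]] [B [BF Hh]]; exists (fun n => \sum_(i < n.+1) A i * B (n - i)%N).
split=> [n|s sp z z0]; first by apply: rpred_sum => i _; rewrite rpredM.
apply: hasSum_ext (qseriesM M0 (Hg s sp) (Hh s sp) z0) => n; congr (_ * _).
by rewrite horner_sum; apply: eq_bigr => i _; rewrite hornerM.
Qed.

Lemma ratfam_cst M M' c : c \in F -> ratfam M M' (fun _ _ => c).
Proof.
move=> cF; exists (fun n => if n == 0%N then c%:P else 0); split=> [n|s sp z z0].
  by case: eqP => _; rewrite ?rpred0 ?polyOverC.
have := @hasSum_finite R _ (fun n : nat => (if n == 0%N then c%:P else 0).[zeta R M' ^+ s] * qpar M z ^+ n) [:: 0%N] isT.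
move=> /(_ _)/wrap[|]; first by move=> n; rewrite inE => /negbTE ->; rewrite horner0 mul0r.
by rewrite big_seq1 eqxx hornerC mulr1.
Qed.

Lemma ratfamcM M M' c g : (0 < M)%N -> c \in F -> ratfam M M' g ->
  ratfam M M' (fun s z => c * g s z).
Proof. by move=> M0 cF H; apply: ratfamM => //; exact: ratfam_cst. Qed.

Lemma ratfamX M M' g n : (0 < M)%N -> ratfam M M' g -> ratfam M M' (fun s z => g s z ^+ n).
Proof.
move=> M0 H; elim: n => [|n IH]; first by apply: ratfam_eq (ratfam_cst M M' (rpred1 F)).
by apply: ratfam_eq (ratfamM M0 H IH) => s z _ _; rewrite exprS.
Qed.

Lemma ratfam_sum (I : Type) (r : seq I) (P : pred I) M M' (g : I -> nat -> C -> C) :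
  (0 < M)%N -> (forall i, P i -> ratfam M M' (g i)) ->
  ratfam M M' (fun s z => \sum_(i <- r | P i) g i s z).
Proof.
move=> M0 H; elim: r => [|i r IH].
  by apply: ratfam_eq (ratfam_cst M M' (rpred0 F)) => s z _ _; rewrite big_nil.
case Pi: (P i).
  by apply: ratfam_eq (ratfamD (H i Pi) IH) => s z _ _; rewrite big_cons Pi.
by apply: ratfam_eq IH => s z _ _; rewrite big_cons Pi.
Qed.

Lemma ratfam_prod (I : Type) (r : seq I) (P : pred I) M M' (g : I -> nat -> C -> C) :
  (0 < M)%N -> (forall i, P i -> ratfam M M' (g i)) ->
  ratfam M M' (fun s z => \prod_(i <- r | P i) g i s z).
Proof.
move=> M0 H; elim: r => [|i r IH].
  by apply: ratfam_eq (ratfam_cst M M' (rpred1 F)) => s z _ _; rewrite big_nil.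
case Pi: (P i).
  by apply: ratfam_eq (ratfamM M0 (H i Pi) IH) => s z _ _; rewrite big_cons Pi.
by apply: ratfam_eq IH => s z _ _; rewrite big_cons Pi.
Qed.

Lemma zeta_raise M e : (0 < e)%N -> zeta R (M * e) ^+ e = zeta R M.
Proof.
by move=> e0; rewrite zetaX /zeta natrM invfM mulrCA mulfV ?mulr1// pnatr_eq0 -lt0n.
Qed.

Lemma ratfam_raise M M' e g : (0 < M')%N -> (0 < e)%N -> ratfam M M' g -> ratfam M (M' * e) g.
Proof.
move=> M0 e0 [A [AF H]]; exists (fun n => A n \Po 'X^e); split=> [n|s sp z z0].
  by rewrite polyOver_comp// polyOverXn.
apply: hasSum_ext (H s sp z z0) => n.
have E : (zeta R (M' * e) ^+ s) ^+ e = zeta R M' ^+ s.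
  by rewrite exprAC zeta_raise.
by rewrite horner_comp hornerXn E.
Qed.

Lemma ratfam_subst M M' u g : coprime u p -> ratfam M M' g ->
  ratfam M M' (fun s => g (s * u)%N).
Proof.
move=> up [A [AF H]]; exists (fun n => A n \Po 'X^u); split=> [n|s sp z z0].
  by rewrite polyOver_comp// polyOverXn.
apply: hasSum_ext (H (s * u)%N _ z z0) => [n|]; first by rewrite horner_comp hornerXn exprM.
by rewrite coprimeMl sp.
Qed.

Lemma ratfam_shift M e g t : (0 < M)%N -> (0 < e)%N -> ratfam M (M * e) g ->
  ratfam M (M * e) (fun s z => g s (z - (s * t)%:R / e%:R)).
Proof.
(* The exponent M e - 1 stands for -1, as zeta^(M e) = 1. *)
move=> M0 e0 [A [AF H]]; exists (fun n => A n * 'X^((M * e).-1 * t * n)).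
split=> [n|s sp z z0]; first by rewrite rpredM ?polyOverXn.
have MC : M%:R != 0 :> C by rewrite pnatr_eq0 -lt0n.
have eC : e%:R != 0 :> C by rewrite pnatr_eq0 -lt0n.
have w0 : 0 < complex.Im (z - (s * t)%:R / e%:R).
  rewrite (_ : (s * t)%:R / e%:R = ((s * t)%:R / e%:R)%:C); last first.
    by rewrite [RHS](rmorphM (real_complex R)) fmorphV !rmorph_nat.
  by rewrite cImD cImN /= oppr0 addr0.
apply: hasSum_ext (H s sp _ w0) => n; rewrite hornerM hornerXn -mulrA; congr (_ * _).
rewrite -exprM mulnA [(s * _)%N]mulnC exprM -exprMn; congr (_ ^+ n).
rewrite /qpar mulrBl nomeD mulrC; congr (_ * _).
have M1 : zeta R (M * e) ^+ (M * e) = 1 by rewrite zetaX divff ?nome1// natrM mulf_neq0.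
have z0' : zeta R (M * e) != 0 by exact: nome_neq0.
apply: (mulIf (expf_neq0 (s * t) z0')); rewrite -exprD.
have -> : (s * ((M * e).-1 * t) + s * t = M * e * (s * t))%N.
  by rewrite mulnCA -mulSnr prednK// muln_gt0 M0.
rewrite [zeta _ _ ^+ (M * e * _)]exprM M1 expr1n zetaX -nomeD [(t * s)%N]mulnC (natrM _ M e).
have -> : (s * t)%:R / (M%:R * e%:R) = (s * t)%:R / e%:R / M%:R :> C.
  by rewrite invfM mulrA mulrAC.
by rewrite addNr nome0.
Qed.

Lemma ratfam_hol M M' g s : (0 < M)%N -> ratfam M M' g -> coprime s p -> hol (g s).
Proof. by move=> M0 [A [AF H]] sp; apply: qseries_hol (H s sp). Qed.

End RationalFamilies.

(** * Averages over roots of unity, and Eisenstein series as rational families *)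

Section RationalFamilies2.
Variable R : realType.
Local Notation C := R[i].
Variables (F : divringClosed C).
Implicit Types (phi : int -> int -> bool) (z : C) (g h : nat -> C -> C).

Lemma zeta_sum_rat M j : (0 < M)%N -> \sum_(i < M) (zeta R M ^+ j) ^+ i \in F.
Proof. by move=> M0; rewrite zeta_sum//; case: ifP => _; rewrite ?rpred_nat ?rpred0. Qed.

Lemma coprime_indicator p s : prime p ->
  (coprime s p)%:R = 1 - p%:R^-1 * \sum_(i < p) (zeta R p ^+ s) ^+ i :> C.
Proof.
move=> pp; rewrite zeta_sum ?prime_gt0// coprime_sym prime_coprime//; case: ifP => _ /=.
  by rewrite mulVf ?subrr// pnatr_eq0 -lt0n prime_gt0.
by rewrite mulr0 subr0.
Qed.

(** By [coprime_indicator] this Ramanujan sum is a rational combination of complete sums of powers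
    of a root of unity. *)
Lemma ramanujan_rat p nu l : prime p -> (0 < nu)%N ->
  \sum_(s < p ^ nu) (coprime s p)%:R * (zeta R (p ^ nu) ^+ l) ^+ s \in F.
Proof.
move=> pp nu0; have M0 : (0 < p ^ nu)%N by rewrite expn_gt0 prime_gt0.
have zp : zeta R (p ^ nu) ^+ (p ^ nu.-1) = zeta R p.
  by rewrite -{1}(prednK nu0) expnS zeta_raise// expn_gt0 prime_gt0.
under eq_bigr do rewrite coprime_indicator// mulrBl mul1r -mulrA mulr_suml.
rewrite sumrB rpredB ?zeta_sum_rat// -mulr_sumr rpredM ?rpredV ?rpred_nat//.
rewrite exchange_big /= rpred_sum// => e _.
under eq_bigr => s _.
  rewrite -[zeta R p]zp (_ : _ * _ = (zeta R (p ^ nu) ^+ (p ^ nu.-1 * e + l)) ^+ s); last first.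
    by rewrite -!exprM -exprD; congr (_ ^+ _); ring.
  over.
by rewrite zeta_sum_rat.
Qed.

(** Comparing coefficients, A_n(zeta^s) = c B_n(zeta^s) for all s prime to p. Summed over s against
    zeta^(j s), both sides become combinations over F of Ramanujan sums, and c is their quotient for
    a suitable j. *)
Lemma trace_descent p nu M X Y c s0 : prime p -> (0 < nu)%N -> (0 < M)%N ->
  ratfam F p M (p ^ nu) X -> ratfam F p M (p ^ nu) Y ->
  (forall s z, coprime s p -> 0 < complex.Im z -> X s z = c * Y s z) ->
  coprime s0 p -> ~ null (Y s0) -> c \in F.
Proof.
move=> pp nu0 M0 [A [AF HA]] [B [BF HB]] XY s0p Y0.
set N := (p ^ nu)%N; have N0 : (0 < N)%N by rewrite expn_gt0 prime_gt0.
pose zt := zeta R N.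
have AB n s : coprime s p -> (A n).[zt ^+ s] = c * (B n).[zt ^+ s].
  move=> sp; apply/eqP; rewrite -subr_eq0 -mulNr; apply/eqP.
  have H : qseries M (fun n => (A n).[zt ^+ s] + - c * (B n).[zt ^+ s]) (fun z => X s z + - c * Y s z).
    move=> z z0; apply: hasSum_ext (hasSumD (HA s sp z z0) (hasSumcM (- c) (HB s sp z z0))) => k.
    by rewrite mulrDl mulrA.
  apply: (null_qseries M0 H) => z z0; by rewrite XY// mulNr subrr.
have [n Bn] : exists n, (B n).[zt ^+ s0] != 0.
  apply: contrapT => /forallNP H; apply: Y0; apply: (qseries_eq0 (HB s0 s0p)) => n.
  by apply: contrapT => /eqP; exact: H.
pose S (P : {poly C}) j := \sum_(s < N) (coprime s p)%:R * (zt ^+ (j * s) * P.[zt ^+ s]).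
have SF P j : P \is a polyOver F -> S P j \in F.
  move=> /polyOverP PF; rewrite /S.
  under eq_bigr do rewrite horner_coef !mulr_sumr.
  rewrite exchange_big rpred_sum// => i _ /=.
  under eq_bigr => s _.
    rewrite (_ : _ * _ = P`_i * ((coprime s p)%:R * (zt ^+ (j + i)) ^+ s)); last first.
      have -> : (zt ^+ (j + i)) ^+ s = zt ^+ (j * s) * (zt ^+ s) ^+ i.
        by rewrite -!exprM -exprD; congr (_ ^+ _); ring.
      by move: (zt ^+ (j * s)) ((zt ^+ s) ^+ i) => x y; ring.
    over.
  by rewrite -mulr_sumr rpredM// ramanujan_rat.
(* Fourier inversion on Z/N: if [S (B n) j] vanished for all j, so would B_n(zeta^s0). *)
have [j Sj] : exists j, S (B n) j != 0.
  apply: contrapT => /forallNP H; case/negP: Bn; apply/eqP.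
  pose r0 := (s0 %% N)%N; have r0N : (r0 < N)%N by rewrite ltn_mod.
  have zN : zt ^+ N = 1 by rewrite /zt zetaX divff ?nome1// pnatr_eq0 -lt0n.
  have zr : zt ^+ s0 = zt ^+ r0 by rewrite {1}(divn_eq s0 N) exprD mulnC exprM zN expr1n mul1r.
  have r0p : coprime r0 p.
    by rewrite /r0 coprime_sym -(@coprime_modr _ _) modn_dvdm ?coprime_modr 1?coprime_sym// dvdn_exp.
  have : \sum_(j < N) zt ^+ (j * (N - r0)) * S (B n) j = 0.
    by apply: big1 => j _; have /negP/negbNE/eqP -> := H j; rewrite mulr0.
  under eq_bigr do rewrite /S mulr_sumr.
  rewrite exchange_big /=.
  under eq_bigr => s _.
    under eq_bigr => j _.
      rewrite (_ : _ * _ = ((coprime s p)%:R * (B n).[zt ^+ s]) * (zt ^+ (N - r0 + s)) ^+ j); last first.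
        rewrite mulrCA [RHS]mulrAC -mulrA; congr (_ * _); rewrite mulrA mulrC [RHS]mulrC; congr (_ * _).
        by rewrite -exprM -exprD; congr (_ ^+ _); ring.
      over.
    rewrite -mulr_sumr zeta_sum//.
    over.
  rewrite (bigD1 (Ordinal r0N))//= big1 ?addr0; last first.
    move=> i /eqP ir; case: ifP => [dv|_]; last by rewrite mulr0.
    case: ir; apply: val_inj => /=; have := ltn_ord i; move: dv => /dvdnP[[|[|q]] qe]; nia.
  rewrite subnK 1?ltnW// dvdnn r0p mul1r -zr => /eqP; rewrite mulf_eq0 pnatr_eq0.
  by rewrite (gtn_eqF N0) orbF => /eqP.
suff -> : c = S (A n) j / S (B n) j by rewrite rpred_div// SF.
apply: (canRL (mulfK Sj)); rewrite /S mulr_sumr; apply: eq_bigr => s _.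
by case sp: (coprime s p); rewrite ?mul0r ?mulr0// !mul1r AB// mulrCA.
Qed.

Lemma inv_root_unity M (x : C) : (0 < M)%N -> x ^+ M = 1 -> x != 1 ->
  (1 - x)^-1 = - (M%:R^-1) * \sum_(i < M) i%:R * x ^+ i.
Proof.
move=> M0 xM x1; have MC : M%:R != 0 :> C by rewrite pnatr_eq0 -lt0n.
have x1' : 1 - x != 0 by rewrite subr_eq0 eq_sym.
apply: (mulfI x1'); rewrite mulfV// mulrCA.
suff -> : (1 - x) * \sum_(i < M) i%:R * x ^+ i = - M%:R by rewrite mulrNN mulVf.
have geo : \sum_(i < M) x ^+ i = 0.
  by apply: (mulfI (_ : x - 1 != 0)); rewrite ?subr_eq0// -subrX1 xM subrr mulr0.
have E n : (1 - x) * \sum_(i < n) i%:R * x ^+ i = \sum_(i < n) x ^+ i - 1 - n.-1%:R * x ^+ n + (n == 0%N)%:R.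
  elim: n => [|n IH]; first by rewrite !big_ord0 eqxx /=; ring.
  rewrite !big_ord_recr /= mulrDr IH; case: n {IH} => [|n]; first by rewrite !big_ord0 eqxx /=; ring.
  have -> : n.+2.-1%:R = n%:R + 1 :> C by rewrite -addn1 natrD.
  rewrite /= !exprS; ring.
have -> : M%:R = M.-1%:R + 1 :> C by rewrite -{1}(prednK M0) -addn1 natrD.
by rewrite E geo xM (gtn_eqF M0) /=; ring.
Qed.

Lemma absum_zpow k : (3 <= k)%N -> absum (fun j : int => (j%:~R : C) ^- k.+1).
Proof.
move=> k3; have z0 : 0 < complex.Im ('i%C : C) by rewrite /= ltr01.
have := @absum_sub _ _ _ (fun j : int => (0 : int, j)) _ _ (absum_lattice z0 k3).
move=> /(_ _)/wrap[|]; first by move=> i j [].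
by move=> [B HB]; exists B => s us; have := HB s us; under eq_bigr do rewrite /= mul0r add0r.
Qed.

(** The sum Z of j^(-k-1) over the nonzero integers, divided by [lip]: the even j contribute
    2^(-k-1) Z, and the odd j contribute 2^(-k-1) lip Li_k(-1) by the Lipschitz formula at 1/2. *)
Definition zeta_even k : C := Li k (-1) / (2 ^+ k.+1 - 1).

Lemma nome_half : nome (2^-1 : C) = -1.
Proof.
have two0 : (2 : C) != 0 by rewrite pnatr_eq0.
have : nome (2^-1 : C) ^+ 2 == 1 by rewrite -nomeMn mulfV// nome1.
rewrite -subr_eq0 subr_sqr_1 mulf_eq0 subr_eq0 addr_eq0 => /orP[/eqP n1|/eqP//].
have : (2^-1 : C) = (2^-1 : R)%:C by rewrite fmorphV rmorph_nat.
move=> e2; move: n1; rewrite e2 => /nome_small_eq1 => /(_ _)/wrap[|/eqP].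
  by rewrite ger0_norm ?invr_ge0//; lra.
by rewrite invr_eq0 pnatr_eq0.
Qed.

Lemma hasSum_zeta_even k : (3 <= k)%N ->
  hasSum (fun j : int => (j%:~R : C) ^- k.+1) (lip R k * zeta_even k).
Proof.
move=> k3; have [Z HZ] := absum_hasSum (absum_zpow k3); suff -> : lip R k * zeta_even k = Z by [].
have two0 : (2 : C) != 0 by rewrite pnatr_eq0.
have Hodd : hasSum (fun j : int => (1 + 2 * j%:~R : C) ^- k.+1) (2 ^- k.+1 * (lip R k * Li k (-1))).
  have := @lipschitz_real R k (2^-1) (2^-1) _ _ _.
  have e2 : ((2^-1 : R)%:C : C) = 2^-1 by rewrite fmorphV rmorph_nat.
  rewrite e2 nome_half => H.
  apply: hasSum_ext (hasSumcM (2 ^- k.+1) (H _ _ _)) => [j|||n].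
  - rewrite -invfM -exprMn; congr (_ ^- _); by rewrite mulrDr mulfV.
  - by apply: leq_trans k3.
  - by rewrite invr_gt0.
  - have : 1 <= `|1 + 2 * n| by lia.
    rewrite -(ler_int R) intr_norm intrD intrM => h.
    rewrite (_ : 2^-1 + n%:~R = 2^-1 * (1 + 2 * n%:~R)); last by field.
    by rewrite normrM ger0_norm ?invr_ge0// ler_peMr ?invr_ge0.
have H2 : hasSum (fun j : int => (j%:~R : C) ^- k.+1)
   (\sum_(i < 2) (if i == 0 then 2 ^- k.+1 * Z else 2 ^- k.+1 * (lip R k * Li k (-1)))).
  apply: hasSum_residues => // -[[|[|//]] /= i2].
    apply: hasSum_ext (hasSumcM (2 ^- k.+1) HZ) => j.
    by rewrite add0r intrM -invfM -exprMn.
  by apply: hasSum_ext Hodd => j; rewrite intrD intrM.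
have := hasSum_unique HZ H2; rewrite big_ord_recl big_ord1 /= => ZE.
have pk : (2 : C) ^+ k.+1 != 0 by rewrite expf_neq0.
have pk1 : (2 : C) ^+ k.+1 - 1 != 0.
  rewrite subr_eq0 -natrX -[1]/(1%:R) eqr_nat expnS; have : (0 < 2 ^ k)%N by rewrite expn_gt0.
  lia.
rewrite /zeta_even mulrA; apply: (canLR (mulfK pk1)).
have : 2 ^+ k.+1 * Z = Z + lip R k * Li k (-1).
  by rewrite [in LHS]ZE mulrDr !mulVKf.
by move=> E; rewrite mulrBr mulr1 [Z * _]mulrC E addrC addKr.
Qed.

(** The analogous sum over the integers congruent to n modulo M, up to the factor M^(-k-1) lip; the
    class of 0 would meet the pole of [Li]. *)
Definition frac_sum k M (n : int) : C :=
  if (M%:Z %| n)%Z then zeta_even k else Li k (nome (n%:~R / M%:R)).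

Lemma hasSum_residue_pow k M (i : 'I_M) : (3 <= k)%N ->
  hasSum (fun j : int => ((i%:Z + M%:Z * j)%:~R : C) ^- k.+1)
    (M%:R ^- k.+1 * (lip R k * frac_sum k M i%:Z)).
Proof.
move=> k3; have M0 : (0 < M)%N by apply: leq_trans (ltn_ord i).
have MC : M%:R != 0 :> C by rewrite pnatr_eq0 -lt0n.
rewrite /frac_sum dvdzE /=; case: ifP => dv.
  have i0 : nat_of_ord i = 0%N by have := ltn_ord i; move: dv => /dvdnP[[|q] -> //]; rewrite mulSn; lia.
  apply: hasSum_ext (hasSumcM (M%:R ^- k.+1) (hasSum_zeta_even k3)) => j.
  by rewrite i0 add0r intrM -invfM -exprMn -pmulrn.
have iR : (i%:R / M%:R : R)%:C = i%:~R / M%:R by rewrite rmorphM fmorphV !rmorph_nat -pmulrn.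
have := @lipschitz_real R k (i%:R / M%:R) (M%:R^-1) _ _ _; rewrite iR => H.
have MR : 0 < M%:R :> R by rewrite ltr0n.
apply: hasSum_ext (hasSumcM (M%:R ^- k.+1) (H _ _ _)) => [j|||n].
- rewrite -invfM -exprMn; congr (_ ^- _).
  by rewrite mulrDr mulrCA mulfV// mulr1 intrD intrM -!pmulrn.
- by apply: leq_trans k3.
- by rewrite invr_gt0.
- have : 1 <= `|i%:Z + M%:Z * n|.
    case: (eqVneq (i%:Z + M%:Z * n) 0) => [e|]; last lia.
    case/negP: dv; rewrite -[(_ %| _)%N]/((M%:Z %| i%:Z)%Z) (_ : i%:Z = M%:Z * - n).
      by rewrite dvdz_mulr.
    by apply/eqP; rewrite -subr_eq0 mulrN opprK e.
  rewrite -(ler_int R) intr_norm intrD intrM -!pmulrn => h.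
  rewrite (_ : i%:R / M%:R + n%:~R = M%:R^-1 * (i%:R + M%:R * n%:~R)); last first.
    by rewrite mulrDr mulrA mulVf ?gt_eqF// mul1r mulrC.
  by rewrite normrM ger0_norm ?invr_ge0 ?ler_peMr ?invr_ge0// ltW.
Qed.

Lemma eis_coef0 k M phi : (3 <= k)%N -> (0 < M)%N -> (forall m n, phi m (n + M%:Z) = phi m n) ->
  eis_coef R k M phi 0 = \sum_(i < M) (phi 0 i%:Z)%:R * (M%:R ^- k.+1 * frac_sum k M i%:Z).
Proof.
move=> k3 M0 phiM; rewrite /eis_coef eqxx; apply: (mulfI (lip_neq0 R k)).
rewrite mulVKf ?lip_neq0// mulr_sumr; apply: csumE; apply: hasSum_residues => // i.
have := hasSumcM (phi 0 i%:Z)%:R (hasSum_residue_pow i k3).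
rewrite (_ : _ * (_ * (lip R k * _)) = lip R k * ((phi 0 i%:Z)%:R * (M%:R ^- k.+1 * frac_sum k M i%:Z))); last by ring.
by apply: hasSum_ext => j; rewrite per_int.
Qed.

Lemma LiP_over k : LiP R k \is a polyOver F.
Proof. by apply/polyOverP => i; have [n ->] := LiP_int R k i; rewrite rpred_int. Qed.

Lemma zeta_even_rat k : zeta_even k \in F.
Proof.
rewrite /zeta_even rpred_div ?rpredB ?rpredX ?rpred_nat ?rpred1//.
by rewrite /Li rpred_horner ?LiP_over// rpredV opprK rpredD ?rpred1.
Qed.

(* The coefficients are polynomials in zeta_M: 1 / (1 - x) is one in x for an M-th root of unity x != 1. *)
Lemma eis_ratfam p k M (Phi : nat -> int -> int -> bool) : (3 <= k)%N -> (0 < M)%N ->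
  (forall s, coprime s p -> coprime s M) ->
  (forall s m n, coprime s p -> Phi s m (n + M%:Z) = Phi s m n) ->
  (forall s m n, coprime s p -> Phi s m (s%:Z * n) = Phi 1%N m n) ->
  ratfam F p M M (fun s => eis k (Phi s)).
Proof.
move=> k3 M0 sM PM Ps; pose P1 := Phi 1%N.
pose A N : {poly C} := if N == 0%N
  then \sum_(i < M) ((P1 0 i%:Z)%:R * M%:R ^- k.+1) *: (if i == 0%N :> nat then (zeta_even k)%:P
     else LiP R k \Po (- (M%:R^-1) *: \sum_(j < M) j%:R *: 'X^(i * j)))
  else M%:R ^- k.+1 *: \sum_(d <- divisors N) (N %/ d)%:R ^+ k *:
    \sum_(i < M) ((P1 d%:Z i%:Z)%:R + (-1) ^+ k.+1 * (P1 (- d%:Z) (- i%:Z))%:R) *: 'X^(N %/ d * i).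
exists A; split.
  move=> N; rewrite /A; case: eqP => _.
    apply: rpred_sum => i _; apply: polyOverZ.
      by rewrite rpredM ?rpredV ?rpredX ?rpred_nat.
    case: eqP => _; first by rewrite polyOverC zeta_even_rat.
    apply: polyOver_comp; first exact: LiP_over.
    apply: polyOverZ; first by rewrite rpredN rpredV rpred_nat.
    by apply: rpred_sum => j _; apply: polyOverZ; rewrite ?rpred_nat ?polyOverXn.
  apply: polyOverZ; first by rewrite rpredV rpredX ?rpred_nat.
  apply: rpred_sum => d _; apply: polyOverZ; first by rewrite rpredX ?rpred_nat.
  apply: rpred_sum => i _; apply: polyOverZ; last exact: polyOverXn.
  by rewrite rpredD ?rpred_nat// rpredM ?rpred_nat// rpredX// rpredN rpred1.
have MC : M%:R != 0 :> C by rewrite pnatr_eq0 -lt0n.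
have zM : zeta R M ^+ M = 1 by rewrite zetaX divff// nome1.
move=> s sp; have H := @eis_qseries R k M (Phi s) k3 M0 (fun m n => PM s m n sp).
move=> z z0; apply: hasSum_ext (H z z0) => N; congr (_ * _).
rewrite /A; case: eqP => [->|/eqP N0].
  rewrite eis_coef0//; last by move=> *; exact: PM.
  pose g (n : int) : C := (Phi s 0 n)%:R * (M%:R ^- k.+1 * frac_sum k M n).
  (* Replacing i by s i turns [Phi s] into [Phi 1] and moves s into the exponent of the root of
     unity. *)
  rewrite -[LHS]/(\sum_(i < M) g i%:Z) (sum_residue_unit M0 (sM s sp)); last first.
    move=> n; rewrite /g PM// /frac_sum rpredDr ?dvdzz//.
    by rewrite intrD mulrDl nomeD -pmulrn divff// nome1 mulr1.
  rewrite horner_sum; apply: eq_bigr => i _; rewrite hornerZ -mulrA /g Ps//; congr (_ * (_ * _)).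
  rewrite /frac_sum dvdzE abszM /= Gauss_dvdr; last by rewrite coprime_sym sM.
  have [i0|i0] := eqVneq (nat_of_ord i) 0%N; first by rewrite i0 dvdn0 hornerC.
  have iM : ~~ (M %| i)%N by rewrite gtnNdvd// lt0n.
  rewrite (negbTE iM) horner_comp /Li; congr (_.[_]).
  have -> : nome ((s%:Z * i%:Z)%:~R / M%:R) = zeta R M ^+ (s * i).
    by rewrite zetaX -PoszM -pmulrn.
  rewrite (@inv_root_unity M)//; last 2 first.
  - by rewrite -exprM mulnC exprM zM expr1n.
  - by rewrite -(prim_order_dvd (zeta_prim R M0)) Gauss_dvdr// coprime_sym sM.
  rewrite hornerZ horner_sum; congr (_ * _); apply: eq_bigr => j _.
  by rewrite hornerZ hornerXn -!exprM mulnA.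
rewrite /eis_coef (negbTE N0) hornerZ horner_sum; congr (_ * _); apply: eq_bigr => d _.
rewrite hornerZ horner_sum; congr (_ * _).
pose g (n : int) : C := ((Phi s d%:Z n)%:R + (-1) ^+ k.+1 * (Phi s (- d%:Z) (- n))%:R) *
   nome (n%:~R / M%:R) ^+ (N %/ d).
transitivity (\sum_(i < M) g i%:Z).
  by apply: eq_bigr => i _; rewrite /g -pmulrn -zetaX -exprM mulnC.
rewrite (sum_residue_unit M0 (sM s sp)); last first.
  move=> n; have e : nome ((n + M%:Z)%:~R / M%:R : C) = nome (n%:~R / M%:R).
    by rewrite intrD mulrDl nomeD -pmulrn divff// nome1 mulr1.
  rewrite /g e PM//; congr ((_ + _ * _%:R) * _).
  by rewrite -[in RHS](subrK M%:Z (- n)) PM// opprD.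
apply: eq_bigr => i _; rewrite hornerZ hornerXn /g Ps// -mulrN Ps//; congr (_ * _).
by rewrite -PoszM -pmulrn -zetaX -!exprM; congr (_ ^+ _); ring.
Qed.

End RationalFamilies2.

(** * Quotients of polynomials in Eisenstein series *)

Section LinearAlgebra.
Variable K : fieldType.
Variable F : divringClosed K.

(** Gaussian elimination does not leave F. *)
Lemma linear_solve m n (M : 'M[K]_(m, n)) : (m < n)%N -> (forall i j, M i j \in F) ->
  exists v : 'cV[K]_n, [/\ v != 0, forall j, v j 0 \in F & M *m v = 0].
Proof.
elim: m n M => [|m IH] n M mn MF.
  exists (const_mx 1); split=> [|j|]; rewrite ?mxE ?rpred1 //; last exact: flatmx0.
  case: n mn {M MF} => // n _; apply/eqP => /matrixP/(_ 0 0); rewrite !mxE => /eqP.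
  by rewrite oner_eq0.
case: n mn M MF => // n; rewrite ltnS => mn M MF.
have [/existsP[j0 Mj0]|/existsPn M0] := boolP [exists j, M 0 j != 0]; last first.
  have [v [v0 vF Mv]] := IH n.+1 (\matrix_(i, j) M (lift 0 i) j) (leqW mn) (fun i j => ltac:(by rewrite mxE)).
  exists v; split=> //; apply/matrixP => i j; rewrite !mxE.
  case: (unliftP 0 i) => [i'|] ->.
    have /matrixP/(_ i' j) := Mv; rewrite !mxE => E; rewrite -[RHS]E.
    by apply: eq_bigr => l _; rewrite !mxE.
  by apply: big1 => l _; have /negbNE/eqP -> := M0 l; rewrite mul0r.
pose M2 : 'M[K]_(m, n) := \matrix_(i, j) (M (lift 0 i) (lift j0 j) -
   M (lift 0 i) j0 * (M 0 (lift j0 j) / M 0 j0)).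
have [|v2 [v0 vF Mv]] := IH n M2 mn.
  by move=> i j; rewrite mxE rpredB ?MF// rpredM ?MF// rpred_div ?MF.
pose x0 := - \sum_j M 0 (lift j0 j) / M 0 j0 * v2 j 0.
pose v : 'cV[K]_n.+1 := \col_j (if unlift j0 j is Some l then v2 l 0 else x0).
exists v; split.
- apply: contraNneq v0 => v0; apply/eqP/matrixP => i j; rewrite (ord1 j) !mxE.
  by have /matrixP/(_ (lift j0 i) 0) := v0; rewrite !mxE liftK.
- move=> j; rewrite mxE; case: unlift => [l|]; first exact: vF.
  by rewrite rpredN rpred_sum// => l _; rewrite rpredM ?vF// rpred_div ?MF.
- apply/matrixP => i j; rewrite (ord1 j) !mxE (bigD1_ord j0)//= mxE unlift_none.
  under eq_bigr do rewrite mxE liftK.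
  case: (unliftP 0 i) => [i'|] ->.
    have /matrixP/(_ i' 0) := Mv; rewrite !mxE => Mv'.
    rewrite -[RHS]Mv' /x0 mulrN mulr_sumr addrC -sumrB; apply: eq_bigr => l _.
    by rewrite /M2 mxE mulrBl !mulrA.
  rewrite /x0 mulrN mulr_sumr addrC -sumrB; apply: big1 => l _.
  by rewrite mulrA mulrCA mulfV// mulr1 subrr.
Qed.

Lemma nat_nonroot (P : {poly K}) : [pchar K] =i pred0 -> P != 0 -> exists n : nat, P.[n%:R] != 0.
Proof.
move=> ch P0; apply: contrapT => /forallNP H.
have := @max_poly_roots K P [seq n%:R | n <- iota 0 (size P)] P0.
rewrite size_map size_iota ltnn => Hm; suff : false by []; apply: Hm.
  by apply/allP => _ /mapP[n _ ->]; apply/rootP; have /negP/negbNE/eqP := H n.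
rewrite map_inj_uniq ?iota_uniq// => i j /eqP; wlog ij : i j / (i <= j)%N.
  by move=> W; case: (leqP i j) => [|/ltnW] ij e; [exact: W|apply/esym/W; rewrite // eq_sym].
rewrite eq_sym -subr_eq0 -natrB// => /eqP ji; apply/eqP; rewrite eqn_leq ij /=.
rewrite -subn_eq0; apply: contraTT isT => d0.
by move/charf0P: ch => /(_ (j - i)%N); rewrite ji eqxx (negbTE d0).
Qed.

End LinearAlgebra.

(** * First coefficients, and two forms of weight 12 and level one *)

Section Jets.
Variable R : realType.
Local Notation C := R[i].
Implicit Types (g h : C -> C).

Definition jet2 g (a b : C) := exists2 c, qseries 1 c g & c 0%N = a /\ c 1%N = b.

Lemma jet2M g h a b a' b' : jet2 g a b -> jet2 h a' b' ->
  jet2 (fun z => g z * h z) (a * a') (a * b' + b * a').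
Proof.
move=> [c Hc [<- <-]] [d Hd [<- <-]]; exists (fun n => \sum_(i < n.+1) c i * d (n - i)%N).
  exact: qseriesM Hc Hd.
by rewrite !big_ord_recl !big_ord0 /= !addr0 subn0.
Qed.

Lemma jet2D g h a b a' b' : jet2 g a b -> jet2 h a' b' ->
  jet2 (fun z => g z + h z) (a + a') (b + b').
Proof.
move=> [c Hc [<- <-]] [d Hd [<- <-]]; exists (fun n => c n + d n) => // z z0.
by apply: hasSum_ext (hasSumD (Hc z z0) (Hd z z0)) => n; rewrite mulrDl.
Qed.

Lemma jet2cM g a b e : jet2 g a b -> jet2 (fun z => e * g z) (e * a) (e * b).
Proof.
move=> [c Hc [<- <-]]; exists (fun n => e * c n) => // z z0.
by apply: hasSum_ext (hasSumcM e (Hc z z0)) => n; rewrite mulrA.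
Qed.

Lemma jet2_cst e : jet2 (fun _ => e) e 0.
Proof.
exists (fun n => if n == 0%N then e else 0) => // z z0.
have := @hasSum_finite R _ (fun n : nat => (if n == 0%N then e else 0) * qpar 1 z ^+ n) [:: 0%N] isT.
move=> /(_ _)/wrap[|]; first by move=> n; rewrite inE => /negbTE ->; rewrite mul0r.
by rewrite big_seq1 eqxx mulr1.
Qed.

Lemma jet2X g a b n : jet2 g a b -> exists b', jet2 (fun z => g z ^+ n) (a ^+ n) b'.
Proof.
move=> H; elim: n => [|n [b' IH]]; first by exists 0; exact: jet2_cst.
exists (a * b' + b * a ^+ n); rewrite exprS.
rewrite (_ : (fun z => _) = (fun z => g z * g z ^+ n)); first exact: jet2M H IH.
by apply/funext => z; rewrite exprS.
Qed.

Lemma jet2_null g a b : jet2 g a b -> null g -> a = 0 /\ b = 0.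
Proof. by move=> [c Hc [<- <-]] g0; split; apply: null_qseries Hc g0 _. Qed.

Lemma jet2_hol g a b : jet2 g a b -> hol g.
Proof. by move=> [c Hc _]; apply: qseries_hol Hc. Qed.

(** At the cusp x is nonzero and y vanishes to order 1. The constant term gives c_0 = 0; then y is
    divided out and the induction goes on. *)
Lemma homogeneous_indep (x y : C -> C) a a' b m : jet2 x a a' -> a != 0 -> jet2 y 0 b -> b != 0 ->
  forall n (c : nat -> C), null (fun z => \sum_(i < m) c i * (x z ^+ (n - i) * y z ^+ i)) ->
  forall i, (i < m)%N -> c i = 0.
Proof.
move=> Jx a0 Jy b0; elim: m => [//|m IH] n c H.
have c0 : c 0%N = 0.
  have J r : exists b', jet2 (fun z => \sum_(i < r.+1) c i * (x z ^+ (n - i) * y z ^+ i)) (c 0%N * a ^+ n) b'.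
    elim: r => [|r [b' IHr]].
      have [b1 J1] := jet2X n Jx; exists (c 0%N * b1).
      rewrite (_ : (fun z => _) = (fun z => c 0%N * x z ^+ n)); first exact: jet2cM.
      by apply/funext => z; rewrite big_ord1 subn0 expr0 mulr1.
    have [b1 J1] := jet2X (n - r.+1) Jx; have [b2 J2] := jet2X r.+1 Jy.
    have := jet2D IHr (jet2cM (c r.+1) (jet2M J1 J2)).
    rewrite expr0n /= mulr0 mulr0 addr0 => J3; eexists.
    rewrite (_ : (fun z => _) = (fun z => \sum_(i < r.+1) c i * (x z ^+ (n - i) * y z ^+ i) +
      c r.+1 * (x z ^+ (n - r.+1) * y z ^+ r.+1))); first exact: J3.
    by apply/funext => z; rewrite big_ord_recr.
  have [b' Jm] := J m; have [/eqP + _] := jet2_null Jm H.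
  by rewrite mulf_eq0 expf_eq0 (negbTE a0) andbF orbF => /eqP.
move=> [|i] im //; apply: (IH n.-1 (fun i => c i.+1)) im.
have holS : hol (fun z => \sum_(i < m) c i.+1 * (x z ^+ (n.-1 - i) * y z ^+ i)).
  apply: hol_sum => j; apply: holM; first exact: hol_cst.
  by apply: holM; apply: holX; [exact: jet2_hol Jx|exact: jet2_hol Jy].
have [|y0|//] := hol_domain (jet2_hol Jy) holS; last first.
  by have [_ /eqP] := jet2_null Jy y0; rewrite (negbTE b0).
move=> z z0; rewrite -[RHS](H z z0) big_ord_recl c0 mul0r add0r mulr_sumr.
apply: eq_bigr => j _; have -> : nat_of_ord (lift ord0 j) = j.+1 by [].
have -> : (n - j.+1 = n.-1 - j)%N by lia.
rewrite exprS; ring.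
Qed.

Lemma hasSum_nonneg_ge (I : eqType) (f : I -> R) (S : C) i0 : hasSum (fun i => (f i)%:C) S ->
  (forall i, 0 <= f i) -> f i0 <= complex.Re S.
Proof.
move=> H f0; apply/ler_addgt0Pr => e /H[s0 Hs].
pose s := undup (i0 :: s0); have := Hs s (undup_uniq _).
move=> /(_ _)/wrap[|]; first by move=> i is0; rewrite mem_undup inE is0 orbT.
have -> : \sum_(i <- s) (f i)%:C = (\sum_(i <- s) f i)%:C by rewrite rmorph_sum.
move=> /(le_lt_trans (Re_le_cn _)); rewrite cReD cReN /= ltr_norml => /andP[_].
have : f i0 <= \sum_(i <- s) f i.
  have i0s : i0 \in s by rewrite mem_undup mem_head.
  by rewrite (big_rem _ i0s) /= lerDl sumr_ge0.
lra.
Qed.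

Lemma zeta_even_Re k : (3 <= k)%N -> odd k -> 1 <= complex.Re (lip R k * zeta_even R k).
Proof.
move=> k3 ko; have H := @hasSum_zeta_even R k k3.
have H' : hasSum (fun j : int => ((j%:~R ^+ k.+1)^-1 : R)%:C) (lip R k * zeta_even R k).
  by apply: hasSum_ext H => j; rewrite fmorphV rmorphXn rmorph_int.
have := hasSum_nonneg_ge 1 H'; rewrite expr1n invr1; apply => j.
by rewrite invr_ge0 exprn_even_ge0//= ko.
Qed.

(** The constant terms of [E4] and [E6] have opposite signs because i^4 = 1 and i^6 = -1; this
    excludes a cancellation in [mody_jet]. *)
Lemma zeta_even_4 : 0 < complex.Re (zeta_even R 3).
Proof.
have := @zeta_even_Re 3 isT isT; have pi0 := pi_gt0 R.
have -> : lip R 3 = (((2 * pi) ^+ 4 / 6 : R))%:C.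
  rewrite [X in _ = X](rmorphM (real_complex R)) fmorphV rmorph_nat (rmorphXn (real_complex R)).
  rewrite /lip (_ : 3`! = 6)%N// /tau exprNn -signr_odd expr0 mul1r.
  have i4 : ('i%C : C) ^+ 4 = 1 by rewrite -[4%N]/(2 * 2)%N exprM sqr_i sqrrN expr1n.
  by rewrite exprMn i4 mulr1.
rewrite cReM /= mul0r subr0 => h; have : 0 < (2 * pi) ^+ 4 / 6 :> R.
  by rewrite divr_gt0// exprn_gt0// mulr_gt0.
nra.
Qed.

Lemma zeta_even_6 : complex.Re (zeta_even R 5) < 0.
Proof.
have := @zeta_even_Re 5 isT isT; have pi0 := pi_gt0 R.
have -> : lip R 5 = (- ((2 * pi) ^+ 6 / 120 : R))%:C.
  rewrite [RHS](rmorphN (real_complex R)) [X in _ = - X](rmorphM (real_complex R)) fmorphV rmorph_nat (rmorphXn (real_complex R)).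
  rewrite /lip (_ : 5`! = 120)%N// /tau exprNn -signr_odd expr0 mul1r.
  have i6 : ('i%C : C) ^+ 6 = -1 by rewrite -[6%N]/(2 * 3)%N exprM sqr_i -signr_odd expr1.
  by rewrite exprMn i6 mulrN1 mulNr.
rewrite cReM /= mul0r subr0 => h; have : 0 < (2 * pi) ^+ 6 / 120 :> R.
  by rewrite divr_gt0// exprn_gt0// mulr_gt0.
nra.
Qed.

Definition E4 : C -> C := eis 3 (fun _ _ => true).
Definition E6 : C -> C := eis 5 (fun _ _ => true).

Lemma eis_full_jet k : (3 <= k)%N -> odd k -> jet2 (eis k (fun _ _ => true)) (zeta_even R k) 2.
Proof.
move=> k3 ko; exists (eis_coef R k 1 (fun _ _ => true)); first exact: eis_qseries.
split.
  rewrite eis_coef0// big_ord1 /frac_sum.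
  have -> : (1%:Z %| (@ord0 0)%:Z)%Z = true by [].
  by rewrite expr1n invr1 !mul1r.
rewrite /eis_coef /= expr1n invr1 mul1r (_ : divisors 1 = [:: 1%N])// big_seq1.
by rewrite divnn /= expr1n mul1r big_ord1 -signr_odd /= ko /= expr0 mul1r muln0 expr0 mulr1.
Qed.

(** With [mody], homogeneous coordinates in level one: [modx] is nonzero at the cusp and [mody] is a
    multiple of Delta. *)
Definition modx z : C := E4 z ^+ 3.
Definition mody z : C := zeta_even R 5 ^+ 2 * E4 z ^+ 3 - zeta_even R 3 ^+ 3 * E6 z ^+ 2.

Lemma modx_jet : exists b, jet2 modx (zeta_even R 3 ^+ 3) b.
Proof.
have [b J] := jet2X 3 (@eis_full_jet 3 isT isT); exists b; exact: J.
Qed.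

Lemma zeta_even_3_neq0 : zeta_even R 3 ^+ 3 != 0.
Proof.
rewrite expf_neq0//; apply/eqP => e; have := zeta_even_4.
by rewrite e /= ltxx.
Qed.

Lemma mody_jet : exists2 b, jet2 mody 0 b & b != 0.
Proof.
have J4 : jet2 E4 _ _ := eis_full_jet (isT : 3 <= 3)%N isT.
have J6 : jet2 E6 _ _ := eis_full_jet (isT : 3 <= 5)%N isT.
have := jet2D (jet2cM (zeta_even R 5 ^+ 2) (jet2M J4 (jet2M J4 J4)))
  (jet2cM (- zeta_even R 3 ^+ 3) (jet2M J6 J6)).
have -> : mody = fun z => zeta_even R 5 ^+ 2 * (E4 z * (E4 z * E4 z)) + - zeta_even R 3 ^+ 3 * (E6 z * E6 z).
  by apply/funext => z; rewrite /mody; ring.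
have := zeta_even_4; have := zeta_even_6; move: (zeta_even R 3) (zeta_even R 5) => a b b0 a0.
(* The coefficient of q, for constant terms a of [E4] and b of [E6] and coefficient 2 of q in
   both. *)
move=> [c Hc [c0 c1]]; exists (2 * a ^+ 2 * b * (3 * b - 2 * a)).
  by exists c => //; split; [rewrite c0; ring|rewrite c1; ring].
have a1 : a != 0 by apply: contraTneq a0 => ->; rewrite ltxx.
have b1 : b != 0 by apply: contraTneq b0 => ->; rewrite ltxx.
rewrite !mulf_neq0 ?expf_neq0 ?pnatr_eq0//; apply/eqP => /(congr1 (@complex.Re R)).
have E (n : nat) (w : C) : complex.Re (n%:R * w) = n%:R * complex.Re w.
  by rewrite -(rmorph_nat (real_complex R)) cReM /= mul0r subr0.
by rewrite cReD cReN !E /=; lra.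
Qed.

End Jets.

(** * Integral matrices and congruences between their lower rows *)

Section IntMatrices.

Definition mx2 (K : Type) (a b c d : K) : 'M[K]_2 :=
  \matrix_(i, j) if i == 0 then (if j == 0 then a else b) else (if j == 0 then c else d).

Lemma mx2E (K : Type) (a b c d : K) : [/\ mx2 a b c d 0 0 = a, mx2 a b c d 0 1 = b,
  mx2 a b c d 1 0 = c & mx2 a b c d 1 1 = d].
Proof. by split; rewrite mxE. Qed.

Lemma eq_mx2 (K : Type) (g h : 'M[K]_2) : g 0 0 = h 0 0 -> g 0 1 = h 0 1 -> g 1 0 = h 1 0 ->
  g 1 1 = h 1 1 -> g = h.
Proof.
have H (i : 'I_2) : i = 0 \/ i = 1 by case: i => -[|[|//]] i2; [left|right]; exact: val_inj.
by move=> e1 e2 e3 e4; apply/matrixP => i j; case: (H i) => ->; case: (H j) => ->.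
Qed.

Lemma det_mx2 (K : comRingType) (a b c d : K) : \det (mx2 a b c d) = a * d - b * c.
Proof. by rewrite det2; case: (mx2E a b c d) => -> -> -> ->. Qed.

Variable L : nat.

(** For e = 1 and g, h in SL_2(Z) this says that g and h lie in one coset of Gamma_1(L); e = -1
    allows for the sign. *)
Definition req (e : int) (g h : 'M[int]_2) : bool :=
  (L%:Z %| (g 1 0 - e * h 1 0)%R)%Z && (L%:Z %| (g 1 1 - e * h 1 1)%R)%Z.

Lemma req_mul e g h A : req e g h -> req e (g *m A) (h *m A).
Proof.
move=> /andP[h0 h1]; apply/andP; rewrite !mulmx2; split.
  have -> : g 1 0 * A 0 0 + g 1 1 * A 1 0 - e * (h 1 0 * A 0 0 + h 1 1 * A 1 0) =
     (g 1 0 - e * h 1 0) * A 0 0 + (g 1 1 - e * h 1 1) * A 1 0 by ring.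
  by rewrite rpredD// dvdz_mulr.
have -> : g 1 0 * A 0 1 + g 1 1 * A 1 1 - e * (h 1 0 * A 0 1 + h 1 1 * A 1 1) =
   (g 1 0 - e * h 1 0) * A 0 1 + (g 1 1 - e * h 1 1) * A 1 1 by ring.
by rewrite rpredD// dvdz_mulr.
Qed.

Definition adj2 (h : 'M[int]_2) := mx2 (h 1 1) (- h 0 1) (- h 1 0) (h 0 0).

Lemma adj2_SL h : SL2Z h -> SL2Z (adj2 h).
Proof. by rewrite /SL2Z /= det_mx2 det2 => <-; ring. Qed.

Lemma adj2K h : SL2Z h -> h *m adj2 h = 1%:M /\ adj2 h *m h = 1%:M.
Proof.
rewrite /SL2Z /= det2 => dh.
by split; apply: eq_mx2; rewrite mulmx2 !mxE /= -?dh; ring.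
Qed.

Lemma SL2Z_opp g : SL2Z g -> SL2Z (- g).
Proof. by rewrite /SL2Z /= !det2 !mxE => <-; ring. Qed.

End IntMatrices.

(** * Forms for Gamma_1(L) and their transforms *)

Section Level.
Variable R : realType.
Local Notation C := R[i].
Variable L : nat.
Implicit Types (z : C) (f W : C -> C) (g h : 'M[int]_2).

Lemma cn_slashZ_opp w g W z : SL2Z g -> cn (slashZ w (- g) W z) = cn (slashZ w g W z).
Proof.
move=> gS; rewrite !slashZE//; last exact: SL2Z_opp.
rewrite !mxE !mulrNz !mulNr -!opprD invrN mulrNN !cnM; congr (_ * _).
by rewrite !cnV !cnX cnN.
Qed.

(** Invariance under Gamma_1(L), on which a nebentypus modulo a divisor of L is trivial. *)
Definition G1inv w W := forall g, SL2Z g -> (L%:Z %| (g 1 0)%R)%Z -> (L%:Z %| (g 1 1 - 1)%R)%Z ->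
  forall z, 0 < complex.Im z -> slashZ w g W z = W z.

Lemma G1inv_slash w W g h z : G1inv w W -> SL2Z g -> SL2Z h -> req L 1 g h ->
  0 < complex.Im z -> slashZ w g W z = slashZ w h W z.
Proof.
move=> WG gS hS /andP[r0 r1] z0; have [hK Kh] := adj2K hS.
have dS : SL2Z (g *m adj2 h) by apply: SL2Z_mul => //; exact: adj2_SL.
have -> : g = (g *m adj2 h) *m h by rewrite -mulmxA Kh mulmx1.
rewrite slashZM//; apply: slashZ_eq => // u u0; rewrite mul1r in r0; rewrite mul1r in r1.
have dh : h 0 0 * h 1 1 - h 0 1 * h 1 0 = 1 by rewrite -det2.
apply: WG => //; rewrite mulmx2 !mxE /=.
  have -> : g 1 0 * h 1 1 + g 1 1 * - h 1 0 =
    (g 1 0 - h 1 0) * h 1 1 - (g 1 1 - h 1 1) * h 1 0 by ring.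
  by rewrite rpredB// dvdz_mulr.
have -> : g 1 0 * - h 0 1 + g 1 1 * h 0 0 - 1 =
    (g 1 1 - h 1 1) * h 0 0 - (g 1 0 - h 1 0) * h 0 1 by rewrite -dh; ring.
by rewrite rpredB// dvdz_mulr.
Qed.

Lemma G1inv_cn w W g h e z : G1inv w W -> SL2Z g -> SL2Z h -> e = 1 \/ e = -1 -> req L e g h ->
  0 < complex.Im z -> cn (slashZ w g W z) = cn (slashZ w h W z).
Proof.
move=> WG gS hS [->|->] r z0; first by rewrite (G1inv_slash WG gS hS r z0).
rewrite -(cn_slashZ_opp w W z hS); congr cn; apply: G1inv_slash => //; first exact: SL2Z_opp.
by move: r; rewrite /req !mxE !mul1r !mulN1r.
Qed.

Lemma G1invM w1 w2 W1 W2 : G1inv w1 W1 -> G1inv w2 W2 -> G1inv (w1 + w2) (fun z => W1 z * W2 z).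
Proof. by move=> H1 H2 g gS g0 g1 z z0; rewrite /slashZ slash_mul -!/(slashZ _ _ _ _) H1// H2. Qed.

Lemma G1invB w W1 W2 : G1inv w W1 -> G1inv w W2 -> G1inv w (fun z => W1 z - W2 z).
Proof.
move=> H1 H2 g gS g0 g1 z z0.
by rewrite slashZE// mulrBr -!slashZE// H1// H2.
Qed.

Lemma slashZ_cM w g c W z : slashZ w g (fun z => c * W z) z = c * slashZ w g W z.
Proof. exact: slash_scale. Qed.

Lemma slashZ_sum (I : Type) (r : seq I) w g (W : I -> C -> C) z : SL2Z g ->
  slashZ w g (fun z => \sum_(i <- r) W i z) z = \sum_(i <- r) slashZ w g (W i) z.
Proof.
by move=> gS; rewrite slashZE// mulr_sumr; apply: eq_bigr => i _; rewrite -slashZE.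
Qed.

Definition resid (a : int) : int -> int -> bool := fun m _ => (L%:Z %| (m - a)%R)%Z.

Lemma phi_act_resid g a m n : (L%:Z %| (g 1 0)%R)%Z ->
  phi_act g (resid a) m n = (L%:Z %| (m * g 1 1 - a)%R)%Z.
Proof.
move=> Lg; rewrite /phi_act /resid (_ : _ - _ - a = m * g 1 1 - a - n * g 1 0); last by ring.
by rewrite rpredBr// dvdz_mull.
Qed.

Lemma eis_resid_inv k a : (3 <= k)%N -> G1inv k.+1 (eis k (resid a)).
Proof.
move=> k3 g gS g0 g1 z z0; rewrite eis_modular//; congr (eis k _ z).
apply/funext => m; apply/funext => n; rewrite phi_act_resid// /resid.
rewrite (_ : m * g 1 1 - a = m - a + m * (g 1 1 - 1)); last by ring.
by rewrite rpredDr// dvdz_mull.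
Qed.

Lemma phi_act_period g a m n : phi_act g (resid a) m (n + L%:Z) = phi_act g (resid a) m n.
Proof.
rewrite /phi_act /resid (_ : _ - _ - a = m * g 1 1 - n * g 1 0 - a - L%:Z * g 1 0); last by ring.
by rewrite rpredBr// dvdz_mulr.
Qed.

(** Plays the part of a primitive element over level one: for a suitable integer t its transforms
    [theta_act] over the cosets are pairwise distinct ([theta_separates]). *)
Definition theta (t : nat) : C -> C := fun z => \sum_(a < L) t%:R ^+ a * eis 11 (resid a%:Z) z.
Definition theta_act (t : nat) g : C -> C :=
  fun z => \sum_(a < L) t%:R ^+ a * eis 11 (phi_act g (resid a%:Z)) z.

Lemma slashZ_theta t g z : SL2Z g -> 0 < complex.Im z ->
  slashZ 12 g (theta t) z = theta_act t g z.
Proof.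
move=> gS z0; rewrite /theta (slashZ_sum _ _ _ _ gS); apply: eq_bigr => a _.
rewrite (slashZ_cM 12 g (t%:R ^+ a) (eis 11 (resid a%:Z))).
by rewrite (@eis_modular R 11 (resid a%:Z) g z isT gS z0).
Qed.

Lemma slashZ_full k g z : (3 <= k)%N -> SL2Z g -> 0 < complex.Im z ->
  slashZ k.+1 g (eis k (fun _ _ => true)) z = eis k (fun _ _ => true) z.
Proof. by move=> k3 gS z0; rewrite eis_modular. Qed.

(** Homogeneous of degree n in three forms of weight 12. The degree in T stays below [l], later the
    number of cosets. *)
Definition eform m l n (c : 'I_m * 'I_l -> C) (T : C -> C) z : C :=
  \sum_(i : 'I_m * 'I_l) c i * (modx z ^+ (n - i.1 - i.2) * mody z ^+ i.1 * T z ^+ i.2).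

Lemma slashZ_form m l n c T g z : (m + l <= n)%N -> SL2Z g -> 0 < complex.Im z ->
  slashZ (12 * n) g (@eform m l n c T) z = @eform m l n c (slashZ 12 g T) z.
Proof.
move=> mln gS z0.
have x4 := @slashZ_full 3 g z isT gS z0; have x6 := @slashZ_full 5 g z isT gS z0.
move: x4 x6; rewrite /eform !slashZE// mulr_sumr -/(E4 _) -/(E6 _).
set u := (_ * z + _); set v := (_ / u); rewrite -/(E4 z) -/(E6 z) -/(E4 v) -/(E6 v) => x4 x6.
have xE : modx z = u ^- 12 * modx v.
  by rewrite /modx -x4 exprMn -exprVn -exprM exprVn.
have yE : mody z = u ^- 12 * mody v.
  rewrite /mody -x4 -x6 ![(u ^- _ * _) ^+ _]exprMn -!exprVn -!exprM mulrBr.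
  by rewrite mulrCA [_ * (_ * E6 v ^+ 2)]mulrCA.
apply: eq_bigr => -[i j] _ /=; rewrite mulrCA; congr (_ * _).
rewrite xE yE ![(u ^- _ * _) ^+ _]exprMn -!exprVn -!exprM.
have -> : (12 * n = 12 * (n - i - j) + 12 * i + 12 * j)%N.
  by have := ltn_ord i; have := ltn_ord j; lia.
rewrite !exprD; ring.
Qed.

Lemma theta_inv t : G1inv 12 (theta t).
Proof.
move=> g gS g0 g1 z z0; rewrite /theta (slashZ_sum _ _ _ _ gS); apply: eq_bigr => a _.
rewrite (slashZ_cM 12 g (t%:R ^+ a) (eis 11 (resid a%:Z))).
by rewrite (@eis_resid_inv 11 a%:Z isT g gS g0 g1 z z0).
Qed.

Lemma form_inv m l n c t : (m + l <= n)%N -> G1inv (12 * n) (@eform m l n c (theta t)).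
Proof.
move=> mln g gS g0 g1 z z0; rewrite slashZ_form//; apply: eq_bigr => i _.
by rewrite (theta_inv t gS g0 g1 z0).
Qed.

Lemma modx_hol : hol (@modx R).
Proof. by have [b J] := modx_jet R; exact: jet2_hol J. Qed.
Lemma mody_hol : hol (@mody R).
Proof. by have [b J _] := mody_jet R; exact: jet2_hol J. Qed.

Lemma form_hol m l n c T : hol T -> hol (@eform m l n c T).
Proof.
move=> hT; apply: hol_sum => i; apply: holM; first exact: hol_cst.
apply: holM; last exact: holX.
by apply: holM; apply: holX; [exact: modx_hol|exact: mody_hol].
Qed.

Definition bdd W := exists K Y : R, forall z, Y <= complex.Im z -> cn (W z) <= K.

Lemma bdd_qseries M b W : (0 < M)%N -> qseries M b W -> bdd W.
Proof.
move=> M0 H; have [K [Y HK]] := qseries_asymp M0 H 0%N; exists K, Y => z zY.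
by have := HK z zY; rewrite big_ord0 subr0 expr0 mulr1.
Qed.

Lemma bdd_cst c : bdd (fun _ => c).
Proof. by exists (cn c), 0. Qed.
Lemma bddD W1 W2 : bdd W1 -> bdd W2 -> bdd (fun z => W1 z + W2 z).
Proof.
move=> [K [Y H]] [K' [Y' H']]; exists (K + K'), (Num.max Y Y') => z; rewrite ge_max => /andP[y y'].
by rewrite (le_trans (cnD _ _))// lerD ?H ?H'.
Qed.
Lemma bddM W1 W2 : bdd W1 -> bdd W2 -> bdd (fun z => W1 z * W2 z).
Proof.
move=> [K [Y H]] [K' [Y' H']]; exists (K * K'), (Num.max Y Y') => z; rewrite ge_max => /andP[y y'].
by rewrite cnM ler_pM ?cn_ge0 ?H ?H'.
Qed.
Lemma bddX W n : bdd W -> bdd (fun z => W z ^+ n).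
Proof.
move=> H; elim: n => [|n IH]; first exact: bdd_cst.
by have [K [Y HK]] := bddM H IH; exists K, Y => z zY; rewrite exprS HK.
Qed.
Lemma bdd_sum (I : Type) (r : seq I) (W : I -> C -> C) : (forall i, bdd (W i)) ->
  bdd (fun z => \sum_(i <- r) W i z).
Proof.
move=> H; elim: r => [|i r [K [Y IH]]].
  by exists 0, 0 => z _; rewrite big_nil cn0.
have [K' [Y' HK]] := bddD (H i) (ex_intro _ K (ex_intro _ Y IH)).
by exists K', Y' => z zY; rewrite big_cons HK.
Qed.

Lemma bdd_eis k M phi : (3 <= k)%N -> (0 < M)%N -> (forall m n, phi m (n + M%:Z) = phi m n) ->
  bdd (eis k phi : C -> C).
Proof. by move=> k3 M0 phiM; apply: bdd_qseries M0 (@eis_qseries R k M phi k3 M0 phiM). Qed.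

Lemma bdd_form m l n c T : bdd T -> bdd (@eform m l n c T).
Proof.
have b4 : bdd (@E4 R) by exact: (@bdd_eis 3 1).
have b6 : bdd (@E6 R) by exact: (@bdd_eis 5 1).
move=> bT; apply: bdd_sum => i; apply: bddM; first exact: bdd_cst.
apply: bddM; last exact: bddX.
apply: bddM; apply: bddX; first exact: bddX.
apply: bddD; first by apply: bddM; [exact: bdd_cst|exact: bddX].
have [K [Y HK]] := bddM (bdd_cst (zeta_even R 3 ^+ 3)) (bddX 2 b6).
by exists K, Y => z zY; rewrite cnN HK.
Qed.

Lemma bdd_theta_act t g : (0 < L)%N -> bdd (theta_act t g).
Proof.
move=> L0; apply: bdd_sum => a; apply: bddM; first exact: bdd_cst.
by apply: (bdd_eis (M := L)) => // m n; exact: phi_act_period.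
Qed.

Lemma eis_act_hol k g a : (3 <= k)%N -> (0 < L)%N -> hol (eis k (phi_act g (resid a)) : C -> C).
Proof.
move=> k3 L0; apply: (qseries_hol L0 (@eis_qseries R k L _ k3 L0 _)) => m n.
exact: phi_act_period.
Qed.

Lemma theta_act_hol t g : (0 < L)%N -> hol (theta_act t g).
Proof.
by move=> L0; apply: hol_sum => a; apply: holM; [exact: hol_cst|exact: eis_act_hol].
Qed.

End Level.

(** * The cosets of Gamma_1(L) up to sign *)

Section Classes.
Variable L : nat.
Hypothesis L1 : (1 < L)%N.

Lemma Zp_int_eq0 (a : int) : (a%:~R == 0 :> 'Z_L) = (L%:Z %| a)%Z.
Proof.
have N n : (n%:R == 0 :> 'Z_L) = (L %| n)%N.
  by rewrite Zp_nat -val_eqE /= Zp_cast.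
by case: a => n; rewrite ?NegzE ?mulrNz ?oppr_eq0 -?pmulrn N dvdzE.
Qed.

Definition brow (g : 'M[int]_2) : 'Z_L * 'Z_L := ((g 1 0)%:~R, (g 1 1)%:~R).
(** A coset up to sign is encoded by its lower row modulo L together with the opposite row, so that
    the cosets form a finite type. *)
Definition cls (g : 'M[int]_2) : {set 'Z_L * 'Z_L} :=
  [set r | (r == brow g) || (r == (- (brow g).1, - (brow g).2))].

Lemma clsP g h : (cls g == cls h) = req L 1 g h || req L (-1) g h.
Proof.
have E (e : int) : req L e g h = (brow g == ((e * h 1 0)%:~R, (e * h 1 1)%:~R)).
  by rewrite /req -!Zp_int_eq0 !intrB !subr_eq0 xpair_eqE.
rewrite !E !mul1r !mulN1r !mulrNz; apply/eqP/idP => [gh|].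
  have : brow g \in cls h by rewrite -gh inE eqxx.
  by rewrite inE.
move=> /orP[] /eqP gh; apply/setP => r; rewrite !inE gh /brow /= ?opprK //.
by rewrite orbC.
Qed.

Definition clsS : {set {set 'Z_L * 'Z_L}} := [set X | `[< exists2 g, SL2Z g & cls g = X >]].
Definition clsT : finType := {X | X \in clsS}.

Lemma clsS_mem g : SL2Z g -> cls g \in clsS.
Proof. by move=> gS; rewrite inE; apply/asboolP; exists g. Qed.

Lemma cls_rep (i : clsT) : exists g, SL2Z g /\ cls g = val i.
Proof. by case: i => X /=; rewrite inE => /asboolP[g gS gX]; exists g. Qed.

Definition crep (i : clsT) := projT1 (cid (cls_rep i)).
Lemma crepS i : SL2Z (crep i). Proof. by rewrite /crep; case: cid => g []. Qed.
Lemma crepE i : cls (crep i) = val i. Proof. by rewrite /crep; case: cid => g []. Qed.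

Definition cl0 : clsT := Sub (cls 1%:M) (clsS_mem SL2Z_one).
Definition cl g : clsT := insubd cl0 (cls g).
Lemma clE g : SL2Z g -> val (cl g) = cls g.
Proof. by move=> gS; rewrite insubdK// clsS_mem. Qed.

Lemma cl_crep i : cl (crep i) = i.
Proof. by apply: val_inj; rewrite clE ?crepE//; exact: crepS. Qed.

Lemma cl_eq g h : SL2Z g -> SL2Z h -> (cl g == cl h) = req L 1 g h || req L (-1) g h.
Proof. by move=> gS hS; rewrite -val_eqE !clE// clsP. Qed.

Lemma cl_mul_inj A : SL2Z A -> injective (fun i => cl (crep i *m A)).
Proof.
move=> AS i j /eqP; have SA k := SL2Z_mul (crepS k) AS; rewrite cl_eq// => H.
rewrite -(cl_crep i) -(cl_crep j); apply/eqP; rewrite cl_eq; [|exact: crepS|exact: crepS].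
have [AK _] := adj2K AS; have K k : crep k *m A *m adj2 A = crep k by rewrite -mulmxA AK mulmx1.
by move: H => /orP[] /(req_mul (adj2 A)); rewrite !K => ->; rewrite ?orbT.
Qed.

End Classes.

(** * Separation of the cosets and independence of the forms *)

Section Independence.
Variable R : realType.
Local Notation C := R[i].
Variable L : nat.
Hypothesis L1 : (1 < L)%N.
Let L0 : (0 < L)%N := ltnW L1.
Implicit Types (z : C) (g h : 'M[int]_2).

Lemma qseriesB M a b (f h : C -> C) : qseries M a f -> qseries M b h ->
  qseries M (fun n => a n - b n) (fun z => f z - h z).
Proof.
move=> Hf Hh z z0; rewrite -mulN1r; apply: hasSum_ext (hasSumD (Hf z z0) (hasSumcM (-1) (Hh z z0))) => n.
by rewrite mulN1r mulrBl.
Qed.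

(** The class a = 0 forces L | c by its constant term, and a = 1 then forces d = 1 or -1 modulo L by
    the coefficient of q. *)
Lemma eis_resid_stab k g : (3 <= k)%N -> odd k -> SL2Z g ->
  (forall a : 'I_L, forall z, 0 < complex.Im z ->
    eis k (phi_act g (resid L a%:Z)) z = eis k (resid L a%:Z) z) ->
  req L 1 g 1%:M || req L (-1) g 1%:M.
Proof.
move=> k3 ko gS H; have ek : (-1) ^+ k.+1 = 1 :> C by rewrite -signr_odd /= ko. have resM a m n : resid L a m (n + L%:Z) = resid L a m n by [].
(* In the constant term, g keeps only the n with L | n c. The lost terms n^(-k-1) are nonnegative as
   k is odd, and n = 1 is lost unless L | c. *)
have c0 : (L%:Z %| (g 1 0)%R)%Z.
  apply: contraT => cL.
  have Q1 := @eis_qseries R k L (phi_act g (resid L 0)) k3 L0 (fun m n => phi_act_period L g 0 m n).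
  have Q2 := @eis_qseries R k L (resid L 0) k3 L0 (resM 0).
  have Q := qseriesB Q2 Q1.
  have := null_qseries L0 Q; move=> /(_ _)/wrap[|/(_ 0%N)].
    by move=> z z0; rewrite (H (Ordinal L0) z z0) subrr.
  rewrite /eis_coef eqxx -mulrBr => /eqP; rewrite mulf_eq0 invr_eq0 (negbTE (lip_neq0 R k)) /=.
  have A (P : int -> bool) : absum (fun n : int => (P n)%:R * (n%:~R : C) ^- k.+1).
    apply: (absum_le _ (absum_zpow R k3)) => n.
    by rewrite cnM; case: (P n); rewrite ?cn1 ?mul1r// cn0 mul0r cn_ge0.
  have := hasSumD (csumP (A (fun n => resid L 0 0 n))) (hasSumcM (-1) (csumP (A (fun n => phi_act g (resid L 0) 0 n)))).
  rewrite mulN1r => HS /eqP E; rewrite E in HS.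
  pose f (n : int) : R := (~~ phi_act g (resid L 0) 0 n)%:R * (n%:~R ^+ k.+1)^-1.
  have HS' : hasSum (fun n => (f n)%:C) (0 : C).
    apply: hasSum_ext HS => n; rewrite {1}/resid subr0 dvdz0 /f.
    rewrite (rmorphM (real_complex R)) fmorphV rmorphXn rmorph_int rmorph_nat mulN1r -mulrBl.
    by congr (_ * _); case: (phi_act _ _ _ _); rewrite /= ?subrr ?subr0.
  have := hasSum_nonneg_ge 1 HS'; rewrite /f expr1n invr1 mulr1.
  rewrite /phi_act /resid mul0r sub0r subr0 mul1r rpredN cL /= => h.
  suff : (1 : R) <= 0 by rewrite ler10.
  by apply: h => j; rewrite mulr_ge0 ?ler0n// invr_ge0 exprn_even_ge0//= ko.
(* The coefficient of q counts the signs m = 1, -1 with m d = 1 modulo L; for the identity matrix it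
   is positive. *)
have pE m n : phi_act g (resid L 1) m n = (L%:Z %| (m * g 1 1 - 1)%R)%Z by rewrite phi_act_resid.
have Q1 := @eis_qseries R k 1 (phi_act g (resid L 1)) k3 isT _.
have {}Q1 := Q1 (fun m n => etrans (pE _ _) (esym (pE _ _))).
have Q2 := @eis_qseries R k 1 (resid L 1) k3 isT (fun m n => erefl).
have Q := qseriesB Q2 Q1.
have := null_qseries (isT : 0 < 1)%N Q; move=> /(_ _)/wrap[|/(_ 1%N)].
  by move=> z z0; rewrite (H (Ordinal L1) z z0) subrr.
rewrite /eis_coef /= expr1n invr1 !mul1r (_ : divisors 1 = [:: 1%N])// !big_seq1.
rewrite divnn /= expr1n !mul1r !big_ord1 muln0 expr0 !mulr1 !pE.
rewrite ek !mul1r /resid subrr dvdz0 => /eqP; rewrite subr_eq0 -!natrD eqr_nat.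
rewrite /req !mxE /= !mulr0 !subr0 c0 !mul1r !mulr1 /=.
case: ((L%:Z %| (g 1 1 - 1)%R)%Z) => //=.
have -> : (- 1%Z * g 1 1 - 1 = - (g 1 1 - -1)) by ring.
by rewrite rpredN; case: ((L%:Z %| (g 1 1 - -1)%R)%Z) => //; case: (_ %| _)%Z.
Qed.

Lemma eis_crep_inj k (i j : clsT L) : (3 <= k)%N -> odd k ->
  (forall (a : 'I_L) z, 0 < complex.Im z ->
    eis k (phi_act (crep i) (resid L a%:Z)) z = eis k (phi_act (crep j) (resid L a%:Z)) z) ->
  i = j.
Proof.
move=> k3 ko E; apply/eqP.
rewrite -(cl_crep i) -(cl_crep j) (cl_eq L1); [|exact: crepS|exact: crepS].
have [jK Kj] := adj2K (crepS j); have aS := adj2_SL (crepS j).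
have := @eis_resid_stab k (crep i *m adj2 (crep j)) k3 ko (SL2Z_mul (crepS i) aS).
move=> /(_ _)/wrap[|].
  move=> a z z0; have w0 := mobius_upper (SL2Z_det_gt0 R aS) z0.
  rewrite -(eis_modular _ k3 (SL2Z_mul (crepS i) aS) z0) (slashZM _ _ (crepS i) aS z0).
  rewrite (slashZ_eq (f2 := slashZ k.+1 (crep j) (eis k (resid L a%:Z))) k.+1 aS z0).
    rewrite -(slashZM _ _ (crepS j) aS z0) jK.
    by rewrite /slashZ map_mx1 slash1.
  move=> w w0'; rewrite (eis_modular _ k3 (crepS i) w0') (eis_modular _ k3 (crepS j) w0').
  exact: E.
by move=> /orP[] /(req_mul (crep j)); rewrite -mulmxA Kj mulmx1 mul1mx => ->; rewrite ?orbT.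
Qed.

(** For two distinct cosets the difference, at a well chosen point z, is a nonzero polynomial in t;
    t is a natural number that is no root of the product of these polynomials. *)
Lemma theta_separates : exists t : nat, forall i j : clsT L, i != j ->
  ~ null (fun z => theta_act L t (crep i) z - theta_act L t (crep j) z : C).
Proof.
have [G [GE Ginj]] : exists G : clsT L -> nat -> C -> C,
    (forall t i z, theta_act L t (crep i) z = \sum_(a < L) t%:R ^+ a * G i a z) /\
    (forall i j, (forall (a : 'I_L) z, 0 < complex.Im z -> G i a z = G j a z) -> i = j).
  exists (fun i a z => eis 11 (phi_act (crep i) (resid L a%:Z)) z); split=> // i j.
  exact: (@eis_crep_inj 11 i j isT isT).
have sep (ij : clsT L * clsT L) : exists z, 0 < complex.Im z /\ (ij.1 != ij.2 ->
    \poly_(a < L) (G ij.1 a z - G ij.2 a z) != 0).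
  case: ij => i j /=; have [_|ij] := eqVneq i j; first by exists 'i%C; rewrite /= ltr01.
  apply: contrapT => /forallNP H; case/negP: ij; apply/eqP.
  apply: Ginj => a z z0.
  apply/eqP; rewrite -subr_eq0; apply: contraT => n0; case: (H z).
  split=> [//|_]; apply/eqP => /polyP/(_ a).
  by rewrite coef_poly ltn_ord coef0 => /eqP; rewrite (negbTE n0).
have [pt ptP] := choice sep.
pose P ij := \poly_(a < L) (G ij.1 a (pt ij) - G ij.2 a (pt ij)).
have [|t tP] := @nat_nonroot C (\prod_(ij : clsT L * clsT L | ij.1 != ij.2) P ij) (Num.Theory.pchar_num _).
  by apply/prodf_neq0 => ij ij0; have [_] := ptP ij; apply.
exists t => i j ij N; case/negP: tP; rewrite horner_prod.
rewrite (bigD1 (i, j))//= mulf_eq0; apply/orP; left.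
have [z0 _] := ptP (i, j); rewrite -(N _ z0) !GE -sumrB horner_poly; apply/eqP.
by apply: eq_bigr => a _; rewrite -mulrBr mulrC.
Qed.

(** Transforming a vanishing form by every coset gives a polynomial of degree below l with l roots,
    the transforms of theta; so its coefficients, forms in [modx] and [mody], vanish, and
    [homogeneous_indep] applies. *)
Lemma form_indep m n t (c : 'I_m * 'I_#|clsT L| -> C) :
  (forall i j : clsT L, i != j -> ~ null (fun z => theta_act L t (crep i) z - theta_act L t (crep j) z : C)) ->
  (m + #|clsT L| <= n)%N -> null (eform n c (theta L t)) -> forall i, c i = 0.
Proof.
move=> sep mn N; set l := #|clsT L| in c mn N *.
pose P (b : 'I_l) z := \sum_(a < m) c (a, b) * (modx z ^+ (n - b - a) * mody z ^+ a).
have Pv (i : clsT L) z : 0 < complex.Im z ->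
    (rVpoly (\row_b P b z)).[theta_act L t (crep i) z] = 0.
  move=> z0; have sz : (size (rVpoly (\row_b P b z)) <= l)%N by exact: size_poly.
  rewrite (horner_coef_wide _ sz); have iS := crepS i.
  have := @slashZ_form R m l n c (theta L t) (crep i) z mn iS z0.
  rewrite slashZE// (N _ _) ?mulr0; last first.
    have := mobius_upper (SL2Z_det_gt0 R iS) z0.
    by rewrite /mobius /automorphy_factor !mxE !(rmorph_int (real_complex R)).
  rewrite /eform slashZ_theta// => E; rewrite [RHS]E.
  transitivity (\sum_(b < l) \sum_(a < m) c (a, b) * (modx z ^+ (n - a - b) * mody z ^+ a *
    theta_act L t (crep i) z ^+ b)); last first.
    by rewrite exchange_big pair_bigA; apply: eq_bigr => -[].
  apply: eq_bigr => b _; rewrite coef_rVpoly_ord mxE /P mulr_suml; apply: eq_bigr => a _.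
  by rewrite (subnAC n b a) !mulrA.
have hT i : hol (theta_act L t (crep i) : C -> C) by exact: theta_act_hol.
have PN b : null (P b).
  have hP : hol (P b).
    apply: hol_sum => a; apply: holM; first exact: hol_cst.
    by apply: holM; apply: holX; [exact: modx_hol|exact: mody_hol].
  (* The factors of a discriminant. Where their product is nonzero the roots are distinct and [P b]
     vanishes; [hol_domain] removes the restriction. *)
  pose d (ij : clsT L * clsT L) z := if ij.1 == ij.2 then 1
     else theta_act L t (crep ij.1) z - theta_act L t (crep ij.2) z.
  have hd ij : hol (d ij).
    rewrite /d; case: eqP => _; first exact: hol_cst.
    by apply: holD => //; exact: holN.
  have [|//|dN] := @hol_domain R (P b) (fun z => \prod_ij d ij z) hP (hol_prod _ _ hd); last first.
    have [[i j]] := hol_domain_prod hd dN; rewrite /d /=; case: eqP => [_ /(_ 'i%C)|/eqP ij /sep]; last exact.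
    by rewrite /= ltr01 => /(_ isT) /eqP; rewrite oner_eq0.
  move=> z z0; have [->|] := eqVneq (\prod_ij d ij z) 0; first by rewrite mulr0.
  move=> /prodf_neq0 dz; suff -> : P b z = 0 by rewrite mul0r.
  pose Q := rVpoly (\row_b P b z).
  suff : Q = 0 by by move=> /polyP/(_ b); rewrite coef_rVpoly_ord mxE coef0.
  apply: contrapT => /eqP Q0; have := max_poly_roots Q0 (rs := [seq theta_act L t (crep i) z | i <- enum (clsT L)]).
  rewrite size_map -cardE ltnNge size_poly /= => H; suff : false by []; apply: H.
    by apply/allP => _ /mapP[i _ ->]; apply/rootP; exact: Pv.
  have inj : injective (fun i : clsT L => theta_act L t (crep i) z).
    move=> i j ij; apply/eqP; apply: contraT => nij.
    by have := dz (i, j) isT; rewrite /d /= (negbTE nij) ij subrr eqxx.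
  by rewrite (map_inj_uniq inj) enum_uniq.
have [b Jx] := modx_jet R; have [b' Jy b'0] := mody_jet R.
move=> [a e]; have := PN e => Ne.
pose c' (a : nat) : C := if insub a is Some a' then c (a', e) else 0.
have := @homogeneous_indep R _ _ _ _ _ m Jx (zeta_even_3_neq0 R) Jy b'0 (n - e) c'.
move=> /(_ _)/wrap[|].
  by move=> z z0; rewrite -[RHS](Ne z z0); apply: eq_bigr => i _; rewrite /c' valK.
by move=> /(_ a (ltn_ord a)); rewrite /c' valK.
Qed.

End Independence.

(** * The newform as a quotient *)

Section Quotient.
Variable R : realType.
Local Notation C := R[i].
Implicit Types (z : C) (W V : C -> C) (g : 'M[int]_2).

Lemma null_slash w g W : SL2Z g -> null (slashZ w g W) -> null W.
Proof.
move=> gS N z z0; have [gK _] := adj2K gS; have aS := adj2_SL gS.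
have w0 := mobius_upper (SL2Z_det_gt0 R aS) z0.
have := slashZM w W gS aS z0; rewrite gK {1}/slashZ map_mx1 slash1 => ->.
rewrite slashZE// N ?mulr0//.
by move: w0; rewrite /mobius /automorphy_factor !mxE !(rmorph_int (real_complex R)).
Qed.

Lemma cn_slash_cl L w W g z : (1 < L)%N -> G1inv L w W -> SL2Z g -> 0 < complex.Im z ->
  cn (slashZ w (crep (cl L g)) W z) = cn (slashZ w g W z).
Proof.
move=> L1 WG gS z0; have := cl_eq L1 (crepS (cl L g)) gS.
rewrite cl_crep eqxx => /esym/orP[] r; apply: G1inv_cn r _ => //; try exact: crepS.
  by left.
by right.
Qed.

Lemma dirichlet_per N (Psi : int -> C) x j : dirichlet_character N Psi ->
  Psi (x + N%:Z * j) = Psi x.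
Proof.
move=> [_ P _]; apply/eqP.
by rewrite (@per_int N (fun n => Psi n == Psi x)) // => n; rewrite P.
Qed.

Lemma dirichlet1 N (Psi : int -> C) : dirichlet_character N Psi -> Psi 1 = 1.
Proof.
move=> [M _ P0]; have := M 1 1; rewrite mulr1 => e.
have n0 : Psi 1 != 0 by rewrite P0 /coprimez gcd1z.
by apply: (mulfI n0); rewrite -e mulr1.
Qed.

Lemma cusp_G1inv L N k (Psi : int -> C) f : dirichlet_character N Psi -> cusp_form k N Psi f ->
  (N %| L)%N -> G1inv L k f.
Proof.
move=> PsiD [_ fG _] NL g gS g0 g1 z z0.
have NLz : (N%:Z %| L%:Z)%Z by [].
rewrite fG//; last by split=> //; exact: dvdz_trans g0.
have /dvdzP[j e] := dvdz_trans NLz g1.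
have -> : g 1 1 = 1 + N%:Z * j by rewrite mulrC -e addrC subrK.
by rewrite (dirichlet_per _ _ PsiD) (dirichlet1 PsiD) mul1r.
Qed.

Lemma bdd_pos W V : (forall z, 0 < complex.Im z -> W z = V z) -> bdd V -> bdd W.
Proof.
move=> WV [K [Y H]]; exists K, (Num.max Y 1) => z; rewrite ge_max => /andP[zY z1].
by rewrite WV ?H// (lt_le_trans ltr01).
Qed.

Lemma cusp_bdd k N (Psi : int -> C) f g : cusp_form k N Psi f -> SL2Z g -> bdd (slashZ k g f).
Proof.
move=> [_ _ fc] gS; have [y Hy] := fc g gS 1 ltr01.
exists 1, (Num.max (y + 1) 1) => z; rewrite ge_max => /andP[zy z1].
have z0 : 0 < complex.Im z by rewrite (lt_le_trans ltr01).
have : `|slashZ k g f z| < (1 : R)%:C by apply: Hy => //; lra.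
by rewrite cnE ltcR => /ltW.
Qed.

Lemma sturm_G1 L w W r : (1 < L)%N -> hol W -> G1inv L w W ->
  (forall g, SL2Z g -> bdd (slashZ w g W)) ->
  (exists K Y : R, forall z, Y <= complex.Im z ->
     cn (W z) * expR (2 * pi * r.+1%:R * complex.Im z) <= K) ->
  (5 * (w * #|clsT L|) < 32 * r)%N -> null W.
Proof.
move=> L1 hW WG Wb [K [Y HK]] wr.
have TS : SL2Z (mx2 1 1 0 1) by rewrite /SL2Z /= det_mx2.
have SS : SL2Z (mx2 0 (-1) 1 0) by rewrite /SL2Z /= det_mx2.
have [||||||||i Ni] := @sturm R _ (cl0 L) (fun i => slashZ w (crep i) W)
  (fun i => cl L (crep i *m mx2 0 (-1) 1 0)) (fun i => cl L (crep i *m mx2 1 1 0 1)) w r.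
- exact: cl_mul_inj.
- exact: cl_mul_inj.
- by move=> i; apply: slashZ_hol => //; exact: crepS.
- move=> i z z0; rewrite (cn_slash_cl L1 WG (SL2Z_mul (crepS i) TS) z0).
  rewrite (slashZM w W (crepS i) TS z0) [slashZ w (mx2 _ _ _ _) _ _](slashZE _ _ _ TS).
  have [-> -> -> ->] := mx2E 1 1 0 (1 : int).
  by rewrite !mulr1z !mulr0z mul0r add0r expr1n invr1 !mul1r mulr1.
- move=> i z z0; rewrite (cn_slash_cl L1 WG (SL2Z_mul (crepS i) SS) z0).
  rewrite (slashZM w W (crepS i) SS z0) [slashZ w (mx2 _ _ _ _) _ _](slashZE _ _ _ SS).
  have [-> -> -> ->] := mx2E 0 (-1) 1 (0 : int).
  have zn0 : z != 0 by apply: contraTneq z0 => ->; rewrite ltxx.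
  rewrite !mulr1z !mulr0z mulrN1z mul0r add0r addr0 mul1r mulN1r (cnM (z ^- w)) cnV cnX mulrA mulfV ?mul1r//.
  by rewrite expf_neq0// cn_eq0.
- by move=> i; apply: Wb; exact: crepS.
- exists K, (Num.max Y 1) => z; rewrite ge_max => /andP[zY z1].
  have z0 : 0 < complex.Im z by rewrite (lt_le_trans ltr01).
  have -> : cl0 L = cl L 1%:M by apply: val_inj; rewrite clE//; exact: SL2Z_one.
  rewrite (cn_slash_cl L1 WG SL2Z_one z0) {1}/slashZ map_mx1 slash1.
  exact: HK.
- exact: wr.
exact: null_slash (crepS i) Ni.
Qed.

Section Existence.
Variables (F : divringClosed C) (L N k : nat) (Psi : int -> C) (f : C -> C) (a : nat -> C).
Hypotheses (L1 : (1 < L)%N) (NL : (N %| L)%N) (PsiD : dirichlet_character N Psi)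
  (fC : cusp_form k N Psi f) (fa : q_expansion f a) (aF : forall n, a n \in F).
Let L0 : (0 < L)%N := ltnW L1.

Lemma eis_rat1 j (P : int -> bool) : (3 <= j)%N ->
  ratfam F 1 1 1 (fun _ => eis j (fun m _ => P m)).
Proof. by move=> j3; apply: (@eis_ratfam R F 1 j 1 (fun _ m _ => P m)). Qed.

Lemma modx_rat p M M' : ratfam F p M M' (fun _ => @E4 R) -> (0 < M)%N ->
  ratfam F p M M' (fun _ => @modx R).
Proof. by move=> H M0; apply: ratfamX. Qed.

Lemma mody_rat p M M' : ratfam F p M M' (fun _ => @E4 R) -> ratfam F p M M' (fun _ => @E6 R) ->
  (0 < M)%N -> ratfam F p M M' (fun _ => @mody R).
Proof.
move=> H4 H6 M0.
have h : ratfam F p M M' (fun _ z => zeta_even R 5 ^+ 2 * E4 z ^+ 3 + - zeta_even R 3 ^+ 3 * E6 z ^+ 2).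
  apply: ratfamD; apply: ratfamcM => //; try exact: ratfamX.
    by rewrite rpredX// zeta_even_rat.
  by rewrite rpredN rpredX// zeta_even_rat.
by apply: ratfam_eq h => s z _ _; rewrite mulNr.
Qed.

Lemma eform_rat p M M' m l n (c : 'I_m * 'I_l -> C) (T : nat -> C -> C) : (0 < M)%N ->
  ratfam F p M M' (fun _ => @E4 R) -> ratfam F p M M' (fun _ => @E6 R) ->
  ratfam F p M M' T -> (forall i, c i \in F) -> ratfam F p M M' (fun s => eform n c (T s)).
Proof.
move=> M0 H4 H6 HT cF; apply: ratfam_sum => // i _; apply: ratfamcM => //.
apply: ratfamM => //; last exact: ratfamX.
by apply: ratfamM => //; apply: ratfamX => //; [exact: modx_rat|exact: mody_rat].
Qed.

(** Its weight 11k + 12 raises the weight k of f to 12 (k + 1), so that both sides of the identity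
    below have weight 12 (n + k + 1). *)
Definition hfac : C -> C := eis (11 * k + 11) (resid L 1).

(** The coefficients of both forms are the unknowns, and the equations over F let the first
    coefficients of the difference vanish; by the Sturm bound the difference is zero. If the first
    form were zero, so would be the second, and [form_indep] would annul all unknowns. *)
Lemma quotient_form : ~ null f ->
  exists t m n (c d : 'I_m * 'I_#|clsT L| -> C),
  [/\ forall i, c i \in F, forall i, d i \in F, (m + #|clsT L| <= n)%N,
      ~ null (eform n c (theta L t)) &
      forall z, 0 < complex.Im z ->
      eform n c (theta L t) z * (f z * hfac z) = eform (n + k.+1) d (theta L t) z].
Proof.
move=> fN; have [t sep] := theta_separates R L1.
set mu := #|clsT L|; have mu0 : (0 < mu)%N by apply/card_gt0P; exists (cl0 L).
(* The Sturm bound asks 60 (m + mu + k + 1) mu < 32 (2 m mu - 2), that is 60 (mu + k + 1) mu + 64 <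
   4 m mu. *)
pose m := (15 * mu + 15 * k.+1 + 17)%N; pose n := (m + mu)%N; exists t, m, n.
pose J := ('I_m * 'I_mu)%type; pose T := (bool * J)%type.
pose th := theta L t : C -> C.
pose mono nn (i : J) z : C := modx z ^+ (nn - i.1 - i.2) * mody z ^+ i.1 * th z ^+ i.2.
pose e (u : T) z : C := if u.1 then mono n u.2 z * (f z * hfac z) else - mono (n + k.+1)%N u.2 z.
have R4 := eis_rat1 (fun=> true) (isT : 3 <= 3)%N; have R6 := eis_rat1 (fun=> true) (isT : 3 <= 5)%N.
have Rth : ratfam F 1 1 1 (fun _ => th).
  apply: ratfam_sum => [//|i _]; apply: ratfamcM => [//||]; first by rewrite rpredX ?rpred_nat.
  exact: (eis_rat1 (fun m => (L%:Z %| (m - i%:Z)%R)%Z) (isT : 3 <= 11)%N).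
have Rmono nn i : ratfam F 1 1 1 (fun _ => mono nn i).
  apply: ratfamM => //; last exact: ratfamX.
  by apply: ratfamM => //; apply: ratfamX => //; [exact: modx_rat|exact: mody_rat].
have k3 : (3 <= 11 * k + 11)%N by lia.
have Rh : ratfam F 1 1 1 (fun _ => hfac) by exact: (eis_rat1 (fun m => (L%:Z %| (m - 1)%R)%Z) k3).
have fq := q_expansion_qseries fa.
have Rf : ratfam F 1 1 1 (fun _ => f).
  exists (fun n => (a n)%:P); split=> [j|s _ z z0]; first by rewrite polyOverC.
  by apply: hasSum_ext (fq z z0) => j; rewrite hornerC.
have Re u : ratfam F 1 1 1 (fun _ => e u).
  case: u => -[] i; rewrite /e /=; first by apply: ratfamM => //; apply: ratfamM.
  by apply: ratfam_eq (ratfamcM _ (rpredN1 F) (Rmono (n + k.+1)%N i)) => // s z _ _; rewrite mulN1r.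
have ex u : exists b : nat -> C, (forall j, b j \in F) /\ qseries 1 b (e u).
  have [A [AF HA]] := Re u; exists (fun j => (A j).[zeta R 1 ^+ 1]); split; last exact: HA.
  move=> j; have -> : zeta R 1 = 1 by rewrite /zeta invr1 nome1.
  by rewrite expr1n rpred_horner ?rpred1.
have [b Hb] := choice ex.
have cT : #|{: T}| = (2 * (m * mu))%N by rewrite !card_prod card_bool !card_ord.
(* The coefficients of index 0 to r give one equation fewer than there are unknowns. *)
pose r := (2 * (m * mu) - 2)%N.
have mm : (0 < m * mu)%N by rewrite muln_gt0 mu0 /m; lia.
have [||v [v0 vF vM]] := @linear_solve _ F r.+1 #|{: T}| (\matrix_(i, j) b (enum_val j) i) _ _.
- by rewrite cT /r; lia.
- by move=> i j; rewrite mxE; have [] := Hb (enum_val j).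
pose vv (u : T) := v (enum_rank u) 0.
pose c1 (i : 'I_m * 'I_mu) : C := vv (true, i); pose c2 (i : 'I_m * 'I_mu) : C := vv (false, i).
exists c1, c2.
pose W z : C := \sum_u vv u * e u z.
have WE z : W z = eform n c1 th z * (f z * hfac z) -
   eform (n + k.+1) c2 th z.
  have -> : W z = \sum_(x : bool) \sum_(y : J) vv (x, y) * e (x, y) z.
    by rewrite /W pair_bigA; apply: eq_bigr => -[].
  rewrite big_bool /= /eform mulr_suml -sumrN.
  by congr (_ + _); apply: eq_bigr => i _; [exact: mulrA|exact: mulrN].
have Wq : qseries 1 (fun j => \sum_u vv u * b u j) W.
  move=> z z0; have := hasSum_sum (index_enum T) predT (fun u => hasSumcM (vv u) ((Hb u).2 z z0)).
  by apply: hasSum_ext => j; rewrite mulr_suml; apply: eq_bigr => u _; rewrite mulrA.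
have W0 j : (j < r.+1)%N -> \sum_u vv u * b u j = 0.
  move=> jr; have /matrixP/(_ (Ordinal jr) 0) := vM; rewrite !mxE => E; rewrite -[RHS]E.
  rewrite (reindex (@enum_val _ [in {: T}])) /=; last by apply: onW_bij; exact: enum_val_bij.
  by apply: eq_bigr => u _; rewrite mxE /vv enum_valK mulrC.
have mn : (m + mu <= n)%N by [].
have mn2 : (m + mu <= n + k.+1)%N by rewrite (leq_trans mn)// leq_addr.
have we : (12 * (n + k.+1) = 12 * n + (k + (11 * k + 11).+1))%N by lia.
set w := (12 * (n + k.+1))%N.
have WG : G1inv L w W.
  have H1 : G1inv L w (fun z => eform n c1 th z * (f z * hfac z)).
    rewrite /w we; apply: G1invM; first exact: form_inv.
    by apply: G1invM; [exact: cusp_G1inv fC NL|exact: eis_resid_inv].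
  have H2 : G1inv L w (eform (n + k.+1) c2 th) by exact: form_inv.
  move=> g gS g0 g1 z z0; rewrite WE -(G1invB H1 H2 gS g0 g1 z0).
  by apply: slashZ_eq => // u u0; rewrite WE.
have hW : hol W by exact: qseries_hol Wq.
have Wb g : SL2Z g -> bdd (slashZ w g W).
  move=> iS.
  have B1 : bdd (theta_act L t (g) : C -> C) by exact: bdd_theta_act.
  apply: bdd_pos (bddD (bddM (bdd_form n c1 B1)
     (bddM (cusp_bdd fC iS) (bdd_eis R k3 L0 (phi_act_period L (g) 1))))
     (bddM (bdd_cst (-1)) (bdd_form (n + k.+1) c2 B1))).
  move=> z z0; have tE := @slashZ_theta R L t g z iS z0.
  rewrite mulN1r; have -> : slashZ w (g) W z =
     slashZ w (g) (fun z => eform n c1 th z * (f z * hfac z)) z -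
     slashZ w (g) (eform (n + k.+1) c2 th) z.
    by rewrite !slashZE// WE mulrBr.
  congr (_ - _); last by rewrite slashZ_form// /eform tE.
  rewrite /w we /slashZ !slash_mul; congr (_ * (_ * _)).
    by have := slashZ_form c1 th mn iS z0; rewrite /eform tE.
  exact: eis_modular.
have Wd : exists K Y : R, forall z, Y <= complex.Im z ->
     cn (W z) * expR (2 * pi * r.+1%:R * complex.Im z) <= K.
  have [K [Y HK]] := qseries_asymp (isT : 0 < 1)%N Wq r.+1.
  exists K, Y => z zY; have := HK z zY.
  rewrite big1 ?subr0; last by move=> j _; rewrite W0 ?mul0r.
  rewrite cn_qpar divr1 -expRM_natl => h.
  rewrite -ler_pdivlMr ?expR_gt0// -expRN (_ : - (2 * pi * r.+1%:R * _) = r.+1%:R * - (2 * pi * complex.Im z))//.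
  by ring.
have WN : null W.
  by apply: (sturm_G1 L1 hW WG Wb Wd); rewrite -/mu /w /r /n /m; nia.
have indep := @form_indep R L L1 m _ t _ sep.
have AfB z : 0 < complex.Im z -> eform n c1 th z * (f z * hfac z) =
    eform (n + k.+1) c2 th z.
  by move=> z0; apply/eqP; rewrite -subr_eq0 -WE WN.
split=> //; try by move=> i'; rewrite /vv vF.
move=> AN; have c0 := indep _ _ mn AN.
have d0 := indep (n + k.+1)%N c2 mn2 _.
have {}d0 : forall i, c2 i = 0.
  by apply: d0 => z z0; rewrite -AfB// AN// mul0r.
case/negP: v0; apply/eqP/matrixP => j j'; rewrite (ord1 j') mxE -(enum_valK j).
by case: (enum_val j) => -[] u; [exact: c0|exact: d0].
Qed.

End Existence.
End Quotient.

(** * Descent to the field of coefficients *)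

Section Descent.
Variable R : realType.
Local Notation C := R[i].
Implicit Types (z : C) (W V : C -> C) (g : 'M[int]_2).
Variables (F : divringClosed C) (p N k : nat) (Psi : int -> C) (f : C -> C) (a : nat -> C).
Hypotheses (pp : prime p) (pN : (p %| N)%N) (N0 : (0 < N)%N) (PsiD : dirichlet_character N Psi)
  (fC : cusp_form k N Psi f) (fa : q_expansion f a) (aF : forall n, a n \in F) (fN : ~ null f).
(** The factor p ensures L > 2 even for N = 2, so that 1 and -1 differ modulo L in [hfac_nonnull];
    accordingly [y_exists] works modulo p^(nu + 1). *)
Let L := (p * N)%N.

Let L2 : (2 < L)%N.
Proof. by have := prime_gt1 pp; have := dvdn_leq N0 pN; rewrite /L; nia. Qed.
Let L1 : (1 < L)%N := ltnW L2.
Let L0 : (0 < L)%N := ltnW L1.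
Let NL : (N %| L)%N := dvdn_mull p (dvdnn N).
Let w1 := (11 * k + 11)%N.
Let w3 : (3 <= w1)%N. Proof. by rewrite /w1; lia. Qed.

Let hfac_nonnull : ~ null (@hfac R L k).
Proof.
move=> hN; have Q := @eis_qseries R w1 1 (resid L 1) w3 isT (fun m n => erefl).
have := null_qseries (isT : 0 < 1)%N Q hN 1%N.
rewrite /eis_coef /= expr1n invr1 mul1r (_ : divisors 1 = [:: 1%N])// big_seq1.
rewrite divnn /= expr1n mul1r big_ord1 muln0 expr0 mulr1 /resid subrr dvdz0.
have -> : (L%:Z %| (- 1%:Z - 1)%R)%Z = false.
  by rewrite dvdzE /=; apply/negP => /dvdn_leq => /(_ isT); rewrite leqNgt L2.
by move=> /eqP; rewrite mulr0 addr0 oner_eq0.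
Qed.

Let f_hol : hol f.
Proof. exact: qseries_hol (q_expansion_qseries fa). Qed.
Definition hact g : C -> C := eis w1 (phi_act g (resid L 1)).

Lemma hact_slash g z : SL2Z g -> 0 < complex.Im z -> slashZ w1.+1 g (@hfac R L k) z = hact g z.
Proof. by move=> gS z0; rewrite (eis_modular _ w3 gS z0). Qed.

Lemma hact_nonnull g : SL2Z g -> ~ null (hact g).
Proof.
move=> gS hN; apply: hfac_nonnull; apply: (null_slash gS (w := w1.+1)) => z z0.
by rewrite hact_slash// hN.
Qed.

Lemma hact_hol g : hol (hact g).
Proof. exact: (@eis_act_hol R L w1 g 1 w3 L0). Qed.

Lemma quotient_slash t m n (c d : 'I_m * 'I_#|clsT L| -> C) g z : (m + #|clsT L| <= n)%N ->
  (forall z, 0 < complex.Im z ->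
      eform n c (theta L t) z * (f z * @hfac R L k z) = eform (n + k.+1) d (theta L t) z) ->
  SL2Z g -> 0 < complex.Im z ->
  eform n c (theta_act L t g) z * (slashZ k g f z * hact g z) = eform (n + k.+1) d (theta_act L t g) z.
Proof.
move=> mn Q gS z0; have tE := @slashZ_theta R L t g z gS z0.
have mn2 : (m + #|clsT L| <= n + k.+1)%N by rewrite (leq_trans mn)// leq_addr.
have EA : eform n c (theta_act L t g) z = slashZ (12 * n) g (eform n c (theta L t)) z.
  by rewrite slashZ_form// /eform tE.
have EB : eform (n + k.+1) d (theta_act L t g) z = slashZ (12 * (n + k.+1)) g (eform (n + k.+1) d (theta L t)) z.
  by rewrite slashZ_form// /eform tE.
rewrite EA EB -hact_slash// /slashZ -slash_mul -slash_mul.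
have -> : (12 * (n + k.+1) = 12 * n + (k + w1.+1))%N by rewrite /w1; lia.
by apply: slash_eq => //; exact: SL2Z_det_gt0.
Qed.

Lemma eform_act_nonnull t m n (c : 'I_m * 'I_#|clsT L| -> C) g : (m + #|clsT L| <= n)%N ->
  ~ null (eform n c (theta L t)) -> SL2Z g -> ~ null (eform n c (theta_act L t g)).
Proof.
move=> mn AN gS N'; apply: AN; apply: (null_slash gS (w := 12 * n)) => z z0.
by rewrite slashZ_form//; have := N' z z0; rewrite /eform (@slashZ_theta R L t g z gS z0).
Qed.

Lemma nonnullM W V : hol W -> hol V -> ~ null W -> ~ null V -> ~ null (fun z => W z * V z).
Proof. by move=> hW hV nW nV /(hol_domain hW hV) []. Qed.

Lemma cross_mul (K : comRingType) (u1 u2 v w1' w2 P b1 b2 : K) :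
  u1 * (v * w1') = b1 -> u2 * (P * v * w2) = b2 -> b2 * (u1 * w1') = P * (u2 * w2 * b1).
Proof. by move=> <- <-; ring. Qed.

(** A matrix of Gamma_0(L) with lower right entry x multiplies f by Psi(x). Transforming the
    identity A f h = B by it and eliminating f leaves Psi(x) as a ratio of series over F, to which
    [trace_descent] applies with families constant in s. *)
Lemma psi_rat (x : int) : coprimez x N%:Z -> Psi x \in F.
Proof.
move=> xN; have xL : coprimez x L%:Z.
  rewrite /L PoszM coprimezMr xN andbT.
  by move: xN; rewrite -(divnK pN) PoszM coprimezMr => /andP[].
have [u [v uv]] : exists u v : int, u * x - v * L%:Z = 1.
  have [u [v uv]] := Bezoutz x L%:Z; exists u, (- v); rewrite mulNr opprK uv.
  by move: xL; rewrite /coprimez => /eqP.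
pose g := mx2 u v L%:Z x.
have gS : SL2Z g by rewrite /SL2Z /= det_mx2.
have [g00 g01 g10 g11] := mx2E u v L%:Z x.
have [t [m [n [c [d [cF dF mn AN Q]]]]]] := quotient_form L1 NL PsiD fC fa aF fN.
have fg z : 0 < complex.Im z -> slashZ k g f z = Psi x * f z.
  by move=> z0; have [_ fG _] := fC; rewrite fG//; [rewrite g11|split=> //; rewrite g10].
have Qg z (z0 : 0 < complex.Im z) := quotient_slash mn Q gS z0.
pose X z := eform (n + k.+1) d (theta_act L t g) z * (eform n c (theta L t) z * @hfac R L k z).
pose Y z := (eform n c (theta_act L t g) z * hact g z) * eform (n + k.+1) d (theta L t) z.
have XY z : 0 < complex.Im z -> X z = Psi x * Y z.
  move=> z0; apply: cross_mul (Q z z0) _.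
  by have := Qg z z0; rewrite (fg z z0).
have M1 : (0 < 1)%N by [].
have Rlift V : ratfam F p 1 1 (fun _ => V) -> ratfam F p 1 (p ^ 1) (fun _ => V).
  by move=> /(ratfam_raise M1 (prime_gt0 pp)); rewrite mul1n expn1.
have Rphi j (P : int -> bool) : (3 <= j)%N -> ratfam F p 1 1 (fun _ => eis j (fun m _ => P m)).
  by move=> j3; apply: (@eis_ratfam R F p j 1 (fun _ m _ => P m)) => // s _; exact: coprimen1.
have R4 := Rphi 3 (fun=> true) isT; have R6 := Rphi 5 (fun=> true) isT.
have actE b : phi_act g (resid L b) = fun m _ => (L%:Z %| (m * x - b)%R)%Z.
  by apply/funext => i; apply/funext => j; rewrite phi_act_resid ?g11// g10.
have Rth : ratfam F p 1 1 (fun _ => theta L t).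
  apply: ratfam_sum => [//|i _]; apply: ratfamcM => [//||]; first by rewrite rpredX ?rpred_nat.
  exact: (Rphi 11 (fun m => (L%:Z %| (m - i%:Z)%R)%Z) isT).
have Rthg : ratfam F p 1 1 (fun _ => theta_act L t g).
  apply: ratfam_sum => [//|i _]; apply: ratfamcM => [//||]; first by rewrite rpredX ?rpred_nat.
  by rewrite actE; exact: (Rphi 11 (fun m => (L%:Z %| (m * x - i%:Z)%R)%Z) isT).
have Rh : ratfam F p 1 1 (fun _ => @hfac R L k) by exact: (Rphi w1 (fun m => (L%:Z %| (m - 1)%R)%Z) w3).
have Rhg : ratfam F p 1 1 (fun _ => hact g).
  by rewrite /hact actE; exact: (Rphi w1 (fun m => (L%:Z %| (m * x - 1)%R)%Z) w3).
apply: (@trace_descent R F p 1 1 (fun _ => X) (fun _ => Y) (Psi x) 1 pp isT isT).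
- exact: Rlift (ratfamM M1 (eform_rat (n + k.+1) M1 R4 R6 Rthg dF)
    (ratfamM M1 (eform_rat n M1 R4 R6 Rth cF) Rh)).
- exact: Rlift (ratfamM M1 (ratfamM M1 (eform_rat n M1 R4 R6 Rthg cF) Rhg)
    (eform_rat (n + k.+1) M1 R4 R6 Rth dF)).
- by move=> s z _; exact: XY.
- exact: coprime1n.
have hth : hol (theta L t : C -> C) by exact: ratfam_hol (isT : 0 < 1)%N Rth (coprime1n p).
have hthg : hol (theta_act L t g : C -> C) by exact: theta_act_hol.
apply: nonnullM; [|exact: form_hol| |].
- by apply: holM; [exact: form_hol|exact: hact_hol].
- apply: nonnullM; [exact: form_hol|exact: hact_hol| |exact: hact_nonnull].
  exact: eform_act_nonnull.
move=> BN; have : null (fun z => eform n c (theta L t) z * (f z * @hfac R L k z)).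
  by move=> z z0; rewrite Q// BN.
apply: nonnullM => //; first exact: form_hol.
  by apply: holM => //; exact: (ratfam_hol (isT : 0 < 1)%N Rh (coprime1n p)).
by apply: nonnullM => //; exact: (ratfam_hol (isT : 0 < 1)%N Rh (coprime1n p)).
Qed.

(** With this sign the condition in [phi_act_nlow] reads m + n y = b modulo L. *)
Definition nlow (y : int) : 'M[int]_2 := mx2 1 0 (- y) 1.
Lemma nlow_SL y : SL2Z (nlow y).
Proof. by rewrite /SL2Z /= det_mx2; ring. Qed.

Lemma phi_act_nlow y b m n : phi_act (nlow y) (resid L b) m n = (L%:Z %| (m + n * y - b)%R)%Z.
Proof.
rewrite /phi_act /resid /nlow !mxE /=.
by congr (_ %| _)%Z; ring.
Qed.

Lemma shift_upper z (x : R) : complex.Im (z - x%:C) = complex.Im z.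
Proof. by rewrite cImD cImN /= oppr0 addr0. Qed.

Lemma hol_shift W (x : R) : hol W -> hol (fun z => W (z - x%:C)).
Proof.
move=> hW z z0; apply: (@taylor2_comp R W (fun z => z - x%:C)); first by apply: hW; rewrite shift_upper.
by apply: taylor2D; [exact: taylor2_id|exact: taylor2_cst].
Qed.

Lemma nonnull_shift W (x : R) : ~ null W -> ~ null (fun z => W (z - x%:C)).
Proof.
move=> nW H; apply: nW => z z0; rewrite -(H (z + x%:C)) ?addrK//.
by rewrite cImD /= addr0.
Qed.

(** The congruences on y make the transformed Eisenstein series rational families: m + n y_s modulo
    L has period p^nu in n, and replacing n by s n turns y_s into y_1. After multiplication by a
    common denominator the relation on S is one for [trace_descent]. *)
Lemma descent_main (nu r T u : nat) (y : nat -> int) (c om : C) s0 :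
  (0 < nu)%N -> coprime u p ->
  (forall s, coprime s p -> (L%:Z %| (p ^ nu)%:Z * y s)%Z) ->
  (forall s, coprime s p -> (L%:Z %| (s%:Z * y s - y 1%N)%R)%Z) ->
  om \in F ->
  (let G s := slashZ k (nlow (y s)) f in
   let S v s z := \sum_(j < T) G (s * v)%N (z - (s * j)%:R / (p ^ r)%:R) in
   (forall s z, coprime s p -> 0 < complex.Im z ->
      S (u ^ 2)%N s z - c * S u s z + om * S 1%N s z = 0) /\
   coprime s0 p /\ ~ null (S u s0)) -> c \in F.
Proof.
move=> nu0 up Ly Lsy omF [/= HS [s0p SN]].
have [t [m [n [al [be [alF beF mn AN Q]]]]]] := quotient_form L1 NL PsiD fC fa aF fN.
set M := (p ^ nu)%N; have M0 : (0 < M)%N by rewrite expn_gt0 prime_gt0.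
set e := (p ^ r)%N; have e0 : (0 < e)%N by rewrite expn_gt0 prime_gt0.
pose G s := slashZ k (nlow (y s)) f.
pose A s z := eform n al (theta_act L t (nlow (y s))) z * hact (nlow (y s)) z.
pose B s := eform (n + k.+1) be (theta_act L t (nlow (y s))).
have AGB s z : 0 < complex.Im z -> A s z * G s z = B s z.
  move=> z0; rewrite /B -(quotient_slash mn Q (nlow_SL (y s)) z0) /A /G.
  by rewrite mulrAC mulrA.
have Reis j b : (3 <= j)%N -> ratfam F p M M (fun s => eis j (phi_act (nlow (y s)) (resid L b))).
  move=> j3; apply: (@eis_ratfam R F p j M (fun s => phi_act (nlow (y s)) (resid L b))) => //.
  - by move=> s sp; rewrite coprimeXr.
  - move=> s x q sp; rewrite !phi_act_nlow.
    rewrite (_ : x + (q + M%:Z) * y s - b = x + q * y s - b + M%:Z * y s); last by ring.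
    by rewrite rpredDr// Ly.
  - move=> s x q sp; rewrite !phi_act_nlow.
    rewrite (_ : x + s%:Z * q * y s - b = x + q * y 1%N - b + q * (s%:Z * y s - y 1%N)); last by ring.
    by rewrite rpredDr// dvdz_mull// Lsy.
have R4 : ratfam F p M M (fun _ => @E4 R).
  by apply: (@eis_ratfam R F p 3 M (fun _ _ _ => true)) => // s sp; rewrite coprimeXr.
have R6 : ratfam F p M M (fun _ => @E6 R).
  by apply: (@eis_ratfam R F p 5 M (fun _ _ _ => true)) => // s sp; rewrite coprimeXr.
have Rth : ratfam F p M M (fun s => theta_act L t (nlow (y s))).
  by apply: ratfam_sum => [//|i _]; apply: ratfamcM => [//||]; [rewrite rpredX ?rpred_nat|exact: Reis].
have RA : ratfam F p M M A.
  exact: (ratfamM M0 (eform_rat n M0 R4 R6 Rth alF) (Reis w1 1 w3)).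
have RB : ratfam F p M M B by exact: (eform_rat (n + k.+1) M0 R4 R6 Rth beF).
have hA s : hol (A s).
  by apply: holM; [apply: form_hol; exact: theta_act_hol|exact: hact_hol].
have nA s : ~ null (A s).
  apply: nonnullM; [apply: form_hol; exact: theta_act_hol|exact: hact_hol| |].
    exact: eform_act_nonnull mn AN (nlow_SL _).
  exact: hact_nonnull (nlow_SL _).
have hG s : hol (G s) by apply: slashZ_hol => //; exact: nlow_SL.
pose sh (g : nat -> C -> C) v j s z : C := g (s * v)%N (z - (s * j)%:R / e%:R).
have shE (g : nat -> C -> C) v j s : sh g v j s = fun z => g (s * v)%N (z - ((s * j)%:R / e%:R : R)%:C).
  apply/funext => z; rewrite /sh; congr (g _ (_ - _)).
  by rewrite (rmorphM (real_complex R)) fmorphV !rmorph_nat.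
have Rsh (g : nat -> C -> C) v j : coprime v p -> ratfam F p M M g -> ratfam F p M (p ^ (nu + r)) (sh g v j).
  move=> vp Rg; rewrite expnD; apply: (ratfam_shift j M0 e0 (g := fun s => g (s * v)%N)).
  exact: ratfam_subst vp (ratfam_raise M0 e0 Rg).
pose vs (b : 'I_3) := (u ^ b)%N.
have vsp b : coprime (vs b) p by rewrite coprimeXl.
(* The denominators of all T translates for the three multipliers 1, u, u^2. [num i] is this product
   with the i-th factor A replaced by B, that is P times the i-th translate of G. *)
pose P s z := \prod_(i : 'I_T * 'I_3) sh A (vs i.2) i.1 s z.
pose num (i : 'I_T * 'I_3) s z := sh B (vs i.2) i.1 s z * \prod_(l | l != i) sh A (vs l.2) l.1 s z.
have Rnum i : ratfam F p M (p ^ (nu + r)) (num i).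
  apply: (ratfamM M0); first exact: (Rsh _ _ _ (vsp _) RB).
  by apply: (ratfam_prod _ M0) => l _; exact: (Rsh _ _ _ (vsp _) RA).
have PG (i : 'I_T * 'I_3) s z : 0 < complex.Im z -> P s z * sh G (vs i.2) i.1 s z = num i s z.
  move=> z0; rewrite /P (bigD1 i)//= /num mulrAC; congr (_ * _).
  by rewrite !shE AGB// shift_upper.
pose X s z := \sum_(j < T) num (j, inord 2) s z + om * \sum_(j < T) num (j, inord 0) s z.
pose Y s z := \sum_(j < T) num (j, inord 1) s z.
have SE b s z : 0 < complex.Im z -> (b < 3)%N ->
    P s z * \sum_(j < T) G (s * u ^ b)%N (z - (s * j)%:R / e%:R) = \sum_(j < T) num (j, inord b) s z.
  move=> z0 b3; rewrite mulr_sumr; apply: eq_bigr => j _.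
  by rewrite -PG//= /vs inordK.
have YE s z : 0 < complex.Im z -> Y s z = P s z * \sum_(j < T) G (s * u)%N (z - (s * j)%:R / e%:R).
  by move=> z0; rewrite /Y -SE// expn1.
apply: (@trace_descent R F p (nu + r) M X Y c s0) => //.
- by rewrite addn_gt0 nu0.
- apply: ratfamD; first by apply: (ratfam_sum _ M0) => j _; exact: Rnum.
  by apply: (ratfamcM M0 omF); apply: (ratfam_sum _ M0) => j _; exact: Rnum.
- by apply: (ratfam_sum _ M0) => j _; exact: Rnum.
- move=> s z sp z0; rewrite YE// /X -!SE// expn0 mulrCA (mulrCA c) -mulrDr; congr (_ * _).
  by apply/eqP; rewrite -subr_eq0 addrAC HS.
have hsh (g : nat -> C -> C) v j s : (forall s, hol (g s)) -> hol (sh g v j s).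
  by move=> hg; rewrite shE; apply: hol_shift.
have PN : ~ null (P s0).
  have hh (i : 'I_T * 'I_3) : hol (sh A (vs i.2) i.1 s0) by exact: hsh.
  move=> HP; have [i Hi] := hol_domain_prod hh HP; move: Hi; rewrite shE.
  exact: nonnull_shift.
have : ~ null (fun z => P s0 z * \sum_(j < T) G (s0 * u)%N (z - (s0 * j)%:R / e%:R)).
  apply: nonnullM => //; first by apply: hol_prod => i; exact: hsh.
  by apply: hol_sum => j; exact: (hsh G u j s0).
by move=> nY YN; apply: nY => z z0; rewrite -YE// YN.
Qed.

End Descent.

(** * p-adic approximation *)

Section RatrChar0.
Variable K : fieldType.
Hypothesis K0 : forall a : int, (a%:~R == 0 :> K) = (a == 0).

Lemma ratr_frac0 (a b : int) : b != 0 -> ratr (a%:~R / b%:~R : rat) = a%:~R / b%:~R :> K.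
Proof.
move=> b0; have [q qE] : exists q : rat, q = a%:~R / b%:~R by eexists.
rewrite -qE /ratr; have d0 : (denq q)%:~R != 0 :> K by rewrite K0 denq_neq0.
have b0' : b%:~R != 0 :> K by rewrite K0.
apply/eqP; rewrite eqr_div// -!intrM; apply/eqP; congr (_%:~R).
have : q * b%:~R = a%:~R by rewrite qE divfK// intr_eq0.
rewrite -{1}(divq_num_den q) => /(congr1 (fun x => x * (denq q)%:~R)).
rewrite mulrAC divfK ?intr_eq0 ?denq_neq0// -!intrM => /eqP; rewrite eqr_int => /eqP.
by [].
Qed.

Lemma ratr_zmod0 : zmod_morphism (@ratr K).
Proof.
move=> x y; rewrite -(divq_num_den x) -(divq_num_den y).
have [dx dy] := (denq_neq0 x, denq_neq0 y).
have dx' : (denq x)%:~R != 0 :> K by rewrite K0.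
have dy' : (denq y)%:~R != 0 :> K by rewrite K0.
rewrite (ratr_frac0 _ dx) (ratr_frac0 _ dy) -mulNr -mulNr -!mulrNz addf_div ?intr_eq0//.
by rewrite addf_div// -!intrM -!intrD ratr_frac0// mulf_neq0.
Qed.

Lemma ratr_monoid0 : monoid_morphism (@ratr K).
Proof.
split=> [|x y]; first by rewrite /ratr divr1.
rewrite -(divq_num_den x) -(divq_num_den y).
have [dx dy] := (denq_neq0 x, denq_neq0 y).
by rewrite (ratr_frac0 _ dx) (ratr_frac0 _ dy) !mulf_div -!intrM ratr_frac0// mulf_neq0.
Qed.

Lemma pow_cancel (P x w : K) (n m : nat) : P != 0 -> P ^+ n * x = P ^+ m * w ->
  x = w * P ^ (m%:Z - n%:Z).
Proof.
move=> P0 E; have pn0 : P ^+ n != 0 by rewrite expf_neq0.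
apply: (mulfI pn0); rewrite E mulrCA -[P ^+ n]/(P ^ n%:Z) -expfzDr// addrC subrK.
by rewrite mulrC.
Qed.

Lemma dense_cancel (P x t y : K) (r m : nat) : P != 0 -> P ^+ r * x = t + P ^+ (r + m) * y ->
  x = t / P ^+ r + P ^+ m * y.
Proof.
move=> P0 E; have pn0 : P ^+ r != 0 by rewrite expf_neq0.
by apply: (mulfI pn0); rewrite E mulrDr mulrCA mulfV// mulr1 mulrA exprD.
Qed.
End RatrChar0.

Section PadicArithmetic.
Variable p : primeT.
Local Notation Zp := (Defs.Zp p).
Local Notation Qp := (Qp p).
Local Notation iota := (@Zp_to_Qp p).

Lemma p_gt0 : (0 < p)%N. Proof. exact: prime_gt0 (valP p). Qed.
Lemma p_gt1 : (1 < p)%N. Proof. exact: prime_gt1 (valP p). Qed.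
Lemma ppow_neq0 n : (p ^ n)%:Z != 0. Proof. by rewrite eqz_nat -lt0n expn_gt0 p_gt0. Qed.

Lemma zp_seq_int (a : int) n : zp_seq (a%:~R : Zp) n = (a %% (p ^ n)%:Z)%Z.
Proof.
case: a => a; first by rewrite -pmulrn zp_natr.
rewrite NegzE mulrNz -pmulrn /= zp_natr.
exact: modzNm.
Qed.

Lemma zp_dvd (z : Zp) n : zp_seq z n = 0 -> exists y, z = p%:R ^+ n * y.
Proof.
move=> zn; pose y k := (zp_seq z (k + n)%N %/ (p ^ n)%:Z)%Z.
have yE k : zp_seq z (k + n)%N = y k * (p ^ n)%:Z.
  by rewrite divzK//; apply/dvdz_mod0P; rewrite zp_stable zn mod0z.
have ystep k : (y k.+1 = y k %[mod (p ^ k)%:Z])%Z.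
  have := zp_step z (k + n); rewrite -addSn !yE => /eqP.
  rewrite eqz_mod_dvd -mulrBl expnD PoszM dvdz_mul2r ?ppow_neq0// -eqz_mod_dvd.
  by move=> /eqP.
exists (zp_reduce ystep); apply: zp_eqP => k.
rewrite -natrX /= zp_natr modz_mod modzMml modzMmr mulrC -yE addnC zp_stable.
by [].
Qed.

Lemma Zp_decomp (x : Zp) n : exists t, (t < p ^ n)%N /\ exists y, x = t%:R + p%:R ^+ n * y.
Proof.
have := zp_mod x n; set s := zp_seq x n => sE.
have s0 : 0 <= s by rewrite -sE modz_ge0// ppow_neq0.
have s1 : s < (p ^ n)%:Z by rewrite -sE ltz_pmod// ltz_nat expn_gt0 p_gt0.
exists `|s|%N; split; first by lia.
have [|y yE] := @zp_dvd (x - `|s|%:R) n; last by exists y; rewrite -yE addrC subrK.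
have sa : (`|s|%N)%:Z = s by lia.
by rewrite /= zp_natr sa -/s modzDmr -modzDmr modzNm modzDmr subrr mod0z.
Qed.

Lemma natp_neq0 : (p%:R : Zp) != 0.
Proof.
apply/eqP => /(congr1 (fun z => zp_seq z 2)); rewrite zp_natr /= mod0z modz_small; last first.
  by rewrite /= ltz_nat -{1}(expn1 p) ltn_exp2l// p_gt1.
by move=> [] /eqP; rewrite (gtn_eqF p_gt0).
Qed.

(** Some c b is a power of p; as p does not divide b it divides c, and is cancelled until the power
    is 1. *)
Lemma zp_nondvd_unit (b : Zp) : zp_seq b 1 != 0 -> b \is a GRing.unit.
Proof.
move=> b1; have b0 : b != 0 by apply: contraNneq b1 => ->; rewrite /= mod0z.
have [n [c]] := zp_dvd_pow b0; elim: n c => [|n IH] c cb.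
  by apply: (@zp_unitPl p b c); rewrite cb expr0.
have /(congr1 (fun z => zp_seq z 1)) := cb.
rewrite exprS /= zp_natr !expn1 modzz ?mod0z mul0r ?mod0z => /dvdz_mod0P.
rewrite dvdzE abszM Euclid_dvdM ?(valP p)// => /orP[] h.
  have [|c' c'E] := @zp_dvd c 1.
    by have := zp_mod c 1; rewrite expn1 => <-; apply/dvdz_mod0P; rewrite dvdzE.
  apply: (IH c'); apply: (mulfI natp_neq0); rewrite -exprS -cb c'E expr1 mulrA.
  by [].
case/negP: b1; have := zp_mod b 1; rewrite expn1 => <-.
by apply/eqP/dvdz_mod0P; rewrite dvdzE.
Qed.

Lemma zp_unit_natr t : coprime t p -> (t%:R : Zp) \is a GRing.unit.
Proof.
move=> tp; apply: zp_nondvd_unit; rewrite zp_natr expn1; apply/eqP => /dvdz_mod0P.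
by rewrite dvdzE /= => pt; move: tp; rewrite coprime_sym prime_coprime ?(valP p)// pt.
Qed.

Lemma natp_nonunit : (p%:R : Zp) \isn't a GRing.unit.
Proof.
apply/negP => pu; have := congr1 (fun z => zp_seq z 1) (mulVr pu).
rewrite /= zp_natr expn1 modzz mulr0 mod0z modz_small//.
by rewrite ltz_nat p_gt1.
Qed.

Lemma unit_approx (w : Zp) n : w \is a GRing.unit ->
  exists s y, coprime s p /\ w = s%:R + p%:R ^+ n.+1 * y.
Proof.
move=> wu; have [s [_ [y wE]]] := Zp_decomp w n.+1; exists s, y; split=> //.
rewrite coprime_sym prime_coprime ?(valP p)//; apply: contraTN wu => /dvdnP[q qE].
by rewrite wE qE natrM exprS -mulrA [q%:R * _]mulrC -mulrDr unitrM negb_and natp_nonunit.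
Qed.

Lemma Zp_val (z : Zp) : z != 0 -> exists m w, w \is a GRing.unit /\ z = p%:R ^+ m * w.
Proof.
move=> z0; have [n [c]] := zp_dvd_pow z0; elim: n z z0 => [|n IH] z z0 cz.
  by exists 0%N, z; split; [exact: (@zp_unitPl p z c)|rewrite expr0 mul1r].
have [z1|z1] := eqVneq (zp_seq z 1) 0; last first.
  by exists 0%N, z; split; [exact: zp_nondvd_unit|rewrite expr0 mul1r].
have [y yE] := zp_dvd z1; rewrite expr1 in yE.
have y0 : y != 0 by apply: contraNneq z0 => y0; rewrite yE y0 mulr0.
have [|m [w [wu wE]]] := IH y y0.
  by apply: (mulfI natp_neq0); rewrite mulrCA -yE cz exprS.
by exists m.+1, w; split=> //; rewrite yE wE exprS mulrA.
Qed.

Definition Qint (x : Qp) := exists z : Zp, x = iota z.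

Lemma QintD x y : Qint x -> Qint y -> Qint (x + y).
Proof. by move=> [a ->] [b ->]; exists (a + b); rewrite rmorphD. Qed.
Lemma QintN x : Qint x -> Qint (- x).
Proof. by move=> [a ->]; exists (- a); rewrite rmorphN. Qed.
Lemma QintM x y : Qint x -> Qint y -> Qint (x * y).
Proof. by move=> [a ->] [b ->]; exists (a * b); rewrite rmorphM. Qed.
Lemma Qint_nat n : Qint n%:R.
Proof. by exists n%:R; rewrite rmorph_nat. Qed.
Lemma QintX x n : Qint x -> Qint (x ^+ n).
Proof. by move=> [a ->]; exists (a ^+ n); rewrite rmorphXn. Qed.

Lemma Qnatp_neq0 : (p%:R : Qp) != 0.
Proof.
rewrite -(rmorph_nat iota) -(rmorph0 iota).
by apply/eqP => /Zp_to_Qp_inj/eqP; rewrite (negbTE natp_neq0).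
Qed.

Lemma Zp_unitsV (u : Qp) : Zp_units u -> Zp_units u^-1.
Proof.
move=> [w /= wu <-]; exists w^-1; first by rewrite /= unitrV.
have wi : iota w * iota w^-1 = 1 by rewrite -rmorphM mulrV// rmorph1.
have w0 : iota w != 0 by apply: contraTneq isT => w0; move: wi; rewrite w0 mul0r => /esym/eqP; rewrite oner_eq0.
by apply: (mulfI w0); rewrite wi mulfV.
Qed.
Lemma Zp_unitsM (u v : Qp) : Zp_units u -> Zp_units v -> @Zp_units p (u * v).
Proof. by move=> [a /= ua <-] [b /= ub <-]; exists (a * b); rewrite ?rmorphM //= unitrM ua. Qed.
Lemma Zp_units_int (u : Qp) : Zp_units u -> Qint u.
Proof. by move=> [w _ <-]; exists w. Qed.
Lemma Zp_units_neq0 u : @Zp_units p u -> u != 0.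
Proof.
move=> [w /= wu <-]; rewrite -(rmorph0 iota); apply/eqP => /Zp_to_Qp_inj w0.
by move: wu; rewrite w0 unitr0.
Qed.
Lemma Zp_units_natr t : coprime t p -> @Zp_units p t%:R.
Proof. by move=> tp; exists t%:R; rewrite ?rmorph_nat//=; exact: zp_unit_natr. Qed.
Lemma Zp_units1 : @Zp_units p 1.
Proof. by exists 1; rewrite ?rmorph1 //= unitr1. Qed.

Lemma Qp_val (x : Qp) : x != 0 -> exists (j : int) u, Zp_units u /\ x = u * p%:R ^ j.
Proof.
move=> x0; have [n [z xE]] := Qp_bounded x.
have z0 : z != 0.
  apply: contraNneq x0 => z0; move: xE; rewrite z0 rmorph0 => /eqP.
  by rewrite mulf_eq0 (negbTE (expf_neq0 n Qnatp_neq0)).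
have [m [w [wu wE]]] := Zp_val z0; exists (m%:Z - n%:Z), (iota w); split; first by exists w.
by apply: (pow_cancel Qnatp_neq0); rewrite xE wE rmorphM rmorphXn rmorph_nat.
Qed.

Lemma Qint_or_inv (x : Qp) : x != 0 -> Qint x \/ Qint x^-1.
Proof.
move=> x0; have [[] j [u [uu ->]]] := Qp_val x0.
  by left; apply: QintM; [exact: Zp_units_int|exact/QintX/Qint_nat].
right; rewrite invfM; apply: QintM; first exact/Zp_units_int/Zp_unitsV.
by rewrite NegzE invr_expz opprK; exact/QintX/Qint_nat.
Qed.

Lemma padic_val_unit (u : Qp) : Zp_units u -> padic_val u = 0.
Proof.
move=> uu; rewrite /padic_val; case: xgetP => [j _ [v vu uE]|/(_ 0)]; last first.
  by case; exists u => //; rewrite expr0z mulr1.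
have pk (w : Qp) n : Zp_units w -> w = p%:R ^+ n -> n = 0%N.
  case: n => // n [a /= au <-]; rewrite -(rmorph_nat iota) -rmorphXn => /Zp_to_Qp_inj aE.
  by move: au; rewrite aE exprS unitrM (negbTE natp_nonunit).
have vV := Zp_unitsM (Zp_unitsV vu) uu; have v0 := Zp_units_neq0 vu.
case: j uE => n uE.
  by rewrite (pk _ n vV)// uE mulKf.
have := pk _ n.+1 (Zp_unitsV vV); rewrite uE mulKf// NegzE invr_expz opprK => /(_ erefl) //.
Qed.

(** Density of Z[1/p] in Q_p, the source of strong approximation in [Omega_nup] and [Omega_nlo]. *)
Lemma Qp_dense (x : Qp) m : exists t r z, x = t%:R / p%:R ^+ r + p%:R ^+ m * iota z.
Proof.
have [r [z xE]] := Qp_bounded x; have [t [_ [y zE]]] := Zp_decomp z (r + m).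
exists t, r, y; apply: (dense_cancel Qnatp_neq0).
by rewrite xE zE rmorphD rmorphM rmorphXn !rmorph_nat.
Qed.

Lemma zp_int_dvd (a : int) n y : (a%:~R : Zp) = p%:R ^+ n * y -> ((p ^ n)%:Z %| a)%Z.
Proof.
move=> /(congr1 (fun z => zp_seq z n)); rewrite zp_seq_int -natrX /= zp_natr modzz mul0r mod0z.
by move=> /dvdz_mod0P.
Qed.

Lemma Qp_intr_eq0 (a : int) : (a%:~R == 0 :> Qp) = (a == 0).
Proof.
apply/eqP/eqP => [|->//]; rewrite -(rmorph_int iota) -(rmorph0 iota) => /Zp_to_Qp_inj aE.
apply/eqP; apply: contraT => a0; have := @zp_int_dvd a `|a| 0; rewrite mulr0 => /(_ aE).
rewrite dvdzE /= => /dvdn_leq; rewrite absz_gt0 => /(_ a0); rewrite leqNgt.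
by rewrite ltn_expl// p_gt1.
Qed.

(* A copy of [ratr], whose morphism structure in MathComp is the one into number fields. *)
Definition ratQ (x : rat) : Qp := ratr x.
Lemma ratr_Qp_zmod : zmod_morphism ratQ.
Proof. exact: ratr_zmod0 Qp_intr_eq0. Qed.
Lemma ratr_Qp_monoid : monoid_morphism ratQ.
Proof. exact: ratr_monoid0 Qp_intr_eq0. Qed.
HB.instance Definition _ := GRing.isZmodMorphism.Build rat Qp ratQ ratr_Qp_zmod.
HB.instance Definition _ := GRing.isMonoidMorphism.Build rat Qp ratQ ratr_Qp_monoid.
End PadicArithmetic.

Section LocalGlobal.

(** A prime factor of the denominator would divide the numerator as well. *)
Lemma rat_int (q : rat) : (forall l : primeT, Qint (ratQ l q)) -> exists n : int, q = n%:~R.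
Proof.
move=> H; suff d1 : denq q = 1 by exists (numq q); rewrite -{1}(divq_num_den q) d1 divr1.
have d0' := denq_gt0 q; case: (ltP 1 (denq q)) => [d1|]; last by lia.
exfalso; pose l0 := pdiv `|denq q|.
have lp : prime l0 by rewrite pdiv_prime//; lia.
pose l : primeT := exist _ l0 lp; have [z zE] := H l.
have d0 : (denq q)%:~R != 0 :> Qp l by rewrite Qp_intr_eq0 denq_neq0.
have : ratQ l q * (denq q)%:~R = (numq q)%:~R by exact: divfK d0 _.
rewrite zE -!(rmorph_int (@Zp_to_Qp l)) -(rmorphM (@Zp_to_Qp l)) mulrC => /Zp_to_Qp_inj/esym nE.
have /dvdzP[e eE] : (l0%:Z %| denq q)%Z by rewrite dvdzE /= pdiv_dvd.
have := @zp_int_dvd l (numq q) 1 (e%:~R * z); rewrite nE eE intrM -pmulrn expr1 expn1.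
rewrite mulrA [e%:~R * _]mulrC => /(_ erefl) ln.
have := coprime_num_den q; rewrite /coprime => /eqP g1.
have : (l0 %| gcdn `|numq q| `|denq q|)%N by rewrite dvdn_gcd pdiv_dvd andbT.
by rewrite g1 dvdn1 => /eqP l1; have := prime_gt1 lp; rewrite l1.
Qed.

End LocalGlobal.

(** * Two by two matrices over a field *)

Section GL2Field.
Variable K : fieldType.
Implicit Types (g h : GL2 K).

Definition G2 (a b c d : K) : GL2 K := insubd (1%g : GL2 K) (mx2 a b c d).

Lemma G2E a b c d : a * d - b * c != 0 -> GL2_mx (G2 a b c d) = mx2 a b c d.
Proof. by move=> H; rewrite [LHS]insubdK// unitmxE unitfE det_mx2. Qed.

Definition nup (x : K) := G2 1 x 0 1.
Definition nlo (x : K) := G2 1 0 x 1.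
Definition dia (a d : K) := G2 a 0 0 d.
Definition wG := G2 0 1 1 0.

Lemma nupE x : GL2_mx (nup x) = mx2 1 x 0 1.
Proof. by rewrite G2E// mulr0 subr0 mulr1 oner_neq0. Qed.
Lemma nloE x : GL2_mx (nlo x) = mx2 1 0 x 1.
Proof. by rewrite G2E// mul0r subr0 mulr1 oner_neq0. Qed.
Lemma diaE a d : a != 0 -> d != 0 -> GL2_mx (dia a d) = mx2 a 0 0 d.
Proof. by move=> a0 d0; rewrite G2E// mul0r subr0 mulf_neq0. Qed.
Lemma wGE : GL2_mx wG = mx2 0 1 1 0.
Proof. by rewrite G2E// mul0r mulr1 sub0r oppr_eq0 oner_neq0. Qed.

Lemma GL2_ext g h : g 0 0 = h 0 0 -> g 0 1 = h 0 1 -> g 1 0 = h 1 0 -> g 1 1 = h 1 1 -> g = h.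
Proof. by move=> *; apply: val_inj; apply: eq_mx2. Qed.

Lemma GL2_det0 g : g 0 0 * g 1 1 - g 0 1 * g 1 0 != 0.
Proof. by rewrite -det2; have := GL2_unit g; rewrite unitmxE unitfE. Qed.

Lemma GL2_mulE g h : GL2_mx (g * h)%g = GL2_mx g *m GL2_mx h. Proof. by []. Qed.

Lemma nupD x y : (nup x * nup y)%g = nup (x + y).
Proof. by apply: GL2_ext; rewrite GL2_mulE mulmx2 !nupE !mxE /=; ring. Qed.
Lemma nloD x y : (nlo x * nlo y)%g = nlo (x + y).
Proof. by apply: GL2_ext; rewrite GL2_mulE mulmx2 !nloE !mxE /=; ring. Qed.
Lemma nup0 : nup 0 = 1%g.
Proof. by apply: GL2_ext; rewrite nupE !mxE. Qed.
Lemma nlo0 : nlo 0 = 1%g.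
Proof. by apply: GL2_ext; rewrite nloE !mxE. Qed.
Lemma dia1 : dia 1 1 = 1%g.
Proof. by apply: GL2_ext; rewrite diaE ?oner_neq0// !mxE. Qed.
Lemma diaM a b c d : a != 0 -> b != 0 -> c != 0 -> d != 0 -> (dia a b * dia c d)%g = dia (a * c) (b * d).
Proof.
by move=> a0 b0 c0 d0; apply: GL2_ext; rewrite GL2_mulE mulmx2 !diaE ?mulf_neq0// !mxE /=; ring.
Qed.

Lemma nup_dia x a : a != 0 -> (nup x * dia a 1)%g = (dia a 1 * nup (x / a))%g.
Proof.
move=> a0; apply: GL2_ext; rewrite !GL2_mulE !mulmx2 !nupE !diaE ?oner_neq0// !mxE /=; try ring.
by rewrite mulr0 add0r mulr1 mul0r addr0 mulrC divfK.
Qed.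
Lemma nlo_dia x a : a != 0 -> (nlo x * dia a 1)%g = (dia a 1 * nlo (x * a))%g.
Proof.
by move=> a0; apply: GL2_ext; rewrite !GL2_mulE !mulmx2 !nloE !diaE ?oner_neq0// !mxE /=; ring.
Qed.
Lemma wn_dia x a : a != 0 -> (wG * nup x * dia a 1)%g = (dia 1 a * wG * nup (x / a))%g.
Proof.
move=> a0; rewrite -mulgA nup_dia// !mulgA; congr (_ * _)%g.
by apply: GL2_ext; rewrite !GL2_mulE !mulmx2 wGE !diaE ?oner_neq0// !mxE /=; ring.
Qed.

Lemma bruhat g : g 1 0 != 0 -> exists b y, GL2_mx b 1 0 = 0 /\ g = (b * wG * nup y)%g.
Proof.
move=> c0; pose be := g 0 1 - g 0 0 * g 1 1 / g 1 0.
have be0 : be * g 1 0 - g 0 0 * 0 != 0.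
  rewrite mulr0 subr0 mulrBl divfK//; have := GL2_det0 g.
  by rewrite -oppr_eq0 opprB.
exists (G2 be (g 0 0) 0 (g 1 0)), (g 1 1 / g 1 0); split; first by rewrite G2E// mxE.
apply: GL2_ext; rewrite !GL2_mulE !mulmx2 G2E// wGE nupE !mxE /=; try ring.
  by rewrite /be; ring.
by field.
Qed.

Lemma wn_lower z : z != 0 -> (wG * nup z)%g = (G2 (- z^-1) 1 0 z * nlo z^-1)%g.
Proof.
move=> z0; have d0 : - z^-1 * z - 1 * 0 != 0 by rewrite mulNr mulVf// mulr0 subr0 oppr_eq0 oner_neq0.
by apply: GL2_ext; rewrite !GL2_mulE !mulmx2 G2E// wGE nupE nloE !mxE /=; field.
Qed.

Lemma lower_decomp g : g 1 1 != 0 -> exists b, GL2_mx b 1 0 = 0 /\ g = (b * nlo (g 1 0 / g 1 1)%R)%g.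
Proof.
move=> d0; pose al := g 0 0 - g 0 1 * g 1 0 / g 1 1.
have al0 : al * g 1 1 - g 0 1 * 0 != 0.
  by rewrite mulr0 subr0 mulrBl divfK//; exact: GL2_det0.
exists (G2 al (g 0 1) 0 (g 1 1)); split; first by rewrite G2E// mxE.
apply: GL2_ext; rewrite !GL2_mulE !mulmx2 G2E// nloE !mxE /=; try ring.
  by rewrite /al; ring.
by field.
Qed.

(** With lower left entry nonzero, a matrix of determinant 1 is a product of upper, lower and upper
    unipotents; otherwise one lower unipotent factor makes the entry nonzero. *)
Lemma SL2_unip (P : GL2 K -> Prop) : (forall x g, P g -> P (nup x * g)%g) ->
  (forall x g, P g -> P (nlo x * g)%g) ->
  forall s h, \det (GL2_mx s) = 1 -> P h -> P (s * h)%g.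
Proof.
move=> Pu Pl.
have step (s h : GL2 K) : s 1 0 != 0 -> \det (GL2_mx s) = 1 -> P h -> P (s * h)%g.
  move=> c0; rewrite det2 => ds Ph.
  have -> : s = (nup ((s 0 0 - 1) / s 1 0)%R * (nlo (s 1 0)%R * nup ((s 1 1 - 1) / s 1 0)%R))%g.
    have bE : s 0 1 = (s 0 0 * s 1 1 - 1) / s 1 0.
      by apply: (mulIf c0); rewrite divfK// -ds; ring.
    apply: GL2_ext; rewrite !GL2_mulE !mulmx2 !nupE !nloE !mxE /= ?bE; field => //.
  by rewrite -!mulgA; apply/Pu/Pl/Pu.
move=> s h ds Ph; have [c0|c0] := eqVneq (s 1 0) 0; last exact: step.
have -> : (s * h)%g = (nlo (-1) * (nlo 1 * s * h))%g by rewrite !mulgA nloD addNr nlo0 mul1g.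
apply: Pl; apply: step => //.
  rewrite GL2_mulE mulmx2 nloE !mxE /= c0 mulr0 addr0 mul1r.
  by apply: contra_eq_neq ds => s0; rewrite det2 s0 c0 mul0r mulr0 subr0 eq_sym oner_neq0.
by rewrite GL2_mulE det_mulmx ds mulr1 nloE det_mx2; ring.
Qed.

End GL2Field.

Section SumPeriod.
Variable V : zmodType.
Lemma sum_shift (M : nat) (g : nat -> V) a : (forall n, g (n + M)%N = g n) ->
  \sum_(i < M) g (i + a)%N = \sum_(i < M) g i.
Proof.
move=> gM; elim: a => [|a IH]; first by apply: eq_bigr => i _; rewrite addn0.
rewrite -IH; case: M gM {IH} => [|M] gM; first by rewrite !big_ord0.
rewrite big_ord_recr big_ord_recl /= addrC; congr (_ + _); first by rewrite -[RHS]gM; congr g; rewrite /=; lia.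
by apply: eq_bigr => i _; congr g; rewrite /= /bump /=; lia.
Qed.
End SumPeriod.

(** * Principal series *)

(* The field Q_p enters only through the following properties of its integers and units; keeping it
   abstract prevents the unfolding of the construction of Q_p. *)
Section Kill.
Variables (C : fieldType) (K : fieldType) (p : nat) (I U : K -> Prop).
Local Notation P := (p%:R : K).
Hypotheses (p0 : (0 < p)%N) (P0 : P != 0).
Hypotheses (ID : forall x y, I x -> I y -> I (x + y)) (IN : forall x, I x -> I (- x))
  (IM : forall x y, I x -> I y -> I (x * y)) (I1 : I 1).
Hypotheses (U0 : forall x, U x -> x != 0) (UI : forall x, U x -> I x) (UV : forall x, U x -> U x^-1)
  (UM : forall x y, U x -> U y -> U (x * y)) (Unat : forall a, coprime a p -> U a%:R).
Hypothesis Iinv : forall x, x != 0 -> I x \/ I x^-1.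
Hypothesis Idec : forall x n, I x -> exists (t : nat) y, I y /\ x = t%:R + P ^+ n * y.

Lemma Inat n : I n%:R.
Proof.
elim: n => [|n IH]; last by rewrite -addn1 natrD; exact: ID.
have -> : 0%:R = 1 - 1 :> K by rewrite subrr.
by apply: ID => //; exact: IN.
Qed.
Lemma IX x n : I x -> I (x ^+ n).
Proof. by move=> Ix; elim: n => [|n IH]; rewrite ?expr0// exprS; exact: IM. Qed.

Definition smallI m (x : K) := exists z, I z /\ x = P ^+ m * z.

Lemma smallI_le m n x : (m <= n)%N -> smallI n x -> smallI m x.
Proof.
move=> mn [z [Iz ->]]; exists (P ^+ (n - m) * z); split; first by apply: IM => //; exact/IX/Inat.
by rewrite mulrA -exprD subnKC.
Qed.
Lemma smallIM m x y : smallI m x -> I y -> smallI m (x * y).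
Proof. by move=> [z [Iz ->]] Iy; exists (z * y); rewrite mulrA; split=> //; exact: IM. Qed.

Variables (chi1 chi2 wt : K -> C).
Hypotheses (chi1M : forall x y, x != 0 -> y != 0 -> chi1 (x * y) = chi1 x * chi1 y)
  (chi2M : forall x y, x != 0 -> y != 0 -> chi2 (x * y) = chi2 x * chi2 y)
  (chi11 : chi1 1 = 1) (chi21 : chi2 1 = 1) (wtU : forall x, U x -> wt x = 1).
Variable f : GL2 K -> C.
Hypothesis fB : forall b g : GL2 K, b 1 0 = 0 ->
   f (b * g)%g = chi1 (b 0 0) * chi2 (b 1 1) * wt (b 0 0 / b 1 1) * f g.
Variable n : nat.
Hypothesis f_nup : forall g x, smallI n x -> f (g * nup x)%g = f g.
Hypothesis f_nlo : forall g x, smallI n x -> f (g * nlo x)%g = f g.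
Variable u : nat.
Hypothesis up : coprime u p.
Let c := chi1 u%:R + chi2 u%:R.
Let om := chi1 u%:R * chi2 u%:R.

(** The value at g of (A^2 - c A + om) f, where A is right translation by diag(u, 1). *)
Definition tw (g : GL2 K) : C := f (g * dia (u%:R ^+ 2) 1)%g - c * f (g * dia u%:R 1)%g + om * f g.

Let uu : U u%:R. Proof. exact: Unat. Qed.

Let uu2 : U (u%:R ^+ 2). Proof. by rewrite expr2; exact: UM. Qed.
Lemma chi1_sqr : chi1 (u%:R ^+ 2) = chi1 u%:R ^+ 2.
Proof. by rewrite !expr2 chi1M ?U0. Qed.
Lemma chi2_sqr : chi2 (u%:R ^+ 2) = chi2 u%:R ^+ 2.
Proof. by rewrite !expr2 chi2M ?U0. Qed.

Lemma f_dia a g : U a -> f (dia a 1 * g)%g = chi1 a * f g.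
Proof.
move=> au; have a0 := U0 au; have d : GL2_mx (dia a 1) = mx2 a 0 0 1 by rewrite diaE ?oner_neq0.
by rewrite fB d !mxE //= divr1 wtU// chi21 !mulr1.
Qed.
Lemma f_dia' a g : U a -> f (dia 1 a * g)%g = chi2 a * f g.
Proof.
move=> au; have a0 := U0 au; have d : GL2_mx (dia 1 a) = mx2 1 0 0 a by rewrite diaE ?oner_neq0.
by rewrite fB d !mxE //= div1r wtU ?chi11 ?mul1r ?mulr1//; exact: UV.
Qed.

Lemma twB (b g : GL2 K) : b 1 0 = 0 ->
   tw (b * g)%g = chi1 (b 0 0) * chi2 (b 1 1) * wt (b 0 0 / b 1 1) * tw g.
Proof. by move=> b0; rewrite /tw -!mulgA !(fB _ b0); ring. Qed.

(** At the identity A acts as chi1(u), a root of X^2 - c X + om. *)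
Lemma tw1 : tw 1%g = 0.
Proof.
rewrite /tw !mul1g -[dia u%:R 1]mulg1 -[dia (u%:R ^+ 2) 1]mulg1 !f_dia// chi1_sqr.
by rewrite /c /om; ring.
Qed.

Lemma tw_nup g x : smallI n x -> tw (g * nup x)%g = tw g.
Proof.
move=> sx; have H a h : U a -> f (h * nup x * dia a 1)%g = f (h * dia a 1)%g.
  move=> au; rewrite -mulgA nup_dia ?U0// mulgA f_nup//.
  by apply: smallIM => //; exact/UI/UV.
by rewrite /tw !H// f_nup.
Qed.
Lemma tw_nlo g x : smallI n x -> tw (g * nlo x)%g = tw g.
Proof.
move=> sx; have H a h : U a -> f (h * nlo x * dia a 1)%g = f (h * dia a 1)%g.
  move=> au; rewrite -mulgA nlo_dia ?U0// mulgA f_nlo//.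
  by apply: smallIM => //; exact: UI.
by rewrite /tw !H// f_nlo.
Qed.

(** On the Borel cell every term is 0 by [tw1]. On the big cell, at w n(y), either p^r y is not
    integral, and each w n(x) occurring is a Borel element times a lower unipotent so small that
    [tw1] applies again; or the sum runs over all of p^-r Z_p modulo p^m, where A acts as chi2(u),
    the other root. *)
Lemma series_kill r m : (n <= r)%N -> (n <= m)%N -> forall g : GL2 K,
  \sum_(t < p ^ (r + m)) tw (g * nup (t%:R / P ^+ r))%g = 0.
Proof.
move=> nr nm g; have pr0 : P ^+ r != 0 by exact: expf_neq0.
have M0 : (0 < p ^ (r + m))%N by rewrite expn_gt0 p0.
have [c0|c0] := eqVneq (g 1 0) 0.
  apply: big1 => t _; rewrite (twB _ c0) -[nup _]mulg1 twB; last by rewrite nupE mxE.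
  by rewrite tw1 !mulr0.
have [b [y [b0 ->]]] := bruhat c0.
under eq_bigr do rewrite -!mulgA (twB _ b0) nupD.
rewrite -mulr_sumr; set S := \sum_(t < _) _; suff -> : S = 0 by rewrite mulr0.
have Mr : ((p ^ (r + m))%:R : K) / P ^+ r = P ^+ m.
  by rewrite natrX exprD mulrAC mulfV// mul1r.
pose ps (x : K) := tw (wG _ * nup x)%g.
have psP x z : I z -> ps (x + P ^+ m * z) = ps x.
  by move=> Iz; rewrite /ps -nupD mulgA (tw_nup (wG _ * nup x)%g)//; apply: (smallI_le nm); exists z.
have intE (a : int) : a%:~R / P ^+ r + P ^+ m = (a + (p ^ (r + m))%:Z)%:~R / P ^+ r.
  by rewrite intrD mulrDl -pmulrn Mr.
have [Iy|ny] := pselect (I (P ^+ r * y)); last first.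
  rewrite /S; apply: big1 => t _; set x := y + _.
  have nx : ~ I (P ^+ r * x).
    move=> Ix; apply: ny; rewrite (_ : P ^+ r * y = P ^+ r * x - t%:R).
      by apply: ID => //; exact/IN/Inat.
    by rewrite /x mulrDr mulrCA mulfV// mulr1 addrK.
  have x0 : x != 0 by apply: contra_notN nx => /eqP ->; rewrite mulr0; exact: (Inat 0).
  have [//|Iw] := Iinv (mulf_neq0 pr0 x0).
  have xs : smallI r x^-1.
    by exists (P ^+ r * x)^-1; split=> //; rewrite invfM mulrA mulfV// mul1r.
  rewrite wn_lower// twB; last by rewrite G2E ?mxE// mulr0 subr0 mulNr mulVf// oppr_eq0 oner_neq0.
  by rewrite -[nlo _]mul1g tw_nlo ?tw1 ?mulr0//; exact: smallI_le nr xs.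
(* y lies in p^-r Z_p and is absorbed by a shift of t. *)
have [t0 [z' [Iz' zE]]] := Idec (r + m) Iy.
have yE' : y = t0%:R / P ^+ r + P ^+ m * z' by exact: dense_cancel.
pose gg (j : nat) := ps (j%:R / P ^+ r).
have ggM j : gg (j + p ^ (r + m))%N = gg j.
  by rewrite /gg natrD mulrDl Mr -[P ^+ m]mulr1; exact: psP.
have -> : S = \sum_(t < p ^ (r + m)) gg t.
  rewrite -(sum_shift t0 ggM); apply: eq_bigr => t _; rewrite -/(ps _) /gg -[RHS](psP _ z')// yE'.
  by congr ps; rewrite natrD mulrDl addrC addrA.
rewrite /gg /ps /tw big_split sumrB /= -!mulr_sumr.
(* Moving diag(a, 1) to the left through w n(x) divides x by a, which only permutes the residues t,
   and brings out chi2(a). *)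
have scale a : coprime a p -> \sum_(t < p ^ (r + m)) f (wG _ * nup (t%:R / P ^+ r) * dia a%:R 1)%g =
    chi2 a%:R * \sum_(t < p ^ (r + m)) f (wG _ * nup (t%:R / P ^+ r))%g.
  move=> ap; have au := Unat ap; have a0 := U0 au.
  pose hh (j : int) : C := f (wG _ * nup (j%:~R / P ^+ r / a%:R))%g.
  have hhM j : hh (j + (p ^ (r + m))%:Z) = hh j.
    rewrite /hh -intE mulrDl -nupD mulgA (f_nup (wG _ * _)%g)//.
    apply: smallIM; last exact/UI/UV.
    by apply: (smallI_le nm); exists 1; rewrite mulr1.
  transitivity (chi2 a%:R * \sum_(t < p ^ (r + m)) hh t%:Z).
    rewrite mulr_sumr; apply: eq_bigr => t _; by rewrite wn_dia// -mulgA f_dia'.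
  congr (_ * _); rewrite (sum_residue_unit M0 _ hhM (s := a)) ?coprimeXr//.
  apply: eq_bigr => t _; rewrite /hh intrM; congr (f (_ * nup _)%g).
  by rewrite -[a%:~R]/(a%:R) -[t%:~R]/(t%:R) [a%:R * _]mulrC -!mulrA [a%:R * _]mulrCA mulfV// mulr1.
have S2 := scale (u ^ 2)%N (coprimeXl 2 up); rewrite natrX in S2.
by rewrite S2 (scale u up) chi2_sqr /c /om; ring.
Qed.

End Kill.

(** * Local components *)

Section Tensor.
Variables (C : fieldType).

Section SubLmod.
Variables (P : lmodType C) (S : submodClosed P).
Record sublmod := SubLmod { sublmod_val : P; sublmodP : sublmod_val \in S }.
HB.instance Definition _ := [isSub for sublmod_val].
HB.instance Definition _ := [Choice of sublmod by <:].
HB.instance Definition _ := [SubChoice_isSubLmodule of sublmod by <:].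
End SubLmod.

End Tensor.

Section TensorSpan.
Variable R : realType.
Local Notation C := R[i].
Variables (V W P : lmodType C) (t : V -> W -> P).
Hypothesis tP : tensor_product t.

Definition tspan : {pred P} := fun x => `[< exists s : seq (V * W), x = \sum_(y <- s) t y.1 y.2 >].

Lemma tspan_submod : GRing.submod_closed tspan.
Proof.
split; first by apply/asboolP; exists [::]; rewrite big_nil.
move=> a x y /asboolP[s ->] /asboolP[s' ->]; apply/asboolP.
exists ([seq (a *: z.1, z.2) | z <- s] ++ s'); rewrite big_cat big_map scaler_sumr; congr (_ + _).
apply: eq_bigr => z _ /=; have [[tl _] _] := tP.
have t0 : t 0 z.2 = 0.
  by have := tl z.2 (-1) 0 0; rewrite /= scaler0 addr0 scaleN1r addNr.
by have := tl z.2 a z.1 0; rewrite /= t0 !addr0.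
Qed.
HB.instance Definition _ := GRing.isSubmodClosed.Build C P tspan tspan_submod.

(** By the universal property the pure tensors map P into their own span; followed by the inclusion,
    this map agrees with the identity on pure tensors, hence everywhere. *)
Lemma tensor_span x : exists s : seq (V * W), x = \sum_(y <- s) t y.1 y.2.
Proof.
have tS v w : t v w \in tspan by apply/asboolP; exists [:: (v, w)]; rewrite big_seq1.
have [[tl tr] tU] := tP.
pose b v w : sublmod tspan := SubLmod (tS v w).
have bb : bilinear_for *:%R *:%R b.
  by split=> [w a v v'|v a w w']; apply: val_inj; [exact: tl|exact: tr].
have [h hb _] := tU _ b bb.
have [h0 h0b h0U] := tU P t (tl, tr).
pose vh : {linear P -> P} := (\val : sublmod tspan -> P) \o h.
have e1 := h0U vh; have e2 := h0U (idfun : {linear P -> P}).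
have vhE v w : vh (t v w) = t v w by rewrite /vh /= hb.
have xE : x = sublmod_val (h x).
  transitivity (h0 x); [exact: (e2 (fun _ _ => erefl) x)|exact: esym (e1 vhE x)].
by have /asboolP := sublmodP (h x); rewrite -xE.
Qed.

Lemma tensor_t0 w : t 0 w = 0.
Proof.
have [[tl _] _] := tP.
by have := tl w (-1) 0 0; rewrite /= scaler0 addr0 scaleN1r addNr.
Qed.
Lemma tensorDl v v' w : t (v + v') w = t v w + t v' w.
Proof. by have [[tl _] _] := tP; have := tl w 1 v v'; rewrite /= !scale1r. Qed.
Lemma tensorZl a v w : t (a *: v) w = a *: t v w.
Proof. by have [[tl _] _] := tP; have := tl w a v 0; rewrite /= tensor_t0 !addr0. Qed.
Lemma tensor_tr0 v : t v 0 = 0.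
Proof.
have [[_ tr] _] := tP.
by have := tr v (-1) 0 0; rewrite /= scaler0 addr0 scaleN1r addNr.
Qed.
Lemma tensorDr v w w' : t v (w + w') = t v w + t v w'.
Proof. by have [[_ tr] _] := tP; have := tr v 1 w w'; rewrite /= !scale1r. Qed.
Lemma tensorZr a v w : t v (a *: w) = a *: t v w.
Proof. by have [[_ tr] _] := tP; have := tr v a w 0; rewrite /= tensor_tr0 !addr0. Qed.
Lemma tensor_suml (I : Type) (r : seq I) (F : I -> V) w :
  t (\sum_(i <- r) F i) w = \sum_(i <- r) t (F i) w.
Proof.
elim: r => [|i r IH]; first by rewrite !big_nil tensor_t0.
by rewrite !big_cons tensorDl IH.
Qed.
Lemma tensor_sumr (I : Type) (r : seq I) (F : I -> W) v :
  t v (\sum_(i <- r) F i) = \sum_(i <- r) t v (F i).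
Proof.
elim: r => [|i r IH]; first by rewrite !big_nil tensor_tr0.
by rewrite !big_cons tensorDr IH.
Qed.

Lemma tensor_tri a b v1 v2 v3 w : t v1 w - a *: t v2 w + b *: t v3 w = t (v1 - a *: v2 + b *: v3) w.
Proof. by rewrite !tensorDl -scaleN1r tensorZl -!tensorZl scaleN1r. Qed.

Variables (I : Type) (e : I -> V -> C).
Hypothesis (eL : forall i a v v', e i (a *: v + v') = a * e i v + e i v')
  (eS : forall v, (forall i, e i v = 0) -> v = 0).

Lemma tensor_ev i : exists h : {linear P -> W}, forall v w, h (t v w) = e i v *: w.
Proof.
have [_ tU] := tP; have [|h hb _] := tU W (fun v w => e i v *: w); last by exists h.
split=> [w a v v'|v a w w'] /=; first by rewrite eL scalerDl scalerA.
by rewrite scalerDr !scalerA mulrC.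
Qed.

(** If e_i(v) is nonzero for the first pair (v, w), the hypothesis at i expresses w through the
    other second components, and the sum is rewritten with one pair fewer. *)
Lemma tensor_separated (s : seq (V * W)) :
  (forall i, \sum_(y <- s) e i y.1 *: y.2 = 0) -> \sum_(y <- s) t y.1 y.2 = 0.
Proof.
move: {2}(size s) (leqnn (size s)) => n; elim: n s => [|n IH] [|[v w] s]; rewrite ?big_nil//= => sn H.
have [v0|] := pselect (forall i, e i v = 0).
  rewrite big_cons /= (eS v0) tensor_t0 add0r IH// => i.
  by have := H i; rewrite big_cons /= v0 scale0r add0r.
move=> /existsNP[i0 /eqP ev].
have wE : w = \sum_(y <- s) (- (e i0 y.1 / e i0 v)) *: y.2.
  have := H i0; rewrite big_cons /= => /eqP; rewrite addr_eq0 => /eqP/(congr1 ( *:%R (e i0 v)^-1)).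
  rewrite scalerA mulVf// scale1r => ->; rewrite -sumrN scaler_sumr; apply: eq_bigr => y _.
  by rewrite -scalerN scalerA mulrC scalerN scaleNr.
pose s' := [seq ((- (e i0 y.1 / e i0 v)) *: v + y.1, y.2) | y <- s].
transitivity (\sum_(y <- s') t y.1 y.2).
  rewrite big_cons /= {1}wE tensor_sumr big_map -big_split /=; apply: eq_bigr => y _.
  by rewrite tensorDl tensorZl tensorZr.
apply: IH => [|i]; first by rewrite size_map.
rewrite big_map /=; have := H i; rewrite big_cons /= {1}wE scaler_sumr -big_split /= => {2}<-.
by apply: eq_bigr => y _; rewrite eL scalerDl scalerA mulrC.
Qed.

Lemma tensor_separation x (h : I -> {linear P -> W}) :
  (forall i v w, h i (t v w) = e i v *: w) -> (forall i, h i x = 0) -> x = 0.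
Proof.
move=> hE hx; have [s sE] := tensor_span x; rewrite sE; apply: tensor_separated => i.
have := hx i; rewrite sE raddf_sum => {2}<-; apply: eq_bigr => y _; exact: esym (hE _ _ _).
Qed.

End TensorSpan.

(** * Adelic points supported at p and infinity *)

Section LocalEmbedding.
Variables (R : realType) (p : primeT).

Definition at_p (g : GL2 (Qp p)) : forall l : primeT, GL2 (Qp l) :=
  @dfwith primeT (fun l => GL2 (Qp l)) (fun l => 1%g) p g.
Lemma at_p_in g : at_p g p = g. Proof. exact: dfwith_in. Qed.
Lemma at_p_out g (l : primeT) : l != p -> at_p g l = 1%g.
Proof. by rewrite eq_sym => lp; exact: dfwith_out. Qed.

Lemma locA_subproof (g : GL2 (Qp p)) : finite_set [set l | ~ GL2_Zp (at_p g l)].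
Proof.
apply: (@sub_finite_set _ _ [set p]); last exact: finite_set1.
by move=> l /=; case: (eqVneq l p) => [->//|pl] []; rewrite at_p_out//; exact: GL2_Zp1.
Qed.
Definition mkA (h : GL2 R) (g : GL2 (Qp p)) : GL2A R := MkGL2A h (locA_subproof g).
Definition locA := mkA 1%g.

Lemma mkA_p h g : comp_fin (mkA h g) p = g. Proof. exact: at_p_in. Qed.
Lemma mkA_l h g (l : primeT) : l != p -> comp_fin (mkA h g) l = 1%g. Proof. exact: at_p_out. Qed.
Lemma mkA_loc h g k : (mkA h g * locA k)%g = mkA h (g * k)%g.
Proof.
apply: GL2A_eqP => [|l] /=; first by rewrite mulg1.
have [->|lp] := eqVneq l p; first by rewrite !at_p_in.
by rewrite !at_p_out// mulg1.
Qed.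
Lemma locAM g k : (locA g * locA k)%g = locA (g * k)%g. Proof. exact: mkA_loc. Qed.
End LocalEmbedding.

Section ThreeTerms.
Variables (C : fieldType) (X Y : lmodType C) (A B D : {linear X -> Y}) (a b : C).
Lemma tri_linD x y : A (x + y) - a *: B (x + y) + b *: D (x + y) =
  (A x - a *: B x + b *: D x) + (A y - a *: B y + b *: D y).
Proof. by rewrite (raddfD A) (raddfD B) (raddfD D) !scalerDr opprD; rewrite [X in X + _]addrACA [LHS]addrACA. Qed.
Lemma tri_lin0 : A 0 - a *: B 0 + b *: D 0 = 0.
Proof. by rewrite (raddf0 A) (raddf0 B) (raddf0 D) !scaler0 subr0 addr0. Qed.
End ThreeTerms.

(** * The relation and the nonvanishing in the global representation *)

Section LocalRep.
Variables (R : realType) (p : primeT).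
Local Notation C := R[i].
Local Notation K := (Qp p).
Local Notation P := (p%:R : K).
Variables chi1 chi2 : K -> C.
Hypotheses (q1 : quasi_character chi1) (q2 : quasi_character chi2).

Lemma quasi_character1 (chi : K -> C) : quasi_character chi -> chi 1 = 1.
Proof.
move=> [c0 cM _]; have o0 := oner_neq0 K.
by apply: (mulIf (c0 1 o0)); rewrite mul1r -{3}[1]mulr1 cM.
Qed.
Lemma quasi_characterM (chi : K -> C) : quasi_character chi ->
  forall x y, x != 0 -> y != 0 -> chi (x * y) = chi x * chi y.
Proof. by case. Qed.

Let V := principal_series chi1 chi2.
Let ev (g : GL2 K) (v : V) : C := subfun_val v g.
Let wt (x : K) : C := (sqrt_padic_abs R x)%:C.

Lemma wt_unit x : Zp_units x -> wt x = 1.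
Proof. by move=> xu; rewrite /wt /sqrt_padic_abs padic_val_unit// oppr0 expr0z. Qed.

Lemma evB v (b g : GL2 K) : b 1 0 = 0 ->
  ev (b * g)%g v = chi1 (b 0 0) * chi2 (b 1 1) * wt (b 0 0 / b 1 1) * ev g v.
Proof. by move=> b0; have /asboolP[H _] := subfunP v; exact: (H b g b0). Qed.

Lemma congr_nup n (x : K) : smallI p (@Qint p) n x -> congruence_subgroup n (nup x).
Proof.
move=> [_ [[z ->] ->]]; exists (mx2 0 z 0 0); rewrite nupE; apply: eq_mx2;
  by rewrite !mxE /= ?mulr1n ?mulr0n ?rmorph0 ?mulr0 ?addr0 ?add0r.
Qed.
Lemma congr_nlo n (x : K) : smallI p (@Qint p) n x -> congruence_subgroup n (nlo x).
Proof.
move=> [_ [[z ->] ->]]; exists (mx2 0 0 z 0); rewrite nloE; apply: eq_mx2;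
  by rewrite !mxE /= ?mulr1n ?mulr0n ?rmorph0 ?mulr0 ?addr0 ?add0r.
Qed.

Lemma ps_kill (v : V) (u : nat) : coprime u p -> exists n0, forall r m, (n0 <= r)%N -> (n0 <= m)%N ->
  forall g, \sum_(t < p ^ (r + m)) tw chi1 chi2 (fun g => ev g v) u (g * nup (t%:R / P ^+ r))%g = 0.
Proof.
move=> up; have /asboolP[_ [n nP]] := subfunP v; exists n.+1 => r m nr nm g.
apply: (@series_kill C K p (@Qint p) (@Zp_units p) (p_gt0 p) (Qnatp_neq0 p) (@QintD p) (@QintN p) (@QintM p)
  (Qint_nat p 1) (@Zp_units_neq0 p) (@Zp_units_int p) (@Zp_unitsV p) (@Zp_unitsM p) (@Zp_units_natr p)
  (@Qint_or_inv p) _ chi1 chi2 wt (quasi_characterM q1) (quasi_characterM q2) (quasi_character1 q1)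
  (quasi_character1 q2) wt_unit (fun g => ev g v) (evB v) n.+1 _ _ u up r m nr nm g).
- move=> x k [z ->]; have [t [_ [y ->]]] := Zp_decomp z k.
  exists t, (Zp_to_Qp y); split; first by exists y.
  by rewrite rmorphD rmorphM rmorphXn !rmorph_nat.
- by move=> h x xs; exact: (nP h _ (congr_nup xs)).
- by move=> h x xs; exact: (nP h _ (congr_nlo xs)).
Qed.

Lemma ps_scalar v a g : Zp_units a -> ev (g * dia a a)%g v = chi1 a * chi2 a * ev g v.
Proof.
move=> au; have a0 := Zp_units_neq0 au; have d : GL2_mx (dia a a) = mx2 a 0 0 a by rewrite diaE.
have -> : (g * dia a a = dia a a * g)%g.
  by apply: GL2_ext; rewrite !GL2_mulE !mulmx2 !d !mxE /=; ring.
rewrite evB d !mxE //= divff// (wt_unit (Zp_units1 p)) mulr1 //.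
Qed.

Variable pi : rep R (GL2A R).
Hypothesis piP : local_component pi V.
Variable u : nat.
Hypothesis up : coprime u p.
Let c := chi1 u%:R + chi2 u%:R.
Let om := chi1 u%:R * chi2 u%:R.
Local Notation loc := (@locA R p).
Local Notation ra := (@rep_act R (GL2A R) pi).

(** The sum of [series_kill] as an operator on the global representation, through the place p. *)
Definition kill_op r m (x : pi) : pi := \sum_(t < p ^ (r + m))
  (ra (loc (nup (t%:R / P ^+ r) * dia (u%:R ^+ 2) 1)%g) x
   - c *: ra (loc (nup (t%:R / P ^+ r) * dia u%:R 1)%g) x + om *: ra (loc (nup (t%:R / P ^+ r))) x).

Lemma kill_opD r m x y : kill_op r m (x + y) = kill_op r m x + kill_op r m y.
Proof.
rewrite /kill_op -big_split /=; apply: eq_bigr => t _.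
exact: tri_linD.
Qed.

Lemma act_loc (W : rep R (GL2A R)) (t : V -> W -> pi) :
  (forall g : GL2A R, comp_inf g = 1%g -> (forall l, l != p -> comp_fin g l = 1%g) ->
     forall w, @rep_act R (GL2A R) W g w = w) ->
  (forall (g : GL2A R) v w, ra g (t v w) = t (@rep_act R (GL2 (Qp p)) V (comp_fin g p) v) (@rep_act R (GL2A R) W g w)) ->
  forall g v w, ra (loc g) (t v w) = t (@rep_act R (GL2 (Qp p)) V g v) w.
Proof.
move=> H1 H2 g v w; rewrite H2 mkA_p H1// => l; exact: mkA_l.
Qed.

(** x is a finite sum of pure tensors; as [ps_kill] holds beyond its bound, the largest of the
    bounds serves for all. *)
Lemma local_kill (x : pi) : exists n0, forall r m, (n0 <= r)%N -> (n0 <= m)%N -> kill_op r m x = 0.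
Proof.
have [W [t [H1 tP H2]]] := piP; have aE := act_loc H1 H2.
have [s ->] := tensor_span tP x; elim: s => [|[v w] s [n IH]].
  exists 0%N => r m _ _; rewrite big_nil /kill_op big1// => i _; exact: tri_lin0.
have [n' n'P] := ps_kill v up; exists (maxn n n') => r m.
rewrite !geq_max => /andP[nr nr'] /andP[nm nm']; rewrite big_cons kill_opD IH// addr0 /=.
have tri k1 k2 k3 : ra (loc k1) (t v w) - c *: ra (loc k2) (t v w) + om *: ra (loc k3) (t v w) =
    t (@rep_act R (GL2 (Qp p)) V k1 v - c *: @rep_act R (GL2 (Qp p)) V k2 v +
       om *: @rep_act R (GL2 (Qp p)) V k3 v) w by rewrite !aE (tensor_tri tP).
rewrite /kill_op (eq_bigr _ (fun i _ => tri _ _ _)).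
rewrite -(tensor_suml tP) -[RHS](tensor_t0 tP w); congr (t _ w); apply/val_inj/funext => g.
rewrite raddf_sum /= fct_sumE -[RHS](n'P r m nr' nm' g); apply: eq_bigr => i _.
rewrite /tw -/c -/om; move: (nup _) (dia (u%:R ^+ 2) 1) (dia u%:R 1) => k d2 d1.
transitivity (ev (g * (k * d2))%g v - c * ev (g * (k * d1))%g v + om * ev (g * k)%g v); first by [].
by rewrite !mulgA.
Qed.

Lemma local_scalar (x : pi) : ra (loc (dia u%:R u%:R)) x = om *: x.
Proof.
have [W [t [H1 tP H2]]] := piP; have aE := act_loc H1 H2.
have [s ->] := tensor_span tP x; rewrite raddf_sum scaler_sumr; apply: eq_bigr => -[v w] _ /=.
rewrite aE -(tensorZl tP); congr (t _ w); apply/val_inj/funext => g.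
exact: ps_scalar (Zp_units_natr up).
Qed.

(** The maps h g, evaluation at g on the factor V, separate the vectors of [pi], and h g transforms
    by characters under Borel elements on the left. It suffices to find a lower unipotent matrix at
    which h is nonzero on x and to evaluate the sum at 1. *)
Lemma local_nonzero (x : pi) n : x != 0 ->
  (forall z, Qint z -> ra (loc (nup z)) x = x) ->
  (forall z, smallI p (@Qint p) n z -> ra (loc (nlo z)) x = x) ->
  exists j : nat, forall r M, (0 < M)%N ->
    \sum_(t < M) ra (loc (nup (t%:R / P ^+ r) * dia u%:R 1)%g) (ra (loc (nlo j%:R)) x) != 0.
Proof.
move=> x0 xu xl; have [W [t [H1 tP H2]]] := piP; have aE := act_loc H1 H2.
have eL g a v v' : ev g (a *: v + v') = a * ev g v + ev g v' by [].
have eS v : (forall g, ev g v = 0) -> v = 0 by move=> H; apply/val_inj/funext.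
have [h hE] := choice (tensor_ev tP eL).
have hK g k y : h g (ra (loc k) y) = h (g * k)%g y.
  have [s ->] := tensor_span tP y; rewrite !raddf_sum /=; apply: eq_bigr => -[v w] _ /=.
  by rewrite aE !hE.
have hB b g y : GL2_mx b 1 0 = 0 -> h (b * g)%g y = (chi1 (b 0 0) * chi2 (b 1 1) * wt (b 0 0 / b 1 1)) *: h g y.
  move=> b0; have [s ->] := tensor_span tP y; rewrite raddf_sum (raddf_sum (h g)) scaler_sumr /=; apply: eq_bigr => -[v w] _ /=.
  by rewrite !hE evB// scalerA.
have [g hg] : exists g, h g x != 0.
  apply: contrapT => /forallNP H; case/eqP: x0; apply: (tensor_separation tP eL eS hE) => g.
  by apply: contrapT => /eqP; exact: H.
(* If the ratio c / d of the lower row is not integral, d / c is; x being fixed by n(1 - d / c), g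
   may be multiplied by it, and its lower row becomes (c, c). *)
have [g' [d0 [[z zE] hg']]] : exists g', GL2_mx g' 1 1 != 0 /\ Qint (g' 1 0 / g' 1 1) /\ h g' x != 0.
  have [H|H] := pselect (GL2_mx g 1 1 != 0 /\ Qint (g 1 0 / g 1 1)); first by exists g; case: H.
  have [c0 Idc] : GL2_mx g 1 0 != 0 /\ Qint (g 1 1 / g 1 0).
    have [d0|d0] := eqVneq (g 1 1) 0.
      split; last by rewrite d0 mul0r; exact: (Qint_nat p 0).
      by apply: contraNneq (GL2_det0 g) => c0; rewrite c0 d0 !mulr0 subrr.
    have c0 : GL2_mx g 1 0 != 0.
      by apply: contra_notN H => /eqP ->; split=> //; rewrite mul0r; exact: (Qint_nat p 0).
    split=> //; have [Hq|] := Qint_or_inv (mulf_neq0 c0 (invr_neq0 d0)); first by case: H.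
    by rewrite invfM invrK mulrC.
  have gE : GL2_mx (g * nup (1 - g 1 1 / g 1 0)%R)%g 1 0 = g 1 0 /\
      GL2_mx (g * nup (1 - g 1 1 / g 1 0)%R)%g 1 1 = g 1 0.
    rewrite !GL2_mulE !mulmx2 !nupE !mxE /= mulr0 addr0 !mulr1 mulrBr mulr1 mulrCA mulfV// mulr1.
    by rewrite subrK.
  exists (g * nup (1 - g 1 1 / g 1 0)%R)%g; case: gE => -> ->; split=> //; split.
    by rewrite divff//; exact: (Qint_nat p 1).
  by rewrite -hK xu//; apply: QintD; [exact: (Qint_nat p 1)|exact: QintN].
(* The lower unipotent part may be taken at a natural number j, since x is fixed by those of depth
   n. *)
have [b [b0 gE]] := lower_decomp d0; have [j [_ [y yE]]] := Zp_decomp z n.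
exists j => r M M0.
have hj : h (nlo j%:R) x != 0.
  apply: contraNneq hg' => H; rewrite gE zE yE rmorphD rmorphM rmorphXn !rmorph_nat -nloD mulgA -hK xl.
    by rewrite hB// H scaler0.
  by exists (Zp_to_Qp y); split=> //; exists y.
have hnup w k : h (nup w * k)%g x = h k x.
  by rewrite hB nupE !mxE //= divr1 !(quasi_character1 q1, quasi_character1 q2) (wt_unit (Zp_units1 p)) !mulr1 scale1r.
have uu := Zp_units_natr up; have u0 := Zp_units_neq0 uu.
have hdia k : h (dia u%:R 1 * k)%g x = chi1 u%:R *: h k x.
  by rewrite hB diaE ?oner_neq0// !mxE //= divr1 (quasi_character1 q2) (wt_unit uu) !mulr1.
(* Evaluation at 1 ignores n(t / p^r) and turns diag(u, 1) into chi1(u): the M terms are equal, so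
   they cannot cancel. *)
apply: contraNneq hj => S0; have := congr1 (h 1%g) S0; rewrite linear0 raddf_sum /=.
under eq_bigr => i _.
  rewrite !hK mul1g -mulgA hnup hdia.
  over.
rewrite sumr_const card_ord -scaler_nat scalerA => /eqP; rewrite scaler_eq0 mulf_eq0 pnatr_eq0.
have [chi0 _ _] := q1; by rewrite (negbTE (chi0 _ u0)) orbF eqn0Ngt M0.
Qed.

End LocalRep.

(** * The adelic lift *)

Section LocalK0.
Variables (A : comUnitRingType) (N : nat).
Implicit Types (u v : 'M[A]_2).

Definition K0r (n : int) u := [/\ u \in unitmx, exists z, u 1 0 = N%:R * z &
  exists z, u 1 1 = n%:~R + N%:R * z].

Lemma K0r_mul n n' u v : K0r n u -> K0r n' v -> K0r (n * n') (u *m v).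
Proof.
move=> [uu [a ua] [b ub]] [vv [a' va] [b' vb]]; split; first by rewrite unitmx_mul uu.
  exists (a * v 0 0 + u 1 1 * a'); rewrite mulmx2 ua va; ring.
exists (a * v 0 1 + n%:~R * b' + b * v 1 1); rewrite mulmx2 ua ub intrM.
by rewrite mulrDl {1}vb; ring.
Qed.

Lemma K0r_inv n n' e u : n * n' = 1 + N%:Z * e -> K0r n u -> K0r n' (invmx u).
Proof.
move=> nn [uu [a ua] [b ub]]; split; first by rewrite unitmx_inv.
  have D : \det u \is a GRing.unit by rewrite -unitmxE.
  have /matrixP E := mulVmx uu.
  have := E 1 0; have := E 1 1; rewrite !mulmx2 !mxE /= => E1 E0.
  exists (- a / \det u); apply: (mulIr D); rewrite -[RHS]mulrA divrK// det2.
  transitivity (u 1 1 * (invmx u 1 0 * u 0 0 + invmx u 1 1 * u 1 0) - u 1 0 * (invmx u 1 0 * u 0 1 + invmx u 1 1 * u 1 1)); first by ring.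
  by rewrite E0 E1 ua; ring.
have /matrixP/(_ 1 1) := mulmxV uu; rewrite mulmx2 !mxE /= ua ub => E.
exists (- (n'%:~R * a * invmx u 0 1 + n'%:~R * b * invmx u 1 1) - e%:~R * invmx u 1 1).
have nnA : n%:~R * n'%:~R = 1 + N%:R * e%:~R :> A by rewrite -intrM nn intrD intrM.
transitivity (n'%:~R * (N%:R * a * invmx u 0 1 + (n%:~R + N%:R * b) * invmx u 1 1) -
  (n%:~R * n'%:~R - 1) * invmx u 1 1 - N%:R * (n'%:~R * a * invmx u 0 1 + n'%:~R * b * invmx u 1 1)); first by ring.
by rewrite E nnA; ring.
Qed.

Lemma K0r1 : K0r 1 1%:M.
Proof.
split; first exact: unitmx1.
  by exists 0; rewrite mulr0 mxE.
by exists 0; rewrite mulr0 addr0 mxE.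
Qed.

Lemma K0r_mx2 (n : int) a b c d : a * d - b * c \is a GRing.unit -> (exists z, c = N%:R * z) ->
  (exists z, d = n%:~R + N%:R * z) -> K0r n (mx2 a b c d).
Proof. by move=> H Hc Hd; split; rewrite ?unitmxE ?det_mx2 ?mxE. Qed.

End LocalK0.

Section Lift.
Variables (R : realType) (k N : nat) (Psi : int -> R[i]) (f : R[i] -> R[i]).
Local Notation C := R[i].
Hypotheses (N0 : (0 < N)%N) (PsiD : dirichlet_character N Psi) (fC : cusp_form k N Psi f).
Local Notation ii := (0 +i* 1 : C).
Local Notation phi := (adelic_lift k N Psi f).

Lemma int_dvd_local (a : int) : (forall l : primeT, exists z : Defs.Zp l, a%:~R = N%:R * z) -> (N%:Z %| a)%Z.
Proof.
move=> H; have n0 : (N%:R : rat) != 0 by rewrite pnatr_eq0 -lt0n.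
have [l|q qE] := @rat_int (a%:~R / N%:R).
  have [z zE] := H l; exists z; have Nl : (N%:R : Qp l) != 0.
    by rewrite -[N%:R]/(N%:Z%:~R) Qp_intr_eq0 -lt0n.
  apply: (mulIf Nl); rewrite -(rmorph_nat (@ratQ l)) -rmorphM divfK// rmorph_int.
  by rewrite -(rmorph_int (@Zp_to_Qp l)) zE rmorphM /= !rmorph_nat mulrC.
apply/dvdzP; exists q; apply/eqP; rewrite -(eqr_int rat) intrM -qE divfK//.
Qed.

Lemma in_K0_coprime (u : forall l : primeT, 'M[Defs.Zp l]_2) n : in_K0 N u n -> coprimez n N%:Z.
Proof.
move=> H; rewrite coprimezE /=; apply: contraT => nc.
have g1 : (1 < gcdn `|n| N)%N by rewrite ltn_neqAle eq_sym nc gcdn_gt0 N0 orbT.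
pose l0 := pdiv (gcdn `|n| N); have lp : prime l0 by exact: pdiv_prime.
pose l : primeT := exist _ l0 lp; have [uu [a ua] [b ub]] := H l.
have dl : (l0 %| gcdn `|n| N)%N by exact: pdiv_dvd.
have /dvdnP[e eE] : (l0 %| N)%N by apply: dvdn_trans dl (dvdn_gcdr _ _).
have /dvdzP[e' eE'] : (l0%:Z %| n)%Z by rewrite dvdzE /=; apply: dvdn_trans dl (dvdn_gcdl _ _).
move: uu; rewrite unitmxE det2 ua ub eE' eE natrM intrM -[l0%:~R]/(l0%:R).
have -> : (u l 0 0 * (e'%:~R * l0%:R + e%:R * l0%:R * b) - u l 0 1 * (e%:R * l0%:R * a)) =
  (u l 0 0 * (e'%:~R + e%:R * b) - u l 0 1 * (e%:R * a)) * l0%:R by ring.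
by rewrite unitrM => /andP[_]; rewrite (negbTE (natp_nonunit l)).
Qed.

Lemma int_inv_mod n : coprimez n N%:Z -> exists n' e : int, n * n' = 1 + N%:Z * e.
Proof.
rewrite coprimezE => nc; have [v [w vw]] := Bezoutz n N%:Z.
exists v, (- w); rewrite mulrN [N%:Z * _]mulrC -[1]/(1%N%:Z).
have -> : 1%N%:Z = gcdz n N%:Z by rewrite /gcdz /= (eqP nc).
by rewrite -vw; ring.
Qed.

Definition liftS (g : GL2A R) (w : C) := exists (gamma : GL2 rat) (h : GL2 R)
  (u : forall l : primeT, 'M[Defs.Zp l]_2) (n : int),
    [/\ 0 < \det h, in_K0 N u n,
        GL2_mx (comp_inf g) = map_mx ratr gamma *m h,
        forall l, GL2_mx (comp_fin g l) = map_mx (@ratQ l) gamma *m map_mx (@Zp_to_Qp l) (u l) &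
        w = slash k h f ii * (Psi n)^-1].

Lemma unit_map (F G : fieldType) (t : {rmorphism F -> G}) (g : GL2 F) : map_mx t g \in unitmx.
Proof. by rewrite map_unitmx GL2_unit. Qed.

(** At every prime l the ratio equals u' u^-1, so its rational entries are integral everywhere. *)
Lemma lift_ratio (g g' : GL2 rat) (u u' : forall l : primeT, 'M[Defs.Zp l]_2) :
  (forall l, u l \in unitmx) ->
  (forall l, map_mx (@ratQ l) g *m map_mx (@Zp_to_Qp l) (u l) =
     map_mx (@ratQ l) g' *m map_mx (@Zp_to_Qp l) (u' l)) ->
  exists D : 'M[int]_2, invmx g' *m g = map_mx intr D /\
     forall l, map_mx intr D = u' l *m invmx (u l).
Proof.
move=> uu E; have key l : map_mx (@ratQ l) (invmx g' *m g) = map_mx (@Zp_to_Qp l) (u' l *m invmx (u l)).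
  have ul := uu l; have mu : map_mx (@Zp_to_Qp l) (u l) *m map_mx (@Zp_to_Qp l) (invmx (u l)) = 1%:M.
    by rewrite -map_mxM mulmxV// map_mx1.
  have gE : map_mx (@ratQ l) g = map_mx (@ratQ l) g' *m map_mx (@Zp_to_Qp l) (u' l) *m map_mx (@Zp_to_Qp l) (invmx (u l)).
    by rewrite -E -mulmxA mu mulmx1.
  have gV : map_mx (@ratQ l) (invmx g') *m map_mx (@ratQ l) g' = 1%:M.
    by rewrite -map_mxM mulVmx ?GL2_unit// map_mx1.
  by rewrite map_mxM gE [RHS]map_mxM !mulmxA gV mul1mx.
have H (ij : 'I_2 * 'I_2) : exists n : int, (invmx g' *m g) ij.1 ij.2 = n%:~R.
  apply: rat_int => l; have /matrixP/(_ ij.1 ij.2) := key l; rewrite !mxE => ->; eexists; reflexivity.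
have [d dE] := choice H; exists (\matrix_(i, j) d (i, j)).
have E1 : invmx g' *m g = map_mx intr (\matrix_(i, j) d (i, j)).
  by apply/matrixP => i j; rewrite (dE (i, j)) !mxE.
split=> // l; apply/matrixP => i j; apply: (@Zp_to_Qp_inj l).
have /matrixP/(_ i j) := key l; rewrite E1 !mxE => <-.
by rewrite !rmorph_int.
Qed.

(** The ratio D of two decompositions lies in Gamma_0(N): its determinant is positive at infinity
    and invertible over Z. Its lower right entry is n' / n modulo N, so the factor Psi of f under D
    compensates the two characters. *)
Lemma lift_uniq g w w' : liftS g w -> liftS g w' -> w = w'.
Proof.
move=> [ga [h [u [n [dh uK gi gl ->]]]]] [ga' [h' [u' [n' [dh' uK' gi' gl' ->]]]]].
have uu l : u l \in unitmx by case: (uK l).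
have uu' l : u' l \in unitmx by case: (uK' l).
have E l : map_mx (@ratQ l) ga *m map_mx (@Zp_to_Qp l) (u l) =
     map_mx (@ratQ l) ga' *m map_mx (@Zp_to_Qp l) (u' l) by rewrite -gl -gl'.
have [D [DE Dl]] := lift_ratio uu E; have [D' [DE' _]] := lift_ratio uu' (fun l => esym (E l)).
have hE : GL2_mx h' = map_mx intr D *m h.
  have -> : map_mx intr D = map_mx (@ratr R) (invmx ga' *m ga).
    by rewrite DE -map_mx_comp; apply: eq_map_mx => x /=; rewrite ratr_int.
  rewrite map_mxM -mulmxA -gi gi' mulmxA -map_mxM mulVmx ?GL2_unit// map_mx1 mul1mx //.
have dD : \det D = 1.
  have p1 : \det D * \det D' = 1.
    apply/eqP; rewrite -(eqr_int rat) intrM -!det_map_mx -DE -DE' -det_mulmx.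
    by rewrite mulmxA mulmxK ?GL2_unit// mulVmx ?GL2_unit// det1.
  have p2 : 0 < \det D.
    by move: dh'; rewrite hE det_mulmx det_map_mx /= pmulr_lgt0// ltr0z.
  have : \det D \is a GRing.unit by apply/unitrPr; exists (\det D').
  by move: p2; case: (\det D) => // x; rewrite unfold_in /= => _ /orP[/eqP ->//|/eqP].
have nc := in_K0_coprime uK; have [nb [e nE]] := int_inv_mod nc.
have KD l : K0r N (n' * nb) (map_mx intr D : 'M[Defs.Zp l]_2).
  by rewrite Dl; apply: K0r_mul (uK' l) _; apply: K0r_inv nE (uK l).
have D10 : (N%:Z %| (D 1 0)%R)%Z by apply: int_dvd_local => l; case: (KD l) => _; rewrite !mxE.
have /dvdzP[q qE] : (N%:Z %| (D 1 1 - n' * nb)%R)%Z.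
  apply: int_dvd_local => l; case: (KD l) => _ _ [z]; rewrite !mxE => zE; exists z.
  by rewrite intrB zE addrC addKr.
have [PM _ P0] := PsiD.
have PD : Psi (D 1 1) * Psi n = Psi n'.
  have -> : D 1 1 = n' * nb + N%:Z * q by rewrite [N%:Z * q]mulrC -qE addrC subrK.
  rewrite (dirichlet_per _ _ PsiD) PM -mulrA -PM mulrC [nb * _]mulrC nE (dirichlet_per _ _ PsiD).
  by rewrite (dirichlet1 PsiD) mul1r.
have Pn0 : Psi n != 0 by rewrite P0.
have [_ fG _] := fC.
have -> : slash k h' f ii = Psi (D 1 1) * slash k h f ii.
  have dD' : 0 < \det (map_mx intr D : 'M[R]_2) by rewrite det_map_mx dD rmorph1 ltr01.
  have i0 : 0 < complex.Im ii by exact: ltr01.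
  rewrite hE (slashM k f dD' dh i0) (@slash_eq R k h _ (fun z => Psi (D 1 1) * f z) _ dh i0).
    by rewrite /slash mulrCA.
  by move=> z z0; exact: fG.
have PD0 : Psi (D 1 1) != 0 by apply: contraNneq Pn0 => H; have := P0 n'; rewrite -PD H mul0r eqxx (in_K0_coprime uK').
by rewrite -PD invfM mulrACA mulfV// mul1r.
Qed.

Lemma lift_val g w : liftS g w -> phi g = w.
Proof.
move=> H; rewrite /adelic_lift; case: xgetP => [x _ Hx|/(_ w)]; last by move=> /(_ H).
exact: lift_uniq Hx H.
Qed.

Lemma lift_nonempty g : phi g != 0 -> liftS g (phi g).
Proof. by rewrite /adelic_lift; case: xgetP => [x _ Hx //|_]; rewrite eqxx. Qed.

Definition lift_rel (gamma : GL2 rat) (ka : forall l : primeT, 'M[Defs.Zp l]_2) (g g' : GL2A R) :=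
  GL2_mx (comp_inf g') = map_mx ratr gamma *m GL2_mx (comp_inf g) /\
  forall l, GL2_mx (comp_fin g' l) = map_mx (@ratQ l) gamma *m GL2_mx (comp_fin g l) *m map_mx (@Zp_to_Qp l) (ka l).

Lemma liftS_rel gamma ka n g g' w : in_K0 N ka n -> lift_rel gamma ka g g' -> liftS g w ->
  liftS g' (w * (Psi n)^-1).
Proof.
move=> kK [ri rl] [ga [h [u [n' [dh uK gi gl ->]]]]].
exists (gamma * ga)%g, h, (fun l => u l *m ka l), (n' * n); split=> //.
- by move=> l; exact: K0r_mul (uK l) (kK l).
- by rewrite ri gi mulmxA map_mxM.
- by move=> l; rewrite rl gl map_mxM [map_mx _ (u l *m _)]map_mxM !mulmxA.
- by have [PM _ _] := PsiD; rewrite PM invfM mulrA.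
Qed.

Lemma lift_rel_inv gamma ka g g' : (forall l, ka l \in unitmx) -> lift_rel gamma ka g g' ->
  lift_rel (gamma^-1)%g (fun l => invmx (ka l)) g' g.
Proof.
move=> ku [ri rl]; split=> [|l].
  by rewrite ri mulmxA -map_mxM mulVmx ?GL2_unit// map_mx1 mul1mx.
rewrite rl !mulmxA -map_mxM mulVmx ?GL2_unit// map_mx1 mul1mx -mulmxA -map_mxM mulmxV// map_mx1 mulmx1//.
Qed.

(** Where there is no decomposition the lift has the default value 0; the relation being invertible,
    such points correspond to each other. *)
Lemma lift_equiv gamma ka n g g' : in_K0 N ka n -> lift_rel gamma ka g g' ->
  phi g' = phi g * (Psi n)^-1.
Proof.
move=> kK r; have [H|/eqP H] := eqVneq (phi g) 0; last first.
  by apply: lift_val; apply: liftS_rel kK r (lift_nonempty _); exact/eqP.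
rewrite H mul0r; apply: contrapT => /eqP g'0; have H' := lift_nonempty g'0.
have [nb [e nE]] := int_inv_mod (in_K0_coprime kK).
have kK' : in_K0 N (fun l => invmx (ka l)) nb by move=> l; exact: K0r_inv nE (kK l).
have ku l : ka l \in unitmx by case: (kK l).
have := lift_val (liftS_rel kK' (lift_rel_inv ku r) H'); rewrite H => /esym/eqP.
have [_ _ P0] := PsiD.
by rewrite mulf_eq0 invr_eq0 (negbTE g'0) -[_ == 0]negbK P0 (in_K0_coprime kK').
Qed.

End Lift.

Section MapGL2.
Variables (F G : fieldType) (t : {rmorphism F -> G}).
Definition mapG (g : GL2 F) : GL2 G := MkGL2 (unit_map t g).
Lemma mapGM g h : mapG (g * h)%g = (mapG g * mapG h)%g.
Proof. by apply: val_inj; rewrite /= map_mxM. Qed.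
Lemma mapG_nup x : mapG (nup x) = nup (t x).
Proof. by apply: GL2_ext; rewrite !nupE !mxE nupE !mxE /= ?rmorph1 ?rmorph0. Qed.
Lemma mapG_nlo x : mapG (nlo x) = nlo (t x).
Proof. by apply: GL2_ext; rewrite !nloE !mxE nloE !mxE /= ?rmorph1 ?rmorph0. Qed.
Lemma mapG_dia x : x != 0 -> mapG (dia x 1) = dia (t x) 1.
Proof.
move=> x0; have tx0 : t x != 0 by rewrite fmorph_eq0.
by apply: GL2_ext; rewrite !diaE ?oner_neq0// !mxE diaE ?oner_neq0// !mxE /= ?rmorph1 ?rmorph0.
Qed.
End MapGL2.

Section FieldFacts.
Variable F : fieldType.
Lemma dia_split (v s : F) : v != 0 -> s != 0 -> dia v 1 = (dia s 1 * dia (v / s) 1)%g.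
Proof.
by move=> v0 s0; rewrite diaM ?oner_neq0 ?mulf_neq0 ?invr_eq0// mulr1 mulrCA mulfV// mulr1.
Qed.
Lemma dia_sdiv (v s q y : F) : v != 0 -> s != 0 -> v = s + q * y ->
  GL2_mx (dia (v / s) 1) = mx2 (1 + q * (y / s)) 0 0 1.
Proof. by move=> v0 s0 vE; rewrite diaE ?oner_neq0 ?mulf_neq0 ?invr_eq0// {1}vE mulrDl mulfV// mulrA. Qed.
Lemma dia_normal (g : GL2 F) c : c != 0 -> \det g = c ->
  \det (GL2_mx (g * (dia c 1)^-1)%g) = 1.
Proof.
move=> c0 gc; rewrite GL2_mulE det_mulmx /= det_inv diaE ?oner_neq0// det_mx2 mulr1 mul0r subr0 gc mulfV//.
Qed.
Lemma dia_mull (v w : F) : v != 0 -> w != 0 -> dia (v * w) 1 = (dia w 1 * dia v 1)%g.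
Proof. by move=> v0 w0; rewrite diaM ?oner_neq0// mulr1 mulrC. Qed.
End FieldFacts.

(** * Translations of the lift at p *)

Section LiftLocal.
Variables (R : realType) (k N : nat) (Psi : int -> R[i]) (f : R[i] -> R[i]).
Local Notation C := R[i].
Hypotheses (N0 : (0 < N)%N) (PsiD : dirichlet_character N Psi) (fC : cusp_form k N Psi f).
Local Notation phi := (adelic_lift k N Psi f).
Variable p : primeT.
Local Notation K := (Qp p).
Local Notation P := (p%:R : K).
Local Notation loc := (@locA R p).

Let nu := logn p N.
Let Np := (N %/ p ^ nu)%N.
Lemma level_split : N = (p ^ nu * Np)%N /\ coprime p Np.
Proof.
have dv : (p ^ nu %| N)%N by exact: pfactor_dvdnn.
have E : N = (p ^ nu * Np)%N by rewrite mulnC divnK.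
split=> //; rewrite prime_coprime ?(valP p)//; apply/negP => pN.
have : (p ^ nu.+1 %| N)%N by rewrite expnSr E dvdn_mul.
by rewrite pfactor_dvdn ?(valP p)// ltnn.
Qed.

Lemma p_unit_away (l : primeT) : l != p -> (p%:R : Defs.Zp l) \is a GRing.unit.
Proof.
move=> lp; apply: zp_unit_natr; rewrite prime_coprime ?(valP p)// dvdn_prime2 ?(valP p, valP l)//.
by apply: contra lp => /eqP pl; apply/eqP/val_inj.
Qed.

Lemma level_away (l : primeT) y : l != p -> (Np%:Z %| y)%Z -> exists z : Defs.Zp l, y%:~R = N%:R * z.
Proof.
move=> lp /dvdzP[q ->]; have pu := unitrX nu (p_unit_away lp); exists (q%:~R * (p%:R ^+ nu)^-1).
have [NE _] := level_split; rewrite {1}NE natrM natrX intrM -[Np%:Z%:~R]/(Np%:R).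
by rewrite mulrA [p%:R ^+ nu * _]mulrC -!mulrA [p%:R ^+ nu * _]mulrCA mulrV// mulr1 mulrC.
Qed.

Lemma level_at y : ((p ^ nu)%:Z %| y)%Z -> exists z : Defs.Zp p, y%:~R = N%:R * z.
Proof.
move=> /dvdzP[q ->]; have [NE cop] := level_split.
have Nu : (Np%:R : Defs.Zp p) \is a GRing.unit by apply: zp_unit_natr; rewrite coprime_sym.
exists (q%:~R * Np%:R^-1); rewrite {1}NE natrM intrM -[(p ^ nu)%:Z%:~R]/((p ^ nu)%:R).
by rewrite -mulrA [Np%:R * _]mulrCA mulrV// mulr1 mulrC.
Qed.

(** Psi depends on a class modulo N, so prescribed entries at p and away from p have to be glued:
    Chinese remainders for N = p^nu Np. *)
Lemma level_mix (n1 n2 : int) : exists n' : int,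
  (forall l : primeT, l != p -> exists z : Defs.Zp l, n'%:~R = n1%:~R + N%:R * z) /\
  (exists z : Defs.Zp p, n'%:~R = n2%:~R + N%:R * z).
Proof.
have [NE cop] := level_split.
have cz : coprimez (p ^ nu)%:Z Np%:Z by rewrite coprimezE /= coprimeXl.
exists (zchinese (p ^ nu)%:Z Np%:Z n2 n1); set n' := zchinese _ _ _ _.
have E1 : (Np%:Z %| n' - n1)%Z by rewrite -eqz_mod_dvd; apply/eqP; exact: zchinese_modr.
have E2 : ((p ^ nu)%:Z %| n' - n2)%Z by rewrite -eqz_mod_dvd; apply/eqP; exact: zchinese_modl.
split=> [l lp|].
  by have [z zE] := level_away lp E1; exists z; rewrite -zE intrB addrC subrK.
by have [z zE] := level_at E2; exists z; rewrite -zE intrB addrC subrK.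
Qed.

Lemma K0r_shift (A : comUnitRingType) n n' (u : 'M[A]_2) :
  (exists z : A, n'%:~R = n%:~R + N%:R * z) -> K0r N n u -> K0r N n' u.
Proof.
move=> [z zE] [uu uN [y yE]]; split=> //; exists (y - z).
by rewrite yE zE; ring.
Qed.

Definition mxat (x : 'M[Defs.Zp p]_2) (y : forall l : primeT, 'M[Defs.Zp l]_2) : forall l, 'M[Defs.Zp l]_2 :=
  @dfwith primeT (fun l => 'M[Defs.Zp l]_2) y p x.
Lemma mxat_in x y : mxat x y p = x. Proof. exact: dfwith_in. Qed.
Lemma mxat_out x y (l : primeT) : l != p -> mxat x y l = y l.
Proof. by rewrite eq_sym => lp; exact: dfwith_out. Qed.

Lemma in_K0_mix x y n1 n2 n' : (forall l, l != p -> K0r N n1 (y l)) -> K0r N n2 x ->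
  (forall l : primeT, l != p -> exists z : Defs.Zp l, n'%:~R = n1%:~R + N%:R * z) ->
  (exists z : Defs.Zp p, n'%:~R = n2%:~R + N%:R * z) -> in_K0 N (mxat x y) n'.
Proof.
move=> yK xK H1 H2 l; have [->|lp] := eqVneq l p; first by rewrite mxat_in; exact: K0r_shift xK.
by rewrite mxat_out//; exact: K0r_shift (H1 l lp) (yK l lp).
Qed.
Lemma in_K0_mix1 x y : (forall l, l != p -> K0r N 1 (y l)) -> K0r N 1 x -> in_K0 N (mxat x y) 1.
Proof.
by move=> yK xK; apply: (in_K0_mix yK xK) => [l lp|]; exists 0; rewrite mulr0 addr0.
Qed.

Lemma lift_loc n2 (g : GL2 K) x : GL2_mx g = map_mx (@Zp_to_Qp p) x -> K0r N n2 x ->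
  exists n', coprimez n' N%:Z /\ forall h, phi (h * loc g)%g = phi h * (Psi n')^-1.
Proof.
move=> gx xK; have [n' [H1 H2]] := level_mix 1 n2; exists n'.
have kK := in_K0_mix (fun l _ => K0r1 (Defs.Zp l) N) xK H1 H2; split; first exact: in_K0_coprime kK.
move=> h; apply: (lift_equiv N0 PsiD fC (gamma := 1%g) kK); split=> [|l] /=.
  by rewrite map_mx1 mul1mx mulmx1.
rewrite map_mx1 mul1mx; have [->|lp] := eqVneq l p; first by rewrite mxat_in at_p_in gx.
by rewrite mxat_out// at_p_out// map_mx1.
Qed.

Lemma lift_loc1 (g : GL2 K) x h : GL2_mx g = map_mx (@Zp_to_Qp p) x -> K0r N 1 x ->
  phi (h * loc g)%g = phi h.
Proof.
move=> gx xK; have kK := in_K0_mix1 (fun l _ => K0r1 (Defs.Zp l) N) xK.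
rewrite (lift_equiv N0 PsiD fC (gamma := 1%g) (g := h) kK); first by rewrite (dirichlet1 PsiD) invr1 mulr1.
split=> [|l] /=; first by rewrite map_mx1 mul1mx mulmx1.
rewrite map_mx1 mul1mx; have [->|lp] := eqVneq l p; first by rewrite mxat_in at_p_in gx.
by rewrite mxat_out// at_p_out// map_mx1.
Qed.

(* The elements of GL_2(Q) lying in K_0(N), with lower right entry 1 mod N, at all l <> p. *)
Definition away_K0 (ga : GL2 rat) := forall l : primeT, l != p ->
  exists2 ka : 'M[Defs.Zp l]_2, K0r N 1 ka & map_mx (@ratQ l) ga *m map_mx (@Zp_to_Qp l) ka = 1%:M.

Lemma away_K0M g h : away_K0 g -> away_K0 h -> away_K0 (g * h)%g.
Proof.
move=> H1 H2 l lp; have [a aK aE] := H1 l lp; have [b bK bE] := H2 l lp.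
exists (b *m a); first by rewrite -[1]mulr1; exact: K0r_mul.
by rewrite map_mxM [X in _ *m X]map_mxM mulmxA -[X in X *m _]mulmxA bE mulmx1 aE.
Qed.

Lemma away_nup (q : rat) : (forall l : primeT, l != p -> Qint (ratQ l q)) -> away_K0 (nup q).
Proof.
move=> H l lp; have [z zE] := H l lp; exists (mx2 1 (- z) 0 1).
  apply: K0r_mx2; first by rewrite mulr1 mulr0 subr0 unitr1.
    by exists 0; rewrite mulr0.
  by exists 0; rewrite mulr0 addr0.
rewrite nupE; apply: eq_mx2; rewrite mulmx2 !mxE /= ?rmorph1 ?rmorph0 ?rmorphN /= ?zE; ring.
Qed.

Lemma away_nlo (q : rat) : (forall l : primeT, l != p -> exists z, ratQ l q = Zp_to_Qp (N%:R * z)) -> away_K0 (nlo q).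
Proof.
move=> H l lp; have [z zE] := H l lp; exists (mx2 1 0 (N%:R * - z) 1).
  apply: K0r_mx2; first by rewrite mulr1 mul0r subr0 unitr1.
    by exists (- z).
  by exists 0; rewrite mulr0 addr0.
rewrite nloE mulrN; apply: eq_mx2; rewrite mulmx2 !mxE /= ?rmorph1 ?rmorph0 ?rmorphN /= ?zE; ring.
Qed.

Lemma away_dia (j : int) : away_K0 (dia (p%:R ^ j) 1).
Proof.
move=> l lp; have pu := p_unit_away lp.
have p0 : (p%:R : rat) != 0 by rewrite pnatr_eq0 -lt0n p_gt0.
exists (mx2 (p%:R ^ (- j)) 0 0 1).
  apply: K0r_mx2; first by rewrite mulr1 mul0r subr0; exact: unitrXz.
    by exists 0; rewrite mulr0.
  by exists 0; rewrite mulr0 addr0.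
have E : ratQ l (p%:R ^ j) * Zp_to_Qp (p%:R ^ (- j)) = 1.
  have q0 : (p%:R : Qp l) \is a GRing.unit.
    by rewrite -(rmorph_nat (@Zp_to_Qp l)); exact: (rmorph_unit (@Zp_to_Qp l)).
  rewrite (rmorphXz (@ratQ l)) ?unitfE// (rmorphXz (@Zp_to_Qp l))// (rmorph_nat (@ratQ l)) rmorph_nat.
  by rewrite -exprzDr// subrr.
rewrite diaE ?expfz_neq0 ?oner_neq0//; apply: eq_mx2; rewrite mulmx2 !mxE /= ?rmorph1 ?rmorph0 ?E; ring.
Qed.

Lemma frac_away (a r : nat) (l : primeT) : l != p -> exists z : Defs.Zp l, ratQ l (a%:R / p%:R ^+ r) = Zp_to_Qp z.
Proof.
move=> lp; have pu := unitrX r (p_unit_away lp); exists (a%:R * (p%:R ^+ r)^-1).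
have E : Zp_to_Qp ((p%:R : Defs.Zp l) ^+ r) = p%:R ^+ r by rewrite rmorphXn rmorph_nat.
have p0 : (p%:R : Qp l) ^+ r != 0.
  by rewrite -E -(rmorph0 (@Zp_to_Qp l)); apply: contraTneq pu => /Zp_to_Qp_inj ->; rewrite unitr0.
have pr0 : (p%:R : rat) ^+ r != 0 by rewrite expf_neq0 // pnatr_eq0 -lt0n p_gt0.
apply: (mulIf p0); rewrite -[in LHS](rmorph_nat (@ratQ l)) -[in LHS]rmorphXn -rmorphM divfK//.
by rewrite -E -rmorphM -mulrA mulVr// mulr1 !rmorph_nat.
Qed.

Local Notation qG := (mapG (@ratQ p)).
Local Notation rG := (mapG (@ratr R)).

(** By left invariance under GL_2(Q) a rational matrix at p is traded for its inverse at infinity;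
    at the other primes K_0(N) absorbs it. *)
Lemma lift_left ga h g : away_K0 ga -> phi (mkA h (qG ga * g)%g) = phi (mkA (rG (ga^-1) * h)%g g).
Proof.
move=> aw; have [ka kaP] : exists ka : forall l : primeT, 'M[Defs.Zp l]_2, forall l, l != p ->
    K0r N 1 (ka l) /\ map_mx (@ratQ l) ga *m map_mx (@Zp_to_Qp l) (ka l) = 1%:M.
  have H (l : primeT) : exists ka : 'M[Defs.Zp l]_2, l != p ->
      K0r N 1 ka /\ map_mx (@ratQ l) ga *m map_mx (@Zp_to_Qp l) ka = 1%:M.
    have [->|lp] := eqVneq l p; first by exists 1%:M.
    by have [ka kaK kaE] := aw l lp; exists ka.
  by exists (fun l => projT1 (cid (H l))) => l; exact: projT2 (cid (H l)).
have kK := in_K0_mix1 (fun l lp => (kaP l lp).1) (K0r1 _ N).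
rewrite (lift_equiv N0 PsiD fC (gamma := ga) (g := mkA (rG (ga^-1) * h)%g g) kK).
  by rewrite (dirichlet1 PsiD) invr1 mulr1.
split=> [|l] /=.
  by rewrite mulmxA -map_mxM mulmxV ?GL2_unit// map_mx1 mul1mx.
have [->|lp] := eqVneq l p; first by rewrite mxat_in !at_p_in map_mx1 mulmx1.
by rewrite mxat_out// !at_p_out//= mulmx1; have [_ ->] := kaP l lp.
Qed.

(** ** Vanishing of sums of translates *)

Variables (a : nat -> GL2 K) (M : nat).
Definition Ysum (x : GL2A R) : C := \sum_(t < M) phi (x * loc (a t))%g.
(** Quantifying over all h makes this set stable under rational matrices of positive determinant
    that satisfy [away_K0]; unipotents and small matrices then enlarge it to the whole group. *)
Definition Omega (g : GL2 K) := forall h : GL2 R, 0 < \det h -> Ysum (mkA h g) = 0.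

Lemma Ysum_mkA h g : Ysum (mkA h g) = \sum_(t < M) phi (mkA h (g * a t)%g).
Proof. by apply: eq_bigr => t _; rewrite mkA_loc. Qed.

Lemma Ysum_left ga h g : away_K0 ga -> Ysum (mkA h (qG ga * g)%g) = Ysum (mkA (rG (ga^-1) * h)%g g).
Proof. by move=> aw; rewrite !Ysum_mkA; apply: eq_bigr => t _; rewrite -mulgA lift_left. Qed.

Lemma Omega_left ga g : away_K0 ga -> 0 < \det ga -> Omega g -> Omega (qG ga * g)%g.
Proof.
move=> aw dga H h dh; rewrite Ysum_left//; apply: H.
by rewrite /= det_mulmx det_map_mx det_inv mulr_gt0// ltr0q invr_gt0.
Qed.

Lemma congr_K0 (g : GL2 K) : congruence_subgroup nu.+1 g ->
  exists2 x, GL2_mx g = map_mx (@Zp_to_Qp p) x & K0r N 1 x.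
Proof.
move=> [h gE]; have [NE cop] := level_split; exists (1%:M + p%:R ^+ nu.+1 *: h).
  by rewrite gE map_mxD map_mx1 map_mxZ rmorphXn rmorph_nat.
have Nu : (Np%:R : Defs.Zp p) \is a GRing.unit by apply: zp_unit_natr; rewrite coprime_sym.
have dvN (z : Defs.Zp p) : p%:R ^+ nu.+1 * z = N%:R * (Np%:R^-1 * p%:R * z).
  by rewrite [in RHS]NE natrM natrX exprSr -!mulrA [Np%:R * _]mulrA mulrV// mul1r.
split.
- rewrite unitmxE det2 !mxE /= !mulr1n !mulr0n !add0r.
  pose y := p%:R ^+ nu * (h 0 0 + h 1 1 + p%:R ^+ nu.+1 * (h 0 0 * h 1 1 - h 0 1 * h 1 0)).
  have -> : (1 + p%:R ^+ nu.+1 * h 0 0) * (1 + p%:R ^+ nu.+1 * h 1 1) - p%:R ^+ nu.+1 * h 0 1 * (p%:R ^+ nu.+1 * h 1 0) =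
    1 + p%:R * y by rewrite /y exprSr; ring.
  apply: zp_nondvd_unit; apply: contraNneq (natp_nonunit p) => /zp_dvd[z].
  rewrite expr1 => E; apply/unitrPr; exists (z - y).
  by rewrite mulrBr -E addrK.
- by rewrite !mxE /= mulr0n add0r dvN; eexists.
- by rewrite !mxE /= mulr1n dvN; eexists.
Qed.

Lemma Ysum_smooth : exists m, forall (g c : GL2 K), congruence_subgroup m.+1 c ->
  forall h, Ysum (mkA h (g * c)%g) = Ysum (mkA h g).
Proof.
have [m mP] := choice (fun t => congruence_subgroup_conj (a t) nu).
pose mm := \max_(t < M) m t; exists mm => g c cc h; rewrite !Ysum_mkA; apply: eq_bigr => t _.
have ct : congruence_subgroup (m t).+1 c.
  by apply: congruence_subgroup_le cc; rewrite ltnS /mm (leq_bigmax t).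
have [x xE xK] := congr_K0 (mP t c ct).
have -> : (g * c * a t = g * a t * ((a t)^-1 * c * a t))%g by rewrite !mulgA mulgK.
by rewrite -mkA_loc; exact: lift_loc1 xE xK.
Qed.

Lemma Omega_small g : exists m, forall c, congruence_subgroup m.+1 c -> Omega g -> Omega (c * g)%g.
Proof.
have [m mP] := Ysum_smooth; have [m' m'P] := congruence_subgroup_conj g m.
exists m' => c /m'P cc H h dh.
have -> : (c * g = g * (g^-1 * c * g))%g by rewrite !mulgA mulgV mul1g.
by rewrite mP//; exact: H.
Qed.

(** x is an element of Z[1/p], which is integral at the other primes and moves to infinity, plus a
    small part absorbed by smoothness. *)
Lemma Omega_nup x g : Omega g -> Omega (nup x * g)%g.
Proof.
move=> Og; have [m mP] := Omega_small g; have [t [r [z ->]]] := Qp_dense x m.+1.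
rewrite -nupD -mulgA; have -> : t%:R / p%:R ^+ r = ratQ p (t%:R / p%:R ^+ r).
  by rewrite rmorphM fmorphV rmorphXn !rmorph_nat.
rewrite -mapG_nup; apply: Omega_left.
- apply: away_nup => l lp; have [y ->] := frac_away t r lp; by exists y.
- by rewrite nupE det_mx2 mulr1 mulr0 subr0.
- apply: mP => //; apply: congr_nup; exists (Zp_to_Qp z); split=> //; by exists z.
Qed.

Lemma Omega_nlo x g : Omega g -> Omega (nlo x * g)%g.
Proof.
move=> Og; have [m mP] := Omega_small g; have NQ : (N%:R : K) != 0.
  by rewrite -[N%:R]/(N%:Z%:~R) Qp_intr_eq0 -lt0n.
(* Dividing by N first puts the lower left entry of the rational part into N Z_l at the primes l <>
   p. *)
have [t [r [z zE]]] := Qp_dense (x / N%:R) m.+1.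
have -> : x = ratQ p (N%:R * (t%:R / p%:R ^+ r)) + p%:R ^+ m.+1 * (N%:R * Zp_to_Qp z).
  rewrite -[LHS](divfK NQ) zE rmorphM fmorph_div rmorphXn !rmorph_nat mulrDl.
  by rewrite [_ * N%:R]mulrC -mulrA [Zp_to_Qp z * _]mulrC.
rewrite -nloD -mulgA -mapG_nlo; apply: Omega_left.
- apply: away_nlo => l lp; have [y yE] := frac_away t r lp; exists y.
  transitivity (ratQ l N%:R * ratQ l (t%:R / p%:R ^+ r)); first exact: (rmorphM (@ratQ l)).
  rewrite [X in _ * X]yE (rmorph_nat (@ratQ l)) -(rmorph_nat (@Zp_to_Qp l)); exact: esym (rmorphM (@Zp_to_Qp l) _ _).
- by rewrite nloE det_mx2 mulr1 mul0r subr0.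
- apply: mP => //; apply: congr_nlo; exists (N%:R * Zp_to_Qp z); split=> //.
  by exists (N%:R * z); rewrite rmorphM rmorph_nat.
Qed.

Lemma Omega_unit v : (forall s : nat, coprime s p -> Omega (dia s%:R 1)) -> Zp_units v -> Omega (dia v 1).
Proof.
move=> H [w /= wu <-] h dh; have [m mP] := Ysum_smooth.
have [s [y [sp wE]]] := unit_approx m wu.
have su := Zp_units_natr sp; have s0 := Zp_units_neq0 su.
have w0 : Zp_to_Qp w != 0 by apply: Zp_units_neq0; exists w.
have sV : Zp_to_Qp (s%:R^-1 : Defs.Zp p) = s%:R^-1.
  by rewrite (rmorphV (@Zp_to_Qp p)) ?zp_unit_natr// rmorph_nat.
have wE' : Zp_to_Qp w = s%:R + P ^+ m.+1 * Zp_to_Qp y.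
  by rewrite wE (rmorphD (@Zp_to_Qp p)) (rmorphM (@Zp_to_Qp p)) (rmorphXn (@Zp_to_Qp p)) !(rmorph_nat (@Zp_to_Qp p)).
rewrite (dia_split w0 s0) mP; first exact: (H s sp h dh).
exists (mx2 (y * s%:R^-1) 0 0 0); rewrite (dia_sdiv w0 s0 wE') -sV -(rmorphM (@Zp_to_Qp p)).
by apply: eq_mx2; rewrite !mxE /= ?mulr1n ?mulr0n ?rmorph0 ?mulr0 ?addr0 ?add0r.
Qed.

(** g is an element of SL_2 times diag(det g, 1), and det g = v p^j with v a unit; the power of p
    moves to infinity by [away_dia]. *)
Lemma Omega_full : (forall s : nat, coprime s p -> Omega (dia s%:R 1)) -> forall g, Omega g.
Proof.
move=> H g; have dg : \det g != 0 by have := GL2_unit g; rewrite unitmxE unitfE.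
have [j [v [vu dE]]] := Qp_val dg; have v0 := Zp_units_neq0 vu.
have pj0 : P ^ j != 0 := expfz_neq0 j (Qnatp_neq0 p).
have -> : (g = g * (dia (v * P ^ j)%R 1)^-1 * dia (v * P ^ j)%R 1)%g by rewrite -mulgA mulVg mulg1.
apply: (SL2_unip Omega_nup Omega_nlo); first exact: dia_normal (mulf_neq0 v0 pj0) dE.
have p0' : (p%:R : rat) != 0 by rewrite pnatr_eq0 -lt0n p_gt0.
have -> : dia (v * P ^ j) 1 = (qG (dia (p%:R ^ j) 1) * dia v 1)%g.
  rewrite (dia_mull v0 pj0); congr (_ * _)%g; rewrite (mapG_dia _ (expfz_neq0 j p0')); congr (dia _ 1).
  by rewrite (rmorphXz (@ratQ p)) ?unitfE// (rmorph_nat (@ratQ p)).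
apply: Omega_left; [exact: away_dia| |exact: Omega_unit].
have p0 : (0 : rat) < p%:R by rewrite ltr0n p_gt0.
by rewrite diaE ?oner_neq0 ?expfz_neq0 ?gt_eqF// det_mx2 mulr1 mul0r subr0 exprz_gt0.
Qed.

(* Strong approximation reduces an adelic point to its components at p and infinity. *)
Lemma Ysum_reduce x : Ysum x != 0 -> exists h (g : GL2 K), 0 < \det (GL2_mx h) /\ Ysum (mkA h g) != 0.
Proof.
move=> Yx; have [t t0] : exists t : 'I_M, phi (x * loc (a t))%g != 0.
  apply: contrapT => /forallNP H; case/eqP: Yx; apply: big1 => t _.
  by apply: contrapT => /eqP; exact: H.
have [ga [h [u [n [dh uK xi xl _]]]]] := lift_nonempty t0.
have xi' : GL2_mx (comp_inf x) = map_mx ratr ga *m h by rewrite -xi /= mulmx1.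
have up : map_mx (@Zp_to_Qp p) (u p) \in unitmx.
  by case: (uK p) => uu _ _; rewrite unitmxE det_map_mx; apply: (rmorph_unit (@Zp_to_Qp p)); rewrite -unitmxE.
pose gp : GL2 K := MkGL2 up.
have xp : comp_fin x p = (qG ga * gp * (a t)^-1)%g.
  rewrite -[LHS](mulgK (a t)); congr (_ * _)%g; apply: val_inj => /=.
  by have := xl p; rewrite /= at_p_in.
have xo (l : primeT) : l != p -> GL2_mx (comp_fin x l) = map_mx (@ratQ l) ga *m map_mx (@Zp_to_Qp l) (u l).
  by move=> lp; rewrite -xl /= at_p_out//= mulmx1.
have [n' [H1 H2]] := level_mix n 1.
have kK := in_K0_mix (fun l _ => uK l) (K0r1 _ N) H1 H2.
exists h, (gp * (a t)^-1)%g; split=> //; apply: contra_neq Yx => Y0.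
rewrite /Ysum; transitivity (\sum_(s < M) phi (mkA h (gp * (a t)^-1)%g * loc (a s))%g * (Psi n')^-1); last first.
  by rewrite -mulr_suml -/(Ysum _) Y0 mul0r.
apply: eq_bigr => s _; apply: (lift_equiv N0 PsiD fC (gamma := ga) kK); split=> [|l] /=.
  by rewrite !mulmx1.
have [->|lp] := eqVneq l p; first by rewrite mxat_in !at_p_in map_mx1 mulmx1 xp /= !mulmxA.
by rewrite mxat_out// !at_p_out//= !mulmx1 xo.
Qed.

Lemma Ysum_neq0 x : Ysum x != 0 -> exists (s : nat) (h : GL2 R), coprime s p /\ 0 < \det (GL2_mx h) /\
  Ysum (mkA h (dia (s%:R : K) 1)) != 0.
Proof.
move=> /Ysum_reduce[h [g [dh Y0]]]; apply: contrapT => H; case/eqP: Y0.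
apply: Omega_full => // s sp h' dh'; apply: contrapT => /eqP Y0; apply: H.
by exists s, h'.
Qed.

End LiftLocal.

(** * Evaluation of the lift *)

Section SlashEval.
Variables (R : realType) (k : nat).
Local Notation C := R[i].
Local Notation ii := (0 +i* 1 : C).
Implicit Types (F G : C -> C) (z : C).

Lemma Im_ii : 0 < complex.Im ii. Proof. exact: ltr01. Qed.

(** The matrix with rows (y, x) and (0, 1) carries i to x + i y. *)
Lemma slash_surj F : (forall h : GL2 R, 0 < \det (GL2_mx h) -> slash k h F ii = 0) -> null F.
Proof.
move=> H z z0; have dz : complex.Im z * 1 - complex.Re z * 0 != 0 by rewrite mulr1 mulr0 subr0 gt_eqF.
have hE := G2E dz; have := H (G2 (complex.Im z) (complex.Re z) 0 1).
rewrite hE det_mx2 mulr1 mulr0 subr0 => /(_ z0); rewrite /slash det_mx2 mulr1 mulr0 subr0.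
have -> : automorphy_factor (mx2 (complex.Im z) (complex.Re z) 0 1) ii = 1.
  by rewrite /automorphy_factor !mxE /= rmorph0 rmorph1 mul0r add0r.
have -> : mobius (mx2 (complex.Im z) (complex.Re z) 0 1) ii = z.
  rewrite /mobius /automorphy_factor !mxE /= rmorph0 rmorph1 mul0r add0r divr1.
  by rewrite [RHS]complexE addrC mulrC.
rewrite expr1n divr1 => /eqP; rewrite mulf_eq0 expf_eq0 => /orP[|/eqP//].
have s0 : Num.sqrt (complex.Im z) != 0 by rewrite gt_eqF// sqrtr_gt0.
by rewrite -(rmorph0 (real_complex R)) (inj_eq (@complexI R)) (negbTE s0) andbF.
Qed.

Lemma slash_null (h : 'M[R]_2) F : 0 < \det h -> null F -> slash k h F ii = 0.
Proof. by move=> dh nF; rewrite /slash nF ?mulr0//; exact: mobius_upper Im_ii. Qed.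

Lemma slash_sum (h : 'M[R]_2) n (F : 'I_n -> C -> C) z :
  slash k h (fun w => \sum_(i < n) F i w) z = \sum_(i < n) slash k h (F i) z.
Proof. by rewrite /slash mulr_sumr. Qed.

Lemma slash_tri (h : 'M[R]_2) (c d : C) F1 F2 F3 z :
  slash k h (fun w => F1 w - c * F2 w + d * F3 w) z =
  slash k h F1 z - c * slash k h F2 z + d * slash k h F3 z.
Proof. by rewrite /slash; ring. Qed.

Lemma slash_nup (b : R) F z : slash k (mx2 1 b 0 1) F z = F (z + b%:C).
Proof.
rewrite /slash /mobius /automorphy_factor det_mx2 !mxE /= mulr1 mulr0 subr0 sqrtr1.
by rewrite !rmorph0 !rmorph1 mul0r add0r expr1n !divr1 !mul1r.
Qed.
End SlashEval.

Section FieldFacts2.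
Variable K : fieldType.
Lemma eval_split (s b v x : K) : s != 0 -> v != 0 ->
  (dia s 1 * (nup b * dia v 1 * nlo x) = nup (s * b) * (nlo (x / (s * v)) * dia (s * v) 1))%g.
Proof.
move=> s0 v0; apply: GL2_ext; rewrite !GL2_mulE !mulmx2 !nupE !nloE !diaE ?mulf_neq0 ?oner_neq0// !mxE /=; field;
  by rewrite ?s0 ?v0.
Qed.
Lemma nlo_split (x y w : K) : w != 0 ->
  (nlo (x / w) * dia w 1 = nlo y * G2 w 0 (x - y * w) 1)%g /\ GL2_mx (G2 w 0 (x - y * w) 1) = mx2 w 0 (x - y * w) 1.
Proof.
move=> w0; have E : GL2_mx (G2 w 0 (x - y * w) 1) = mx2 w 0 (x - y * w) 1.
  by rewrite G2E// mulr1 mul0r subr0.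
split=> //; apply: GL2_ext; rewrite !GL2_mulE !mulmx2 E !nloE !diaE ?oner_neq0// !mxE /=; field; by rewrite ?w0.
Qed.
End FieldFacts2.

Section Evaluation.
Variables (R : realType) (k N : nat) (Psi : int -> R[i]) (f : R[i] -> R[i]).
Local Notation C := R[i].
Local Notation ii := (0 +i* 1 : C).
Hypotheses (N0 : (0 < N)%N) (PsiD : dirichlet_character N Psi) (fC : cusp_form k N Psi f).
Local Notation phi := (adelic_lift k N Psi f).
Variable p : primeT.
Local Notation K := (Qp p).
Local Notation P := (p%:R : K).
Local Notation loc := (@locA R p).
Local Notation nu := (logn p N).
Local Notation Np := (N %/ p ^ nu)%N.

Lemma lift_eval1 (h : GL2 R) : 0 < \det (GL2_mx h) -> phi (mkA h (1%g : GL2 K)) = slash k h f ii.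
Proof.
move=> dh; apply: (lift_val N0 PsiD fC); exists 1%g, h, (fun l => 1%:M), 1; split=> //.
- by move=> l; exact: K0r1.
- by rewrite /= map_mx1 mul1mx.
- move=> l; have -> : comp_fin (mkA h (1%g : GL2 K)) l = 1%g.
    by have [->|lp] := eqVneq l p; rewrite ?mkA_p ?mkA_l.
  by rewrite !map_mx1 mul1mx.
- by rewrite (dirichlet1 PsiD) invr1 mulr1.
Qed.

Lemma mkA_split (h : GL2 R) (g1 g2 g3 g4 : GL2 K) : g2 = (g3 * g4)%g ->
  mkA h (g1 * g2)%g = (mkA h (g1 * g3) * loc g4)%g.
Proof. by move=> ->; rewrite mkA_loc mulgA. Qed.

(** As y w is congruent to x, the lower unipotent of x / w times diag(w, 1) is that of the integer y
    times an element of K_0(N) at p. Divisible by Np, y is harmless at the other primes, and the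
    rational matrices move to infinity. *)
Lemma lift_eval (h : GL2 R) (q : rat) (y : int) (w x : nat) : 0 < \det (GL2_mx h) -> coprime w p ->
  (forall l : primeT, l != p -> Qint (ratQ l q)) -> (Np%:Z %| y)%Z -> ((p ^ nu)%:Z %| y * w%:Z - x%:Z)%Z ->
  phi (mkA h (nup (ratQ p q) * (nlo (x%:R / w%:R) * dia w%:R 1))%g) =
    slash k h (fun z => slashZ k (nlow y) f (z - (ratr q)%:C)) ii.
Proof.
move=> dh wp qa yN yp; have w0 := Zp_units_neq0 (Zp_units_natr wp).
have [kp [E1 E]] : exists kp : GL2 K, (nlo (x%:R / w%:R) * dia w%:R 1 = nlo (ratQ p y%:~R) * kp)%g /\
  GL2_mx kp = mx2 w%:R 0 (x%:R - ratQ p y%:~R * w%:R) 1.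
  by exists (G2 w%:R 0 (x%:R - ratQ p y%:~R * w%:R) 1); exact: nlo_split.
rewrite (mkA_split _ _ E1).
have [z zE] := level_at N0 yp.
have EZ : GL2_mx kp = map_mx (@Zp_to_Qp p) (mx2 w%:R 0 (N%:R * - z) 1).
  rewrite E mulrN -zE; apply: eq_mx2; rewrite !mxE /= ?rmorph0 ?rmorph1 ?rmorph_nat//.
  rewrite (rmorphN (@Zp_to_Qp p)) (rmorph_int (@Zp_to_Qp p)) (rmorph_int (@ratQ p)) intrB intrM opprB //.
have KZ : K0r N 1 (mx2 w%:R 0 (N%:R * - z) (1 : Defs.Zp p)).
  apply: K0r_mx2; first by rewrite mulr1 mul0r subr0; exact: zp_unit_natr.
    by exists (- z).
  by exists 0; rewrite mulr0 addr0.
rewrite (lift_loc1 N0 PsiD fC _ EZ KZ).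
pose ga : GL2 rat := (nup q * nlo y%:~R)%g.
have -> : (nup (ratQ p q) * nlo (ratQ p y%:~R))%g = (mapG (@ratQ p) ga * 1)%g.
  by rewrite mulg1 /ga mapGM mapG_nup mapG_nlo.
have aw : away_K0 N p ga.
  apply: away_K0M; first exact: away_nup.
  apply: away_nlo => l lp; have [z' zE'] := level_away N0 lp yN; exists z'.
  by rewrite -zE' (rmorph_int (@ratQ l)) (rmorph_int (@Zp_to_Qp l)).
rewrite (lift_left N0 PsiD fC _ _ aw).
have gaE : GL2_mx (mapG (@ratr R) (ga^-1)%g) = map_mx intr (nlow y) *m mx2 1 (- ratr q) 0 1.
  have -> : (ga^-1 = nlo (- y%:~R) * nup (- q))%g.
    by apply: (mulgI ga); rewrite mulgV /ga !mulgA -[(nup q * _ * _)%g]mulgA nloD subrr nlo0 mulg1 nupD subrr nup0.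
  rewrite mapGM mapG_nlo mapG_nup GL2_mulE nloE nupE; congr (_ *m _); apply: eq_mx2;
    by rewrite !mxE /= ?rmorph0 ?rmorph1 ?rmorphN /= ?ratr_int ?rmorphN.
have d1 : 0 < \det (map_mx intr (nlow y) : 'M[R]_2) by apply: SL2Z_det_gt0; exact: nlow_SL.
have d2 : 0 < \det (mx2 1 (- ratr q) 0 1 : 'M[R]_2) by rewrite det_mx2 mulr1 mulr0 subr0 ltr01.
have dgh : 0 < \det (GL2_mx (mapG (@ratr R) (ga^-1) * h)%g).
  by rewrite GL2_mulE gaE !det_mulmx !mulr_gt0.
have d12 : 0 < \det (map_mx intr (nlow y) *m mx2 1 (- ratr q) 0 1 : 'M[R]_2) by rewrite det_mulmx mulr_gt0.
rewrite (lift_eval1 dgh) GL2_mulE gaE (slashM k f d12 dh (Im_ii R)).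
apply: (slash_eq k dh (Im_ii R)) => z' z0; rewrite (slashM k f d1 d2 z0) slash_nup.
by rewrite rmorphN.
Qed.

(** Chinese remainders. The exponent nu + 1, one more than [lift_eval] asks, gives the congruence of
    [y_dvd2] modulo p N. *)
Lemma y_exists (x w : nat) : exists y : int, coprime w p ->
  (Np%:Z %| y)%Z /\ ((p ^ nu.+1)%:Z %| y * w%:Z - x%:Z)%Z.
Proof.
have [wp|_] := boolP (coprime w p); last by exists 0.
have [NE cop] := level_split N0 p.
have cz : coprimez (p ^ nu.+1)%:Z Np%:Z by rewrite coprimezE /= coprimeXl.
have [v [v' vE]] := Bezoutz w%:Z (p ^ nu.+1)%:Z.
have g1 : gcdz w%:Z (p ^ nu.+1)%:Z = 1.
  by rewrite /gcdz /=; have := coprimeXr nu.+1 wp; rewrite /coprime => /eqP ->.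
exists (zchinese (p ^ nu.+1)%:Z Np%:Z (x%:Z * v) 0); set y := zchinese _ _ _ _; split.
  by apply/dvdz_mod0P; rewrite zchinese_modr// mod0z.
have : ((p ^ nu.+1)%:Z %| y - x%:Z * v)%Z by rewrite -eqz_mod_dvd; apply/eqP; exact: zchinese_modl.
move=> /dvdzP[e eE]; apply/dvdzP; exists (e * w%:Z - x%:Z * v').
have -> : y = e * (p ^ nu.+1)%:Z + x%:Z * v by rewrite -eE subrK.
have vw : v * w%:Z = 1 - v' * (p ^ nu.+1)%:Z by rewrite -g1 -vE addrK.
transitivity (e * w%:Z * (p ^ nu.+1)%:Z + x%:Z * (v * w%:Z) - x%:Z); first by ring.
by rewrite vw; ring.
Qed.

Lemma level_succ : (p * N)%:Z = (p ^ nu.+1)%:Z * Np%:Z.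
Proof. by have [NE _] := level_split N0 p; rewrite {1}NE mulnA -expnS PoszM. Qed.

Section Fixed.
Variables (x r T : nat).
Definition at_ (v : nat) (t : nat) : GL2 K := (nup (t%:R / P ^+ r) * dia v%:R 1 * nlo x%:R)%g.
Variable y : nat -> int.
Hypothesis yP : forall w, coprime w p -> (Np%:Z %| y w)%Z /\ ((p ^ nu.+1)%:Z %| y w * w%:Z - x%:Z)%Z.

Lemma Ysum_eval v s (h : GL2 R) : coprime v p -> coprime s p -> 0 < \det (GL2_mx h) ->
  Ysum k N Psi f (at_ v) T (mkA h (dia (s%:R : K) 1)) =
  slash k h (fun z => \sum_(j < T) slashZ k (nlow (y (s * v)%N)) f (z - (s * j)%:R / (p ^ r)%:R)) ii.
Proof.
move=> vp sp dh; rewrite Ysum_mkA slash_sum; apply: eq_bigr => j _.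
have v0 := Zp_units_neq0 (Zp_units_natr vp); have s0 := Zp_units_neq0 (Zp_units_natr sp).
have wp : coprime (s * v) p by rewrite coprimeMl sp.
have [yN yp] := yP wp; pose q : rat := (s * j)%:R / p%:R ^+ r.
have qE : ratQ p q = s%:R * (j%:R / P ^+ r).
  rewrite /q (rmorphM (@ratQ p)) (fmorphV (@ratQ p)) (rmorphXn (@ratQ p)) !(rmorph_nat (@ratQ p)) natrM.
  exact: esym (mulrA _ _ _).
rewrite /at_ (eval_split _ _ s0 v0) -qE -natrM (@lift_eval h q (y (s * v)%N) (s * v) x)//.
- apply: (slash_eq k dh (Im_ii R)) => z z0; congr (slashZ _ _ _ (_ - _)).
  have -> : ratr q = (s * j)%:R / (p ^ r)%:R :> R.
    by rewrite /q (fmorph_div (@ratr R)) (rmorphXn (@ratr R)) !(rmorph_nat (@ratr R)) natrX.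
  by rewrite (fmorph_div (real_complex R)) !(rmorph_nat (real_complex R)).
- by move=> l lp; have [z zE] := frac_away (s * j) r lp; exists z.
- by apply: dvdz_trans yp; rewrite dvdzE /= dvdn_exp2l.
Qed.

Lemma y_dvd1 s : coprime s p -> ((p * N)%:Z %| (p ^ nu.+1)%:Z * y s)%Z.
Proof.
move=> sp; by have [yN _] := yP sp; rewrite level_succ; exact: dvdz_mul.
Qed.
Lemma y_dvd2 s : coprime s p -> ((p * N)%:Z %| s%:Z * y s - y 1%N)%Z.
Proof.
move=> sp; have [yN yp] := yP sp; have [yN1 yp1] := yP (coprime1n p); have [NE cop] := level_split N0 p.
rewrite level_succ Gauss_dvdz; last by rewrite coprimezE /= coprimeXl.
apply/andP; split.
  have -> : s%:Z * y s - y 1%N = (y s * s%:Z - x%:Z) - (y 1%N * 1%:Z - x%:Z) by ring.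
  exact: rpredB.
by apply: rpredB => //; exact: dvdz_mull.
Qed.
End Fixed.

End Evaluation.

(** * Proof of the theorem *)

Section UnitValue.
Variables (R : realType) (p : primeT).
Local Notation C := R[i].
Local Notation K := (Qp p).
Local Notation P := (p%:R : K).

Variables (chi : K -> C) (d : nat) (xi : C).
Hypotheses (qc : quasi_character chi) (dO : has_order (@Zp_units p) chi d) (xd : d.-primitive_root xi).

Lemma chi_unitX x n : Zp_units x -> chi (x ^+ n) = chi x ^+ n.
Proof.
move=> xu; elim: n => [|n IH]; first by rewrite !expr0 (quasi_character1 qc).
have x0 := Zp_units_neq0 xu; have xn0 : x ^+ n != 0 := expf_neq0 n x0.
by rewrite !exprS (quasi_characterM qc x0 xn0) IH.
Qed.

Lemma chi_order x : Zp_units x -> chi x ^+ d = 1.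
Proof. by case: dO => _ H; have /H := dvdnn d; apply. Qed.

(** The exponents e for which xi^e is a value on the units are multiples of the least positive one,
    g. Then chi^(d / g) = 1 on the units, and the exact order d forces g = 1. *)
Lemma chi_surj : exists2 x : K, Zp_units x & chi x = xi.
Proof.
have [d0 dH] := dO.
pose E (e : nat) := `[< exists2 x : K, Zp_units x & chi x = xi ^+ e >].
have Ed : exists e, (0 < e)%N && E e.
  exists d; rewrite d0; apply/asboolP; exists 1; first exact: Zp_units1.
  by rewrite (quasi_character1 qc) (prim_expr_order xd).
case: (ex_minnP Ed) => g /andP[g0 /asboolP[x0 x0u x0E]] gmin.
have Eg e : E e -> (g %| e)%N.
  move=> /asboolP[x xu xE]; rewrite /dvdn; apply: contraT => r0; rewrite -lt0n in r0.
  have : (g <= e %% g)%N; last by rewrite leqNgt ltn_mod g0.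
  apply: gmin; rewrite r0; apply/asboolP.
  have x0n m : Zp_units (x0 ^+ m).
    by elim: m => [|m IH]; rewrite ?expr0 ?exprS; [exact: Zp_units1|exact: Zp_unitsM].
  (* The factor d - 1 stands for -1 in the exponent, as xi^d = 1. *)
  exists (x * x0 ^+ (e %/ g * d.-1)); first exact: Zp_unitsM.
  rewrite (quasi_characterM qc (Zp_units_neq0 xu) (Zp_units_neq0 (x0n _))) (chi_unitX _ x0u) x0E xE -exprM -exprD.
  have -> : (e + g * (e %/ g * d.-1) = d * (g * (e %/ g)) + e %% g)%N.
    rewrite {1}(divn_eq e g) -{2}(prednK d0) mulSn; ring.
  by rewrite exprD exprM (prim_expr_order xd) expr1n mul1r.
have gd : (g %| d)%N.
  by apply: Eg; apply/asboolP; exists 1; rewrite ?(quasi_character1 qc) ?(prim_expr_order xd)//; exact: Zp_units1.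
have : (d %| d %/ g)%N.
  apply/dH => x xu; have [i xE] := prim_rootP xd (chi_order xu).
  have /dvdnP[q qE] : (g %| i)%N by apply: Eg; apply/asboolP; exists x.
  rewrite xE qE -exprM; have -> : (q * g * (d %/ g) = d * q)%N by rewrite -mulnA [(g * _)%N]mulnC divnK// mulnC.
  by rewrite exprM (prim_expr_order xd) expr1n.
move=> /dvdn_leq; rewrite divn_gt0// dvdn_leq// => /(_ isT) dg.
have g1 : g = 1%N.
  apply/eqP; rewrite eqn_leq g0 andbT leqNgt; apply/negP => g2.
  by move: dg; rewrite leqNgt ltn_Pdiv.
by exists x0; rewrite // x0E g1 expr1.
Qed.

(** On the units chi has finitely many values, so by continuity it keeps the value xi near a unit,
    and a natural number prime to p is found there. *)
Lemma chi_surj_nat : exists u : nat, coprime u p /\ chi u%:R = xi.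
Proof.
have [_ [w /= wu <-] xE] := chi_surj; have [_ _ qC] := qc.
have wu' : Zp_units (Zp_to_Qp w) by exists w.
have H (i : 'I_d) : exists n, xi ^+ i != xi -> forall y : K, y != 0 ->
    (exists z : Defs.Zp p, y - Zp_to_Qp w = P ^+ n * Zp_to_Qp z) -> chi y != xi ^+ i.
  have [->|ne] := eqVneq (xi ^+ i) xi; first by exists 0%N.
  have e0 : 0 < cn (xi ^+ i - xi) by rewrite cn_gt0 subr_eq0.
  have [n nP] := qC _ (Zp_units_neq0 wu') _ e0; exists n => _ y y0 yz.
  have := nP y y0 yz; rewrite xE; apply: contraTneq => ->.
  by rewrite cnE ltxx.
have [n nP] := choice H; pose m := \max_(i < d) n i.
have [s [y [sp wE]]] := unit_approx m wu; exists s; split=> //.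
have su := Zp_units_natr sp; have [i sE] := prim_rootP xd (chi_order su).
rewrite sE; apply/eqP; apply: contraT => ne.
have := nP i ne s%:R (Zp_units_neq0 su); rewrite sE eqxx => /(_ _)/wrap[|//].
exists (- (p%:R ^+ (m.+1 - n i) * y)); rewrite wE.
have le : (n i <= m.+1)%N by rewrite ltnW// ltnS /m (leq_bigmax i).
rewrite (rmorphD (@Zp_to_Qp p)) (rmorphN (@Zp_to_Qp p)) !(rmorphM (@Zp_to_Qp p)) !(rmorphXn (@Zp_to_Qp p)).
rewrite !(rmorph_nat (@Zp_to_Qp p)) opprD addrA subrr add0r mulrN mulrA -exprD subnKC//.
Qed.
End UnitValue.

Lemma sum_tri (A : comNzRingType) T (F1 F2 F3 : 'I_T -> A) (b e : A) :
  \sum_(t < T) (F1 t - b * F2 t + e * F3 t) =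
  \sum_(t < T) F1 t - b * (\sum_(t < T) F2 t) + e * (\sum_(t < T) F3 t).
Proof. by rewrite big_split sumrB /= -!mulr_sumr. Qed.

(** * The central value om and the trace c *)

Section Core.
Variables (R : realType) (k N m : nat) (Psi : int -> R[i]) (f : R[i] -> R[i]) (a : nat -> R[i]) (p : primeT).
Local Notation C := R[i].
Local Notation K := (Qp p).
Local Notation P := (p%:R : K).
Local Notation ii := (0 +i* 1 : C).
Variables (chi1 chi2 : K -> C).
Hypotheses (N0 : (0 < N)%N) (PsiD : dirichlet_character N Psi)
  (Pm : has_order [set x : int | coprimez x N%:Z] Psi m)
  (fC : cusp_form k N Psi f) (fa : q_expansion f a) (fN : ~ null f) (pN : (p %| N)%N)
  (q1 : quasi_character chi1) (q2 : quasi_character chi2)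
  (piP : local_component (automorphic_rep k N Psi f) (principal_series chi1 chi2)).
Variable u : nat.
Hypothesis up : coprime u p.
Local Notation phi := (adelic_lift k N Psi f).
Local Notation loc := (@locA R p).
Local Notation nu := (logn p N).
Local Notation Np := (N %/ p ^ nu)%N.
Local Notation pi := (automorphic_rep k N Psi f).
Let om := chi1 u%:R * chi2 u%:R.
Let c := chi1 u%:R + chi2 u%:R.

Lemma phi_translate : phi \in translates phi.
Proof.
apply/asboolP; exists [:: (1, 1%g)]; rewrite big_seq1 scale1r.
by apply/funext => x; rewrite /rtrans mulg1.
Qed.
Definition Phi : pi := MkSubfun phi_translate.

Lemma act_val g (x : pi) y : subfun_val (@rep_act R (GL2A R) pi g x) y = subfun_val x (y * g)%g.
Proof. by []. Qed.

Lemma val_sum (I : Type) (r : seq I) (F : I -> pi) y :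
  subfun_val (\sum_(i <- r) F i) y = \sum_(i <- r) subfun_val (F i) y.
Proof. exact: (big_morph (fun x : pi => subfun_val x y) (fun _ _ => erefl) erefl). Qed.

Lemma val_tri (A1 A2 A3 : GL2A R) (x : pi) (b e : C) y :
  subfun_val (@rep_act R (GL2A R) pi A1 x - b *: @rep_act R (GL2A R) pi A2 x + e *: @rep_act R (GL2A R) pi A3 x) y =
  subfun_val x (y * A1)%g - b * subfun_val x (y * A2)%g + e * subfun_val x (y * A3)%g.
Proof. by []. Qed.

Lemma Phi_act (A B : GL2 K) y :
  subfun_val (@rep_act R (GL2A R) pi (loc B) Phi) (y * loc A)%g = phi (y * loc (A * B)%g)%g.
Proof. by rewrite act_val -mulgA locAM. Qed.

Lemma phi_neq0 : exists2 h : GL2 R, 0 < \det (GL2_mx h) & phi (mkA h (1%g : GL2 K)) != 0.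
Proof.
apply: contrapT => H; apply: fN; apply: (@slash_surj R k) => h dh.
rewrite -(lift_eval1 N0 PsiD fC p dh); apply: contrapT => /eqP H'; apply: H; by exists h.
Qed.

(** diag(u, u) at p acts on [Phi] by om, through the principal series, and by Psi(n)^-1, through the
    lift; the two are compared at a point where the lift is nonzero. *)
Lemma om_Psi : exists n : int, coprimez n N%:Z /\ om = (Psi n)^-1.
Proof.
have E : GL2_mx (dia (u%:R : K) u%:R) = map_mx (@Zp_to_Qp p) (mx2 u%:R 0 0 u%:R).
  have u0 := Zp_units_neq0 (Zp_units_natr up); rewrite diaE//.
  by apply: eq_mx2; rewrite !mxE /= ?rmorph0 ?rmorph_nat.
have uK : K0r N u%:Z (mx2 u%:R 0 0 (u%:R : Defs.Zp p)).
  apply: K0r_mx2; first by rewrite mul0r subr0 unitrM (zp_unit_natr up).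
    by exists 0; rewrite mulr0.
  by exists 0; rewrite mulr0 addr0.
have [n [nc H]] := lift_loc N0 PsiD fC E uK; exists n; split=> //.
have [h _ h0] := phi_neq0.
have := local_scalar piP up Phi => /(congr1 (fun x : pi => subfun_val x (mkA h (1%g : GL2 K)))).
rewrite act_val /= H => E'; apply: (mulIf h0); rewrite mulrC in E'; exact: esym E'.
Qed.

Lemma om_root : om ^+ m = 1.
Proof.
have [n [nc ->]] := om_Psi; rewrite exprVn; have [_ H] := Pm.
by have /H := dvdnn m => ->; rewrite ?invr1.
Qed.

Variable F : divringClosed C.
Hypothesis aF : forall n, a n \in F.

Lemma om_in : om \in F.
Proof. by have [n [nc ->]] := om_Psi; rewrite rpredV (psi_rat (valP p) pN N0 PsiD fC fa aF fN). Qed.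

Lemma Phi_neq0 : Phi != 0.
Proof.
have [h _ h0] := phi_neq0; apply: contraNneq h0 => /(congr1 (fun x : pi => subfun_val x (mkA h (1%g : GL2 K)))).
by move=> /= ->.
Qed.

Lemma Phi_nup (z : K) : Qint z -> @rep_act R (GL2A R) pi (loc (nup z)) Phi = Phi.
Proof.
move=> [y ->]; apply/val_inj/funext => x /=; rewrite /rtrans.
apply: (lift_loc1 N0 PsiD fC (x := mx2 1 y 0 1)).
  by rewrite nupE; apply: eq_mx2; rewrite !mxE /= ?rmorph1 ?rmorph0.
apply: K0r_mx2; first by rewrite mulr1 mulr0 subr0 unitr1.
  by exists 0; rewrite mulr0.
by exists 0; rewrite mulr0 addr0.
Qed.

Lemma Phi_nlo (z : K) : smallI p (@Qint p) nu z -> @rep_act R (GL2A R) pi (loc (nlo z)) Phi = Phi.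
Proof.
move=> [_ [[y ->] ->]]; have [NE cop] := level_split N0 p.
have Nu : (Np%:R : Defs.Zp p) \is a GRing.unit by apply: zp_unit_natr; rewrite coprime_sym.
have yN : p%:R ^+ nu * y = N%:R * (Np%:R^-1 * y).
  by rewrite {2}NE natrM natrX -mulrA [Np%:R * _]mulrA mulrV// mul1r.
apply/val_inj/funext => x /=; rewrite /rtrans.
apply: (lift_loc1 N0 PsiD fC (x := mx2 1 0 (p%:R ^+ nu * y) 1)).
  rewrite nloE; apply: eq_mx2; rewrite !mxE /= ?rmorph1 ?rmorph0//.
  by rewrite (rmorphM (@Zp_to_Qp p)) (rmorphXn (@Zp_to_Qp p)) (rmorph_nat (@Zp_to_Qp p)).
apply: K0r_mx2; first by rewrite mulr1 mul0r subr0 unitr1.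
  by rewrite yN; eexists.
by exists 0; rewrite mulr0 addr0.
Qed.

(** [local_nonzero] holds for every r, so r can be chosen large enough for [local_kill]; relation
    and nonvanishing then concern the same sums Y, which [Ysum_eval] turns into those of
    [descent_main]. *)
Lemma trace_in : c \in F.
Proof.
have [x xP] := local_nonzero q1 q2 piP up Phi_neq0 Phi_nup Phi_nlo.
set Phi1 := (@rep_act R (GL2A R) pi (loc (nlo x%:R)) Phi) in xP.
have [r /(_ r r (leqnn r) (leqnn r)) Kr] := local_kill q1 q2 piP up Phi1.
set T := (p ^ (r + r))%N in Kr; have T0 : (0 < T)%N by rewrite expn_gt0 p_gt0.
have up2 : coprime (u ^ 2)%N p by exact: coprimeXl.
pose Y v := Ysum k N Psi f (at_ p x r v) T.
have Phi1E' (w : K) v t g : w = v%:R ->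
    subfun_val Phi1 (g * loc (nup (t%:R / P ^+ r) * dia w 1))%g = phi (g * loc (at_ p x r v t))%g.
  by move=> ->; exact: Phi_act.
have Phi1E v t g := Phi1E' v%:R v t g erefl.
have Phi1E2 t g := Phi1E' (u%:R ^+ 2) (u ^ 2)%N t g (esym (natrX _ _ _)).
have Phi1E1 t g : subfun_val Phi1 (g * loc (nup (t%:R / P ^+ r)))%g = phi (g * loc (at_ p x r 1 t))%g.
  by have <- := Phi1E' 1 1%N t g erefl; rewrite dia1 mulg1.
have Yu g : subfun_val (\sum_(t < T) @rep_act R (GL2A R) pi (loc (nup (t%:R / P ^+ r) * dia u%:R 1)%g) Phi1) g = Y u g.
  by rewrite /Y /Ysum val_sum; apply: eq_bigr => t _; rewrite act_val Phi1E.
have YK g : Y (u ^ 2)%N g - c * Y u g + om * Y 1%N g = 0.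
  have := congr1 (fun x : pi => subfun_val x g) Kr; rewrite /kill_op val_sum => E.
  have : \sum_(t < T) (phi (g * loc (at_ p x r (u ^ 2) t))%g - c * phi (g * loc (at_ p x r u t))%g +
      om * phi (g * loc (at_ p x r 1 t))%g) = 0.
    rewrite -[RHS]E; apply: eq_bigr => t _.
    have tri := val_tri (loc (nup (t%:R / P ^+ r) * dia (u%:R ^+ 2) 1)%g)
      (loc (nup (t%:R / P ^+ r) * dia u%:R 1)%g) (loc (nup (t%:R / P ^+ r))) Phi1 c om g.
    have eq3 (a1 a2 a3 b1 b2 b3 : C) : a1 = b1 -> a2 = b2 -> a3 = b3 ->
      b1 - c * b2 + om * b3 = a1 - c * a2 + om * a3 by move=> -> -> ->.
    exact: (etrans (eq3 _ _ _ _ _ _ (Phi1E2 t g) (Phi1E u t g) (Phi1E1 t g)) (esym tri)).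
  by move=> <-; exact: esym (sum_tri (fun t : 'I_T => phi (g * loc (at_ p x r (u ^ 2) t))%g)
    (fun t => phi (g * loc (at_ p x r u t))%g) (fun t => phi (g * loc (at_ p x r 1 t))%g) c om).
have [g Yg] : exists g, Y u g != 0.
  apply: contrapT => /forallNP H; have /eqP := xP r T T0; apply.
  apply/val_inj/funext => g; apply: (etrans (Yu g)); apply: contrapT => /eqP; exact: H.
have [s0 [h0 [s0p [dh0 Y0]]]] := Ysum_neq0 N0 PsiD fC Yg.
have [y yP] := choice (y_exists N0 p x).
have Ye v s h := @Ysum_eval R k N Psi f N0 PsiD fC p x r T y yP v s h.
apply: (@descent_main R F p N k Psi f a (valP p) pN N0 PsiD fC fa aF fN nu.+1 r T u y c om s0) => //.
- by move=> s sp; exact: (y_dvd1 N0 yP).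
- by move=> s sp; exact: (y_dvd2 N0 yP).
- exact: om_in.
move=> G S; split; last split=> //.
- move=> s z sp z0; pose H z := S (u ^ 2)%N s z - c * S u s z + om * S 1%N s z.
  suff : null H by move=> /(_ z z0).
  apply: (@slash_surj R k) => h dh; rewrite /H slash_tri.
  by rewrite -!Ye ?coprime1n//; exact: YK.
move=> S0; case/eqP: Y0; rewrite Ye//; exact: slash_null dh0 S0.
Qed.

End Core.

Theorem lemma4p2 (R : realType) (k N m : nat) (Psi : int -> R[i])
    (f : R[i] -> R[i]) (a : nat -> R[i]) (p : primeT)
    (chi1 chi2 : Qp p -> R[i]) (d : nat) (xi : R[i]) :
  (0 < N)%N ->
  dirichlet_character N Psi ->
  has_order [set x : int | coprimez x N%:Z] Psi m ->
  newform k N Psi f a ->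
  (p %| N)%N ->
  quasi_character chi1 -> quasi_character chi2 ->
  irreducible_rep (principal_series chi1 chi2) ->
  local_component (automorphic_rep k N Psi f) (principal_series chi1 chi2) ->
  has_order (@Zp_units p) chi1 d ->
  d.-primitive_root xi ->
  exists2 zeta : R[i], zeta ^+ m = 1 &
    Q_adjoin [set xi + zeta * xi^-1] `<=` hecke_field a.
Proof.
move=> N0 PsiD Pm fn pN q1 q2 _ piP dO xd; have [fC fa _ _ a1] := fn.
have fN : ~ null f.
  move=> f0; have := null_qseries (isT : (0 < 1)%N) (q_expansion_qseries fa) f0 1%N.
  by rewrite a1 => /eqP; rewrite oner_eq0.
have [u [up uE]] := chi_surj_nat q1 dO xd.
have u0 := Zp_units_neq0 (Zp_units_natr up).
have xi0 : xi != 0 by rewrite -uE; case: q1 => + _ _; apply.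
have om1 := om_root N0 PsiD Pm fC fN piP up.
exists (chi1 u%:R * chi2 u%:R); first exact: om1.
have -> : xi + chi1 u%:R * chi2 u%:R * xi^-1 = chi1 u%:R + chi2 u%:R.
  by rewrite uE mulrAC mulfV// mul1r.
(* Both fields are intersections of subfields, so it suffices to find the generator in each [F]
   containing the coefficients. *)
move=> z zQ F Fc Fa; apply: zQ => // _ ->.
pose FF : divringClosed R[i] := HB.pack F (GRing.isDivringClosed.Build _ F Fc).
apply: (trace_in N0 PsiD fC fa fN pN q1 q2 piP up (F := FF)) => n.
by apply: Fa; exists n.
Qed.
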